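(* Let $X\subset\mathbb{P}^5_{\mathbb{C}}$ be a general cubic fourfold with Fano scheme of lines $F$. The map $$\psi:F\dashrightarrow X,\qquad [\ell]\mapsto \ell\cap\ell',$$ sending a general line $\ell\subset X$ to its intersection point with its residual line $\ell'$, is a dominant rational map of degree $24$.
   Context: ''General'' cubic means: in some dense Zariski-open subset of $|\mathcal{O}_{\mathbb{P}^5}(3)|$. $F\subset\mathrm{G}(2,6)$ is the Fano scheme of lines in $X$ (a smooth projective fourfold). For a general line $\ell\subset X$ there is a unique 2-plane $\Pi_\ell\subset\mathbb{P}^5$ tangent to $X$ along $\ell$, and $X\cap\Pi_\ell=2\ell+\ell'$; the line $\ell'$ is called the residual line of $\ell$. *)

(* Defs.v *)
From mathcomp Require Import all_boot all_order all_algebra.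
From mathcomp Require Import classical_sets reals.
From mathcomp Require Import complex mpoly.
Set Implicit Arguments.
Unset Strict Implicit.
Unset Printing Implicit Defensive.
Import GRing.Theory.
Local Open Scope classical_set_scope.
Local Open Scope ring_scope.

(* Subsets of the projective space P^(n-1) over [k] are encoded by the sets of
   their homogeneous coordinate vectors: sets of nonzero row vectors of length
   [n], stable under nonzero scalars. *)

Section Projective.
Variable k : fieldType.

Definition proj_space n : set 'rV[k]_n := [set v | v != 0].

Definition ev n (p : {mpoly k[n]}) (v : 'rV[k]_n) : k := p.@[v 0].

Definition zclosed n (Z : set 'rV[k]_n) : Prop :=
  exists2 S : set {mpoly k[n]},
    (forall p, S p -> exists d, p \is d.-homog) &
    Z = [set v | v != 0 /\ forall p, S p -> ev p v = 0].

Definition zdense_in n (A V : set 'rV[k]_n) : Prop :=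
  forall Z, zclosed Z -> A `<=` Z -> V `<=` Z.

(* [P] holds on a dense Zariski-open subset [V `\` Z] of [V]. *)
Definition generically n (V : set 'rV[k]_n) (P : 'rV[k]_n -> Prop) : Prop :=
  exists Z, [/\ zclosed Z, zdense_in (V `\` Z) V &
                forall v, (V `\` Z) v -> P v].

(* Representatives of rational functions on [V]: quotients of two forms of the
   same degree whose denominator does not vanish on a dense open subset.  Two
   of them are the same rational function when their values agree
   generically. *)
Record ratfun n (V : set 'rV[k]_n) := RatFun {
  rf_num : {mpoly k[n]};
  rf_den : {mpoly k[n]};
  rf_deg : nat;
  rf_num_homog : rf_num \is rf_deg.-homog;
  rf_den_homog : rf_den \is rf_deg.-homog;
  rf_den_neq0 : generically V (fun v => ev rf_den v != 0) }.

Definition rf_val n (V : set 'rV[k]_n) (h : ratfun V) (v : 'rV[k]_n) : k :=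
  ev (rf_num h) v / ev (rf_den h) v.

(* Representatives of rational maps [V --> W]: tuples of forms of the same
   degree, which generically on [V] are not all zero and give a point of [W]
   (the vectors in [W] are nonzero). *)
Record ratmap m n (V : set 'rV[k]_m) (W : set 'rV[k]_n) := RatMap {
  rm_comp : 'I_n -> {mpoly k[m]};
  rm_deg : nat;
  rm_homog : forall i, rm_comp i \is rm_deg.-homog;
  rm_codom : generically V (fun v => W (\row_i ev (rm_comp i) v)) }.

Definition rm_val m n (V : set 'rV[k]_m) (W : set 'rV[k]_n)
    (phi : ratmap V W) (v : 'rV[k]_m) : 'rV[k]_n :=
  \row_i ev (rm_comp phi i) v.

Definition dominant m n (V : set 'rV[k]_m) (W : set 'rV[k]_n)
    (phi : ratmap V W) : Prop :=
  zdense_in (W `&` (rm_val phi @` V)) W.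

(* [b] is the pull-back of the rational function [c] by [phi]. *)
Definition pullback m n (V : set 'rV[k]_m) (W : set 'rV[k]_n)
    (phi : ratmap V W) (c : ratfun W) (b : ratfun V) : Prop :=
  generically V (fun v =>
    ev (rf_den c) (rm_val phi v) != 0 /\
    rf_val b v = rf_val c (rm_val phi v)).

(* [k(V) : phi^* k(W)] = d : the function field of [V] has a basis [e] of
   length [d] over the pull-back of the function field of [W]. *)
Definition ratmap_degree m n (V : set 'rV[k]_m) (W : set 'rV[k]_n)
    (phi : ratmap V W) (d : nat) : Prop :=
  (forall c : ratfun W, exists b : ratfun V, pullback phi c b) /\
  exists e : 'I_d -> ratfun V,
    (forall h : ratfun V, exists (c : 'I_d -> ratfun W) (b : 'I_d -> ratfun V),
       (forall i, pullback phi (c i) (b i)) /\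
       generically V (fun v =>
         rf_val h v = \sum_i rf_val (b i) v * rf_val (e i) v)) /\
    (forall (c : 'I_d -> ratfun W) (b : 'I_d -> ratfun V),
       (forall i, pullback phi (c i) (b i)) ->
       generically V (fun v => \sum_i rf_val (b i) v * rf_val (e i) v = 0) ->
       forall i, generically W (fun w => rf_val (c i) w = 0)).

End Projective.

Section Lines.
Variable k : fieldType.

Definition monomial_of_degree (n d : nat) :=
  {m : 'X_{1..n < d.+1} | mdeg m == d}.

Definition nb_monomials (n d : nat) : nat := #|{: monomial_of_degree n d}|.

(* The form of degree [d] with coefficient vector [a]: this identifies
   P^(nb_monomials n d - 1) with the linear system |O(d)| on P^(n-1). *)
Definition form_of n d (a : 'rV[k]_(nb_monomials n d)) : {mpoly k[n]} :=
  \sum_i a 0 i *: 'X_[val (val (enum_val i : monomial_of_degree n d))].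

Definition hypersurface n (f : {mpoly k[n]}) : set 'rV[k]_n :=
  [set v | v != 0 /\ ev f v = 0].

(* A linear subspace of P^(n-1) of dimension r is a vector subspace of
   dimension r + 1. *)
Definition line_in n (f : {mpoly k[n]}) (L : {vspace 'rV[k]_n}) : Prop :=
  \dim L = 2 /\ forall x, x \in L -> ev f x = 0.

(* [p] is a vector of Pluecker coordinates of [L], recorded as the n * n
   entries u_i v_j - u_j v_i of an alternating matrix (so the Grassmannian
   lies in a linear subspace of P^(n * n - 1)). *)
Definition plucker n (L : {vspace 'rV[k]_n}) (p : 'rV[k]_(n * n)) : Prop :=
  exists u v : 'rV[k]_n,
    basis_of L [:: u; v] /\ p = mxvec (u^T *m v - v^T *m u).

Definition fano n (f : {mpoly k[n]}) : set 'rV[k]_(n * n) :=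
  [set p | exists2 L, line_in f L & plucker L p].

(* The 2-plane [P] contains the line [L] and lies in the embedded tangent space
   of the hypersurface f = 0 at every point of [L]. *)
Definition tangent_plane n (f : {mpoly k[n]}) (L P : {vspace 'rV[k]_n}) :=
  [/\ \dim P = 3, (L <= P)%VS &
      forall x y, x \in L -> y \in P -> \sum_i ev f^`M(i) x * y 0 i = 0].

(* The cubic f = 0 cuts the 2-plane [P] in the divisor 2 L + L'; [a] and [b]
   are linear forms whose restrictions to [P] are equations of the lines [L]
   and [L']. *)
Definition plane_section n (f : {mpoly k[n]}) (P L L' : {vspace 'rV[k]_n}) :=
  [/\ \dim P = 3, \dim L = 2, \dim L' = 2, (L <= P)%VS & (L' <= P)%VS] /\
  exists a b : 'cV[k]_n, forall x, x \in P ->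
    [/\ (x \in L) = (x *m a == 0),
        (x \in L') = (x *m b == 0) &
        ev f x = (x *m a) 0 0 ^+ 2 * (x *m b) 0 0].

Definition residual_line n (f : {mpoly k[n]}) (L L' : {vspace 'rV[k]_n}) :=
  exists2 P, unique (tangent_plane f L) P & plane_section f P L L'.

(* The point [x] of P^(n-1) is the intersection of [L] with its residual
   line. *)
Definition residual_point n (f : {mpoly k[n]}) (L : {vspace 'rV[k]_n})
    (x : 'rV[k]_n) : Prop :=
  x != 0 /\ exists2 L', residual_line f L L' & (L :&: L')%VS = <[x]>%VS.

End Lines.

(* Main.v *)
(* A line [l] on the cubic with residual point [x] is encoded by a flag
   [x, y, z]: [l] is spanned by [x, y] and the plane tangent along [l] by
   [x, y, z].  In terms of the polar trilinear form [T], the form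
   [T (s x + t y + r z)^3] is [r^2] times a linear form in [t, r].

   Fibres.  For fixed [x], the plane of the flag projects from [x] to a line
   [<y, z>] on the quadric surface [T x x v = T x v v = 0] of P^3, tangent to the
   cubic surface [T v v v = 0] at [y].  On each of the two rulings such lines
   are the roots of the discriminant, of degree 12, of a binary cubic, and all
   roots are simple when all the flags over [x] are nondegenerate.  This gives
   24 points in each fibre.

   Upper bound.  The points [y] satisfy equations of degrees 1, 2, 3 and 4: the
   last one says that [T y y], vanishing on the Lagrangian subspace [<x, y, z>]
   of the quadratic form [T x], is isotropic for the dual form.  At one explicit
   cubic these equations reduce every polynomial to 24 monomials, hence so they
   do generically, by linear algebra over the polynomials in [x].  The 24 monomials
   are therefore a basis of the functions on the Fano scheme over those on the
   cubic.

   Genericity.  Flags in a moving frame form an affine space fibred over the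
   space of cubics with fibres of dimension 4.  Counting monomials, a degeneracy
   condition on the flags forces an equation on the cubic and any four
   coordinates of the flag.  As the cubic and its Fano scheme are smooth, four of
   their coordinates are local parameters, so that such an equation excludes only
   the complement of a dense open set. *)
Require Import Defs.
From mathcomp Require Import all_boot all_order all_algebra.
From mathcomp Require Import boolp classical_sets.
From mathcomp Require Import fingroup perm separable.
From mathcomp Require Import mpoly.
From mathcomp Require Import ring zify.
Set Implicit Arguments.
Unset Strict Implicit.
Unset Printing Implicit Defensive.
Import Order.TTheory GRing.Theory Num.Theory.
Local Open Scope ring_scope.

(** * Polynomial functions *)

(** What remains to be explained is the passage from a count of points to a degree of function
    fields. A basis with 24 elements must be exhibited, and both halves are linear algebra with
    polynomial coefficients: 24 distinct points in each good fibre make the monomials independent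
    there, and reduction modulo the flag equations makes them generate. Denominators are the
    obstacle. The denominator of a rational function on the Fano scheme is not a function of x
    alone. Multiplication by it is a matrix over the functions of x, whose determinant must be
    nonzero on a dense open set; since zero divisors could a priori occur, this goes through the
    characteristic polynomial. Density is always tested on forms: a set is dense when every form
    vanishing on it vanishes on the whole variety. Dimension counts are made explicit: the 12
    parameters of a flag exceed its 8 conditions by 4, and the 5 parameters of a point exceed its
    single condition by 4, the dimension of the cubic and of its Fano scheme. *)

Section FunctionAlgebras.
Variables (k : comNzRingType) (T : Type).

(* Polynomial dependence on a parameter [t : T] is expressed by membership in
   such a class of functions, which avoids substitutions in polynomials. *)
Record funalg (C : (T -> k) -> Prop) : Prop := FunAlg {
  falgC : forall c, C (fun=> c);
  falgD : forall a b, C a -> C b -> C (fun t => a t + b t);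
  falgM : forall a b, C a -> C b -> C (fun t => a t * b t) }.

Variable C : (T -> k) -> Prop.
Hypothesis algC : funalg C.

Lemma falg_ext a b : C a -> a =1 b -> C b.
Proof. by move=> Ca /funext <-. Qed.

Lemma falgN a : C a -> C (fun t => - a t).
Proof.
move=> Ca; apply: falg_ext (falgM algC (falgC algC (-1)) Ca) _ => t /=.
by rewrite mulN1r.
Qed.

Lemma falgB a b : C a -> C b -> C (fun t => a t - b t).
Proof. by move=> Ca Cb; apply: (falgD algC) => //; apply: falgN. Qed.

Lemma falgZ c a : C a -> C (fun t => c * a t).
Proof. by move=> Ca; apply: (falgM algC) => //; apply: (falgC algC). Qed.

Lemma falg_sum I (r : seq I) (P : pred I) F :
  (forall i, C (F i)) -> C (fun t => \sum_(i <- r | P i) F i t).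
Proof.
move=> CF; elim: r => [|i r IH].
  by apply: falg_ext (falgC algC 0) _ => t; rewrite big_nil.
case Pi: (P i).
  by apply: falg_ext (falgD algC (CF i) IH) _ => t; rewrite big_cons Pi.
by apply: falg_ext IH _ => t; rewrite big_cons Pi.
Qed.

Lemma falg_prod I (r : seq I) (P : pred I) F :
  (forall i, C (F i)) -> C (fun t => \prod_(i <- r | P i) F i t).
Proof.
move=> CF; elim: r => [|i r IH].
  by apply: falg_ext (falgC algC 1) _ => t; rewrite big_nil.
case Pi: (P i).
  by apply: falg_ext (falgM algC (CF i) IH) _ => t; rewrite big_cons Pi.
by apply: falg_ext IH _ => t; rewrite big_cons Pi.
Qed.

Lemma falgX a n : C a -> C (fun t => a t ^+ n).
Proof.
move=> Ca; apply: falg_ext (falg_prod (index_enum 'I_n) xpredT (fun=> Ca)) _.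
by move=> t; rewrite prodr_const card_ord.
Qed.

Lemma falg_det n (A : T -> 'M[k]_n) :
  (forall i j, C (fun t => A t i j)) -> C (fun t => \det (A t)).
Proof.
move=> CA; apply: (falg_sum _ _ (fun s : 'S_n => _)) => s.
by apply: falgZ; apply: falg_prod.
Qed.

Lemma falg_adj n (A : T -> 'M[k]_n) i j :
  (forall i j, C (fun t => A t i j)) -> C (fun t => (\adj (A t)) i j).
Proof.
move=> CA; apply: (@falg_ext (fun t => cofactor (A t) j i)); last first.
  by move=> t; rewrite mxE.
apply: falgZ; apply: falg_det => a b.
by apply: falg_ext (CA (lift j a) (lift i b)) _ => t; rewrite !mxE.
Qed.

Lemma falg_mulmx m n p (A : T -> 'M[k]_(m, n)) (B : T -> 'M[k]_(n, p)) :
  (forall i j, C (fun t => A t i j)) -> (forall i j, C (fun t => B t i j)) ->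
  forall i j, C (fun t => (A t *m B t) i j).
Proof.
move=> CA CB i j.
apply: (@falg_ext (fun t => \sum_l A t i l * B t l j)) => [|t]; last by rewrite mxE.
by apply: falg_sum => l; apply: (falgM algC).
Qed.

End FunctionAlgebras.

Section Evaluation.
Variable k : fieldType.

Lemma evC n c (v : 'rV[k]_n) : ev c%:MP v = c. Proof. exact: mevalC. Qed.
Lemma ev1 n (v : 'rV[k]_n) : ev 1 v = 1. Proof. exact: meval1. Qed.
Lemma ev0 n (v : 'rV[k]_n) : ev 0 v = 0. Proof. exact: meval0. Qed.
Lemma evX n i (v : 'rV[k]_n) : ev 'X_i v = v 0 i. Proof. exact: mevalXU. Qed.
Lemma evXm n m (v : 'rV[k]_n) : ev 'X_[m] v = \prod_i v 0 i ^+ m i.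
Proof. exact: mevalX. Qed.
Lemma evD n p q (v : 'rV[k]_n) : ev (p + q) v = ev p v + ev q v.
Proof. exact: mevalD. Qed.

Lemma evB n p q (v : 'rV[k]_n) : ev (p - q) v = ev p v - ev q v.
Proof. exact: mevalB. Qed.
Lemma evM n p q (v : 'rV[k]_n) : ev (p * q) v = ev p v * ev q v.
Proof. exact: mevalM. Qed.
Lemma evZ n c p (v : 'rV[k]_n) : ev (c *: p) v = c * ev p v.
Proof. exact: mevalZ. Qed.
Lemma ev_sum n I (r : seq I) (P : pred I) F (v : 'rV[k]_n) :
  ev (\sum_(i <- r | P i) F i) v = \sum_(i <- r | P i) ev (F i) v.
Proof. exact: raddf_sum. Qed.
Lemma ev_prod n I (r : seq I) (P : pred I) F (v : 'rV[k]_n) :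
  ev (\prod_(i <- r | P i) F i) v = \prod_(i <- r | P i) ev (F i) v.
Proof. exact: rmorph_prod. Qed.
Lemma ev_exp n p d (v : 'rV[k]_n) : ev (p ^+ d) v = ev p v ^+ d.
Proof. exact: rmorphXn. Qed.

Lemma evE n p (v : 'rV[k]_n) :
  ev p v = \sum_(m <- msupp p) p@_m * \prod_i v 0 i ^+ m i.
Proof. exact: mevalE. Qed.

Lemma mpoly_alg_ind n (Q : {mpoly k[n]} -> Prop) :
  (forall c, Q c%:MP) -> (forall i, Q 'X_i) ->
  (forall p q, Q p -> Q q -> Q (p + q)) ->
  (forall p q, Q p -> Q q -> Q (p * q)) -> forall p, Q p.
Proof.
move=> QC QX QD QM p; rewrite [p]mpolyE.
have Qm m : Q 'X_[m].
  rewrite mpolyXE_id; elim/big_ind: _ => [| |i _]; first exact: (QC 1).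
    exact: QM.
  elim: (m i) => [|d IH]; first exact: (QC 1).
  by rewrite exprS; apply: QM.
elim/big_ind: _ => [| |m _]; first exact: (QC 0).
  exact: QD.
by rewrite -mul_mpolyC; apply: QM.
Qed.

(** Over an infinite field a polynomial is determined by its values ([mpoly_ext]), so polynomials
    are carried as functions, and a representing polynomial is chosen only where coefficients or
    degrees matter. *)
Definition polyf n (phi : 'rV[k]_n -> k) :=
  exists P : {mpoly k[n]}, forall v, phi v = ev P v.

Lemma polyf_ext n (a b : 'rV[k]_n -> k) : polyf a -> a =1 b -> polyf b.
Proof. by move=> pa /funext <-. Qed.

Lemma polyf_ev n (P : {mpoly k[n]}) : polyf (ev P).
Proof. by exists P. Qed.

Lemma polyf_alg n : funalg (@polyf n).
Proof.
split=> [c|a b [P aP] [Q bQ]|a b [P aP] [Q bQ]].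
- by exists c%:MP => v; rewrite evC.
- by exists (P + Q) => v; rewrite evD aP bQ.
- by exists (P * Q) => v; rewrite evM aP bQ.
Qed.

Lemma polyfX n (i : 'I_n) : polyf (fun v : 'rV_n => v 0 i).
Proof. by exists 'X_i => v; rewrite evX. Qed.

Lemma falg_ev T (C : (T -> k) -> Prop) n (g : T -> 'rV[k]_n) P :
  funalg C -> (forall i, C (fun t => g t 0 i)) -> C (fun t => ev P (g t)).
Proof.
move=> Ca Cg; elim/mpoly_alg_ind: P => [c|i|p q Cp Cq|p q Cp Cq].
- by apply: falg_ext (falgC Ca c) _ => t; rewrite evC.
- by apply: falg_ext (Cg i) _ => t; rewrite evX.
- by apply: falg_ext (falgD Ca Cp Cq) _ => t; rewrite evD.
- by apply: falg_ext (falgM Ca Cp Cq) _ => t; rewrite evM.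
Qed.

Lemma falg_polyf T (C : (T -> k) -> Prop) n (g : T -> 'rV[k]_n) phi :
  funalg C -> (forall i, C (fun t => g t 0 i)) -> polyf phi ->
  C (fun t => phi (g t)).
Proof.
move=> Ca Cg [P phiP]; apply: falg_ext (falg_ev P Ca Cg) _ => t.
by rewrite phiP.
Qed.

End Evaluation.

(** * Nonvanishing of polynomials over an infinite field *)

Section NonVanishing.
Variable k : numClosedFieldType.

Lemma poly_nonroot (q : {poly k}) : q != 0 -> exists t, q.[t] != 0.
Proof.
move=> q0; pose rs := [seq i%:R | i <- iota 0 (size q)] : seq k.
have urs : uniq rs by rewrite map_inj_uniq ?iota_uniq // => i j /eqP; rewrite eqr_nat => /eqP.
have [all_root|] := boolP (all (root q) rs).
  by have := max_poly_roots q0 all_root urs; rewrite size_map size_iota ltnn.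
by rewrite -has_predC => /hasP [t _ /= Nr]; exists t; apply: contra Nr => /eqP/rootP.
Qed.

Lemma digits_inj n D (m m' : 'I_n -> nat) :
  (forall i, (m i < D)%N) -> (forall i, (m' i < D)%N) ->
  (\sum_i m i * D ^ i = \sum_i m' i * D ^ i)%N -> m =1 m'.
Proof.
elim: n m m' => [|n IH] m m' mD m'D; first by move=> _ [].
rewrite !big_ord_recl /= !muln1.
have shift (f : 'I_n.+1 -> nat) :
    (\sum_(i < n) f (lift ord0 i) * D ^ (bump 0 i) =
     (\sum_(i < n) f (lift ord0 i) * D ^ i) * D)%N.
  by rewrite big_distrl; apply: eq_bigr => i _ /=; rewrite expnS mulnCA mulnC.
rewrite !shift => eq_s.
have e0 : m ord0 = m' ord0.
  have := congr1 (modn^~ D) eq_s; rewrite ![(_ + _ * D)%N]addnC !modnMDl.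
  by rewrite !modn_small.
move: eq_s; rewrite e0 => /addnI /eqP.
have D0 : (0 < D)%N by apply: leq_ltn_trans (mD ord0).
rewrite eqn_pmul2r // => /eqP /IH e1 i.
by case: (unliftP ord0 i) => [j|] ->; [apply: e1|].
Qed.

(** Kronecker substitution: with [D] above all exponents, replacing the i-th variable by
    [t ^+ (D ^ i)] sends distinct monomials of [P] to distinct powers of [t], by uniqueness of
    digits in base [D]. *)
Lemma mpoly_nonroot n (P : {mpoly k[n]}) : P != 0 -> exists v, ev P v != 0.
Proof.
move=> P0; pose D := msize P; pose e (m : 'X_{1..n}) := (\sum_i m i * D ^ i)%N.
pose q : {poly k} := \sum_(m <- msupp P) P@_m *: 'X^(e m).
have entry m i : m \in msupp P -> (m i < D)%N.
  move=> /msize_mdeg_lt; apply: leq_ltn_trans.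
  by rewrite mdegE (bigD1 i) //= leq_addr.
have qE t : ev P (\row_i t ^+ (D ^ i)) = q.[t].
  rewrite evE /q horner_sum; apply: eq_bigr => m _.
  rewrite hornerZ hornerXn; congr (_ * _).
  rewrite /e -prodrXr; apply: eq_bigr => i _.
  by rewrite mxE -exprM mulnC.
have [m0 m0P] : exists m0, m0 \in msupp P.
  case Es: (msupp P) => [|m s]; last by exists m; rewrite mem_head.
  by move: P0; rewrite -msupp_eq0 Es.
suff /poly_nonroot [t qt] : q != 0 by exists (\row_i t ^+ (D ^ i)); rewrite qE.
apply/eqP => q0; move: (m0P); rewrite mcoeff_msupp => /eqP; apply.
have := congr1 (fun r : {poly k} => r`_(e m0)) q0.
rewrite coef0 /q coef_sum => <-.
rewrite (bigD1_seq m0) ?msupp_uniq //= coefZ coefXn eqxx mulr1.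
rewrite big_seq_cond big1 ?addr0 // => m /andP [mP mm0].
rewrite coefZ coefXn; case: eqP => [em|]; last by rewrite mulr0.
case/negP: mm0; apply/eqP/mnmP => i.
by apply/esym/(@digits_inj _ D) => // j; apply: entry.
Qed.

Lemma poly_ext (p q : {poly k}) : (forall t, p.[t] = q.[t]) -> p = q.
Proof.
move=> pq; apply/eqP; rewrite -subr_eq0; apply/negPn/negP => /poly_nonroot [t].
by rewrite hornerD hornerN pq subrr eqxx.
Qed.

Lemma mpoly_ext n (P Q : {mpoly k[n]}) : (forall v, ev P v = ev Q v) -> P = Q.
Proof.
move=> pq; apply/eqP; rewrite -subr_eq0; apply/negPn/negP => /mpoly_nonroot [v].
by rewrite evB pq subrr eqxx.
Qed.

End NonVanishing.

(** * Images of affine spaces *)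

Section Relation.
Variable k : numClosedFieldType.

Lemma msize_mul_le n (p q : {mpoly k[n]}) a b :
  (msize p <= a.+1)%N -> (msize q <= b.+1)%N -> (msize (p * q) <= (a + b).+1)%N.
Proof.
move=> pa qb; have [->|p0] := eqVneq p 0; first by rewrite mul0r msize0.
have [->|q0] := eqVneq q 0; first by rewrite mulr0 msize0.
rewrite msizeM //; move: pa qb; move: (mmeasure _ p) (mmeasure _ q) => x y; lia.
Qed.

Lemma msize_exp_le n (p : {mpoly k[n]}) a d :
  (msize p <= a.+1)%N -> (msize (p ^+ d) <= (d * a).+1)%N.
Proof.
move=> pa; elim: d => [|d IH]; first by rewrite expr0 msize1.
by rewrite exprS mulSn; apply: msize_mul_le.
Qed.

Lemma msize_prod_le n (I : finType) (p : I -> {mpoly k[n]}) a :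
  (forall i, (msize (p i) <= a.+1)%N) -> (msize (\prod_i p i) <= (#|I| * a).+1)%N.
Proof.
move=> pa; rewrite cardE -big_enum; elim: (enum I) => [|i r IH].
  by rewrite big_nil msize1.
by rewrite big_cons /= mulSn; apply: msize_mul_le.
Qed.

Lemma wide_mx_kernel (R C : finType) (A : R -> C -> k) : (#|C| < #|R|)%N ->
  exists2 u : R -> k, (exists r, u r != 0) & forall c, \sum_r u r * A r c = 0.
Proof.
move=> CR; pose M : 'M[k]_(#|R|, #|C|) := \matrix_(i, j) A (enum_val i) (enum_val j).
have : kermx M != 0.
  rewrite -mxrank_eq0 mxrank_ker -lt0n subn_gt0.
  exact: leq_ltn_trans (rank_leq_col _) CR.
case/rowV0Pn => v /sub_kermxP vM v0.
exists (fun r => v 0 (enum_rank r)).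
  by case/rV0Pn: v0 => j vj; exists (enum_val j); rewrite enum_valK.
move=> c; have /rowP/(_ (enum_rank c)) := vM; rewrite !mxE => vMc.
rewrite -[RHS]vMc (reindex (@enum_val R xpredT)) /=; last first.
  by exists enum_rank => i _; rewrite (enum_valK, enum_rankK).
by apply: eq_bigr => i _; rewrite !mxE enum_valK enum_rankK.
Qed.

(* Counting: the products [B^j phi^f] with exponents below [N] outnumber the
   monomials that can occur in them once [N] is large, so they satisfy a linear
   relation, and a relation of lowest order in [B] survives on [B = 0]. *)
Lemma image_in_hypersurface m m' (phi : 'I_m' -> {mpoly k[m]}) (B : {mpoly k[m]}) :
  (m <= m')%N -> B != 0 ->
  exists2 c : {mpoly k[m']}, c != 0 &
    forall v, ev B v = 0 -> ev c (\row_i ev (phi i) v) = 0.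
Proof.
move=> mm' B0.
pose d := maxn (msize B) (\max_i msize (phi i)).
(* There are N^(m'+1) products, while the monomials with all exponents below N D number (N D)^m. As
   m <= m', taking N > D^m makes the products more numerous. *)
pose D := ((m' + 1) * d + 1)%N; pose N := (D ^ m).+1.
pose mon (f : {ffun 'I_m' -> 'I_N}) : {mpoly k[m]} := \prod_i phi i ^+ f i.
pose Q (jf : 'I_N * {ffun 'I_m' -> 'I_N}) := B ^+ jf.1 * mon jf.2.
have Qdeg jf : (msize (Q jf) <= N * D)%N.
  have B_d : (msize B <= d.+1)%N by apply: leq_trans (leqnSn d); apply: leq_maxl.
  have phi_d i : (msize (phi i) <= d.+1)%N.
    apply: leq_trans (leqnSn d); apply: leq_trans (leq_maxr _ _).
    exact: (leq_bigmax i).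
  have e1 : (msize (B ^+ jf.1) <= (N * d).+1)%N.
    apply: leq_trans (msize_exp_le _ B_d) _; rewrite ltnS leq_mul2r.
    by rewrite (ltnW (ltn_ord _)) orbT.
  have e2 : (msize (mon jf.2) <= (m' * (N * d)).+1)%N.
    rewrite -[m' in (m' * _)%N]card_ord; apply: msize_prod_le => i.
    apply: leq_trans (msize_exp_le _ (phi_d i)) _; rewrite ltnS leq_mul2r.
    by rewrite (ltnW (ltn_ord _)) orbT.
  apply: leq_trans (msize_mul_le e1 e2) _.
  rewrite /D mulnDr muln1 mulnDl mul1n mulnDr addnC.
  have : (0 < N)%N by []; nia.
pose A (jf : 'I_N * {ffun 'I_m' -> 'I_N}) (g : {ffun 'I_m -> 'I_(N * D)}) :=
  (Q jf)@_[multinom (g i : nat) | i < m].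
have [|u [[j0 f0] u0] uA] := @wide_mx_kernel _ _ A.
  rewrite card_prod !card_ffun !card_ord expnMn.
  apply: (@leq_trans (N ^ m * N)); first by rewrite ltn_pmul2l ?expn_gt0.
  by rewrite mulnC leq_mul2l leq_pexp2l.
have rel : \sum_jf u jf *: Q jf = 0.
  apply/mpolyP => mm; rewrite mcoeff0 raddf_sum /=.
  have [/forallP small|] := boolP [forall i, (mm i < N * D)%N].
    apply: etrans (uA [ffun i => Ordinal (small i)]); apply: eq_bigr => jf _.
    rewrite mcoeffZ /A; congr (_ * _@__); apply/mnmP => i.
    by rewrite mnmE ffunE.
  rewrite negb_forall => /existsP [i]; rewrite -leqNgt => big_i.
  apply: big1 => jf _; rewrite mcoeffZ memN_msupp_eq0 ?mulr0 //.
  apply: msize_mdeg_ge; apply: leq_trans (Qdeg jf) (leq_trans big_i _).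
  by rewrite mdegE (bigD1 i) //= leq_addr.
pose hasj j := [exists f, [exists i : 'I_N, (i == j :> nat) && (u (i, f) != 0)]].
have ex_j : exists j, hasj j.
  by exists j0; apply/existsP; exists f0; apply/existsP; exists j0; rewrite eqxx.
case: (ex_minnP ex_j) => j /existsP [f1 /existsP [i1 /andP [/eqP i1j u1]]] min_j.
have lo (jf : 'I_N * {ffun 'I_m' -> 'I_N}) : (jf.1 < j)%N -> u jf = 0.
  case: jf => i f /= ij; apply/eqP; apply: contraLR ij => uif.
  rewrite -leqNgt; apply: min_j; apply/existsP; exists f; apply/existsP.
  by exists i; rewrite eqxx.
pose S := \sum_(jf : 'I_N * {ffun 'I_m' -> 'I_N}) u jf *: (B ^+ (jf.1 - j) * mon jf.2).
have S0 : S = 0.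
  have : B ^+ j * S = 0.
    rewrite -[RHS]rel mulr_sumr; apply: eq_bigr => jf _.
    have [/lo ->|jj] := ltnP jf.1 j; first by rewrite !scale0r mulr0.
    by rewrite -scalerAr mulrA -exprD subnKC.
  by move/eqP; rewrite mulf_eq0 expf_eq0 (negPf B0) andbF => /eqP.
pose mn (f : {ffun 'I_m' -> 'I_N}) := [multinom (f i : nat) | i < m'].
have mon_inj : injective mn.
  move=> f g /mnmP fg; apply/ffunP => i; apply: val_inj.
  by have := fg i; rewrite !mnmE.
exists (\sum_f u (i1, f) *: 'X_[mn f]).
  apply/eqP => c0; case/eqP: u1.
  have := congr1 (mcoeff (mn f1)) c0; rewrite mcoeff0 raddf_sum /= => <-.
  rewrite (bigD1 f1) //= mcoeffZ mcoeffX eqxx mulr1 big1 ?addr0 // => f ff1.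
  by rewrite mcoeffZ mcoeffX (inj_eq mon_inj) (negPf ff1) mulr0.
move=> v Bv; have := congr1 (fun p => ev p v) S0; rewrite ev0 ev_sum => <-.
rewrite !ev_sum.
have -> : \sum_(jf : 'I_N * {ffun 'I_m' -> 'I_N})
      ev (u jf *: (B ^+ (jf.1 - j) * mon jf.2)) v =
    \sum_i \sum_f ev (u (i, f) *: (B ^+ (i - j) * mon f)) v.
  by rewrite pair_bigA; apply: eq_bigr => -[i f] _.
rewrite (bigD1 i1) //= [X in _ + X]big1 ?addr0 => [|i ii1]; last first.
  apply: big1 => f _; rewrite evZ evM ev_exp Bv.
  have [ij|ji] := ltnP i j; first by rewrite lo ?mul0r.
  rewrite expr0n subn_eq0 leqNgt ltn_neqAle ji andbT -i1j.
  by rewrite -val_eqE /= eq_sym in ii1; rewrite ii1 mul0r mulr0.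
apply: eq_bigr => f _; rewrite !evZ i1j subnn expr0 mul1r evXm ev_prod.
by congr (_ * _); apply: eq_bigr => i _; rewrite ev_exp mxE mnmE.
Qed.

Lemma polyf_image_in_hypersurface m m' (phi : 'rV[k]_m -> 'rV[k]_m') (B : 'rV[k]_m -> k) :
  (m <= m')%N -> (forall i, polyf (fun v => phi v 0 i)) -> polyf B ->
  (exists v, B v != 0) ->
  exists2 c : {mpoly k[m']}, c != 0 & forall v, B v = 0 -> ev c (phi v) = 0.
Proof.
move=> mm' /fin_all_exists [P phiP] [Q BQ] [v0 Bv0].
have Q0 : Q != 0 by apply: contraNneq Bv0 => Q0; rewrite BQ Q0 ev0.
have [c c0 cP] := image_in_hypersurface P mm' Q0.
exists c => // v Bv; rewrite -(cP v) -?BQ //; congr ev.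
by apply/rowP => i; rewrite mxE phiP.
Qed.

End Relation.

(** * The Nullstellensatz *)

Section FormalLead.
Variable R : idomainType.
Implicit Types p q : {poly R}.

(** A formal degree: [c] may vanish, so leading terms of sums and products are computed without case
    distinctions on cancellation. *)
Definition deg_lead p d c := (size p <= d.+1)%N /\ p`_d = c.

Lemma deg_leadC c : deg_lead c%:P 0 c.
Proof. by split; [apply: size_polyC_leq1 | rewrite coefC]. Qed.

Lemma deg_leadD p q d a b :
  deg_lead p d a -> deg_lead q d b -> deg_lead (p + q) d (a + b).
Proof.
move=> [sp <-] [sq <-]; split; last by rewrite coefD.
by apply: leq_trans (size_polyD _ _) _; rewrite geq_max sp.
Qed.

Lemma deg_leadZ p d a c : deg_lead p d a -> deg_lead (c *: p) d (c * a).
Proof.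
by move=> [sp <-]; split; [apply: leq_trans (size_scale_leq _ _) sp | rewrite coefZ].
Qed.

Lemma deg_leadN p d a : deg_lead p d a -> deg_lead (- p) d (- a).
Proof. by move=> [sp <-]; split; [rewrite size_polyN | rewrite coefN]. Qed.

Lemma deg_leadM p q d e a b :
  deg_lead p d a -> deg_lead q e b -> deg_lead (p * q) (d + e) (a * b).
Proof.
move=> [sp <-] [sq <-]; split.
  apply: leq_trans (size_polyMleq _ _) _.
  by move: sp sq; move: (size p) (size q) => x y; lia.
rewrite coefM (bigD1 (inord d)) //= inordK ?ltnS ?leq_addr // addKn.
rewrite big1 ?addr0 // => i; rewrite -val_eqE /= inordK ?ltnS ?leq_addr // => id.
have [ltid|ltdi|/eqP] := ltngtP i d; last by rewrite (negPf id).
  by rewrite [q`__]nth_default ?mulr0 //; apply: leq_trans sq _; lia.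
by rewrite [p`__]nth_default ?mul0r //; apply: leq_trans sp _.
Qed.

Lemma deg_leadX p d a n : deg_lead p d a -> deg_lead (p ^+ n) (n * d) (a ^+ n).
Proof.
move=> pa; elim: n => [|n IH]; first by rewrite !expr0; apply: deg_leadC.
by rewrite !exprS mulSn; apply: deg_leadM.
Qed.

Lemma deg_lead_prod I (r : seq I) (p : I -> {poly R}) (d : I -> nat) (a : I -> R) :
  (forall i, deg_lead (p i) (d i) (a i)) ->
  deg_lead (\prod_(i <- r) p i) (\sum_(i <- r) d i) (\prod_(i <- r) a i).
Proof.
move=> pa; elim: r => [|i r IH]; first by rewrite !big_nil; apply: deg_leadC.
by rewrite !big_cons; apply: deg_leadM.
Qed.

Lemma deg_lead_sum (I : eqType) (r : seq I) (p : I -> {poly R}) d (a : I -> R) :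
  {in r, forall i, deg_lead (p i) d (a i)} ->
  deg_lead (\sum_(i <- r) p i) d (\sum_(i <- r) a i).
Proof.
elim: r => [|i r IH] pa.
  by rewrite !big_nil; split; rewrite ?size_poly0 ?coef0.
rewrite !big_cons; apply: deg_leadD; first by apply: pa; rewrite mem_head.
by apply: IH => j jr; apply: pa; rewrite inE jr orbT.
Qed.

Lemma deg_lead_small p d e : (size p <= d)%N -> (d <= e)%N -> deg_lead p e 0.
Proof.
move=> sp de; split; first by apply: leq_trans sp (leqW de).
by rewrite nth_default //; apply: leq_trans sp de.
Qed.

End FormalLead.

Section CoefAlgebra.
Variables (k : comNzRingType) (T : Type) (C : (T -> k) -> Prop).
Hypothesis algC : funalg C.

Definition falg_coef (F : T -> {poly k}) := forall j, C (fun t => (F t)`_j).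

Lemma falg_coefC a : C a -> falg_coef (fun t => (a t)%:P).
Proof.
move=> Ca [|j]; first by apply: falg_ext Ca _ => t; rewrite coefC.
by apply: falg_ext (falgC algC 0) _ => t; rewrite coefC.
Qed.

Lemma falg_coefD F G : falg_coef F -> falg_coef G -> falg_coef (fun t => F t + G t).
Proof. by move=> CF CG j; apply: falg_ext (falgD algC (CF j) (CG j)) _ => t; rewrite coefD. Qed.

Lemma falg_coefM F G : falg_coef F -> falg_coef G -> falg_coef (fun t => F t * G t).
Proof.
move=> CF CG j; pose H t := \sum_(i < j.+1) (F t)`_i * (G t)`_(j - i).
apply: (@falg_ext _ _ _ H) => [|t]; last by rewrite coefM.
by apply: falg_sum => // i; apply: falgM.
Qed.

Lemma falg_coef_const p : falg_coef (fun=> p).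
Proof. by move=> j; apply: falgC. Qed.

End CoefAlgebra.

Section Nullstellensatz.
Variable k : numClosedFieldType.

Record fideal n (I : ('rV[k]_n -> k) -> Prop) : Prop := FIdeal {
  fideal_poly : forall a, I a -> polyf a;
  fideal0 : I (fun=> 0);
  fidealD : forall a b, I a -> I b -> I (fun v => a v + b v);
  fidealM : forall a b, polyf a -> I b -> I (fun v => a v * b v) }.

Lemma fideal_ext n (I : ('rV[k]_n -> k) -> Prop) a b : I a -> a =1 b -> I b.
Proof. by move=> Ia /funext <-. Qed.

Lemma fideal_sum n (I : ('rV[k]_n -> k) -> Prop) (J : Type) (r : seq J) F :
  fideal I -> (forall i, I (F i)) -> I (fun v => \sum_(i <- r) F i v).
Proof.
move=> II IF; elim: r => [|i r IH].
  by apply: fideal_ext (fideal0 II) _ => v; rewrite big_nil.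
by apply: fideal_ext (fidealD II (IF i) IH) _ => v; rewrite big_cons.
Qed.

(** Its value at [w] is the formal leading coefficient of [P] along every line of direction [w]
    ([line_poly_lead]); where it is nonzero, [P] is monic in that direction up to a constant. *)
Definition top_form n (P : {mpoly k[n]}) :=
  \sum_(m <- msupp P) (P@_m * (mdeg m == (msize P).-1)%:R) *: 'X_[m].

Lemma top_form_neq0 n (P : {mpoly k[n]}) : P != 0 -> top_form P != 0.
Proof.
move=> P0; apply/eqP => /(congr1 (mcoeff (mlead P))).
rewrite mcoeff0 raddf_sum /= (bigD1_seq (mlead P)) ?mlead_supp ?msupp_uniq //=.
rewrite mcoeffZ mcoeffX eqxx -mlead_deg //= eqxx !mulr1 big1 ?addr0 => [|m mP].
  by apply/eqP; rewrite mleadc_eq0.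
by rewrite mcoeffZ mcoeffX (negPf mP) mulr0.
Qed.

Section Line.
Variables (n : nat) (w : 'rV[k]_n.+1).

(** Coordinates adapted to a direction [w] with nonzero coordinate 0: a vector is [emb x + t *: w],
    with [x] its [foot] and [t] its [slope]. They play the role of the linear change of variables in
    Noether normalization. *)
Definition emb (x : 'rV[k]_n) : 'rV[k]_n.+1 := 
  \row_i (if unlift ord0 i is Some j then x 0 j else 0).

Definition line_poly (P : {mpoly k[n.+1]}) (x : 'rV[k]_n) : {poly k} :=
  mmap (@polyC k) (fun i => (emb x 0 i)%:P + w 0 i *: 'X) P.

Lemma line_polyE P x t : (line_poly P x).[t] = ev P (emb x + t *: w).
Proof.
rewrite /line_poly; elim/mpoly_alg_ind: P => [c|i|p q IHp IHq|p q IHp IHq].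
- by rewrite mmapC evC hornerC.
- by rewrite mmapX mmap1U evX !mxE hornerD hornerC hornerZ hornerX [t * _]mulrC.
- by rewrite mmapD evD hornerD IHp IHq.
- by rewrite rmorphM evM hornerM IHp IHq.
Qed.

Lemma polyf_emb i : polyf (fun x => emb x 0 i).
Proof.
case Ei: (unlift ord0 i) => [j|].
  by apply: polyf_ext (@polyfX k _ j) _ => x; rewrite mxE Ei.
by apply: polyf_ext (falgC (polyf_alg _ _) 0) _ => x; rewrite mxE Ei.
Qed.

Lemma line_poly_coef P : falg_coef (@polyf k n) (line_poly P).
Proof.
have alg := polyf_alg k n.
elim/mpoly_alg_ind: P => [c|i|p q IHp IHq|p q IHp IHq] j.
- by apply: falg_ext (falgC alg (c%:P)`_j) _ => x; rewrite /line_poly mmapC.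
- have H := falg_coefD alg (falg_coefC alg (polyf_emb i)) (falg_coef_const alg (w 0 i *: 'X)).
  by apply: falg_ext (H j) _ => x; rewrite /line_poly mmapX mmap1U.
- by apply: falg_ext (falg_coefD alg IHp IHq j) _ => x; rewrite /line_poly mmapD.
- by apply: falg_ext (falg_coefM alg IHp IHq j) _ => x; rewrite /line_poly rmorphM.
Qed.

Lemma line_poly_lead P x :
  deg_lead (line_poly P x) (msize P).-1 (ev (top_form P) w).
Proof.
pose d := (msize P).-1.
rewrite /top_form ev_sum /line_poly /mmap; apply: deg_lead_sum => m mP.
rewrite evZ mul_polyC -mulrA; apply: deg_leadZ.
have lm : deg_lead (mmap1 (fun i => (emb x 0 i)%:P + w 0 i *: 'X) m) (mdeg m)
            (ev 'X_[m] w).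
  rewrite evXm mdegE /mmap1; apply: deg_lead_prod => i.
  rewrite -[m i as X in deg_lead _ X]muln1; apply: deg_leadX.
  rewrite -[w 0 i as X in deg_lead _ _ X]add0r; apply: deg_leadD.
    by apply: deg_lead_small (size_polyC_leq1 _) _.
  by rewrite -[X in deg_lead _ _ X]mulr1; apply: deg_leadZ; split; rewrite ?size_polyX ?coefX.
rewrite -/d; have [<-|md] := eqVneq (mdeg m) d; first by rewrite mul1r.
rewrite mul0r; apply: (deg_lead_small (d := (mdeg m).+1)); first by case: lm.
by rewrite ltn_neqAle md /d -ltnS prednK ?msize_mdeg_lt // (leq_ltn_trans _ (msize_mdeg_lt mP)).
Qed.

Hypothesis w0 : w 0 ord0 != 0.

Definition slope (v : 'rV[k]_n.+1) : k := v 0 ord0 / w 0 ord0.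
Definition foot (v : 'rV[k]_n.+1) : 'rV[k]_n :=
  \row_j (v 0 (lift ord0 j) - slope v * w 0 (lift ord0 j)).

Lemma foot_slopeK v : emb (foot v) + slope v *: w = v.
Proof.
apply/rowP => i; rewrite !mxE; case: unliftP => [j ->|->].
  by rewrite !mxE subrK.
by rewrite add0r divfK.
Qed.

Lemma slopeE x t : slope (emb x + t *: w) = t.
Proof. by rewrite /slope !mxE unlift_none add0r mulfK. Qed.

Lemma polyf_slope : polyf slope.
Proof.
apply: polyf_ext (falgZ (polyf_alg k _) (w 0 ord0)^-1 (@polyfX k _ ord0)) _ => v.
by rewrite mulrC.
Qed.

Lemma polyf_foot j : polyf (fun v => foot v 0 j).
Proof.
have alg := polyf_alg k n.+1.
apply: polyf_ext (falgB alg (@polyfX k _ (lift ord0 j))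
  (falgM alg polyf_slope (falgC alg (w 0 (lift ord0 j))))) _ => v.
by rewrite mxE.
Qed.

Variable I : ('rV[k]_n.+1 -> k) -> Prop.
Hypothesis idI : fideal I.

Definition elim_ideal (a : 'rV[k]_n -> k) := polyf a /\ I (fun v => a (foot v)).

Lemma elim_fideal : fideal elim_ideal.
Proof.
have alg := polyf_alg k n.
split=> [a []//||a b [pa Ia] [pb Ib]|a b pa [pb Ib]].
- by split; [apply: (falgC alg) | apply: fideal0].
- by split; [apply: falgD | apply: fidealD].
- split; first exact: falgM.
  apply: (fidealM idI _ Ib).
  exact: (falg_polyf (polyf_alg k _) polyf_foot pa).
Qed.

(* [G] is monic along the lines [emb x + t w]; the determinant of multiplication
   by [F] modulo [G], computed with the companion matrix of [G], is a multiple
   of [F] modulo [G] that does not involve the coordinate [t]. *)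
Lemma elim_norm (d : nat) (G F : {mpoly k[n.+1]}) (x0 : 'rV[k]_n) :
  (forall x, deg_lead (line_poly G x) d.+1 1) -> I (ev G) -> I (ev F) ->
  line_poly F x0 = 1 -> exists2 N, elim_ideal N & N x0 = 1.
Proof.
move=> Gm IG IF F1.
pose C (x : 'rV[k]_n) : 'M[k]_d.+1 := \matrix_(i, j)
  (if (i < d)%N then (j == i.+1 :> nat)%:R else - (line_poly G x)`_j).
pose e (t : k) : 'cV[k]_d.+1 := \col_i t ^+ i.
have lineG v : ev G v = (line_poly G (foot v)).[slope v].
  by rewrite line_polyE foot_slopeK.
have lineF v : ev F v = (line_poly F (foot v)).[slope v].
  by rewrite line_polyE foot_slopeK.
have algn := polyf_alg k n; have algS := polyf_alg k n.+1.
have pC i j : polyf (fun x => C x i j).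
  case ltid: (i < d)%N.
    by apply: polyf_ext (falgC algn (j == i.+1 :> nat)%:R) _ => x; rewrite mxE ltid.
  apply: polyf_ext (falgN algn (line_poly_coef G j)) _ => x.
  by rewrite mxE ltid.
have pCf i j : polyf (fun v => C (foot v) i j).
  exact: (falg_polyf algS polyf_foot (pC i j)).
(* Modulo [I] the vector of powers of the slope is an eigenvector of the companion matrix; only the
   last row uses that [G] lies in [I]. *)
have C1 i : I (fun v => (C (foot v) *m e (slope v) - slope v *: e (slope v)) i 0).
  have [ltid|geid] := ltnP i d.
    apply: fideal_ext (fideal0 idI) _ => v.
    rewrite !mxE (bigD1 (inord i.+1)) //= !mxE ltid inordK ?ltnS // eqxx mul1r.
    rewrite big1 ?addr0 => [|j]; first by rewrite exprS subrr.
    rewrite -val_eqE /= inordK ?ltnS // => ji.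
    by rewrite !mxE ltid (negPf ji) mul0r.
  apply: fideal_ext (fidealM idI (falgC algS (-1)) IG) _ => v.
  have id : i = d :> nat by apply/eqP; rewrite eqn_leq geid -ltnS ltn_ord.
  rewrite lineG (horner_coef_wide _ (proj1 (Gm _))) big_ord_recr /= (proj2 (Gm _)).
  rewrite !mxE id -exprS mul1r mulrDr mulN1r mulN1r; congr (_ - _).
  rewrite -sumrN; apply: eq_bigr => j _.
  by rewrite !mxE id ltnn mulNr.
have I_mul (A : 'rV[k]_n.+1 -> 'M[k]_d.+1) (b : 'rV[k]_n.+1 -> 'cV[k]_d.+1) :
    (forall i j, polyf (fun v => A v i j)) -> (forall i, I (fun v => b v i 0)) ->
    forall i, I (fun v => (A v *m b v) i 0).
  move=> pA Ib i.
  have := @fideal_sum _ _ _ (index_enum 'I_d.+1) (fun j v => A v i j * b v j 0) idI.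
  move=> H; apply: fideal_ext (H _) _ => [j|v]; last by rewrite mxE.
  exact: fidealM (pA _ _) (Ib j).
have pe i : polyf (fun v => (e (slope v)) i 0).
  by apply: polyf_ext (falgX algS i polyf_slope) _ => v; rewrite mxE.
have CX j i : I (fun v => (C (foot v) ^+ j *m e (slope v) -
    slope v ^+ j *: e (slope v)) i 0).
  elim: j i => [|j IH] i.
    by apply: fideal_ext (fideal0 idI) _ => v; rewrite !expr0 mul1mx scale1r subrr mxE.
  have H1 := I_mul _ _ pCf IH i.
  have H2 := fidealM idI (falgX algS j polyf_slope) (C1 i).
  apply: fideal_ext (fidealD idI H1 H2) _ => v.
  set c := C _; set s := slope v; set E := e s.
  have -> : c ^+ j.+1 *m E - s ^+ j.+1 *: E =
      c *m (c ^+ j *m E - s ^+ j *: E) + s ^+ j *: (c *m E - s *: E).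
    rewrite mulmxBr scalerBr mulmxA -[c *m c ^+ j]/(c * c ^+ j) -exprS -scalemxAr scalerA -exprSr.
    by rewrite addrA subrK.
  by rewrite [RHS]mxE; congr (_ + _); rewrite [RHS]mxE.
pose M (x : 'rV[k]_n) := \sum_(j < (msize F).+1) (line_poly F x)`_j *: C x ^+ j.
have sizeF x : (size (line_poly F x) <= (msize F).+1)%N.
  have [sQ _] := line_poly_lead F x.
  by apply: leq_trans sQ _; rewrite ltnS leq_pred.
have pCX j : forall a b, polyf (fun x => (C x ^+ j) a b).
  elim: j => [|j IH] a b.
    by apply: polyf_ext (falgC algn ((1 : 'M[k]_d.+1) a b)) _ => x; rewrite expr0.
  by apply: polyf_ext (falg_mulmx algn pC IH a b) _ => x; rewrite exprS.
have pM a b : polyf (fun x => M x a b).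
  have H j := falgM algn (line_poly_coef F j) (pCX j a b).
  apply: polyf_ext (falg_sum algn (index_enum 'I_(msize F).+1) xpredT (fun j => H j)) _.
  by move=> x; rewrite summxE; apply: eq_bigr => j _; rewrite mxE.
have IMe i : I (fun v => (M (foot v) *m e (slope v)) i 0).
  have pc j : polyf (fun v => (line_poly F (foot v))`_j).
    exact: (falg_polyf algS polyf_foot (line_poly_coef F j)).
  have H1 := @fideal_sum _ _ _ (index_enum 'I_(msize F).+1) _ idI
     (fun j : 'I__ => fidealM idI (pc j) (CX j i)).
  have H2 := fidealM idI (pe i) IF.
  apply: fideal_ext (fidealD idI H1 H2) _ => v.
  rewrite lineF (horner_coef_wide _ (sizeF _)) mulr_sumr -big_split /=.
  rewrite /M mulmx_suml summxE; apply: eq_bigr => j _.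
  by rewrite -scalemxAl !mxE mulrBr; ring.
(* [M] times the vector of powers lies in [I], and that vector has first entry 1: multiplying by the
   adjugate puts the determinant itself in [I]. *)
exists (fun x => \det (M x)).
  split; first exact: falg_det.
  have pf a b : polyf (fun v => (\adj (M (foot v))) a b).
    by apply: falg_adj => // c c'; apply: (falg_polyf algS polyf_foot (pM c c')).
  apply: fideal_ext (I_mul _ _ pf IMe ord0) _ => v.
  by rewrite mulmxA mul_adj_mx mul_scalar_mx !mxE expr0 mulr1.
suff -> : M x0 = 1%:M by rewrite det1.
rewrite /M big_ord_recl F1 coefC eqxx scale1r expr0 big1 ?addr0 // => j _.
by rewrite coefC scale0r.
Qed.

End Line.


(** [K] is an ideal of polynomials in one variable: a nonzero element of least size divides all the
    others, and it is not constant since 1 is not in [K]. *)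
Lemma common_root (K : {poly k} -> Prop) :
  (forall p q, K p -> K q -> K (p + q)) -> (forall p q, K q -> K (p * q)) ->
  ~ K 1 -> exists t, forall p, K p -> p.[t] = 0.
Proof.
move=> KD KM N1.
have [[p [Kp p0]]|none] := pselect (exists p, K p /\ p != 0); last first.
  by exists 0 => p Kp; have [->|p0] := eqVneq p 0; rewrite ?horner0 //; case: none; exists p.
pose has_size m := `[< exists q, [/\ K q, q != 0 & size q = m] >].
have ex_m : exists m, has_size m by exists (size p); apply/asboolP; exists p.
case: (ex_minnP ex_m) => m /asboolP [q [Kq q0 sq]] min_m.
have div r : K r -> q %| r.
  move=> Kr; rewrite /dvdp -[_ == 0]negbK; apply/negP => rm0.
  have Km : K (r %% q).
    rewrite -[r %% q](addrK (r %/ q * q)) [r %% q + _]addrC -divp_eq.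
    by rewrite -mulNr; apply: KD => //; apply: KM.
  have := min_m (size (r %% q)); rewrite leqNgt -sq ltn_modp q0 => H.
  by have: false by apply: H; apply/asboolP; exists (r %% q).
have [sq1|sq1] := eqVneq (size q) 1.
  case: N1; move/eqP: sq1 => /size_poly1P [c c0 qc].
  rewrite (_ : 1 = c^-1%:P * q); first exact: KM.
  by rewrite qc -polyCM mulVf.
have [t qt] := closed_rootP q sq1.
by exists t => r /div /dvdpP [s ->]; rewrite hornerM (rootP qt) mulr0.
Qed.

(** Induction on the number of variables gives a zero [a] of the elimination ideal. The restrictions
    of [I] to the line over [a] form an ideal [K] in one variable; if 1 were among them, [elim_norm]
    would give an element of the elimination ideal with value 1 at [a]. *)
Theorem nullstellensatz n (I : ('rV[k]_n -> k) -> Prop) :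
  fideal I -> ~ I (fun=> 1) -> exists v, forall a, I a -> a v = 0.
Proof.
elim: n I => [|n IH] I idI N1.
  exists 0 => a Ia; apply/eqP; apply: contrapT => /negP a0; apply: N1.
  apply: fideal_ext (fidealM idI (falgC (polyf_alg k 0) (a 0)^-1) Ia) _ => v.
  by rewrite (_ : v = 0) ?mulVf //; apply/rowP => -[].
have [[g [Ig [v0 gv0]]]|none] := pselect (exists g, I g /\ exists v, g v != 0); last first.
  exists 0 => a Ia; apply/eqP; apply: contrapT => /negP a0.
  by apply: none; exists a; split=> //; exists 0.
have [P gP] := fideal_poly idI Ig.
have P0 : P != 0 by apply: contraNneq gv0 => P0; rewrite gP P0 ev0.
have {}Ig : I (ev P) by apply: fideal_ext Ig _.
pose d := (msize P).-1.
have [d0|d0] := posnP d.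
  case: N1; have sP : (msize P <= 1)%N by rewrite /d in d0; move: d0; lia.
  have Pc := msize1_polyC sP.
  have c0 : P@_0%MM != 0 by apply: contraNneq P0 => c0; rewrite Pc c0 mpolyC0.
  apply: fideal_ext (fidealM idI (falgC (polyf_alg k _) (P@_0%MM)^-1) Ig) _ => v.
  by rewrite Pc evC mcoeffC eqxx mulr1 mulVf.
have X0 : 'X_ord0 != 0 :> {mpoly k[n.+1]}.
  by rewrite -msize_poly_eq0 msizeX.
(* The factor ['X_ord0] makes the direction transverse to the hyperplane on which the lines are
   based. *)
have [w] := mpoly_nonroot (mulf_neq0 (top_form_neq0 P0) X0).
rewrite evM evX mulf_eq0 negb_or => /andP [c0 w0].
pose G := (ev (top_form P) w)^-1 *: P.
have IG : I (ev G).
  apply: fideal_ext (fidealM idI (falgC (polyf_alg k _) (ev (top_form P) w)^-1) Ig) _ => v.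
  by rewrite evZ.
have Gm x : deg_lead (line_poly w G x) d.-1.+1 1.
  rewrite prednK // -(mulVf c0) /line_poly mmapZ mul_polyC; apply: deg_leadZ.
  exact: line_poly_lead.
have [a aP] : exists a, forall b, elim_ideal w I b -> b a = 0.
  by apply: IH; [apply: elim_fideal | move=> [_ /N1]].
pose K p := exists2 b, I b & forall t, b (emb a + t *: w) = p.[t].
have [|p q [b Ib bE]|[b Ib bE]|t tP] := @common_root K.
- move=> p q [b Ib bE] [c Ic cE]; exists (fun v => b v + c v); first exact: fidealD.
  by move=> t; rewrite bE cE hornerD.
- exists (fun v => p.[slope w v] * b v); last by move=> t; rewrite bE slopeE // hornerM.
  apply: fidealM => //; have alg := polyf_alg k n.+1.
  apply: polyf_ext (falg_sum alg (index_enum 'I_(size p)) xpredT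
    (fun i : 'I__ => falgZ alg p`_i (falgX alg i (polyf_slope w)))) _ => v.
  by rewrite horner_coef.
- have [F bF] := fideal_poly idI Ib.
  have [||N [pN IN] N1a] := elim_norm w0 idI Gm IG (F := F) (x0 := a).
  + by apply: fideal_ext Ib _.
  + apply/eqP; rewrite -subr_eq0; apply/negPn/negP => /poly_nonroot [t].
    by rewrite hornerD hornerN line_polyE -bF bE subrr eqxx.
  by have := aP N (conj pN IN); rewrite N1a => /eqP; rewrite oner_eq0.
exists (emb a + t *: w) => b Ib; have [F bF] := fideal_poly idI Ib.
rewrite bF -line_polyE; apply: tP; exists b => // s.
by rewrite bF line_polyE.
Qed.

End Nullstellensatz.

(** * Density along local coordinates *)

Section StrongNullstellensatz.
Variable k : numClosedFieldType.

Definition consv n (y : k) (v : 'rV[k]_n) : 'rV[k]_n.+1 :=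
  \row_i (if unlift ord0 i is Some j then v 0 j else y).

Definition tailv n (u : 'rV[k]_n.+1) : 'rV[k]_n := \row_j u 0 (lift ord0 j).

Lemma consvK n y (v : 'rV[k]_n) : tailv (consv y v) = v.
Proof. by apply/rowP => j; rewrite !mxE liftK. Qed.

Lemma clear_denominator n (H : 'rV[k]_n -> k) (P : {mpoly k[n.+1]}) : polyf H ->
  exists N0, forall N, (N0 <= N)%N -> exists2 Q, polyf Q &
    forall v, H v != 0 -> ev P (consv (H v)^-1 v) * H v ^+ N = Q v.
Proof.
have alg := polyf_alg k n.
move=> pH; elim/mpoly_alg_ind: P => [c|i|p q [M pM] [M' qM]|p q [M pM] [M' qM]].
- exists 0%N => N _; exists (fun v => c * H v ^+ N); first exact: falgZ (falgX _ _ _).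
  by move=> v _; rewrite evC.
- case Ei: (unlift ord0 i) => [j|].
    exists 0%N => N _; exists (fun v : 'rV_n => v 0 (j : 'I_n) * H v ^+ N).
      exact: (falgM alg) (@polyfX k _ j) (falgX _ _ _).
    by move=> v _; rewrite evX mxE Ei.
  exists 1%N => -[//|N] _; exists (fun v => H v ^+ N); first exact: falgX.
  by move=> v Hv; rewrite evX mxE Ei exprS mulKf.
- exists (M + M')%N => N MN.
  have [|Q pQ QE] := pM N; first by lia.
  have [|Q' pQ' QE'] := qM N; first by lia.
  exists (fun v => Q v + Q' v); first exact: falgD.
  by move=> v Hv; rewrite evD mulrDl QE ?QE'.
- exists (M + M')%N => N MN.
  have [|Q pQ QE] := pM M; first by lia.
  have [|Q' pQ' QE'] := qM (N - M)%N; first by lia.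
  exists (fun v => Q v * Q' v); first exact: falgM.
  move=> v Hv; rewrite evM -QE // -QE' // -(subnKC (leq_trans (leq_addr _ _) MN)) exprD.
  by rewrite addKn; ring.
Qed.

(** Rabinowitsch's trick: with an extra variable y, the polynomials [g j] and 1 - y H have no common
    zero. Setting y = 1/H in the resulting expression of 1 and clearing powers of [H] gives the
    identity. *)
Lemma strong_nullstellensatz n r (g : 'I_r -> {mpoly k[n]}) (H : {mpoly k[n]}) :
  (forall v, (forall j, ev (g j) v = 0) -> ev H v = 0) ->
  exists N (A : 'I_r -> {mpoly k[n]}), H ^+ N = \sum_j A j * g j.
Proof.
move=> Hg; have alg := polyf_alg k n; have algS := polyf_alg k n.+1.
have pt j : polyf (fun u : 'rV[k]_n.+1 => tailv u 0 j).
  by apply: polyf_ext (@polyfX k _ (lift ord0 j)) _ => u; rewrite mxE.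
pose rel (u : 'rV[k]_n.+1) := 1 - u 0 ord0 * ev H (tailv u).
have prel : polyf rel.
  apply: falgB => //; first exact: (falgC algS).
  by apply: falgM => //; [apply: polyfX | apply: falg_ev].
have pg j : polyf (fun u : 'rV[k]_n.+1 => ev (g j) (tailv u)) by apply: falg_ev.
pose I (a : 'rV[k]_n.+1 -> k) := exists (A : 'I_r -> 'rV[k]_n.+1 -> k) B,
  [/\ forall j, polyf (A j), polyf B &
      forall u, a u = \sum_j A j u * ev (g j) (tailv u) + B u * rel u].
have idI : fideal I.
  split=> [a [A [B [pA pB aE]]]||a b [A [B [pA pB aE]]] [A' [B' [pA' pB' bE]]]|].
  - have /funext -> := aE; apply: falgD => //; last exact: falgM.
    by apply: falg_sum => // j; apply: falgM.
  - exists (fun _ _ => 0), (fun=> 0); split=> [j||u]; try exact: (falgC algS).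
    by rewrite mul0r addr0 big1 // => j _; rewrite mul0r.
  - exists (fun j u => A j u + A' j u), (fun u => B u + B' u).
    split=> [j||u]; try exact: falgD.
    rewrite aE bE mulrDl addrACA -big_split /=; congr (_ + _).
    by apply: eq_bigr => j _; rewrite mulrDl.
  - move=> a b pa [A [B [pA pB bE]]].
    exists (fun j u => a u * A j u), (fun u => a u * B u).
    split=> [j||u]; try exact: falgM.
    rewrite bE mulrDr mulrA mulr_sumr; congr (_ + _).
    by apply: eq_bigr => j _; rewrite mulrA.
have [A [B [pA pB oneE]]] : I (fun=> 1).
  apply: contrapT => N1; have [u uP] := nullstellensatz idI N1.
  have gu j : ev (g j) (tailv u) = 0.
    apply: (uP (fun u => ev (g j) (tailv u))); exists (fun j' _ => (j' == j)%:R), (fun=> 0).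
    split=> [j'||u']; try exact: (falgC algS).
    rewrite mul0r addr0 (bigD1 j) //= eqxx mul1r big1 ?addr0 // => j' /negPf ->.
    by rewrite mul0r.
  have /eqP : rel u = 0.
    apply: (uP rel); exists (fun _ _ => 0), (fun=> 1).
    split=> [j'||u']; try exact: (falgC algS).
    by rewrite mul1r big1 ?add0r // => j' _; rewrite mul0r.
  by rewrite /rel (Hg _ gu) mulr0 subr0 oner_eq0.
have /fin_all_exists [P PA] := pA.
have /fin_all_exists [N NP] := fun j => clear_denominator (P j) (polyf_ev H).
pose M := (\sum_j N j)%N.
have H2 j : exists Q : {mpoly k[n]}, forall v, ev H v != 0 ->
    ev (P j) (consv (ev H v)^-1 v) * ev H v ^+ M = ev Q v.
  have [|Q [F QF] QE] := NP j M; first by rewrite /M (bigD1 j) //= leq_addr.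
  by exists F => v Hv; rewrite -QF QE.
have /fin_all_exists [Q QE] := H2.
(* One factor [H] beyond those that clear the denominators makes both sides vanish where [H] does,
   so that the identity can be checked at each point. *)
exists M.+1, (fun j => H * Q j); apply: mpoly_ext => v.
rewrite ev_exp ev_sum; have [Hv|Hv] := eqVneq (ev H v) 0.
  by rewrite Hv expr0n big1 // => j _; rewrite !evM Hv !mul0r.
have := oneE (consv (ev H v)^-1 v).
rewrite consvK /rel consvK mxE unlift_none mulVf // subrr mulr0 addr0 => E1.
rewrite exprSr -[LHS]mulr1 E1 mulr_sumr; apply: eq_bigr => j _.
by rewrite !evM -QE // PA; ring.
Qed.

End StrongNullstellensatz.

Section LocalCoordinates.
Variable k : numClosedFieldType.

Definition pev n (P : {mpoly k[n]}) (v : 'I_n -> {poly k}) : {poly k} :=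
  mmap (@polyC k) v P.

Lemma pevE n (P : {mpoly k[n]}) v t : (pev P v).[t] = ev P (\row_i (v i).[t]).
Proof.
rewrite /pev; elim/mpoly_alg_ind: P => [c|i|p q IHp IHq|p q IHp IHq].
- by rewrite mmapC evC hornerC.
- by rewrite mmapX mmap1U evX mxE.
- by rewrite mmapD evD hornerD IHp IHq.
- by rewrite rmorphM evM hornerM IHp IHq.
Qed.

Lemma pev_taylor n (P : {mpoly k[n]}) v d e :
  exists r, pev P (fun i => v i + e * d i) =
    pev P v + e * (\sum_i d i * pev P^`M(i) v) + e ^+ 2 * r.
Proof.
rewrite /pev; elim/mpoly_alg_ind: P => [c|i|p q [r rE] [s sE]|p q [r rE] [s sE]].
- exists 0; rewrite !mmapC big1 ?mulr0 ?addr0 // => i _.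
  by rewrite mderivC mmap0 mulr0.
- exists 0; rewrite !mmapX !mmap1U mulr0 addr0 (bigD1 i) //= big1 => [|j ji].
    rewrite mderivX mnm1E eqxx scale1r mmapX.
    by rewrite (_ : (_ - _)%MM = 0%MM) ?mmap11 ?mulr1 ?addr0 //; apply/mnmP => j; rewrite mnmBE mnm0E subnn.
  by rewrite mderivX mnm1E eq_sym (negPf ji) scale0r mmap0 mulr0.
- exists (r + s); rewrite !mmapD rE sE.
  have -> : \sum_i d i * mmap (@polyC k) v (p + q)^`M(i) =
      \sum_i d i * mmap (@polyC k) v p^`M(i) + \sum_i d i * mmap (@polyC k) v q^`M(i).
    by rewrite -big_split; apply: eq_bigr => i _; rewrite mderivD mmapD mulrDr.
  by ring.
- set dp := \sum_i d i * mmap (@polyC k) v p^`M(i) in rE.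
  set dq := \sum_i d i * mmap (@polyC k) v q^`M(i) in sE.
  exists (r * (mmap (@polyC k) v q + e * dq + e ^+ 2 * s) + mmap (@polyC k) v p * s
          + dp * dq + e * (dp * s)).
  rewrite !rmorphM /= rE sE.
  have -> : \sum_i d i * mmap (@polyC k) v (p * q)^`M(i) =
      dp * mmap (@polyC k) v q + mmap (@polyC k) v p * dq.
    rewrite mulr_suml mulr_sumr -big_split; apply: eq_bigr => i _ /=.
    by rewrite mderivM mmapD !rmorphM /=; ring.
  by ring.
Qed.

Lemma polyX_dvd (p : {poly k}) : p.[0] = 0 -> 'X %| p.
Proof. by move=> p0; rewrite -['X]subr0 dvdp_XsubCl; apply/rootP. Qed.

Definition jacobian n r (g : 'I_r -> {mpoly k[n]}) (v : 'rV[k]_n) : 'M[k]_(n, r) :=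
  \matrix_(i, j) ev (g j)^`M(i) v.

Definition select n s (tau : 'I_s -> 'I_n) : 'M[k]_(n, s) :=
  \matrix_(i, l) (i == tau l)%:R.

Lemma mul_select n s (tau : 'I_s -> 'I_n) (v : 'rV[k]_n) :
  v *m select tau = \row_l v 0 (tau l).
Proof.
apply/rowP => l; rewrite !mxE (bigD1 (tau l)) //= mxE eqxx mulr1 big1 ?addr0 // => i /negPf il.
by rewrite mxE il mulr0.
Qed.

(* Newton's method. *)
Lemma formal_arc r s (g : 'I_r -> {mpoly k[r + s]}) (tau : 'I_s -> 'I_(r + s)) v0 (d : 'rV[k]_s) N :
  (forall j, ev (g j) v0 = 0) -> row_mx (jacobian g v0) (select tau) \in unitmx ->
  exists v : 'I_(r + s) -> {poly k},
    [/\ forall i, (v i).[0] = v0 0 i,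
        forall l, v (tau l) = (v0 0 (tau l))%:P + d 0 l *: 'X &
        forall j, 'X^(N.+1) %| pev (g j) v].
Proof.
move=> g0 U; set M := row_mx _ _ in U.
have solve (a : 'rV_r) (b : 'rV_s) : exists de : 'rV[k]_(r + s),
    (forall j, \sum_i de 0 i * ev (g j)^`M(i) v0 = a 0 j) /\
    (forall l, de 0 (tau l) = b 0 l).
  exists (row_mx a b *m invmx M).
  have : row_mx a b *m invmx M *m M = row_mx a b by rewrite mulmxKV.
  rewrite {2}/M mul_mx_row mul_select => /eq_row_mx [ea eb].
  split=> [j|l]; last by have := congr1 (fun m : 'rV_s => m 0 l) eb; rewrite mxE.
  have := congr1 (fun m : 'rV_r => m 0 j) ea; rewrite mxE => <-.
  by apply: eq_bigr => i _; rewrite [jacobian _ _ _ _]mxE.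
have ev_at0 (v : 'I_(r + s) -> {poly k}) P : (forall i, (v i).[0] = v0 0 i) ->
    (pev P v).[0] = ev P v0.
  by move=> v0E; rewrite pevE; congr ev; apply/rowP => i; rewrite mxE v0E.
elim: N => [|N [v [vE vt vg]]].
  have [de [_ det]] := solve 0 d.
  exists (fun i => (v0 0 i)%:P + de 0 i *: 'X); split=> [i|l|j].
  - by rewrite !hornerE ?mulr0 ?addr0.
  - by rewrite det.
  rewrite expr1; apply: polyX_dvd.
  by rewrite ev_at0 // => i; rewrite !hornerE ?mulr0 ?addr0.
have /fin_all_exists [q qE] : forall j, exists q, pev (g j) v = q * 'X^(N.+1).
  by move=> j; apply/dvdpP.
have [de [deg det]] := solve (\row_j - (q j).[0]) 0.
exists (fun i => v i + 'X^(N.+1) * (de 0 i)%:P); split=> [i|l|j].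
- by rewrite hornerD hornerM hornerXn expr0n mul0r addr0.
- by rewrite vt det mxE mulr0 addr0.
have [w ->] := pev_taylor (g j) v (fun i => (de 0 i)%:P) 'X^(N.+1).
rewrite qE [q j * _]mulrC -mulrDr expr2 -mulrA -mulrDr exprSr.
apply: dvdp_mul => //; apply: polyX_dvd.
rewrite !hornerD hornerM hornerXn expr0n mul0r addr0 horner_sum.
rewrite (eq_bigr (fun i => de 0 i * ev (g j)^`M(i) v0)) => [|i _].
  by rewrite deg mxE addrN.
by rewrite hornerM hornerC ev_at0.
Qed.

(** Without such a point, a power of h c would lie in the ideal of the [g j]. Along an arc from [v0]
    whose selected coordinates move linearly towards a point where [c] is nonzero, that power would
    be divisible by high powers of ['X], although [h] is nonzero at the origin of the arc and [c]
    becomes a fixed nonzero polynomial. *)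
Lemma local_coordinate_dense r s (g : 'I_r -> {mpoly k[r + s]})
    (tau : 'I_s -> 'I_(r + s)) v0 h (c : {mpoly k[s]}) :
  (forall j, ev (g j) v0 = 0) -> row_mx (jacobian g v0) (select tau) \in unitmx ->
  ev h v0 != 0 -> c != 0 ->
  exists v, [/\ forall j, ev (g j) v = 0, ev h v != 0 &
                ev c (\row_l v 0 (tau l)) != 0].
Proof.
move=> g0 U h0 c0; apply: contrapT => none.
have [t1 ct1] := mpoly_nonroot c0.
pose d : 'rV[k]_s := t1 - \row_l v0 0 (tau l).
have [C CE] : polyf (fun v : 'rV[k]_(r + s) => ev c (\row_l v 0 (tau l))).
  by apply: falg_ev => [|l]; [apply: polyf_alg | apply: polyf_ext (@polyfX k _ (tau l)) _ => v; rewrite mxE].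
have [N [A HN]] : exists N (A : 'I_r -> {mpoly k[r + s]}), (h * C) ^+ N = \sum_j A j * g j.
  apply: strong_nullstellensatz => v gv; apply/eqP; apply: contrapT => /negP.
  by rewrite evM mulf_eq0 negb_or -CE => /andP [hv cv]; apply: none; exists v.
pose Cc := pev c (fun l => (v0 0 (tau l))%:P + d 0 l *: 'X).
have Cc0 : Cc != 0.
  apply: contraNneq ct1 => Cc0; have := pevE c (fun l => (v0 0 (tau l))%:P + d 0 l *: 'X) 1.
  rewrite -/Cc Cc0 horner0 => /esym/eqP; congr (_ == 0); congr ev.
  by apply/rowP => l; rewrite mxE !hornerE /d !mxE; ring.
(* The precision exceeds the degree of [Cc ^+ N], which depends only on the prescribed linear motion
   and not on the arc. *)
have [v [vE vt vg]] := formal_arc d (N * size Cc) g0 U.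
have pevC : pev C v = Cc.
  apply: poly_ext => t; rewrite !pevE -CE; congr ev.
  by apply/rowP => l; rewrite [LHS]mxE [X in X = _]mxE vt [RHS]mxE.
have : 'X^((N * size Cc).+1) %| (pev h v * Cc) ^+ N.
  have -> : pev h v * Cc = pev (h * C) v by rewrite -pevC /pev rmorphM.
  rewrite /pev -rmorphXn /= HN raddf_sum /=.
  elim/big_ind: _ => [||j _]; [exact: dvdp0 | exact: dvdp_add |].
  by rewrite rmorphM /=; apply: dvdp_mull; exact: (vg j).
rewrite exprMn Gauss_dvdpr; last first.
  apply: coprimep_expl; apply: coprimep_expr.
  rewrite coprimep_sym -['X]subr0 -polyC0 coprimep_XsubC.
  have v0_row : (\row_i (v i).[0]) = v0 by apply/rowP => i; rewrite mxE vE.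
  by rewrite /root pevE v0_row.
move/dvdp_leq => /(_ (expf_neq0 _ Cc0)).
rewrite size_polyXn; have := size_poly_exp_leq Cc N.
by have := Cc0; rewrite -size_poly_gt0; move: (size _) (size Cc) => a b; nia.
Qed.

End LocalCoordinates.

Section Completion.
Variable F : fieldType.

Lemma unitmx_inj n (M : 'M[F]_n) : (forall u : 'rV_n, u *m M = 0 -> u = 0) -> M \in unitmx.
Proof.
move=> Minj; rewrite -row_free_unit -kermx_eq0; apply/rowV0P => v /sub_kermxP.
exact: Minj.
Qed.

(** Choose r independent rows of [D] and let [tau] list the other indices: if [u] vanishes there,
    [u *m D = 0] is a relation between independent rows. *)
Lemma select_complement r s (D : 'M[F]_(r + s, r)) : \rank D = r ->
  exists tau : 'I_s -> 'I_(r + s), forall u : 'rV_(r + s),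
    u *m D = 0 -> (forall l, u 0 (tau l) = 0) -> u = 0.
Proof.
move=> rD; have fD : row_full D by rewrite /row_full rD.
pose f := fullrankfun fD.
pose S := ~: (f @: predT).
have cS : #|S| = s.
  have := cardsC (f @: predT); rewrite -/S card_imset; last exact: fullrankfun_inj.
  have -> : #|(predT : pred 'I_r)| = r by rewrite -[RHS]card_ord; apply: eq_card.
  by rewrite card_ord; lia.
exists (fun l => enum_val (cast_ord (esym cS) l)) => u uD ut.
have u_out i : i \in S -> u 0 i = 0.
  move=> iS; rewrite -(ut (cast_ord cS (enum_rank_in iS i))).
  by rewrite cast_ordK enum_rankK_in.
have uf : (\row_j u 0 (f j)) *m rowsub f D = 0.
  rewrite -[RHS]uD; apply/rowP => j; rewrite !mxE [RHS](bigID (mem S)) /=.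
  rewrite [X in _ = X + _]big1 ?add0r => [|i iS]; last by rewrite u_out ?mul0r.
  rewrite [RHS](eq_bigl (mem (f @: predT))) => [|i]; last by rewrite !inE negbK.
  rewrite [RHS]big_imset /=; last by move=> i i' _ _; apply: fullrankfun_inj.
  by apply: eq_bigr => i _; rewrite !mxE.
have uf0 : \row_j u 0 (f j) = 0.
  apply: (row_free_inj (A := rowsub f D)); last by rewrite uf mul0mx.
  by rewrite /row_free; have := fullrowsub_unit fD; rewrite -row_free_unit.
apply/rowP => i; rewrite mxE; have [|] := boolP (i \in S); first exact: u_out.
rewrite inE negbK => /imsetP [j _ ->].
by have /rowP/(_ j) := uf0; rewrite !mxE.
Qed.

End Completion.

Section SmoothDense.
Variable k : numClosedFieldType.

(** Which [s] coordinates are local parameters depends on [v0], whence one polynomial [c tau] for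
    each choice. *)
Lemma smooth_dense r s (g : 'I_r -> {mpoly k[r + s]}) v0 h
    (c : ('I_s -> 'I_(r + s)) -> {mpoly k[s]}) :
  (forall j, ev (g j) v0 = 0) -> \rank (jacobian g v0) = r ->
  ev h v0 != 0 -> (forall tau, c tau != 0) ->
  exists tau v, [/\ forall j, ev (g j) v = 0, ev h v != 0 &
                ev (c tau) (\row_l v 0 (tau l)) != 0].
Proof.
move=> g0 rJ h0 c0; have [tau tauP] := select_complement rJ.
exists tau; apply: (local_coordinate_dense (v0 := v0)) => //.
apply: unitmx_inj => u uM; apply: tauP => [|l].
  by have := congr1 lsubmx uM; rewrite mul_mx_row row_mxKl linear0.
have := congr1 rsubmx uM; rewrite mul_mx_row row_mxKr linear0 mul_select.
by move/rowP/(_ l); rewrite !mxE.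
Qed.

(** Reads the differential off an expansion to first order, so that derivatives of polynomials known
    only by their values never have to be written out. *)
Lemma jacobian_direction r n (g : 'I_r -> {mpoly k[n]}) (v0 e : 'rV[k]_n) (d : 'rV[k]_r)
    (q : 'I_r -> {poly k}) :
  (forall j t, ev (g j) (v0 + t *: e) = ev (g j) v0 + t * d 0 j + t ^+ 2 * (q j).[t]) ->
  e *m jacobian g v0 = d.
Proof.
move=> gq; apply/rowP => j; rewrite mxE.
have [r' rE] := pev_taylor (g j) (fun i => (v0 0 i)%:P) (fun i => (e 0 i)%:P) 'X.
pose D := \sum_i (e 0 i)%:P * pev (g j)^`M(i) (fun i => (v0 0 i)%:P).
have row0 t : \row_i ((v0 0 i)%:P).[t] = v0 by apply/rowP => i; rewrite mxE hornerC.
have DE : (D.[0] - d 0 j) = 0.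
  have : (ev (g j) v0)%:P + 'X * D + 'X^2 * r' =
         (ev (g j) v0)%:P + 'X * (d 0 j)%:P + 'X^2 * q j.
    apply: poly_ext => t; have := congr1 (fun p => p.[t]) rE; rewrite /= pevE.
    rewrite -/D !hornerE pevE row0 => <-.
    rewrite -gq; congr ev; apply/rowP => i; rewrite !mxE !hornerE //.
  move/(congr1 (fun p : {poly k} => p`_1)).
  rewrite !coefD !coefC /= !add0r !coefXM /= coefXnM coefXnM /= !addr0.
  by rewrite horner_coef0 coefC eqxx => ->; rewrite subrr.
move/eqP: DE; rewrite subr_eq0 => /eqP <-; rewrite /D horner_sum.
by apply: eq_bigr => i _; rewrite hornerM hornerC pevE row0 mxE.
Qed.

End SmoothDense.

(** * Cubic forms and flags *)

Section Polarization.
Variables (k : numClosedFieldType) (n : nat).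
Implicit Types (f : {mpoly k[n]}) (x y z : 'rV[k]_n).

Definition pol f x y z : k :=
  (ev f (x + y + z) - ev f (x + y) - ev f (x + z) - ev f (y + z)
   + ev f x + ev f y + ev f z) / 6%:R.

Definition deriv_along x y (p : {mpoly k[n]}) := \sum_i ev p^`M(i) x * y 0 i.

Lemma mnm_split (m : 'X_{1..n}) d : mdeg m = d.+1 ->
  exists i m', m = (U_(i) + m')%MM /\ mdeg m' = d.
Proof.
move=> md; have /existsP [i mi] : [exists i, m i != 0%N].
  rewrite -negb_forall; apply/negP => /forallP m0.
  by move: md; rewrite mdegE big1 // => i _; apply/eqP.
have mE : m = (U_(i) + (m - U_(i)))%MM by rewrite addmC submK // lep1mP.
exists i, (m - U_(i))%MM; split=> //.
by move: md; rewrite {1}mE mdegD mdeg1 => -[].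
Qed.

Lemma mnm3_split (m : 'X_{1..n}) : mdeg m = 3%N ->
  exists t : 'I_n * 'I_n * 'I_n, m = (U_(t.1.1) + U_(t.1.2) + U_(t.2))%MM.
Proof.
move=> /mnm_split [i [m1 [-> /mnm_split [j [m2 [-> /mnm_split [l [m3 [-> m30]]]]]]]]].
exists (i, j, l); move/eqP: m30; rewrite mdeg_eq0 => /eqP ->.
by rewrite addm0 addmA.
Qed.

(** Identities between polar forms are linear in the cubic, so it suffices to check them on products
    of three variables, where [ring] decides. *)
Lemma cubic_ind (P : {mpoly k[n]} -> Prop) : P 0 ->
  (forall f g, P f -> P g -> P (f + g)) ->
  (forall c i j l, P (c *: ('X_i * 'X_j * 'X_l))) ->
  forall f, f \is 3.-homog -> P f.
Proof.
move=> P0 PD Pm f /dhomogP f3; rewrite [f]mpolyE big_seq.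
elim/big_ind: _ => [||m mf] //.
have [[[i j] l] ->] := mnm3_split (f3 m mf).
by rewrite !mpolyXD; apply: Pm.
Qed.

Lemma natr6_neq0 : 6%:R != 0 :> k. Proof. by rewrite pnatr_eq0. Qed.

Lemma pol0 x y z : pol 0 x y z = 0.
Proof. by rewrite /pol !ev0 !subr0 !addr0 mul0r. Qed.

Lemma polD f g x y z : pol (f + g) x y z = pol f x y z + pol g x y z.
Proof. by rewrite /pol !evD -mulrDl; congr (_ / _); ring. Qed.

Lemma polZ c f x y z : pol (c *: f) x y z = c * pol f x y z.
Proof. by rewrite /pol !evZ mulrA; congr (_ / _); ring. Qed.

Lemma polM3 i j l x y z : pol ('X_i * 'X_j * 'X_l) x y z =
  (x 0 i * y 0 j * z 0 l + x 0 i * z 0 j * y 0 l + y 0 i * x 0 j * z 0 l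
   + y 0 i * z 0 j * x 0 l + z 0 i * x 0 j * y 0 l + z 0 i * y 0 j * x 0 l) / 6%:R.
Proof. by rewrite /pol !evM !evX !mxE; congr (_ / _); ring. Qed.

Lemma polC12 f x y z : pol f x y z = pol f y x z.
Proof. by rewrite /pol [y + x]addrC; congr (_ / _); ring. Qed.

Lemma polC23 f x y z : pol f x y z = pol f x z y.
Proof. by rewrite /pol -!addrA [z + y]addrC; congr (_ / _); ring. Qed.

Lemma pol_linear f c x x' y z : f \is 3.-homog ->
  pol f (c *: x + x') y z = c * pol f x y z + pol f x' y z.
Proof.
elim/cubic_ind => [|g h IHg IHh|d i j l]; first by rewrite !pol0 mulr0 addr0.
  by rewrite !polD IHg IHh; ring.
by rewrite !polZ !polM3 !mxE; ring.
Qed.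

Lemma pol_diag f x : f \is 3.-homog -> pol f x x x = ev f x.
Proof.
elim/cubic_ind => [|g h IHg IHh|d i j l]; first by rewrite pol0 ev0.
  by rewrite polD IHg IHh evD.
rewrite polZ polM3 evZ !evM !evX; congr (_ * _).
by rewrite -[RHS](mulfK natr6_neq0); congr (_ / _); ring.
Qed.

Lemma deriv_alongM x y p q : deriv_along x y (p * q) =
  deriv_along x y p * ev q x + ev p x * deriv_along x y q.
Proof.
rewrite /deriv_along mulr_suml mulr_sumr -big_split; apply: eq_bigr => i _ /=.
by rewrite mderivM evD !evM; ring.
Qed.

Lemma deriv_alongX x y i : deriv_along x y 'X_i = y 0 i.
Proof.
rewrite /deriv_along (bigD1 i) //= mderivX mnm1E eqxx scale1r evXm big1 => [|j _].
  rewrite mul1r big1 ?addr0 // => j ji; rewrite mderivX mnm1E eq_sym (negPf ji).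
  by rewrite scale0r ev0 mul0r.
by rewrite mnmBE subnn expr0.
Qed.

Lemma pol_deriv f x y : f \is 3.-homog ->
  \sum_i ev f^`M(i) x * y 0 i = 3%:R * pol f x x y.
Proof.
rewrite -/(deriv_along x y f).
elim/cubic_ind => [|g h IHg IHh|d i j l].
- by rewrite pol0 mulr0 /deriv_along big1 // => i _; rewrite mderiv0 ev0 mul0r.
- rewrite polD mulrDr -IHg -IHh /deriv_along -big_split /=.
  by apply: eq_bigr => i _; rewrite mderivD evD mulrDl.
have -> : deriv_along x y (d *: ('X_i * 'X_j * 'X_l)) =
    d * deriv_along x y ('X_i * 'X_j * 'X_l).
  by rewrite /deriv_along mulr_sumr; apply: eq_bigr => a _; rewrite mderivZ evZ mulrA.
rewrite polZ mulrCA; congr (_ * _); rewrite !deriv_alongM !deriv_alongX polM3 evM !evX.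
by rewrite mulrA -[LHS](mulfK natr6_neq0); congr (_ / _); ring.
Qed.

End Polarization.

Section Trilinear.
Variables (k : numClosedFieldType) (n : nat).
Local Notation V := 'rV[k]_n.

Record symtri (T : V -> V -> V -> k) : Prop := SymTri {
  triC12 : forall x y z, T x y z = T y x z;
  triC23 : forall x y z, T x y z = T x z y;
  tri_lin : forall c x x' y z, T (c *: x + x') y z = c * T x y z + T x' y z }.

Lemma pol_symtri (f : {mpoly k[n]}) : f \is 3.-homog -> symtri (pol f).
Proof.
by move=> f3; split=> *; [exact: polC12 | exact: polC23 | exact: pol_linear].
Qed.

Variables (T : V -> V -> V -> k) (TT : symtri T).

Lemma triC13 x y z : T x y z = T z y x.
Proof. by rewrite (triC12 TT x) (triC23 TT y) (triC12 TT y). Qed.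

Lemma triD1 x x' y z : T (x + x') y z = T x y z + T x' y z.
Proof. by have := tri_lin TT 1 x x' y z; rewrite scale1r mul1r. Qed.
Lemma tri01 y z : T 0 y z = 0.
Proof. by apply: (addIr (T 0 y z)); rewrite -triD1 !add0r. Qed.
Lemma triZ1 c x y z : T (c *: x) y z = c * T x y z.
Proof. by rewrite -[c *: x]addr0 (tri_lin TT) tri01 addr0. Qed.
Lemma triD2 x y y' z : T x (y + y') z = T x y z + T x y' z.
Proof. by rewrite !(triC12 TT x) triD1. Qed.
Lemma triZ2 c x y z : T x (c *: y) z = c * T x y z.
Proof. by rewrite !(triC12 TT x) triZ1. Qed.
Lemma triD3 x y z z' : T x y (z + z') = T x y z + T x y z'.
Proof. by rewrite !(triC23 TT x y) triD2. Qed.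
Lemma triZ3 c x y z : T x y (c *: z) = c * T x y z.
Proof. by rewrite !(triC23 TT x y) triZ2. Qed.
Lemma tri02 x z : T x 0 z = 0. Proof. by rewrite (triC12 TT) tri01. Qed.
Lemma tri03 x y : T x y 0 = 0. Proof. by rewrite (triC23 TT) tri02. Qed.
Lemma triN1 x y z : T (- x) y z = - T x y z.
Proof. by rewrite -scaleN1r triZ1 mulN1r. Qed.
Lemma triN2 x y z : T x (- y) z = - T x y z.
Proof. by rewrite -scaleN1r triZ2 mulN1r. Qed.
Lemma triN3 x y z : T x y (- z) = - T x y z.
Proof. by rewrite -scaleN1r triZ3 mulN1r. Qed.

Definition triE := (triD1, triD2, triD3, triZ1, triZ2, triZ3, triN1, triN2, triN3).

Lemma tri_sum3 I (r : seq I) (P : pred I) x y F :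
  T x y (\sum_(i <- r | P i) F i) = \sum_(i <- r | P i) T x y (F i).
Proof. by elim/big_rec2: _ => [|i a b _ <-]; rewrite ?tri03 ?triD3. Qed.

Definition covec (x y : V) : V := \row_j T x y (delta_mx 0 j).

Lemma covecE x y z : T x y z = (z *m (covec x y)^T) 0 0.
Proof.
rewrite [z in LHS]row_sum_delta tri_sum3 mxE; apply: eq_bigr => j _.
by rewrite triZ3 !mxE.
Qed.

End Trilinear.

Section Triples.
Variables (F : fieldType) (n : nat).
Implicit Types a b c v : 'rV[F]_n.

Definition ind3 a b c := forall r s t : F, r *: a + s *: b + t *: c = 0 ->
  [/\ r = 0, s = 0 & t = 0].

Definition ind2 a b := forall r s : F, r *: a + s *: b = 0 -> r = 0 /\ s = 0.

Definition mx3 a b c : 'M[F]_(3, n) := \matrix_(i < 3) nth 0 [:: a; b; c] i.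

Definition rv3 (r s t : F) : 'rV[F]_3 := \row_i nth 0 [:: r; s; t] i.

Lemma mul_mx3 (D : 'rV_3) a b c :
  D *m mx3 a b c = D 0 0 *: a + D 0 1 *: b + D 0 2%:R *: c.
Proof.
rewrite mulmx_sum_row !big_ord_recl big_ord0 addr0 addrA !rowK /=.
by congr (_ *: _ + _ *: _ + _ *: _); congr (D _ _); apply: val_inj.
Qed.

Lemma mul_rv3 r s t a b c : rv3 r s t *m mx3 a b c = r *: a + s *: b + t *: c.
Proof. by rewrite mul_mx3 !mxE. Qed.

Lemma ind3_row_free a b c : ind3 a b c -> row_free (mx3 a b c).
Proof.
move=> abc; rewrite -kermx_eq0; apply/rowV0P => v /sub_kermxP.
rewrite mul_mx3 => /abc [v0 v1 v2]; apply/rowP => i; rewrite mxE.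
case: i => -[|[|[|//]]] lti.
- by rewrite -[RHS]v0; congr (v _ _); apply: val_inj.
- by rewrite -[RHS]v1; congr (v _ _); apply: val_inj.
- by rewrite -[RHS]v2; congr (v _ _); apply: val_inj.
Qed.

Lemma ind3_12 a b c : ind3 a b c -> ind2 a b.
Proof.
by move=> abc r s e; have [] := abc r s 0; rewrite ?scale0r ?addr0.
Qed.

Lemma ind3_neq0 a b c : ind3 a b c -> a != 0.
Proof.
move=> abc; apply/eqP => a0; have [|/eqP] := abc 1 0 0; last by rewrite oner_eq0.
by rewrite a0 scaler0 !scale0r !addr0.
Qed.

Lemma mul_mx3_tr v a b c i : (v *m (mx3 a b c)^T) 0 i = (v *m (nth 0 [:: a; b; c] i)^T) 0 0.
Proof. by rewrite !mxE; apply: eq_bigr => j _; rewrite !mxE. Qed.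

(** The kernel of [A^T] has dimension 6 - 3, which is the rank of [B]. *)
Lemma ker3_span (A B : 'M[F]_(3, 6)) : row_free A -> row_free B -> B *m A^T = 0 ->
  forall v : 'rV_6, v *m A^T = 0 -> exists D, v = D *m B.
Proof.
move=> fA fB BA v vA; apply/submxP.
have sBk : (B <= kermx A^T)%MS by apply/sub_kermxP.
have : (kermx A^T <= B)%MS.
  rewrite -(geq_leqif (mxrank_leqif_sup sBk)) mxrank_ker mxrank_tr.
  by rewrite (eqP fA) (eqP fB).
by apply: submx_trans; apply/sub_kermxP.
Qed.

End Triples.

Section Spans.
Variables (F : fieldType) (n : nat).
Implicit Types a b c v : 'rV[F]_n.

Lemma mem_span2 a b v : reflect (exists r s, v = r *: a + s *: b) (v \in <<[:: a; b]>>%VS).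
Proof.
rewrite !span_cons span_nil addv0; apply: (iffP memv_addP).
  by case=> _ /vlineP [r ->] [_ /vlineP [s ->] ->]; exists r, s.
case=> r [s ->]; exists (r *: a); rewrite ?memvZ ?memv_line //.
by exists (s *: b); rewrite ?memvZ ?memv_line.
Qed.

Lemma mem_span3 a b c v :
  reflect (exists r s t, v = r *: a + s *: b + t *: c) (v \in <<[:: a; b; c]>>%VS).
Proof.
rewrite span_cons; apply: (iffP memv_addP).
  case=> _ /vlineP [r ->] [_ /mem_span2 [s [t ->]] ->].
  by exists r, s, t; rewrite addrA.
case=> r [s [t ->]]; exists (r *: a); rewrite ?memvZ ?memv_line //.
by exists (s *: b + t *: c); rewrite ?addrA //; apply/mem_span2; exists s, t.
Qed.

Lemma ind2_free a b : ind2 a b <-> free [:: a; b].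
Proof.
split=> [ab|fab r s e].
  apply/(@freeP _ _ _ [tuple a; b]) => d; rewrite !big_ord_recl big_ord0 addr0 /=.
  move=> /ab [d0 d1] i; case: i => -[|[|//]] lti.
    by rewrite -[RHS]d0; congr d; apply: val_inj.
  by rewrite -[RHS]d1; congr d; apply: val_inj.
have /(@freeP _ _ _ [tuple a; b]) H := fab.
have := H (fun i : 'I_2 => if i == 0 :> nat then r else s).
rewrite !big_ord_recl big_ord0 addr0 /= => /(_ e) d0.
by split; [apply: (d0 0) | apply: (d0 1)].
Qed.

Lemma ind3_free a b c : ind3 a b c -> free [:: a; b; c].
Proof.
move=> abc; apply/(@freeP _ _ _ [tuple a; b; c]) => d.
rewrite !big_ord_recl big_ord0 addr0 /= addrA.
move=> /abc [d0 d1 d2] i; case: i => -[|[|[|//]]] lti.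
- by rewrite -[RHS]d0; congr d; apply: val_inj.
- by rewrite -[RHS]d1; congr d; apply: val_inj.
- by rewrite -[RHS]d2; congr d; apply: val_inj.
Qed.

Lemma dim_span2 a b : ind2 a b -> \dim <<[:: a; b]>>%VS = 2.
Proof. by move/ind2_free; rewrite /free => /eqP. Qed.

Lemma dim_span3 a b c : ind3 a b c -> \dim <<[:: a; b; c]>>%VS = 3.
Proof. by move/ind3_free; rewrite /free => /eqP. Qed.

End Spans.

Section Flags.
Variable k : numClosedFieldType.
Local Notation V := 'rV[k]_6.
Implicit Types (T : V -> V -> V -> k) (x y z u v w : V).

(* The line [<x, y>] lies on the cubic [T x x x = 0], the plane [<x, y, z>] is
   tangent along it, and [x] lies on the residual line. *)
Record flag T x y z : Prop := Flag {
  flag_ind : ind3 x y z;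
  flag_line : [/\ T x x x = 0, T x x y = 0, T x y y = 0 & T y y y = 0];
  flag_plane : [/\ T x x z = 0, T x y z = 0, T y y z = 0 & T x z z = 0] }.

(** The first condition makes the residual line different from [<x, y>], so that the two meet in [x]
    alone. The second makes the tangent plane unique: the line is of the first type. *)
Definition good T x y z :=
  T y z z != 0 /\ ind3 (covec T x x) (covec T x y) (covec T y y).

Definition good_flag T x y z := flag T x y z /\ good T x y z.

Variables (T : V -> V -> V -> k) (TT : symtri T).

Lemma covecD2 x y y' : covec T x (y + y') = covec T x y + covec T x y'.
Proof. by apply/rowP => j; rewrite !mxE (triE TT). Qed.
Lemma covecZ2 c x y : covec T x (c *: y) = c *: covec T x y.
Proof. by apply/rowP => j; rewrite !mxE (triE TT). Qed.
Lemma covecC x y : covec T x y = covec T y x.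
Proof. by apply/rowP => j; rewrite !mxE (triC12 TT). Qed.
Lemma covecD1 x x' y : covec T (x + x') y = covec T x y + covec T x' y.
Proof. by rewrite covecC covecD2 ![covec T y _]covecC. Qed.
Lemma covecZ1 c x y : covec T (c *: x) y = c *: covec T x y.
Proof. by rewrite covecC covecZ2 covecC. Qed.

Lemma flag_change x y z a b c d e g : a != 0 -> b != 0 -> c != 0 ->
  flag T x y z -> flag T (a *: x) (b *: y + d *: x) (c *: z + e *: y + g *: x).
Proof.
move=> a0 b0 c0 [ind [h1 h2 h3 h4] [h5 h6 h7 h8]].
have xxz := h5; have C1 := triC12 TT; have C2 := triC23 TT.
have p1 : T x y x = 0 by rewrite C2.
have p2 : T y x x = 0 by rewrite C1 C2.
have p3 : T y x y = 0 by rewrite C1.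
have p4 : T y y x = 0 by rewrite C2 C1.
have p5 : T x z x = 0 by rewrite C2.
have p6 : T z x x = 0 by rewrite C1 C2.
have p7 : T x z y = 0 by rewrite C2.
have p8 : T y x z = 0 by rewrite C1.
have p9 : T y z x = 0 by rewrite C2 C1.
have p10 : T z x y = 0 by rewrite C1 C2.
have p11 : T z y x = 0 by rewrite C2 C1 C2.
have p12 : T y z y = 0 by rewrite C2.
have p13 : T z y y = 0 by rewrite C1 C2.
have p14 : T z x z = 0 by rewrite C1.
have p15 : T z z x = 0 by rewrite C2 C1.
split.
- move=> r s t E; have := ind (r * a + s * d + t * g) (s * b + t * e) (t * c).
  case=> [|e1 e2 /eqP].
    by rewrite -[RHS]E; apply/rowP => j; rewrite !mxE; ring.
  rewrite mulf_eq0 (negPf c0) orbF => /eqP t0; move: e1 e2; rewrite t0 !mul0r !addr0.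
  move=> e1 /eqP; rewrite mulf_eq0 (negPf b0) orbF => /eqP s0; move: e1.
  by rewrite s0 mul0r addr0 => /eqP; rewrite mulf_eq0 (negPf a0) orbF => /eqP ->.
- by split; rewrite !(triE TT) ?h1 ?h2 ?h3 ?h4 ?p1 ?p2 ?p3 ?p4; ring.
- by split; rewrite !(triE TT) ?h1 ?h2 ?h3 ?h4 ?h5 ?h6 ?h7 ?h8 ?p1 ?p2 ?p3 ?p4
    ?p5 ?p6 ?p7 ?p8 ?p9 ?p10 ?p11 ?p12 ?p13 ?p14 ?p15; ring.
Qed.

Lemma good_change x y z a b c d e g : a != 0 -> b != 0 -> c != 0 ->
  flag T x y z -> good T x y z ->
  good T (a *: x) (b *: y + d *: x) (c *: z + e *: y + g *: x).
Proof.
move=> a0 b0 c0 [ind [h1 h2 h3 h4] [h5 h6 h7 h8]] [yzz cov].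
have C1 := triC12 TT; have C2 := triC23 TT.
have p1 : T x y x = 0 by rewrite C2.
have p4 : T y y x = 0 by rewrite C2 C1.
have p5 : T x z x = 0 by rewrite C2.
have p7 : T x z y = 0 by rewrite C2.
have p9 : T y z x = 0 by rewrite C2 C1.
have p3 : T y x y = 0 by rewrite C1.
have p2 : T y x x = 0 by rewrite C1 C2.
have p8 : T y x z = 0 by rewrite C1.
have p12 : T y z y = 0 by rewrite C2.
split.
  have -> : T (b *: y + d *: x) (c *: z + e *: y + g *: x) (c *: z + e *: y + g *: x) =
      b * c ^+ 2 * T y z z.
    by rewrite !(triE TT) ?h1 ?h2 ?h3 ?h4 ?h5 ?h6 ?h7 ?h8 ?p1 ?p2 ?p3 ?p4 ?p5 ?p7 ?p8 ?p9 ?p12; ring.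
  by rewrite !mulf_neq0 ?expf_neq0.
move=> r s t; rewrite !(covecD1, covecD2, covecZ1, covecZ2) [covec T y x]covecC.
set X := covec T x x; set Y := covec T x y; set Z := covec T y y => E.
have := cov (r * a ^+ 2 + s * (a * d) + t * d ^+ 2) (s * (a * b) + t * (2 * (b * d))) (t * b ^+ 2).
case=> [|e1 e2 /eqP].
  by rewrite -[RHS]E; apply/rowP => j; rewrite !mxE -/(covec T x x); ring.
rewrite mulf_eq0 expf_eq0 (negPf b0) /= orbF => /eqP t0; move: e1 e2; rewrite t0 !mul0r !addr0.
move=> e1 /eqP; rewrite !mulf_eq0 (negPf b0) (negPf a0) !orbF => /eqP s0; move: e1.
by rewrite s0 mul0r addr0 => /eqP; rewrite mulf_eq0 expf_eq0 (negPf a0) /= orbF => /eqP ->.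
Qed.

Lemma flag_ker x y z w : flag T x y z -> ind3 (covec T x x) (covec T x y) (covec T y y) ->
  T x x w = 0 -> T x y w = 0 -> T y y w = 0 ->
  exists r s t, w = r *: x + s *: y + t *: z.
Proof.
move=> [ind [h1 h2 h3 h4] [h5 h6 h7 h8]] cov w1 w2 w3.
have C1 := triC12 TT; have C2 := triC23 TT.
have [||D ->] := ker3_span (ind3_row_free cov) (ind3_row_free ind) _ (v := w).
- apply/row_matrixP => i; rewrite row_mul row0; apply/rowP => j.
  rewrite mul_mx3_tr [RHS]mxE rowK.
  by case: i => -[|[|[|//]]] lti; case: j => -[|[|[|//]]] ltj /=;
    rewrite -(covecE TT) // ?(C2 x y x) // C2 C1.
- by apply/rowP => j; rewrite mul_mx3_tr [RHS]mxE; case: j => -[|[|[|//]]] ltj /=;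
    rewrite -(covecE TT).
by rewrite mul_mx3; exists (D 0 0), (D 0 1), (D 0 2%:R).
Qed.

End Flags.

Section Flags2.
Variable k : numClosedFieldType.
Local Notation V := 'rV[k]_6.
Implicit Types (x y z u v w : V).
Variables (T : V -> V -> V -> k) (TT : symtri T).

Lemma kernel_outside (c1 c2 c3 u v : V) :
  exists z, [/\ z *m c1^T = 0, z *m c2^T = 0, z *m c3^T = 0 &
                forall r s, z != r *: u + s *: v].
Proof.
pose A := (mx3 c1 c2 c3)^T; pose B := col_mx u v.
have : ~~ (kermx A <= B)%MS.
  apply/negP => /mxrankS; rewrite mxrank_ker => rk.
  have := leq_trans rk (rank_leq_row B); have := rank_leq_col A.
  by move: (\rank A) => r; lia.
case/row_subPn => i NzB; exists (row i (kermx A)); set z := row i _ in NzB *.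
have zA : z *m A = 0 by apply/sub_kermxP; apply: row_sub.
have zc j : z *m (nth 0 [:: c1; c2; c3] (j : 'I_3))^T = 0.
  apply/rowP => l; rewrite ord1 -mul_mx3_tr -/A zA; by rewrite !mxE.
split; [exact: (zc 0)|exact: (zc 1)|exact: (zc 2%:R)|move=> r s].
apply: contraNneq NzB => ->; apply/submxP; exists (row_mx r%:M s%:M).
by rewrite mul_row_col !mul_scalar_mx.
Qed.

Lemma ind3_extend u v z : ind2 u v -> (forall r s, z != r *: u + s *: v) -> ind3 u v z.
Proof.
move=> uv Nz r s t E; have [t0|t0] := eqVneq t 0.
  by move: E; rewrite t0 scale0r addr0 => /uv [-> ->].
have /eqP[] := Nz (- (r / t)) (- (s / t)).
apply: (scalerI t0); rewrite scalerDr !scalerA !mulrN.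
rewrite ![t * (_ / t)]mulrC !divfK // !scaleNr -opprD.
by apply/eqP; rewrite -addr_eq0 addrC E.
Qed.

Lemma ind3_basis_change u v z a b c d : a * d - b * c != 0 -> ind3 u v z ->
  ind3 (a *: u + b *: v) (c *: u + d *: v) z.
Proof.
move=> D0 uvz r s t E.
have [|e1 e2 ->] := uvz (r * a + s * c) (r * b + s * d) t.
  by rewrite -[RHS]E; apply/rowP => j; rewrite !mxE; ring.
have r0 : r * (a * d - b * c) = 0.
  have -> : r * (a * d - b * c) = d * (r * a + s * c) - c * (r * b + s * d) by ring.
  by rewrite e1 e2; ring.
have s0 : s * (a * d - b * c) = 0.
  have -> : s * (a * d - b * c) = a * (r * b + s * d) - b * (r * a + s * c) by ring.
  by rewrite e1 e2; ring.
by move/eqP: r0; move/eqP: s0; rewrite !mulf_eq0 (negPf D0) !orbF => /eqP-> /eqP->.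
Qed.

(** Three linear equations in dimension 6 leave a vector [z] off the line and tangent along it. The
    first vector of the flag is then the zero, on the line, of the linear form v -> T v z z. *)
Lemma exists_flag u v : ind2 u v ->
  T u u u = 0 -> T u u v = 0 -> T u v v = 0 -> T v v v = 0 ->
  exists a b c d z, a * d - b * c != 0 /\ flag T (a *: u + b *: v) (c *: u + d *: v) z.
Proof.
move=> uv h1 h2 h3 h4.
have [z [z1 z2 z3 Nz]] := kernel_outside (covec T u u) (covec T u v) (covec T v v) u v.
have {}z1 : T u u z = 0 by rewrite (covecE TT) z1 mxE.
have {}z2 : T u v z = 0 by rewrite (covecE TT) z2 mxE.
have {}z3 : T v v z = 0 by rewrite (covecE TT) z3 mxE.
have uvz := ind3_extend uv Nz.
have C1 := triC12 TT; have C2 := triC23 TT.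
have p1 : T u v u = 0 by rewrite C2.
have p2 : T v u u = 0 by rewrite C1 C2.
have p3 : T v u v = 0 by rewrite C1.
have p4 : T v v u = 0 by rewrite C2 C1.
have p5 : T v u z = 0 by rewrite C1.
suff [a [b [c [d [D0 ab]]]]] : exists a b c d : k,
    a * d - b * c != 0 /\ a * T u z z + b * T v z z = 0.
  exists a, b, c, d, z; split=> //; split; first exact: ind3_basis_change.
    by split; rewrite !(triE TT) ?h1 ?h2 ?h3 ?h4 ?p1 ?p2 ?p3 ?p4; ring.
  split; rewrite !(triE TT) ?z1 ?z2 ?z3 ?p5; try ring.
  exact: ab.
have [v0|v0] := eqVneq (T v z z) 0.
  exists 0, 1, 1, 0; rewrite v0 !mul0r !mul1r !add0r; split=> //.
  by rewrite oppr_eq0 oner_eq0.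
exists (T v z z), (- T u z z), 0, 1; split; last by ring.
by rewrite mulr1 mulr0 subr0.
Qed.

(** Modulo the line, [w] is a multiple of [z], so on the line the form v -> T v w w is a multiple of
    v -> T v z z and vanishes at [x]. This finds [x] from any basis [u], [v] of the line and is the
    source of the formula [psi_uv]. *)
Lemma residual_direction x y z u v w a b c d : flag T x y z -> good T x y z ->
  x = a *: u + b *: v -> y = c *: u + d *: v -> a * d - b * c != 0 ->
  T u u w = 0 -> T u v w = 0 -> T v v w = 0 -> (forall r s, w != r *: u + s *: v) ->
  exists2 mu, mu != 0 & T v w w *: u - T u w w *: v = mu *: x.
Proof.
move=> fl [yzz cov] xE yE D0 w1 w2 w3 Nw.
have C1 := triC12 TT; have C2 := triC23 TT.
have p5 : T v u w = 0 by rewrite C1.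
have [|||r [s [t wE]]] := flag_ker (w := w) TT fl cov.
- by rewrite xE !(triE TT) w1 w2 w3 p5; ring.
- by rewrite xE yE !(triE TT) w1 w2 w3 p5; ring.
- by rewrite yE !(triE TT) w1 w2 w3 p5; ring.
have t0 : t != 0.
  have := Nw (r * a + s * c) (r * b + s * d); apply: contraNneq => t0.
  by rewrite wE t0 xE yE; apply/eqP/rowP => j; rewrite !mxE; ring.
case: fl => ind [h1 h2 h3 h4] [h5 h6 h7 h8].
have q1 : T x y x = 0 by rewrite C2.
have q2 : T x z x = 0 by rewrite C2.
have q3 : T x z y = 0 by rewrite C2.
have q4 : T y x x = 0 by rewrite C1 C2.
have q5 : T y x y = 0 by rewrite C1.
have q6 : T y x z = 0 by rewrite C1.
have q7 : T y y x = 0 by rewrite C2 C1.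
have q8 : T y z x = 0 by rewrite C2 C1.
have q9 : T y z y = 0 by rewrite C2.
have xw : T x w w = 0.
  by rewrite wE !(triE TT) h1 h2 h3 h5 h6 h8 q1 q2 q3; ring.
have yw : T y w w = t ^+ 2 * T y z z.
  by rewrite wE !(triE TT) h4 h7 q4 q5 q6 q7 q8 q9; ring.
set U := T u w w; set W := T v w w.
have e1 : a * U + b * W = 0 by rewrite -xw xE !(triE TT).
have e2 : c * U + d * W = t ^+ 2 * T y z z by rewrite -yw yE !(triE TT).
pose D := a * d - b * c.
exists (t ^+ 2 * T y z z / D).
  by rewrite !mulf_neq0 ?expf_neq0 ?invr_neq0.
have eU : D * U = - b * (t ^+ 2 * T y z z).
  have -> : D * U = d * (a * U + b * W) - b * (c * U + d * W) by rewrite /D; ring.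
  by rewrite e1 e2; ring.
have eW : D * W = a * (t ^+ 2 * T y z z).
  have -> : D * W = a * (c * U + d * W) - c * (a * U + b * W) by rewrite /D; ring.
  by rewrite e1 e2; ring.
apply: (scalerI (D0 : D != 0)); rewrite scalerBr !scalerA eU eW [D * _]mulrC divfK //.
by rewrite xE; apply/rowP => j; rewrite !mxE; ring.
Qed.

End Flags2.

(** * Residual lines of good flags *)

Section Residual.
Variable k : numClosedFieldType.
Local Notation V := 'rV[k]_6.
Implicit Types (x y z : V) (f : {mpoly k[6]}).

Lemma flag_tangent f x y z : f \is 3.-homog -> flag (pol f) x y z ->
  tangent_plane f <<[:: x; y]>>%VS <<[:: x; y; z]>>%VS.
Proof.
move=> f3 [ind [h1 h2 h3 h4] [h5 h6 h7 h8]]; have TT := pol_symtri f3.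
have C1 := triC12 TT; have C2 := triC23 TT.
split; first exact: dim_span3.
  by apply/subvP => v /mem_span2 [r [s ->]]; apply/mem_span3; exists r, s, 0;
     rewrite scale0r addr0.
move=> _ _ /mem_span2 [r [s ->]] /mem_span3 [a [b [c ->]]].
rewrite pol_deriv // !(triE TT).
rewrite (C1 y x) (C2 x y x) (C2 y y x) (C1 y x) h1 h2 h3 h4 h5 h6 h7.
by rewrite (C1 y x z) h6; ring.
Qed.

Lemma good_tangent_unique f x y z : f \is 3.-homog -> good_flag (pol f) x y z ->
  unique (tangent_plane f <<[:: x; y]>>%VS) <<[:: x; y; z]>>%VS.
Proof.
move=> f3 [fl [yzz cov]]; have TT := pol_symtri f3.
split; first exact: flag_tangent.
move=> P [dP LP tP]; apply/esym/eqP; rewrite eqEdim dP dim_span3 ?leqnn ?andbT; last by case: fl.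
apply/subvP => w wP; apply/mem_span3.
have tan a : a \in <<[:: x; y]>>%VS -> pol f a a w = 0.
  move=> aL; have := tP a w aL wP; rewrite pol_deriv // => /eqP.
  by rewrite mulf_eq0 pnatr_eq0 => /eqP.
have xL : x \in <<[:: x; y]>>%VS by apply: memv_span; rewrite inE eqxx.
have yL : y \in <<[:: x; y]>>%VS by apply: memv_span; rewrite !inE eqxx orbT.
apply: (flag_ker TT fl cov); [exact: tan | | exact: tan].
have := tan (x + y); rewrite memvD // => /(_ isT).
rewrite !(triE TT) (tan x) // (tan y) // (triC12 TT y x) add0r addr0 -mulr2n.
by move/eqP; rewrite mulrn_eq0 => /eqP.
Qed.

Lemma flag_section f x y z s t r : f \is 3.-homog -> flag (pol f) x y z ->
  ev f (s *: x + t *: y + r *: z) =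
  r ^+ 2 * (3%:R * pol f y z z * t + pol f z z z * r).
Proof.
move=> f3 [_ [h1 h2 h3 h4] [h5 h6 h7 h8]]; have TT := pol_symtri f3.
have C1 := triC12 TT; have C2 := triC23 TT.
have q1 : pol f x y x = 0 by rewrite C2.
have q2 : pol f x z x = 0 by rewrite C2.
have q3 : pol f x z y = 0 by rewrite C2.
have q4 : pol f y x x = 0 by rewrite C1 C2.
have q5 : pol f y x y = 0 by rewrite C1.
have q6 : pol f y x z = 0 by rewrite C1.
have q7 : pol f y y x = 0 by rewrite C2 C1.
have q8 : pol f y z x = 0 by rewrite C2 C1.
have q9 : pol f y z y = 0 by rewrite C2.
have p1 : pol f z x x = 0 by rewrite C1 C2.
have p2 : pol f z x y = 0 by rewrite C1 C2.
have p3 : pol f z x z = 0 by rewrite C1.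
have p4 : pol f z y x = 0 by rewrite C2 C1 C2.
have p5 : pol f z y y = 0 by rewrite C1 C2.
have p6 : pol f z y z = pol f y z z by rewrite C1.
have p7 : pol f z z x = 0 by rewrite C2 C1.
have p8 : pol f z z y = pol f y z z by rewrite C2 C1.
rewrite -pol_diag // !(triE TT).
by rewrite h1 h2 h3 h4 h5 h6 h7 h8 q1 q2 q3 q4 q5 q6 q7 q8 q9 p1 p2 p3 p4 p5 p6 p7 p8; ring.
Qed.

Lemma good_residual f x y z : f \is 3.-homog -> good_flag (pol f) x y z ->
  residual_point f <<[:: x; y]>>%VS x.
Proof.
move=> f3 gf; have [fl [yzz cov]] := gf; have [ind _ _] := fl.
pose be := 3%:R * pol f y z z; pose ga := pol f z z z.
have be0 : be != 0 by rewrite mulf_neq0 ?pnatr_eq0.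
(* By [flag_section] the residual line is given by [be * t + ga * r = 0] in the plane with
   coordinates s, t, r. The vector [y'] satisfies it and, [be] being nonzero, is not on [<x, y>]. *)
pose y' := ga *: y - be *: z.
have indz : ind2 x y'.
  move=> r s E; have := ind r (s * ga) (- (s * be)).
  case=> [|-> _ /eqP]; first by rewrite -[RHS]E; apply/rowP => j; rewrite !mxE; ring.
  by rewrite oppr_eq0 mulf_eq0 (negPf be0) orbF => /eqP.
have /row_freeP [B MB] := ind3_row_free ind.
have coord r s t : (r *: x + s *: y + t *: z) *m B = rv3 r s t.
  by rewrite -mul_rv3 -mulmxA MB mulmx1.
split; first exact: ind3_neq0 ind.
exists <<[:: x; y']>>%VS; last first.
  apply/vspaceP => w; rewrite memv_cap; apply/andP/vlineP.
    case=> /mem_span2 [r [s wE]] /mem_span2 [a [b]].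
    rewrite wE => E; have [|_ _ /eqP] := ind (r - a) (s - b * ga) (b * be).
      have -> : (r - a) *: x + (s - b * ga) *: y + (b * be) *: z =
          (r *: x + s *: y) - (a *: x + b *: y').
        by apply/rowP => j; rewrite !mxE; ring.
      by rewrite E subrr.
    rewrite mulf_eq0 (negPf be0) orbF => /eqP b0.
    by exists a; rewrite E b0 scale0r addr0.
  case=> r ->; split; apply/mem_span2; exists r, 0; by rewrite scale0r addr0.
exists <<[:: x; y; z]>>%VS; first exact: good_tangent_unique.
split; first split.
- exact: dim_span3.
- by apply: dim_span2; apply: ind3_12 ind.
- exact: dim_span2.
- by case: (flag_tangent f3 fl).
- apply/subvP => w /mem_span2 [r [s ->]]; apply/mem_span3.
  by exists r, (s * ga), (- (s * be)); apply/rowP => j; rewrite !mxE; ring.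
(* Columns 1 and 2 of a right inverse of the flag matrix are the linear forms reading the
   coordinates along [y] and [z]. *)
exists (col 2%:R B), (be *: col 1 B + ga *: col 2%:R B) => w /mem_span3 [r [s [t wE]]].
have colB l : w *m col l B = ((w *m B) 0 l)%:M.
  apply/matrixP => i j; rewrite !ord1 !mxE eqxx mulr1n.
  by apply: eq_bigr => a _; rewrite mxE.
have w2 : w *m col 2%:R B = t%:M by rewrite colB wE coord mxE.
have w1 : w *m col 1 B = s%:M by rewrite colB wE coord mxE.
have wb : w *m (be *: col 1 B + ga *: col 2%:R B) = (be * s + ga * t)%:M.
  by rewrite mulmxDr -!scalemxAr w1 w2 -!mul_scalar_mx -!scalar_mxM -raddfD.
have sc0 (c : k) : (c%:M == 0 :> 'M_1) = (c == 0).
  apply/eqP/eqP => [/matrixP/(_ 0 0)|->]; last by rewrite raddf0.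
  by rewrite !mxE.
split.
- rewrite w2 sc0; apply/mem_span2/eqP.
    case=> a [b E]; have [|_ _ //] := ind (r - a) (s - b) t.
    move: E; rewrite wE => E.
    have -> : (r - a) *: x + (s - b) *: y + t *: z = (r *: x + s *: y + t *: z) - (a *: x + b *: y).
      by apply/rowP => j; rewrite !mxE; ring.
    by rewrite E subrr.
  by move=> t0; exists r, s; rewrite wE t0 scale0r addr0.
- rewrite wb sc0; apply/mem_span2/eqP.
    case=> a [b E]; have [|_ e1 e2] := ind (r - a) (s - b * ga) (t + b * be).
      move: E; rewrite wE => E.
      have -> : (r - a) *: x + (s - b * ga) *: y + (t + b * be) *: z =
         (r *: x + s *: y + t *: z) - (a *: x + b *: y').
        by apply/rowP => j; rewrite !mxE; ring.
      by rewrite E subrr.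
    have -> : be * s + ga * t = be * (s - b * ga) + ga * (t + b * be) by ring.
    by rewrite e1 e2; ring.
  move=> E; exists r, (- (t / be)); rewrite wE; apply/rowP => j; rewrite !mxE.
  have -> : s = - (ga * t) / be.
    by apply: (mulIf be0); rewrite divfK // mulrC; apply/eqP; rewrite -addr_eq0 E.
  by field.
- by rewrite w2 wb wE flag_section // !mxE eqxx !mulr1n -/be -/ga; ring.
Qed.

End Residual.

(** * The 24 flags over a point *)

(* Discriminant of [a X^3 + 3 b X^2 Y + 3 c X Y^2 + d Y^3]. *)
Definition disc3 (R : comNzRingType) (a b c d : R) : R :=
  a ^+ 2 * d ^+ 2 - 6%:R * a * b * c * d + 4%:R * a * c ^+ 3
  + 4%:R * b ^+ 3 * d - 3%:R * b ^+ 2 * c ^+ 2.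

Section BinaryCubics.
Variable k : numClosedFieldType.

Lemma quad_root (a b c : k) : a != 0 -> exists t, a * t ^+ 2 + b * t + c = 0.
Proof.
move=> a0; pose e := sqrtC (b ^+ 2 - 4%:R * a * c).
have e2 : e ^+ 2 = b ^+ 2 - 4%:R * a * c by rewrite sqrtCK.
exists ((- b + e) / (2%:R * a)).
have a2 : 2%:R * a != 0 by rewrite mulf_neq0 ?pnatr_eq0.
apply: (mulfI a2); apply: (mulfI a2); rewrite !mulr0.
have -> : 2%:R * a * (2%:R * a * (a * ((- b + e) / (2%:R * a)) ^+ 2 +
   b * ((- b + e) / (2%:R * a)) + c)) = a * (e ^+ 2 - b ^+ 2 + 4%:R * a * c).
  by field; rewrite a0.
by rewrite e2; ring.
Qed.

(* The double root of a cubic is the double root of its Hessian. *)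
Lemma disc3_root (a b c d : k) : disc3 a b c d = 0 ->
  exists t u, [/\ (t != 0) || (u != 0),
     a * t ^+ 2 + 2%:R * b * t * u + c * u ^+ 2 = 0 &
     b * t ^+ 2 + 2%:R * c * t * u + d * u ^+ 2 = 0].
Proof.
move=> D0; pose A := a * c - b ^+ 2; pose B := a * d - b * c; pose C := b * d - c ^+ 2.
have B2 : B ^+ 2 = 4%:R * A * C.
  by apply/eqP; rewrite -subr_eq0 -[X in _ == X]D0; apply/eqP; rewrite /A /B /C /disc3; ring.
have i1 : a * C - b * B + c * A = 0 by rewrite /A /B /C; ring.
have i2 : b * C - c * B + d * A = 0 by rewrite /A /B /C; ring.
have [A0|A0] := eqVneq A 0; last first.
  exists (- B), (2%:R * A); split.
  - by rewrite mulf_neq0 ?orbT ?pnatr_eq0.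
  - have -> : a * (- B) ^+ 2 + 2%:R * b * (- B) * (2%:R * A) + c * (2%:R * A) ^+ 2 =
      a * B ^+ 2 - 4%:R * b * B * A + 4%:R * c * A ^+ 2 by ring.
    rewrite B2; have -> : a * (4%:R * A * C) - 4%:R * b * B * A + 4%:R * c * A ^+ 2 =
      4%:R * A * (a * C - b * B + c * A) by ring.
    by rewrite i1 mulr0.
  have -> : b * (- B) ^+ 2 + 2%:R * c * (- B) * (2%:R * A) + d * (2%:R * A) ^+ 2 =
    b * B ^+ 2 - 4%:R * c * B * A + 4%:R * d * A ^+ 2 by ring.
  rewrite B2; have -> : b * (4%:R * A * C) - 4%:R * c * B * A + 4%:R * d * A ^+ 2 =
    4%:R * A * (b * C - c * B + d * A) by ring.
  by rewrite i2 mulr0.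
have B0 : B = 0 by move/eqP: B2; rewrite A0 mulr0 mul0r expf_eq0 => /eqP.
have [C0|C0] := eqVneq C 0; last first.
  exists 1, 0; rewrite oner_neq0; move: i1 i2; rewrite A0 B0 !mulr0 !addr0 !subr0.
  move=> /eqP; rewrite mulf_eq0 (negPf C0) orbF => /eqP ->.
  move=> /eqP; rewrite mulf_eq0 (negPf C0) orbF => /eqP ->.
  by split=> //; ring.
have [a0|a0] := eqVneq a 0.
  have b0 : b = 0.
    by move/eqP: A0; rewrite /A a0 mul0r sub0r oppr_eq0 expf_eq0 => /eqP.
  exists 1, 0; rewrite oner_neq0 a0 b0; split=> //; ring.
exists (- b), a; rewrite a0 orbT; split=> //.
  have -> : a * (- b) ^+ 2 + 2%:R * b * (- b) * a + c * a ^+ 2 = a * A by rewrite /A; ring.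
  by rewrite A0 mulr0.
have -> : b * (- b) ^+ 2 + 2%:R * c * (- b) * a + d * a ^+ 2 = a * B - b * A.
  by rewrite /A /B; ring.
by rewrite A0 B0 !mulr0 subr0.
Qed.

Lemma disc3_change (R : comNzRingType) (a b c d t u r s : R) : t * s - u * r = 1 ->
  disc3 (a * t ^+ 3 + 3%:R * b * t ^+ 2 * u + 3%:R * c * t * u ^+ 2 + d * u ^+ 3)
    (a * t ^+ 2 * r + b * (t ^+ 2 * s + 2%:R * t * u * r)
      + c * (2%:R * t * u * s + u ^+ 2 * r) + d * u ^+ 2 * s)
    (a * t * r ^+ 2 + b * (u * r ^+ 2 + 2%:R * t * r * s)
      + c * (t * s ^+ 2 + 2%:R * u * r * s) + d * u * s ^+ 2)
    (a * r ^+ 3 + 3%:R * b * r ^+ 2 * s + 3%:R * c * r * s ^+ 2 + d * s ^+ 3)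
  = disc3 a b c d.
Proof.
move=> E; transitivity ((t * s - u * r) ^+ 6 * disc3 a b c d).
  by rewrite /disc3; ring.
by rewrite E expr1n mul1r.
Qed.

Lemma deriv_XsubC_mul (h : {poly k}) t : (('X - t%:P) * h)^`().[t] = h.[t].
Proof. by rewrite derivM derivXsubC mul1r hornerD hornerM hornerXsubC subrr mul0r addr0. Qed.

(** With [p] and [q] both divisible by X - t, every term of the discriminant except 4 p r^3 vanishes
    to order at least two. *)
Lemma disc3_deriv (p q r s : {poly k}) t : p.[t] = 0 -> q.[t] = 0 ->
  (disc3 p q r s)^`().[t] = 4%:R * p^`().[t] * r.[t] ^+ 3.
Proof.
move=> /rootP/factor_theorem [p1 ->] /rootP/factor_theorem [q1 ->].
have -> : disc3 (p1 * ('X - t%:P)) (q1 * ('X - t%:P)) r s = ('X - t%:P) *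
    (4%:R * p1 * r ^+ 3 + ('X - t%:P) * (p1 ^+ 2 * s ^+ 2 - 6%:R * p1 * q1 * r * s
      + 4%:R * ('X - t%:P) * q1 ^+ 3 * s - 3%:R * q1 ^+ 2 * r ^+ 2)).
  by rewrite /disc3; ring.
rewrite deriv_XsubC_mul [p1 * _]mulrC deriv_XsubC_mul hornerD !hornerM hornerXsubC.
by rewrite subrr mul0r addr0 -[4%:R in LHS]polyC_natr hornerC; ring.
Qed.

End BinaryCubics.

(** * The polar quadric of a point of the cubic *)

Section Rulings.
Variable k : numClosedFieldType.
Local Notation V := 'rV[k]_6.
Implicit Types (y z u v w b : V).
Variables (T : V -> V -> V -> k) (TT : symtri T) (x : V).
Hypotheses (xX : T x x x = 0) (x0 : x 0 0 != 0).

(** Coordinate 0 is nonzero at [x], so this space of dimension 4 represents the quotient of the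
    tangent hyperplane by [x], on which the quadratic form [T x] is nondegenerate. *)
Definition tancut w := T x x w = 0 /\ w 0 0 = 0.

Lemma tancut_lin (a b : k) u v : tancut u -> tancut v -> tancut (a *: u + b *: v).
Proof.
move=> [u1 u2] [v1 v2]; split; first by rewrite !(triE TT) u1 v1 !mulr0 addr0.
by rewrite !mxE u2 v2 !mulr0 addr0.
Qed.

Lemma bil_sym u v : T x u v = T x v u. Proof. exact: (triC23 TT). Qed.

(** Four linear equations leave a subspace of dimension at least 2, on which a quadratic form over a
    closed field has a nontrivial zero. *)
Lemma isotropic_vector (c1 c2 c3 c4 : V) : exists w, [/\ w != 0,
  w *m c1^T = 0, w *m c2^T = 0, w *m c3^T = 0 & w *m c4^T = 0 /\ T x w w = 0].
Proof.
pose A : 'M_(6, 4) := (\matrix_(i < 4) nth 0 [:: c1; c2; c3; c4] i)^T.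
have rA : (2 <= \rank (kermx A))%N.
  by rewrite mxrank_ker; have := rank_leq_col A; move: (\rank A) => r; lia.
have kA w : w *m A = 0 -> [/\ w *m c1^T = 0, w *m c2^T = 0, w *m c3^T = 0 & w *m c4^T = 0].
  move=> wA; have wc (j : 'I_4) : w *m (nth 0 [:: c1; c2; c3; c4] j)^T = 0.
    apply/rowP => l; rewrite ord1 [RHS]mxE.
    transitivity ((w *m A) 0 j); last by rewrite wA mxE.
    by rewrite !mxE; apply: eq_bigr => a _; rewrite !mxE.
  by split; [exact: (wc 0)|exact: (wc 1)|exact: (wc 2%:R)|exact: (wc 3%:R)].
suff [w [w0 wA ww]] : exists w, [/\ w != 0, w *m A = 0 & T x w w = 0].
  by exists w; have [] := kA w wA.
have /rowV0Pn [w1 /sub_kermxP w1A w1_0] : kermx A != 0.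
  by rewrite -mxrank_eq0 -lt0n; apply: leq_trans rA.
have /row_subPn [i Nw2] : ~~ (kermx A <= w1)%MS.
  by apply/negP => /mxrankS; have := rank_leq_row w1; lia.
set w2 := row i _ in Nw2; have w2A : w2 *m A = 0 by apply/sub_kermxP; apply: row_sub.
have [w11|w11] := eqVneq (T x w1 w1) 0; first by exists w1.
have [t tE] := quad_root (2%:R * T x w1 w2) (T x w2 w2) w11.
exists (t *: w1 + w2); split.
- apply: contra Nw2 => /eqP tw; apply/submxP; exists (- t)%:M.
  by rewrite mul_scalar_mx scaleNr; apply/eqP; rewrite -addr_eq0 addrC tw.
- by rewrite mulmxDl -scalemxAl w1A w2A scaler0 addr0.
by rewrite !(triE TT) (bil_sym w2 w1) -[RHS]tE; ring.
Qed.

(** In these coordinates T x v v is 2 e (v1 v4 - v2 v3): the quadric of singular 2 by 2 matrices,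
    whose two rulings are exchanged by swapping [b2] and [b3]. *)
Definition hyperbolic e b1 b2 b3 b4 : Prop :=
  [/\ e != 0, [/\ tancut b1, tancut b2, tancut b3 & tancut b4],
     [/\ T x b1 b1 = 0, T x b2 b2 = 0, T x b3 b3 = 0 & T x b4 b4 = 0],
     [/\ T x b1 b2 = 0, T x b1 b3 = 0, T x b2 b4 = 0 & T x b3 b4 = 0] &
     T x b1 b4 = e /\ T x b2 b3 = - e].

Hypothesis nondeg : forall w, (forall v, T x w v = 0) -> w = 0.

(** If [w] were orthogonal to this subspace, the linear form T x w would be proportional to T x x,
    so [w] would be a multiple of [x] by nondegeneracy; coordinate 0 excludes this. *)
Lemma tancut_nondeg w : tancut w -> w != 0 -> exists2 v, tancut v & T x w v = 1.
Proof.
move=> [w1 w2] w0.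
suff [v [v1 v2] wv] : exists2 v, tancut v & T x w v != 0.
  exists ((T x w v)^-1 *: v); last by rewrite (triE TT) mulVf.
  by rewrite -[_ *: v]addr0 -[0](scale0r v); apply: tancut_lin.
apply: contrapT => none.
have van v : tancut v -> T x w v = 0.
  by move=> vW; apply/eqP; apply: contrapT => /negP wv; apply: none; exists v.
have [u xu] : exists u, T x x u != 0.
  apply: contrapT => N; have x00 : x = 0.
    by apply: nondeg => v; apply/eqP; apply: contrapT => /negP H; apply: N; exists v.
  by move: x0; rewrite x00 mxE eqxx.
pose m := T x w u / T x x u.
have : w - m *: x = 0.
  apply: nondeg => v.
  have [v2 [c [a [W2 ->]]]] : exists v2 c a, tancut v2 /\ v = v2 + c *: x + a *: u.
    pose a := T x x v / T x x u.
    have v'x : T x x (v - a *: u) = 0 by rewrite !(triE TT) divfK ?subrr.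
    move: (v - a *: u) (subrK (a *: u) v) v'x => v' v'E v'x.
    exists (v' - (v' 0 0 / x 0 0) *: x), (v' 0 0 / x 0 0), a.
    split; last by rewrite subrK v'E.
    split; first by rewrite !(triE TT) v'x xX mulr0 subr0.
    by rewrite !mxE divfK ?subrr.
  rewrite !(triE TT) van // xX (bil_sym w x) w1 (proj1 W2).
  by rewrite /m; field.
move/eqP; rewrite subr_eq0 => /eqP wm.
have : w 0 0 = 0 by []; rewrite wm mxE => /eqP; rewrite mulf_eq0 (negPf x0) orbF => /eqP m0.
by move: w0; rewrite wm m0 scale0r eqxx.
Qed.

Lemma exists_hyperbolic : exists b1 b2 b3 b4, hyperbolic 1 b1 b2 b3 b4.
Proof.
pose e0 : V := delta_mx 0 0.
have cut w : w *m (covec T x x)^T = 0 -> w *m e0^T = 0 -> tancut w.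
  move=> h1 h2; split; first by rewrite (covecE TT) h1 mxE.
  have := congr1 (fun M : 'M_1 => M 0 0) h2; rewrite !mxE (bigD1 0) //= !mxE.
  rewrite mulr1 big1 ?addr0 // => i i0; rewrite !mxE eqxx /= (negPf i0) mulr0 //.
have [b1 [b1_0 h1 h2 _ [_ b11]]] := isotropic_vector (covec T x x) e0 0 0.
have W1 := cut _ h1 h2; have [c Wc b1c] := tancut_nondeg W1 b1_0.
pose b4 := c - (T x c c / 2%:R) *: b1.
have W4 : tancut b4.
  by rewrite /b4 -[c]scale1r -scaleNr; apply: tancut_lin.
have b14 : T x b1 b4 = 1 by rewrite !(triE TT) b1c b11; ring.
have b44 : T x b4 b4 = 0.
  by rewrite !(triE TT) (bil_sym c b1) b1c b11; field.
clearbody b4.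
have [b2 [b2_0 h3 h4 h5 [h6 b22]]] :=
  isotropic_vector (covec T x x) e0 (covec T x b1) (covec T x b4).
have W2 := cut _ h3 h4.
have b12 : T x b1 b2 = 0 by rewrite (covecE TT) h5 mxE.
have b42 : T x b4 b2 = 0 by rewrite (covecE TT) h6 mxE.
have [g Wg b2g] := tancut_nondeg W2 b2_0.
(* The opposite of [g], made orthogonal to [b1] and [b4]; the sign gives the pairing -1 with
   [b2]. *)
pose g' := - g + T x b4 g *: b1 + T x b1 g *: b4.
have Wg' : tancut g'.
  rewrite /g' -[_ + _ *: b1 + _]scale1r -[- g]scaleN1r.
  rewrite -[_ *: _]addr0 -[0](scale0r g) scalerDr scale1r.
  have H := tancut_lin (-1) (T x b4 g) Wg W1.
  have := tancut_lin 1 (T x b1 g) H W4; rewrite !scale1r scale0r addr0.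
  by [].
clearbody e0; pose b3 := g' + (T x g' g' / 2%:R) *: b2.
have W3 : tancut b3.
  by have := tancut_lin 1 (T x g' g' / 2%:R) Wg' W2; rewrite scale1r.
have b1g' : T x b1 g' = 0 by rewrite /g' !(triE TT) b11 b14; ring.
have b4g' : T x b4 g' = 0 by rewrite /g' !(triE TT) b44 (bil_sym b4 b1) b14; ring.
have b2g' : T x b2 g' = -1.
  by rewrite /g' !(triE TT) b2g (bil_sym b2 b1) b12 (bil_sym b2 b4) b42; ring.
clearbody g'.
have b33 : T x b3 b3 = 0.
  by rewrite /b3 !(triE TT) (bil_sym g' b2) b2g' b22; field.
have b13 : T x b1 b3 = 0 by rewrite /b3 !(triE TT) b1g' b12; ring.
have b24 : T x b2 b4 = 0 by rewrite bil_sym.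
have b34 : T x b3 b4 = 0 by rewrite bil_sym /b3 !(triE TT) b4g' b42; ring.
have b23 : T x b2 b3 = - 1 by rewrite /b3 !(triE TT) b2g' b22; ring.
by exists b1, b2, b3, b4; split=> //; exact: oner_neq0.
Qed.

End Rulings.

Section CubicPolynomials.
Variable k : numClosedFieldType.

Lemma disc3_morph (R S : comNzRingType) (f : {rmorphism R -> S}) a b c d :
  f (disc3 a b c d) = disc3 (f a) (f b) (f c) (f d).
Proof. by rewrite /disc3 !(rmorph_nat, rmorphXn, rmorphB, rmorphM, rmorphD). Qed.

Definition cubp (c0 c1 c2 c3 : k) : {poly k} :=
  c0%:P + c1 *: 'X + c2 *: 'X^2 + c3 *: 'X^3.

Lemma horner_cubp c0 c1 c2 c3 s :
  (cubp c0 c1 c2 c3).[s] = c0 + c1 * s + c2 * s ^+ 2 + c3 * s ^+ 3.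
Proof. by rewrite /cubp !(hornerD, hornerZ, hornerXn, hornerX, hornerC). Qed.

Lemma horner_deriv_cubp c0 c1 c2 c3 s :
  (cubp c0 c1 c2 c3)^`().[s] = c1 + 2%:R * c2 * s + 3%:R * c3 * s ^+ 2.
Proof.
rewrite /cubp !derivD !derivZ derivC derivX !derivXn.
by rewrite !(hornerD, hornerZ, hornerMn, hornerXn, hornerX, hornerC) /=; ring.
Qed.

Lemma cubp_lead c0 c1 c2 c3 : deg_lead (cubp c0 c1 c2 c3) 3 c3.
Proof.
rewrite /cubp -[c3 in X in deg_lead _ _ X]add0r; apply: deg_leadD.
  apply: (deg_lead_small (d := 3)) => //.
  rewrite (leq_trans (size_polyD _ _)) // geq_max (leq_trans (size_scale_leq _ _)) ?size_polyXn //.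
  rewrite (leq_trans (size_polyD _ _)) // geq_max (leq_trans (size_scale_leq _ _)) ?size_polyX //.
  by rewrite (leq_trans (size_polyC_leq1 _)).
by rewrite -[c3 in X in deg_lead _ _ X]mulr1; apply: deg_leadZ; split; rewrite ?size_polyXn ?coefXn.
Qed.

Lemma disc3_lead (p q r s : {poly k}) a b c d : deg_lead p 3 a -> deg_lead q 3 b ->
  deg_lead r 3 c -> deg_lead s 3 d -> deg_lead (disc3 p q r s) 12 (disc3 a b c d).
Proof.
move=> pa qb rc sd; rewrite /disc3 -!polyC_natr.
have C0 := @deg_leadC k.
have M := @deg_leadM k; have X := @deg_leadX k.
apply: (@deg_leadD _ _ _ 12); last apply: (@deg_leadN _ _ 12).
  apply: (@deg_leadD _ _ _ 12); first apply: (@deg_leadD _ _ _ 12);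
    first apply: (@deg_leadD _ _ _ 12); last first.
  - exact: (M _ _ 9 3 _ _ (M _ _ 0 9 _ _ (C0 _) (X _ _ _ 3 qb)) sd).
  - exact: (M _ _ 3 9 _ _ (M _ _ 0 3 _ _ (C0 _) pa) (X _ _ _ 3 rc)).
  - apply: (@deg_leadN _ _ 12).
    exact: (M _ _ 9 3 _ _ (M _ _ 6 3 _ _ (M _ _ 3 3 _ _ (M _ _ 0 3 _ _ (C0 _) pa) qb) rc) sd).
  exact: (M _ _ 6 6 _ _ (X _ _ _ 2 pa) (X _ _ _ 2 sd)).
exact: (M _ _ 6 6 _ _ (M _ _ 0 6 _ _ (C0 _) (X _ _ _ 2 qb)) (X _ _ _ 2 rc)).
Qed.

Lemma simple_roots (p : {poly k}) n c : deg_lead p n c -> c != 0 ->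
  (forall t, p.[t] = 0 -> p^`().[t] != 0) ->
  exists s : 'I_n -> k, injective s /\ forall i, p.[s i] = 0.
Proof.
move=> [sp pc] c0 simple; have [rs pE] := closed_field_poly_normal p.
have p0 : p != 0 by apply: contraNneq c0 => p0; rewrite -pc p0 coef0.
have szp : size p = n.+1.
  by apply/eqP; rewrite eqn_leq sp ltnNge; apply: contra c0 => H; rewrite -pc nth_default.
have lc0 : lead_coef p != 0 by rewrite lead_coef_eq0.
have szr : size rs = n.
  by move: szp; rewrite pE size_scale // size_prod_XsubC => -[].
have urs : uniq rs.
  rewrite -separable_prod_XsubC unlock.
  have : coprimep p p^`() by apply/Pdiv.ClosedField.coprimepP => t /rootP; apply: simple.
  by rewrite {1 2}pE derivZ coprimepZl // coprimepZr.
exists (fun i => nth 0 rs i); split=> [i j /eqP|i].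
  by rewrite nth_uniq ?szr // => /eqP /val_inj.
apply/rootP; rewrite pE rootZ // root_prod_XsubC mem_nth // szr.
by [].
Qed.

End CubicPolynomials.

Section Ruling.
Variable k : numClosedFieldType.
Local Notation V := 'rV[k]_6.
Implicit Types (y z u v w : V).
Variables (T : V -> V -> V -> k) (TT : symtri T) (x : V).
Hypotheses (xX : T x x x = 0) (x0 : x 0 0 != 0).

Section Basis.
Variables (b1 b2 b3 b4 : V).

(** The arguments are the coefficients of the cubic on the line spanned by b1 + s b2 and b3 + s b4,
    each of degree 3 in s. The discriminant has degree 4 in them, whence 12, and its formal leading
    coefficient belongs to the line at infinity [<b2, b4>]. *)
Definition ruling_disc : {poly k} := disc3
  (cubp (T b1 b1 b1) (3%:R * T b1 b1 b2) (3%:R * T b1 b2 b2) (T b2 b2 b2))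
  (cubp (T b1 b1 b3) (T b1 b1 b4 + 2%:R * T b1 b2 b3) (2%:R * T b1 b2 b4 + T b2 b2 b3) (T b2 b2 b4))
  (cubp (T b1 b3 b3) (2%:R * T b1 b3 b4 + T b2 b3 b3) (T b1 b4 b4 + 2%:R * T b2 b3 b4) (T b2 b4 b4))
  (cubp (T b3 b3 b3) (3%:R * T b3 b3 b4) (3%:R * T b3 b4 b4) (T b4 b4 b4)).

Lemma ruling_disc_lead : deg_lead ruling_disc 12
  (disc3 (T b2 b2 b2) (T b2 b2 b4) (T b2 b4 b4) (T b4 b4 b4)).
Proof. by apply: disc3_lead; apply: cubp_lead. Qed.

Variable s : k.
Let A := b1 + s *: b2.
Let B := b3 + s *: b4.
Let C1 := triC12 TT.
Let C2 := triC23 TT.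
Let sorted := (C1 b2 b1, C1 b3 b1, C1 b4 b1, C1 b3 b2, C1 b4 b2, C1 b4 b3,
  fun a => C2 a b2 b1, fun a => C2 a b3 b1, fun a => C2 a b4 b1,
  fun a => C2 a b3 b2, fun a => C2 a b4 b2, fun a => C2 a b4 b3).

Lemma ruling_disc_horner :
  ruling_disc.[s] = disc3 (T A A A) (T A A B) (T A B B) (T B B B).
Proof.
rewrite /ruling_disc -[_.[s]]/(horner_eval s _) disc3_morph /= !/(horner_eval _ _) !horner_cubp.
by congr disc3; rewrite /A /B !(triE TT) !sorted; ring.
Qed.

(** A constant unimodular change to the basis [y], [z] keeps the discriminant and makes its first
    two coefficients vanish at [s]. Then [disc3_deriv] leaves only the derivative of T y y y, where
    [y] moves with velocity t b2 + u b4; the constant is 12 = 4 * 3. *)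
Lemma ruling_disc_deriv (t u r q : k) : t * q - u * r = 1 ->
  let y := t *: A + u *: B in let z := r *: A + q *: B in
  T y y y = 0 -> T y y z = 0 ->
  ruling_disc^`().[s] = 12%:R * T y y (t *: b2 + u *: b4) * T y z z ^+ 3.
Proof.
move=> E y z yyy yyz; rewrite /ruling_disc.
set pa := cubp _ _ _ _; set pb := cubp _ _ _ _; set pc := cubp _ _ _ _; set pd := cubp _ _ _ _.
have EP : t%:P * q%:P - u%:P * r%:P = 1 :> {poly k} by rewrite -!polyCM -polyCB E.
have ea : pa.[s] = T A A A by rewrite horner_cubp /A /B !(triE TT) !sorted; ring.
have eb : pb.[s] = T A A B by rewrite horner_cubp /A /B !(triE TT) !sorted; ring.
have ec : pc.[s] = T A B B by rewrite horner_cubp /A /B !(triE TT) !sorted; ring.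
have ed : pd.[s] = T B B B by rewrite horner_cubp /A /B !(triE TT) !sorted; ring.
have da : pa^`().[s] = 3%:R * T A A b2.
  by rewrite horner_deriv_cubp /A /B !(triE TT) !sorted; ring.
have db : pb^`().[s] = 2%:R * T A B b2 + T A A b4.
  by rewrite horner_deriv_cubp /A /B !(triE TT) !sorted; ring.
have dc : pc^`().[s] = T B B b2 + 2%:R * T A B b4.
  by rewrite horner_deriv_cubp /A /B !(triE TT) !sorted; ring.
have dd : pd^`().[s] = 3%:R * T B B b4.
  by rewrite horner_deriv_cubp /A /B !(triE TT) !sorted; ring.
rewrite -(disc3_change pa pb pc pd EP).
move: ea eb ec ed da db dc dd yyy yyz.
clearbody pa pb pc pd A B => ea eb ec ed da db dc dd yyy yyz.
have CC := (C1 B A, fun a => C2 a B A).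
set p := (X in disc3 X _ _ _); set p2 := (X in disc3 _ X _ _); set p1 := (X in disc3 _ _ X _).
have hE := (hornerD, horner_exp, hornerM, hornerC, ea, eb, ec, ed).
have num n : (n%:R : {poly k}) = (n%:R)%:P by rewrite polyC_natr.
have p0E : p.[s] = T y y y.
  by rewrite /p !num !hE /y !(triE TT) !CC; ring.
have p2E : p2.[s] = T y y z.
  by rewrite /p2 !num !hE /y /z !(triE TT) !CC; ring.
have p1E : p1.[s] = T y z z.
  by rewrite /p1 !num !hE /y /z !(triE TT) !CC; ring.
have dp : p^`().[s] = 3%:R * T y y (t *: b2 + u *: b4).
  have -> : p = t ^+ 3 *: pa + (3%:R * t ^+ 2 * u) *: pb +
      (3%:R * t * u ^+ 2) *: pc + u ^+ 3 *: pd.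
    by rewrite /p !num -!mul_polyC !(polyCM, polyC_exp); ring.
  rewrite !derivD !derivZ !(hornerD, hornerZ) da db dc dd /y !(triE TT) !CC; ring.
by rewrite disc3_deriv ?p0E ?p2E // dp p1E; ring.
Qed.

End Basis.
End Ruling.

(** * Twelve flags in each ruling *)

Section Fibre.
Variable k : numClosedFieldType.
Local Notation V := 'rV[k]_6.
Implicit Types (y z u v w : V).
Variables (T : V -> V -> V -> k) (TT : symtri T) (x : V).
Hypotheses (xX : T x x x = 0) (x0 : x 0 0 != 0).
Let C1 := triC12 TT.
Let C2 := triC23 TT.

Section Basis.
Variables (e : k) (b1 b2 b3 b4 : V).
Hypothesis hb : hyperbolic T x e b1 b2 b3 b4.

Lemma hyperbolic_ind (r1 r2 r3 r4 : k) :
  r1 *: b1 + r2 *: b2 + r3 *: b3 + r4 *: b4 = 0 ->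
  [/\ r1 = 0, r2 = 0, r3 = 0 & r4 = 0].
Proof.
case: hb => e0 _ [h11 h22 h33 h44] [h12 h13 h24 h34] [h14 h23] E.
have pair v : T x v (r1 *: b1 + r2 *: b2 + r3 *: b3 + r4 *: b4) = 0.
  by rewrite E (tri03 TT).
have z c : e * c = 0 -> c = 0 by move/eqP; rewrite mulf_eq0 (negPf e0) => /eqP.
have := pair b1; rewrite !(triE TT) h11 h12 h13 h14 !mulr0 !add0r mulrC => /z ->.
have := pair b2; rewrite !(triE TT) (C2 x b2 b1) h12 h22 h23 h24 !mulr0 !add0r addr0.
rewrite mulrN mulrC => /eqP; rewrite oppr_eq0 => /eqP /z ->.
have := pair b3; rewrite !(triE TT) (C2 x b3 b1) h13 (C2 x b3 b2) h23 h33 h34 !mulr0 !addr0 add0r.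
rewrite mulrN mulrC => /eqP; rewrite oppr_eq0 => /eqP /z ->.
have := pair b4; rewrite !(triE TT) (C2 x b4 b1) h14 (C2 x b4 b2) h24 (C2 x b4 b3) h34 h44 !mulr0 !addr0.
by rewrite mulrC => /z ->.
Qed.

Lemma hyperbolic_transpose : hyperbolic T x e b1 b3 b2 b4.
Proof.
case: hb => e0 [w1 w2 w3 w4] [h11 h22 h33 h44] [h12 h13 h24 h34] [h14 h23].
by split=> //; split=> //; rewrite C2.
Qed.

(** A new parameter on the same ruling, for which the line of old parameter [s] lies at infinity. *)
Lemma hyperbolic_rebase s : hyperbolic T x (- e) b2 (b1 + s *: b2) b4 (b3 + s *: b4).
Proof.
case: hb => e0 [w1 w2 w3 w4] [h11 h22 h33 h44] [h12 h13 h24 h34] [h14 h23].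
have lin u v : tancut T x u -> tancut T x v -> tancut T x (u + s *: v).
  by move=> Wu Wv; have := tancut_lin TT 1 s Wu Wv; rewrite scale1r.
have c21 := C2 x b2 b1; have c31 := C2 x b3 b1; have c41 := C2 x b4 b1.
have c32 := C2 x b3 b2; have c42 := C2 x b4 b2; have c43 := C2 x b4 b3.
split; first by rewrite oppr_eq0.
- by split=> //; apply: lin.
- by split=> //; rewrite !(triE TT) ?c21 ?c43 ?h11 ?h12 ?h22 ?h33 ?h34 ?h44; ring.
- split=> //; rewrite !(triE TT) ?c21 ?c43 ?c32 ?c41 ?h11 ?h12 ?h22 ?h33 ?h34 ?h44
    ?h13 ?h14 ?h23 ?h24; ring.
by split; rewrite !(triE TT) ?c21 ?c43 ?c32 ?c41 ?h11 ?h12 ?h22 ?h33 ?h34 ?h44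
    ?h13 ?h14 ?h23 ?h24; ring.
Qed.

(* The cubic restricted to the line [<A, B>] of a ruling of the quadric
   [T x v v = 0] has a double point exactly at the roots of [ruling_disc]. *)
Lemma ruling_flag s : (ruling_disc T b1 b2 b3 b4).[s] = 0 ->
  exists t u r q : k, let A := b1 + s *: b2 in let B := b3 + s *: b4 in
    [/\ t * q - u * r = 1, flag T x (t *: A + u *: B) (r *: A + q *: B) &
        good T x (t *: A + u *: B) (r *: A + q *: B) ->
        (ruling_disc T b1 b2 b3 b4)^`().[s] != 0].
Proof.
rewrite (ruling_disc_horner TT); set A := b1 + s *: b2; set B := b3 + s *: b4.
have EA : A = b1 + s *: b2 by []; have EB : B = b3 + s *: b4 by [].
clearbody A B => /disc3_root [t [u [tu0 e1 e2]]].
case: (hb) => e0 [w1 w2 w3 w4] [h11 h22 h33 h44] [h12 h13 h24 h34] [h14 h23].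
have c21 := C2 x b2 b1; have c31 := C2 x b3 b1; have c41 := C2 x b4 b1.
have c32 := C2 x b3 b2; have c42 := C2 x b4 b2; have c43 := C2 x b4 b3.
have [r [q D1]] : exists r q : k, t * q - u * r = 1.
  have [t0|t0] := eqVneq t 0; last by exists 0, t^-1; rewrite mulfV // mulr0 subr0.
  move: tu0; rewrite t0 eqxx /= => u0.
  by exists (- u^-1), 0; rewrite mul0r mulrN opprK mulfV // add0r.
exists t, u, r, q; rewrite /=.
have lin c u1 v1 : tancut T x u1 -> tancut T x v1 -> tancut T x (u1 + c *: v1).
  by move=> Wu Wv; have := tancut_lin TT 1 c Wu Wv; rewrite scale1r.
have WA : tancut T x A by rewrite EA; apply: lin.
have WB : tancut T x B by rewrite EB; apply: lin.
have AA : T x A A = 0 by rewrite EA !(triE TT) c21 h11 h12 h22; ring.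
have AB : T x A B = 0 by rewrite EA EB !(triE TT) h13 h14 h23 h24; ring.
have BB : T x B B = 0 by rewrite EB !(triE TT) c43 h33 h34 h44; ring.
have BA : T x B A = 0 by rewrite C2.
set y := t *: A + u *: B; set z := r *: A + q *: B.
have Ey : y = t *: A + u *: B by []; have Ez : z = r *: A + q *: B by [].
clearbody y z.
have Wy : tancut T x y by rewrite Ey; apply: tancut_lin.
have Wz : tancut T x z by rewrite Ez; apply: tancut_lin.
have CC := (C1 B A, fun a => C2 a B A).
have yyA : T y y A = 0 by rewrite Ey !(triE TT) !CC -[RHS]e1; ring.
have yyB : T y y B = 0 by rewrite Ey !(triE TT) !CC -[RHS]e2; ring.
have yyy : T y y y = 0 by rewrite [X in T _ _ X]Ey !(triE TT) yyA yyB; ring.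
have yyz : T y y z = 0 by rewrite Ez !(triE TT) yyA yyB; ring.
have xyz (a b c d : k) : T x (a *: A + b *: B) (c *: A + d *: B) = 0.
  by rewrite !(triE TT) AA AB BA BB; ring.
have fl : flag T x y z.
  split.
  - move=> a b c E.
    have a0 : a = 0.
      have := congr1 (fun M : V => M 0 0) E; rewrite !mxE (proj2 Wy) (proj2 Wz).
      by rewrite !(mulr0, addr0) => /eqP; rewrite mulf_eq0 (negPf x0) orbF => /eqP.
    have [|f1 _ f3 _] := @hyperbolic_ind (b * t + c * r) (s * (b * t + c * r)) (b * u + c * q) (s * (b * u + c * q)).
      rewrite -[RHS]E a0 Ey Ez EA EB; apply/rowP => j; rewrite !mxE; ring.
    have b0 : b * (t * q - u * r) = 0.
      have -> : b * (t * q - u * r) = q * (b * t + c * r) - r * (b * u + c * q) by ring.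
      by rewrite f1 f3; ring.
    have c0 : c * (t * q - u * r) = 0.
      have -> : c * (t * q - u * r) = t * (b * u + c * q) - u * (b * t + c * r) by ring.
      by rewrite f1 f3; ring.
    by move: b0 c0; rewrite D1 !mulr1.
  - by split; [ | case: Wy | rewrite Ey; apply: xyz | ].
  - by split; [case: Wz | rewrite Ey Ez; apply: xyz | | rewrite Ez; apply: xyz].
split=> // -[yzz cov].
rewrite (ruling_disc_deriv TT D1) -EA -EB -Ey -?Ez // mulf_neq0 ?expf_neq0 // mulf_neq0 ?pnatr_eq0 //.
(* Here [y'] is the velocity of [y] as the line moves in its ruling. Were T y y y' zero, [y'] would
   lie in the plane of the flag, hence be orthogonal to [A] and [B] for [T x], and the pairings of
   the hyperbolic basis would give t = u = 0. *)
set y' := t *: b2 + u *: b4; have Ey' : y' = t *: b2 + u *: b4 by [].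
clearbody y'; apply/eqP => yyy'.
have Wy' : tancut T x y' by rewrite Ey'; apply: tancut_lin.
have xyy' : T x y y' = 0.
  by rewrite Ey Ey' EA EB !(triE TT) c32 h12 h14 h22 h23 h24 h34 h44 c42 h24; ring.
have [||//|a [b [c E]]] := flag_ker TT fl cov (w := y').
- by case: Wy'.
- by [].
have a0 : a = 0.
  have := congr1 (fun M : V => M 0 0) E; rewrite /= (proj2 Wy') !mxE.
  rewrite (proj2 Wy) (proj2 Wz) !mulr0 !addr0 => /esym/eqP.
  by rewrite mulf_eq0 (negPf x0) orbF => /eqP.
have pA : T x A y' = 0.
  by rewrite E a0 Ey Ez !(triE TT) AA AB; ring.
have pB : T x B y' = 0.
  by rewrite E a0 Ey Ez !(triE TT) BA BB; ring.
have u0 : u = 0.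
  have : e * u = 0 by rewrite -[RHS]pA EA Ey' !(triE TT) h12 h14 h22 h24; ring.
  by move/eqP; rewrite mulf_eq0 (negPf e0) => /eqP.
have t0 : t = 0.
  have : e * t = 0.
    by rewrite -[RHS]oppr0 -pB EB Ey' !(triE TT) c32 h23 h34 c42 h24 h44; ring.
  by move/eqP; rewrite mulf_eq0 (negPf e0) => /eqP.
by move: tu0; rewrite t0 u0 eqxx.
Qed.

End Basis.
Hypothesis all_good : forall y z, flag T x y z -> good T x y z.

Definition family_spec (b1 b2 b3 b4 : V) (c : k * k) (Y Z : V) :=
  exists t u r q : k, let A := c.1 *: b1 + c.2 *: b2 in let B := c.1 *: b3 + c.2 *: b4 in
    [/\ t * q - u * r = 1, flag T x Y Z, Y = t *: A + u *: B & Z = r *: A + q *: B].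

Lemma ruling_family e b1 b2 b3 b4 : hyperbolic T x e b1 b2 b3 b4 ->
  exists (c : 'I_12 -> k * k) (Y Z : 'I_12 -> V),
    (forall i, family_spec b1 b2 b3 b4 (c i) (Y i) (Z i)) /\
    (forall i j, i != j -> (c i).1 * (c j).2 - (c i).2 * (c j).1 != 0).
Proof.
(* An identically zero discriminant would have zero derivative at its roots, against their
   simplicity at good flags. The nonroot [s1] is then moved to infinity, so that the coefficient of
   degree 12 is nonzero. *)
move=> hb; have [s1 Ds1] : exists s1, (ruling_disc T b1 b2 b3 b4).[s1] != 0.
  apply: poly_nonroot; apply/eqP => D0.
  have [|t [u [r [q [_ fl]]]]] := ruling_flag hb (s := 0); first by rewrite D0 horner0.
  by move/(_ (all_good fl)); rewrite D0 derivC horner0 eqxx.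
have hb' := hyperbolic_rebase hb s1.
set b2' := b1 + s1 *: b2 in hb'; set b4' := b3 + s1 *: b4 in hb'.
have [||s [s_inj sP]] := simple_roots (ruling_disc_lead T b2 b2' b4 b4').
- by rewrite -(ruling_disc_horner TT).
- move=> s /(ruling_flag hb') [t [u [r [q [_ fl]]]]]; apply; exact: all_good.
pose c i : k * k := (s i, 1 + s i * s1).
have H i : exists YZ : V * V, family_spec b1 b2 b3 b4 (c i) YZ.1 YZ.2.
  have [t [u [r [q [D1 fl _]]]]] := ruling_flag hb' (sP i).
  have EA : b2 + s i *: b2' = (c i).1 *: b1 + (c i).2 *: b2.
    by rewrite /b2' /=; apply/rowP => j; rewrite !mxE; ring.
  have EB : b4 + s i *: b4' = (c i).1 *: b3 + (c i).2 *: b4.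
    by rewrite /b4' /=; apply/rowP => j; rewrite !mxE; ring.
  move: fl; rewrite EA EB => fl.
  by eexists (_, _); exists t, u, r, q; split; [exact: D1 | exact: fl | |].
have /fin_all_exists [YZ YZP] := H.
exists c, (fun i => (YZ i).1), (fun i => (YZ i).2); split=> // i j ij.
have -> : (c i).1 * (c j).2 - (c i).2 * (c j).1 = s i - s j by rewrite /=; ring.
by rewrite subr_eq0; apply: contra ij => /eqP /s_inj ->.
Qed.

Lemma family_distinct e b1 b2 b3 b4 c c' Y Z Y' Z' : hyperbolic T x e b1 b2 b3 b4 ->
  family_spec b1 b2 b3 b4 c Y Z -> family_spec b1 b2 b3 b4 c' Y' Z' ->
  c.1 * c'.2 - c.2 * c'.1 != 0 -> forall m, Y' != m *: Y.
Proof.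
move=> hb [t [u [r [q /= [D1 _ -> _]]]]] [t' [u' [r' [q' /= [D1' _ -> _]]]]] cc m.
apply/negP => /eqP E.
have [|e1 e2 e3 e4] := hyperbolic_ind hb (r1 := t' * c'.1 - m * t * c.1)
    (r2 := t' * c'.2 - m * t * c.2) (r3 := u' * c'.1 - m * u * c.1) (r4 := u' * c'.2 - m * u * c.2).
  by rewrite -(subrr (m *: (t *: (c.1 *: b1 + c.2 *: b2) + u *: (c.1 *: b3 + c.2 *: b4)))) -{1}E;
     apply/rowP => j; rewrite !mxE; ring.
have t0 : t' * (c.1 * c'.2 - c.2 * c'.1) = 0.
  have -> : t' * (c.1 * c'.2 - c.2 * c'.1) =
    c.1 * (t' * c'.2 - m * t * c.2) - c.2 * (t' * c'.1 - m * t * c.1) by ring.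
  by rewrite e1 e2; ring.
have u0 : u' * (c.1 * c'.2 - c.2 * c'.1) = 0.
  have -> : u' * (c.1 * c'.2 - c.2 * c'.1) =
    c.1 * (u' * c'.2 - m * u * c.2) - c.2 * (u' * c'.1 - m * u * c.1) by ring.
  by rewrite e3 e4; ring.
move: t0 u0 D1' => /eqP; rewrite mulf_eq0 (negPf cc) orbF => /eqP -> /eqP.
rewrite mulf_eq0 (negPf cc) orbF => /eqP -> /eqP.
by rewrite !mul0r subrr eq_sym oner_eq0.
Qed.

(* Two tangent planes through the same line coincide, but planes of opposite
   rulings meet in a line only. *)
Lemma families_distinct e b1 b2 b3 b4 c c' Y Z Y' Z' : hyperbolic T x e b1 b2 b3 b4 ->
  family_spec b1 b2 b3 b4 c Y Z -> family_spec b1 b3 b2 b4 c' Y' Z' ->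
  forall m, Y' != m *: Y.
Proof.
move=> hb [t [u [r [q /= [D1 fl EY EZ]]]]] [t' [u' [r' [q' /= [D1' fl' EY' EZ']]]]] m.
apply/negP => /eqP E; case: (hb) => _ [w1 w2 w3 w4] _ _ _.
have WY : tancut T x Y by rewrite EY; do ![apply: tancut_lin => //].
have WZ : tancut T x Z by rewrite EZ; do ![apply: tancut_lin => //].
have WZ' : tancut T x Z' by rewrite EZ'; do ![apply: tancut_lin => //].
have m0 : m != 0.
  apply: contraTneq isT => m0; case: fl' => ind _ _; have [|_ /eqP] := ind 0 1 0; last by rewrite oner_eq0.
  by rewrite E m0 !scale0r scaler0 !addr0.
have [h5 h6 h7 h8] := flag_plane fl'.
have [//|||a [b [d ZE]]] := flag_ker TT fl (proj2 (all_good fl)) (w := Z').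
- by move: h6; rewrite E !(triE TT) => /eqP; rewrite mulf_eq0 (negPf m0) => /eqP.
- move: h7; rewrite E !(triE TT) mulrA => /eqP; rewrite mulf_eq0 mulf_eq0 (negPf m0) => /eqP //.
have a0 : a = 0.
  have := congr1 (fun M : V => M 0 0) ZE; rewrite /= (proj2 WZ') !mxE (proj2 WY) (proj2 WZ).
  by rewrite !mulr0 !addr0 => /esym/eqP; rewrite mulf_eq0 (negPf x0) orbF => /eqP.
move: ZE; rewrite a0 scale0r add0r => ZE.
set A := c.1 *: b1 + c.2 *: b2 in EY EZ; set B := c.1 *: b3 + c.2 *: b4 in EY EZ.
set A' := c'.1 *: b1 + c'.2 *: b3 in EY' EZ'; set B' := c'.1 *: b2 + c'.2 *: b4 in EY' EZ'.
have [p1 [q1 EA']] : exists p1 q1 : k, A' = p1 *: A + q1 *: B.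
  exists (q' * m * t - u' * (b * t + d * r)), (q' * m * u - u' * (b * u + d * q)).
  have -> : A' = q' *: Y' - u' *: Z'.
    by rewrite EY' EZ' -[A' in LHS]scale1r -D1'; apply/rowP => j; rewrite !mxE; ring.
  by rewrite ZE E EY EZ; apply/rowP => j; rewrite !mxE; ring.
have [p2 [q2 EB']] : exists p2 q2 : k, B' = p2 *: A + q2 *: B.
  exists (t' * (b * t + d * r) - r' * m * t), (t' * (b * u + d * q) - r' * m * u).
  have -> : B' = t' *: Z' - r' *: Y'.
    by rewrite EY' EZ' -[B' in LHS]scale1r -D1'; apply/rowP => j; rewrite !mxE; ring.
  by rewrite ZE E EY EZ; apply/rowP => j; rewrite !mxE; ring.
have [|f1 f2 f3 f4] := hyperbolic_ind hb (r1 := c'.1 - p1 * c.1) (r2 := - (p1 * c.2))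
    (r3 := c'.2 - q1 * c.1) (r4 := - (q1 * c.2)).
  by rewrite -(subrr A') {2}EA' /A' /A /B; apply/rowP => j; rewrite !mxE; ring.
have [|g1 g2 g3 g4] := hyperbolic_ind hb (r1 := - (p2 * c.1)) (r2 := c'.1 - p2 * c.2)
    (r3 := - (q2 * c.1)) (r4 := c'.2 - q2 * c.2).
  by rewrite -(subrr B') {2}EB' /B' /A /B; apply/rowP => j; rewrite !mxE; ring.
have [c10 c20] : c'.1 = 0 /\ c'.2 = 0.
  move/eqP: f1; rewrite subr_eq0 => /eqP f1; move/eqP: f3; rewrite subr_eq0 => /eqP f3.
  move/eqP: g2; rewrite subr_eq0 => /eqP g2; move/eqP: g4; rewrite subr_eq0 => /eqP g4.
  have [c0|c0] := eqVneq c.1 0; first by rewrite f1 f3 c0 !mulr0.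
  move/eqP: g1; rewrite oppr_eq0 mulf_eq0 (negPf c0) orbF => /eqP p20.
  move/eqP: g3; rewrite oppr_eq0 mulf_eq0 (negPf c0) orbF => /eqP q20.
  by rewrite g2 g4 p20 q20 !mul0r.
case: fl' => ind _ _; have [|_ /eqP] := ind 0 1 0; last by rewrite oner_eq0.
by rewrite EY' /A' /B' c10 c20; apply/rowP => j; rewrite !mxE; ring.
Qed.

Hypothesis nondeg : forall w, (forall v, T x w v = 0) -> w = 0.

Theorem fibre24 : exists Y Z : 'I_24 -> V,
  [/\ forall i, flag T x (Y i) (Z i), forall i, Y i 0 0 = 0 &
      forall i j, i != j -> forall m, Y j != m *: Y i].
Proof.
have [b1 [b2 [b3 [b4 hb]]]] := exists_hyperbolic TT xX x0 nondeg.
have hb' := hyperbolic_transpose hb.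
have [c [Y [Z [YZ cc]]]] := ruling_family hb.
have [c' [Y' [Z' [YZ' cc']]]] := ruling_family hb'.
pose f (i : 'I_24) := split (i : 'I_(12 + 12)).
have f_inj : injective f by exact: can_inj (@splitK 12 12).
have Yflag i : flag T x (Y i) (Z i) by case: (YZ i) => ? [? [? [? []]]].
have Yflag' i : flag T x (Y' i) (Z' i) by case: (YZ' i) => ? [? [? [? []]]].
have Ytan i : tancut T x (Y i).
  case: (YZ i) => t [u [r [q [_ _ -> _]]]]; case: hb => _ [w1 w2 w3 w4] _ _ _.
  by do ![apply: tancut_lin => //].
have Ytan' i : tancut T x (Y' i).
  case: (YZ' i) => t [u [r [q [_ _ -> _]]]]; case: hb => _ [w1 w2 w3 w4] _ _ _.
  by do ![apply: tancut_lin => //].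
have sym (a b : V) : (forall m, b != m *: a) -> a != 0 -> forall m, a != m *: b.
  move=> H a0 m; apply/negP => /eqP E; have [m0|m0] := eqVneq m 0.
    by move: a0; rewrite E m0 scale0r eqxx.
  by have /eqP[] := H m^-1; rewrite E scalerA mulVf ?scale1r.
have Y0 i : Y i != 0.
  case: (Yflag i) => ind _ _; apply/eqP => Yi0; have [|_ /eqP] := ind 0 1 0; last by rewrite oner_eq0.
  by rewrite Yi0 !scale0r scaler0 !addr0.
exists (fun i => match f i with inl a => Y a | inr a => Y' a end).
exists (fun i => match f i with inl a => Z a | inr a => Z' a end).
split=> [i|i|i j].
- by case: (f i).
- by case: (f i) => a; [case: (Ytan a) | case: (Ytan' a)].
rewrite -(inj_eq f_inj); case: (f i) => a; case: (f j) => b ab.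
- by apply: (family_distinct hb (YZ a) (YZ b)); apply: cc; apply: contra ab => /eqP ->.
- exact: (families_distinct hb (YZ a) (YZ' b)).
- by apply: sym (Y0 b); apply: (families_distinct hb (YZ b) (YZ' a)).
by apply: (family_distinct hb' (YZ' a) (YZ' b)); apply: cc'; apply: contra ab => /eqP ->.
Qed.

End Fibre.

(** * Forms with a given flag *)

Section MCoefAlgebra.
Variables (k : comNzRingType) (T : Type) (C : (T -> k) -> Prop) (n : nat).
Hypothesis algC : funalg C.

Definition falg_mcoef (F : T -> {mpoly k[n]}) := forall m, C (fun t => (F t)@_m).

Lemma falg_mcoef_const p : falg_mcoef (fun=> p).
Proof. by move=> m; apply: falgC. Qed.

Lemma falg_mcoefZ a F : C a -> falg_mcoef F -> falg_mcoef (fun t => a t *: F t).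
Proof.
move=> Ca CF m; apply: falg_ext (falgM algC Ca (CF m)) _ => t.
by rewrite mcoeffZ.
Qed.

Lemma falg_mcoefD F G : falg_mcoef F -> falg_mcoef G -> falg_mcoef (fun t => F t + G t).
Proof.
by move=> CF CG m; apply: falg_ext (falgD algC (CF m) (CG m)) _ => t; rewrite mcoeffD.
Qed.

Lemma falg_mcoefM F G : falg_mcoef F -> falg_mcoef G -> falg_mcoef (fun t => F t * G t).
Proof.
move=> CF CG m.
pose H (b : 'X_{1..n < (mdeg m).+1, (mdeg m).+1}) t := (F t)@_b.1 * (G t)@_b.2.
have CH b : C (H b) by apply: falgM.
apply: falg_ext (falg_sum algC (index_enum _) (fun b : 'X_{1..n < (mdeg m).+1, (mdeg m).+1} =>
   m == (b.1 + b.2)%MM) CH) _ => t.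
by rewrite mcoeffM.
Qed.

Lemma falg_mcoef_sum I (r : seq I) F :
  (forall i, falg_mcoef (F i)) -> falg_mcoef (fun t => \sum_(i <- r) F i t).
Proof.
move=> CF; elim: r => [|i r IH] m.
  by apply: falg_ext (falg_mcoef_const 0 m) _ => t; rewrite big_nil.
by apply: falg_ext (falg_mcoefD (CF i) IH m) _ => t; rewrite big_cons.
Qed.

Lemma falg_mcoef_prod I (r : seq I) F :
  (forall i, falg_mcoef (F i)) -> falg_mcoef (fun t => \prod_(i <- r) F i t).
Proof.
move=> CF; elim: r => [|i r IH] m.
  by apply: falg_ext (falg_mcoef_const 1 m) _ => t; rewrite big_nil.
by apply: falg_ext (falg_mcoefM (CF i) IH m) _ => t; rewrite big_cons.
Qed.

Lemma falg_mcoefX F d : falg_mcoef F -> falg_mcoef (fun t => F t ^+ d).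
Proof.
move=> CF; elim: d => [|d IH] m.
  by apply: falg_ext (falg_mcoef_const 1 m) _ => t; rewrite expr0.
by apply: falg_ext (falg_mcoefM CF IH m) _ => t; rewrite exprS.
Qed.

End MCoefAlgebra.

Section Coefficients.
Variable k : numClosedFieldType.
Local Notation V := 'rV[k]_6.
Local Notation N := (nb_monomials 6 3).

Definition cmon (i : 'I_N) : 'X_{1..6} := val (val (enum_val i : monomial_of_degree 6 3)).

Lemma cmon_deg i : mdeg (cmon i) = 3%N.
Proof. by rewrite /cmon; case: (enum_val i) => m /= /eqP. Qed.

Lemma cmon_inj : injective cmon.
Proof. by move=> i j /val_inj/val_inj/enum_val_inj. Qed.

Lemma cmon_surj m : mdeg m = 3%N -> exists i, cmon i = m.
Proof.
move=> md; have m4 : (mdeg m < 4)%N by rewrite md.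
have md' : mdeg (BMultinom m4) == 3 by rewrite /= md.
by exists (enum_rank (Sub (BMultinom m4) md' : monomial_of_degree 6 3)); rewrite /cmon enum_rankK.
Qed.

Definition coefs (f : {mpoly k[6]}) : 'rV[k]_N := \row_i f@_(cmon i).

Lemma form_of_homog (a : 'rV[k]_N) : form_of a \is 3.-homog.
Proof.
rewrite /form_of; apply: rpred_sum => i _; apply: rpredZ.
by rewrite dhomogX; apply/eqP/(cmon_deg i).
Qed.

Lemma coefs_form_of (a : 'rV[k]_N) : coefs (form_of a) = a.
Proof.
apply/rowP => i; rewrite mxE /form_of raddf_sum /= (bigD1 i) //=.
rewrite mcoeffZ mcoeffX -/(cmon i) eqxx mulr1 big1 ?addr0 // => j ji.
by rewrite mcoeffZ mcoeffX -/(cmon j) (inj_eq cmon_inj) (negPf ji) mulr0.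
Qed.

Lemma form_of_coefs f : f \is 3.-homog -> form_of (coefs f) = f.
Proof.
move=> f3; apply/mpolyP => m; have [md|md] := eqVneq (mdeg m) 3%N.
  have [i <-] := cmon_surj md.
  by have := congr1 (fun a : 'rV_N => a 0 i) (coefs_form_of (coefs f)); rewrite mxE => ->; rewrite mxE.
by rewrite (dhomog_nemf_coeff (form_of_homog _) md) (dhomog_nemf_coeff f3 md).
Qed.

Definition sub_lin (h : 'M[k]_6) (f : {mpoly k[6]}) : {mpoly k[6]} :=
  mmap (@mpolyC 6 k) (fun i => \sum_j h j i *: 'X_j) f.

Lemma ev_sub h f x : ev (sub_lin h f) x = ev f (x *m h).
Proof.
rewrite /sub_lin; elim/mpoly_alg_ind: f => [c|i|p q IHp IHq|p q IHp IHq].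
- by rewrite mmapC !evC.
- rewrite mmapX mmap1U evX mxE ev_sum; apply: eq_bigr => j _.
  by rewrite evZ evX mulrC.
- by rewrite mmapD !evD IHp IHq.
- by rewrite rmorphM !evM IHp IHq.
Qed.

Lemma pol_sub h f x y z : pol (sub_lin h f) x y z = pol f (x *m h) (y *m h) (z *m h).
Proof. by rewrite /pol !ev_sub !mulmxDl. Qed.

Lemma sub_homog h f : f \is 3.-homog -> sub_lin h f \is 3.-homog.
Proof.
elim/cubic_ind => [|f1 f2 h1 h2|c i j l].
- by rewrite /sub_lin mmap0 dhomog0.
- by rewrite /sub_lin mmapD; apply: rpredD.
have lin a : \sum_j h j a *: 'X_j \is 1.-homog.
  by apply: rpred_sum => b _; apply: rpredZ; rewrite dhomogX; apply/eqP/mdeg1.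
rewrite /sub_lin -mul_mpolyC !rmorphM /= mmapC !mmapX !mmap1U mul_mpolyC.
by apply: rpredZ; apply: (dhomogM (dhomogM (lin i) (lin j)) (lin l)).
Qed.

Lemma sub_mul h h' f : sub_lin h' (sub_lin h f) = sub_lin (h' *m h) f.
Proof. by apply: mpoly_ext => x; rewrite !ev_sub mulmxA. Qed.

Lemma sub1 f : sub_lin 1%:M f = f.
Proof. by apply: mpoly_ext => x; rewrite ev_sub mulmx1. Qed.

Variables (T : Type) (C : (T -> k) -> Prop).
Hypothesis algC : funalg C.

Lemma falg_coefs_sub (h : T -> 'M[k]_6) (b : T -> 'rV[k]_N) i :
  (forall i j, C (fun t => h t i j)) -> (forall i, C (fun t => b t 0 i)) ->
  C (fun t => coefs (sub_lin (h t) (form_of (b t))) 0 i).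
Proof.
move=> Ch Cb.
have H : falg_mcoef C (fun t => \sum_j b t 0 j *: \prod_(l < 6)
    (\sum_a h t a l *: 'X_a : {mpoly k[6]}) ^+ (cmon j l)).
  apply: (falg_mcoef_sum algC _ (fun j : 'I_N => _)) => j; apply: falg_mcoefZ => //.
  apply: (falg_mcoef_prod algC _ (fun l : 'I_6 => _)) => l; apply: falg_mcoefX => //.
  apply: (falg_mcoef_sum algC _ (fun a : 'I_6 => _)) => a; apply: falg_mcoefZ => //.
  exact: falg_mcoef_const.
apply: falg_ext (H (cmon i)) _ => t; rewrite mxE; congr mcoeff.
rewrite /sub_lin /form_of raddf_sum /=; apply: eq_bigr => j _.
by rewrite mmapZ mmapX mul_mpolyC.
Qed.

Lemma falg_ev_form (a : T -> 'rV[k]_N) (x : T -> V) :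
  (forall i, C (fun t => a t 0 i)) -> (forall i, C (fun t => x t 0 i)) ->
  C (fun t => ev (form_of (a t)) (x t)).
Proof.
move=> Ca Cx; pose F i t := a t 0 i * \prod_l x t 0 l ^+ cmon i l.
apply: (@falg_ext _ _ _ (fun t => \sum_i F i t)).
  apply: (falg_sum algC _ _ (fun i => _)) => i; apply: falgM => //.
  by apply: (falg_prod algC _ _ (fun l => _)) => l; apply: falgX.
by move=> t; rewrite /form_of ev_sum; apply: eq_bigr => i _; rewrite evZ evXm.
Qed.

Lemma falg_pol (a : T -> 'rV[k]_N) (x y z : T -> V) :
  (forall i, C (fun t => a t 0 i)) -> (forall i, C (fun t => x t 0 i)) ->
  (forall i, C (fun t => y t 0 i)) -> (forall i, C (fun t => z t 0 i)) ->
  C (fun t => pol (form_of (a t)) (x t) (y t) (z t)).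
Proof.
move=> Ca Cx Cy Cz.
have add (u v : T -> V) : (forall i, C (fun t => u t 0 i)) ->
    (forall i, C (fun t => v t 0 i)) -> forall i, C (fun t => (u t + v t) 0 i).
  by move=> Cu Cv i; apply: falg_ext (falgD algC (Cu i) (Cv i)) _ => t; rewrite mxE.
have Cxy := add _ _ Cx Cy; have Cxz := add _ _ Cx Cz; have Cyz := add _ _ Cy Cz.
have Cxyz := add _ _ Cxy Cz; have E u Cu := @falg_ev_form a u Ca Cu.
apply: falg_ext (falgZ algC (6%:R)^-1 (falgD algC (falgD algC (falgD algC (falgB algC
  (falgB algC (falgB algC (E _ Cxyz) (E _ Cxy)) (E _ Cxz)) (E _ Cyz)) (E _ Cx)) (E _ Cy))
  (E _ Cz))) _ => t.
by rewrite /pol mulrC.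
Qed.

End Coefficients.

Section MonomialValues.
Variable k : numClosedFieldType.
Local Notation V := 'rV[k]_6.

Definition m3 (i j l : 'I_6) : 'X_{1..6} := (U_(i) + U_(j) + U_(l))%MM.

Lemma m3_deg i j l : mdeg (m3 i j l) = 3%N.
Proof. by rewrite !mdegD !mdeg1. Qed.

Definition unitv (i : 'I_6) : V := delta_mx 0 i.

(** The constant between a coefficient of a cubic and its polar value at basis vectors; being
    nonzero, it lets the vanishing of one be read as that of the other. *)
Definition m3val i j l : k := pol 'X_[m3 i j l] (unitv i) (unitv j) (unitv l).

Lemma m3val_neq0 i j l : m3val i j l != 0.
Proof.
rewrite /m3val /m3 !mpolyXD polM3 mulf_neq0 ?invr_neq0 ?natr6_neq0 // !mxE !eqxx /=.
by apply: lt0r_neq0; rewrite !mulr1 !ltr_wpDr ?mulr_ge0 ?ler0n ?ltr01.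
Qed.

Lemma pol_m3 a b c i j l : pol 'X_[m3 a b c] (unitv i) (unitv j) (unitv l) =
  (m3 a b c == m3 i j l)%:R * m3val i j l.
Proof.
have [->|ne] := eqVneq; first by rewrite mul1r.
rewrite mul0r /m3 !mpolyXD polM3 !mxE !eqxx /=.
have z (a' b' c' : 'I_6) : m3 a' b' c' = m3 a b c ->
   (a' == i)%:R * (b' == j)%:R * (c' == l)%:R = 0 :> k.
  move=> E; have [ai|] := eqVneq a' i; last by rewrite !mul0r.
  have [bj|] := eqVneq b' j; last by rewrite mulr0 mul0r.
  have [cl|] := eqVneq c' l; last by rewrite mulr0.
  by case/negP: ne; rewrite -E ai bj cl.
have C1 (p q r : 'I_6) : m3 p q r = m3 q p r by rewrite /m3 [(U_(p) + _)%MM]addmC.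
have C2 (p q r : 'I_6) : m3 p q r = m3 p r q by rewrite /m3 -addmA [(U_(q) + _)%MM]addmC addmA.
have z1 := z a b c erefl; have z2 := z a c b (esym (C2 a b c)).
have z3 := z b a c (C1 b a c).
have z4 : m3 c a b = m3 a b c by rewrite C1 C2.
have {}z4 := z _ _ _ z4.
have z5 : m3 b c a = m3 a b c by rewrite C2 C1.
have {}z5 := z _ _ _ z5.
have z6 : m3 c b a = m3 a b c by rewrite C1 C2 C1.
have {}z6 := z _ _ _ z6.
rewrite -[RHS](mul0r (6%:R)^-1); congr (_ / _).
transitivity ((a == i)%:R * (b == j)%:R * (c == l)%:R + (a == i)%:R * (c == j)%:R * (b == l)%:R
  + (b == i)%:R * (a == j)%:R * (c == l)%:R + (c == i)%:R * (a == j)%:R * (b == l)%:R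
  + (b == i)%:R * (c == j)%:R * (a == l)%:R + (c == i)%:R * (b == j)%:R * (a == l)%:R : k).
  by ring.
by rewrite z1 z2 z3 z4 z5 z6 !addr0.
Qed.

Lemma mcoeff_pol (f : {mpoly k[6]}) i j l : f \is 3.-homog ->
  f@_(m3 i j l) * m3val i j l = pol f (unitv i) (unitv j) (unitv l).
Proof.
elim/cubic_ind => [|f1 f2 h1 h2|c a b d].
- by rewrite mcoeff0 mul0r pol0.
- by rewrite mcoeffD polD mulrDl h1 h2.
rewrite mcoeffZ polZ -!mpolyXD -/(m3 a b d) pol_m3 mcoeffX.
by rewrite -mulrA.
Qed.

End MonomialValues.

(** * Dimension counts in moving frames *)

Section FrameRelation.
Variable k : numClosedFieldType.
Local Notation V := 'rV[k]_6.
Local Notation N := (nb_monomials 6 3).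

Lemma falg_row_mx T (C : (T -> k) -> Prop) a b (u : T -> 'rV[k]_a) (v : T -> 'rV[k]_b) :
  (forall i, C (fun t => u t 0 i)) -> (forall i, C (fun t => v t 0 i)) -> funalg C ->
  forall i, C (fun t => row_mx (u t) (v t) 0 i).
Proof.
move=> pu pv alg i; case: (splitP i) => j Ej.
  rewrite (_ : i = lshift b j); last exact: ord_inj.
  by apply: falg_ext (pu j) _ => // t; rewrite row_mxEl.
rewrite (_ : i = rshift a j); last exact: ord_inj.
by apply: falg_ext (pv j) _ => // t; rewrite row_mxEr.
Qed.

Lemma row_mx_polyf n a b (u : 'rV[k]_n -> 'rV[k]_a) (v : 'rV[k]_n -> 'rV[k]_b) :
  (forall i, polyf (fun t => u t 0 i)) -> (forall i, polyf (fun t => v t 0 i)) ->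
  forall i, polyf (fun t => row_mx (u t) (v t) 0 i).
Proof. by move=> pu pv; apply: falg_row_mx => //; exact: polyf_alg. Qed.

Lemma lsubmx_polyf a b i : polyf (fun v : 'rV[k]_(a + b) => lsubmx v 0 i).
Proof. by apply: polyf_ext (@polyfX k _ (lshift b i)) _ => v; rewrite mxE. Qed.

Lemma rsubmx_polyf a b i : polyf (fun v : 'rV[k]_(a + b) => rsubmx v 0 i).
Proof. by apply: polyf_ext (@polyfX k _ (rshift a i)) _ => v; rewrite mxE. Qed.

(* A dimension count: [nw] parameters of the frame [g w] against [size Bs]
   conditions on the coefficients of a form in this frame and [s] functions. *)
Lemma frame_relation nw s (g ginv : 'rV[k]_nw -> 'M[k]_6) (Bs : seq 'I_N)
    (J : 'rV[k]_nw -> 'rV[k]_N -> k) (t : 'rV[k]_nw -> 'rV[k]_s) :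
  uniq Bs -> (nw <= size Bs + s)%N ->
  (forall w, g w *m ginv w = 1%:M) ->
  (forall i j, polyf (fun w => ginv w i j)) -> (forall i, polyf (fun w => t w 0 i)) ->
  polyf (fun v : 'rV_(nw + N) => J (lsubmx v) (rsubmx v)) ->
  (exists w (b : 'rV_N), (forall i, i \in Bs -> b 0 i = 0) /\ J w b != 0) ->
  exists2 c : {mpoly k[N + s]}, c != 0 &
    forall w f, f \is 3.-homog ->
      (forall i, i \in Bs -> coefs (sub_lin (g w) f) 0 i = 0) ->
      J w (coefs (sub_lin (g w) f)) = 0 -> ev c (row_mx (coefs f) (t w)) = 0.
Proof.
move=> uBs dims ggi pgi pt pJ [w0 [b0 [b0B Jb0]]].
pose D := [pred i : 'I_N | i \notin Bs].
have cD : (#|D| + size Bs = N)%N.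
  have -> : size Bs = #|[predC D]|.
    by rewrite -(card_uniqP uBs); apply: eq_card => i; rewrite !inE negbK.
  by rewrite cardC card_ord.
pose bb (v : 'rV[k]_#|D|) : 'rV[k]_N :=
  \row_i \sum_(j < #|D|) v 0 j * (i == enum_val j)%:R.
pose sel (b : 'rV[k]_N) : 'rV[k]_#|D| := \row_j b 0 (enum_val j).
have bbK (b : 'rV_N) : (forall i, i \in Bs -> b 0 i = 0) -> bb (sel b) = b.
  move=> bB; apply/rowP => i; rewrite mxE; have [iB|iB] := boolP (i \in Bs).
    rewrite bB // big1 // => j _; case: eqP => [ij|]; last by rewrite mulr0.
    by have := enum_valP j; rewrite inE -ij iB.
  have iD : i \in D by rewrite inE.
  have [l ->] : exists l : 'I_#|D|, i = enum_val l.
    by exists (enum_rank_in iD i); rewrite enum_rankK_in.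
  rewrite (bigD1 l) //= eqxx mulr1 mxE big1 ?addr0 // => j jl.
  by rewrite (inj_eq enum_val_inj) eq_sym (negPf jl) mulr0.
have algm n := polyf_alg k n.
have pbb i : polyf (fun v : 'rV[k]_(nw + #|D|) => bb (rsubmx v) 0 i).
  have H (j : 'I_#|D|) := falgM (algm _) (rsubmx_polyf nw j) (falgC (algm _) (i == enum_val j)%:R).
  apply: polyf_ext (falg_sum (algm _) (index_enum _) xpredT H) _ => v.
  by rewrite [RHS]mxE; apply: eq_bigr => j _; rewrite !mxE.
pose w_ (v : 'rV[k]_(nw + #|D|)) := lsubmx v.
pose b_ (v : 'rV[k]_(nw + #|D|)) := bb (rsubmx v).
have pw i : polyf (fun v => w_ v 0 i) by exact: lsubmx_polyf.
(* A form with the prescribed vanishing coefficients in the frame is recovered from the frame and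
   its remaining coefficients. The source has dimension nw + N - size Bs, which is at most the
   dimension N + s of the target. *)
pose phi v := row_mx (coefs (sub_lin (ginv (w_ v)) (form_of (b_ v)))) (t (w_ v)).
have pphi i : polyf (fun v => phi v 0 i).
  apply: row_mx_polyf => j; last exact: (falg_polyf (algm _) pw (pt j)).
  by apply: falg_coefs_sub => // a b; apply: (falg_polyf (algm _) pw (pgi a b)).
have pB : polyf (fun v => J (w_ v) (b_ v)).
  have [Q QJ] := pJ.
  have pwb : forall i, polyf (fun v => row_mx (w_ v) (b_ v) 0 i) by apply: row_mx_polyf.
  apply: polyf_ext (falg_ev Q (algm _) pwb) _ => v.
  by rewrite -QJ row_mxKl row_mxKr.
have [||c c0 cP] := polyf_image_in_hypersurface _ pphi pB.
- by move: dims cD; lia.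
- exists (row_mx w0 (sel b0)); rewrite /w_ /b_ row_mxKl row_mxKr bbK //.
exists c => // w f f3 fB Jf.
have := cP (row_mx w (sel (coefs (sub_lin (g w) f)))).
rewrite /phi /w_ /b_ row_mxKl row_mxKr bbK // => /(_ Jf).
rewrite form_of_coefs ?sub_homog // sub_mul.
by have /mulmx1C -> := ggi w; rewrite sub1.
Qed.

End FrameRelation.

Section Frames.
Variable k : numClosedFieldType.
Local Notation V := 'rV[k]_6.
Local Notation N := (nb_monomials 6 3).

(* The rows 0, 1 and 2 of a frame use the parameters 0-4, 5-8 and 9-11. *)
Definition fpos (i j : nat) : nat :=
  match i with 0 => j - 1 | 1 => j + 3 | _ => j + 6 end.

Definition uni (r nw : nat) (w : 'rV[k]_nw.+1) : 'M[k]_6 :=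
  \matrix_(i, j) (if i == j then 1 else
                  if (i < r)%N && (i < j)%N then w 0 (inord (fpos i j)) else 0).

Definition frame r (sigma : 'S_6) nw (w : 'rV[k]_nw.+1) : 'M[k]_6 :=
  uni r w *m perm_mx sigma.

Lemma frameE r sigma nw (w : 'rV[k]_nw.+1) i j :
  frame r sigma w i (sigma j) = uni r w i j.
Proof.
have -> : frame r sigma w = col_perm sigma^-1%g (uni r w) by rewrite col_permE invgK.
by rewrite mxE permK.
Qed.

Lemma det_uni r nw (w : 'rV[k]_nw.+1) : \det (uni r w) = 1.
Proof.
rewrite -det_tr det_trig; last first.
  apply/is_trig_mxP => i j ij; rewrite !mxE; case: eqP => [ji|_].
    by rewrite ji ltnn in ij.
  by rewrite [(j < i)%N]ltnNge (ltnW ij) andbF.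
by rewrite big1 // => i _; rewrite !mxE eqxx.
Qed.

Lemma frame_unit r sigma nw (w : 'rV[k]_nw.+1) : frame r sigma w \in unitmx.
Proof. by rewrite unitmx_mul unitmx_perm unitmxE det_uni unitr1. Qed.

Lemma frameV r sigma nw (w : 'rV[k]_nw.+1) : frame r sigma w *m invmx (frame r sigma w) = 1%:M.
Proof. by rewrite mulmxV ?frame_unit. Qed.

Lemma frame_polyf r sigma nw i j : polyf (fun w : 'rV[k]_nw.+1 => frame r sigma w i j).
Proof.
have alg := polyf_alg k nw.+1.
have -> : j = sigma (sigma^-1%g j) by rewrite permKV.
set l := (sigma^-1%g j).
apply: (@polyf_ext _ _ (fun w => uni r w i l)) => [|w]; last by rewrite frameE.
case Eij: (i == l).
  by apply: polyf_ext (falgC alg 1) _ => w; rewrite mxE Eij.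
case Er: ((i < r)%N && (i < l)%N).
  by apply: polyf_ext (@polyfX k _ (inord (fpos i l))) _ => w; rewrite mxE Eij Er.
by apply: polyf_ext (falgC alg 0) _ => w; rewrite mxE Eij Er.
Qed.

Lemma frame_inv_polyf r sigma nw i j :
  polyf (fun w : 'rV[k]_nw.+1 => invmx (frame r sigma w) i j).
Proof.
have alg := polyf_alg k nw.+1.
have H : polyf (fun w : 'rV[k]_nw.+1 => (\adj (frame r sigma w)) i j).
  by apply: falg_adj => // a b; apply: frame_polyf.
apply: polyf_ext (falgZ alg (\det (perm_mx sigma : 'M[k]_6))^-1 H) _ => w.
by rewrite /invmx frame_unit [RHS]mxE {1}/frame det_mulmx det_uni mul1r.
Qed.

Lemma coefs_frame (g : 'M[k]_6) f (i j l : 'I_6) m : f \is 3.-homog -> cmon m = m3 i j l ->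
  coefs (sub_lin g f) 0 m * m3val k i j l = pol f (row i g) (row j g) (row l g).
Proof.
move=> f3 cm; rewrite mxE cm mcoeff_pol ?sub_homog // pol_sub.
by rewrite /unitv -!rowE.
Qed.

Definition mindex (t : 'I_6 * 'I_6 * 'I_6) : 'I_N :=
  projT1 (cid (cmon_surj (m3_deg t.1.1 t.1.2 t.2))).

Lemma mindexE t : cmon (mindex t) = m3 t.1.1 t.1.2 t.2.
Proof. by rewrite /mindex; case: (cid _). Qed.

(** Distinct codes in base 4 imply distinct monomials, and the codes are plain numbers, so
    uniqueness becomes a computation. *)
Lemma uniq_mindex (ts : seq ('I_6 * 'I_6 * 'I_6)) :
  uniq [seq (4 ^ t.1.1 + 4 ^ t.1.2 + 4 ^ t.2)%N | t : 'I_6 * 'I_6 * 'I_6 <- ts] ->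
  uniq (map mindex ts).
Proof.
pose h (i : 'I_N) := (\sum_(j < 6) cmon i j * 4 ^ j)%N.
have hE t : h (mindex t) = (4 ^ t.1.1 + 4 ^ t.1.2 + 4 ^ t.2)%N.
  rewrite /h mindexE /m3.
  under eq_bigr => j _ do rewrite !mnmDE !mnm1E !mulnDl.
  have one (a : 'I_6) : (\sum_(j < 6) (a == j) * 4 ^ j = 4 ^ a)%N.
    rewrite (bigD1 a) //= eqxx mul1n big1 ?addn0 // => j ja.
    by rewrite eq_sym (negPf ja).
  by rewrite !big_split /= !one.
move=> U; apply: (@map_uniq _ _ h); rewrite -map_comp.
by rewrite (eq_map (g := fun t : 'I_6 * 'I_6 * 'I_6 => (4 ^ t.1.1 + 4 ^ t.1.2 + 4 ^ t.2)%N)).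
Qed.

End Frames.

(** * Generic conditions on affine spaces *)

Section Generic.
Variable k : numClosedFieldType.

Definition gen n (P : 'rV[k]_n -> Prop) :=
  exists2 G : {mpoly k[n]}, G != 0 & forall v, ev G v != 0 -> P v.

Lemma gen_imp n (P Q : 'rV[k]_n -> Prop) : gen P -> (forall v, P v -> Q v) -> gen Q.
Proof. by move=> [G G0 GP] PQ; exists G => // v /GP /PQ. Qed.

Lemma gen_and n (P Q : 'rV[k]_n -> Prop) : gen P -> gen Q -> gen (fun v => P v /\ Q v).
Proof.
move=> [G G0 GP] [H H0 HQ]; exists (G * H); first exact: mulf_neq0.
by move=> v; rewrite evM mulf_eq0 negb_or => /andP [/GP Pv /HQ Qv].
Qed.

Lemma gen_forall n (I : finType) (P : I -> 'rV[k]_n -> Prop) :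
  (forall i, gen (P i)) -> gen (fun v => forall i, P i v).
Proof.
move=> H; have /fin_all_exists [G GP] : forall i, exists G : {mpoly k[n]},
    G != 0 /\ forall v, ev G v != 0 -> P i v by move=> i; have [G] := H i; exists G.
exists (\prod_i G i); first by apply/prodf_neq0 => i _; case: (GP i).
move=> v; rewrite ev_prod => /prodf_neq0 Gv i; case: (GP i) => _; apply.
exact: Gv.
Qed.

Lemma gen_ex n (P : 'rV[k]_n -> Prop) : gen P -> exists v, P v.
Proof. by move=> [G /mpoly_nonroot [v Gv] GP]; exists v; apply: GP. Qed.

Lemma gen_polyf n (phi : 'rV[k]_n -> k) : polyf phi -> (exists v, phi v != 0) ->
  gen (fun v => phi v != 0).
Proof.
move=> [P phiP] [v pv]; exists P => [|u]; last by rewrite phiP.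
by apply: contraNneq pv => P0; rewrite phiP P0 ev0.
Qed.

(** A Fubini principle: a condition on generic pairs of a cubic and four coordinates becomes, for a
    generic cubic, a condition on four generic coordinates. *)
Lemma gen_section a b (P : 'rV[k]_(a + b) -> Prop) : gen P ->
  gen (fun u => gen (fun t => P (row_mx u t))).
Proof.
move=> [G G0 GP]; have [v Gv] := mpoly_nonroot G0.
have alg n := polyf_alg k n.
have : gen (fun u : 'rV[k]_a => ev G (row_mx u (rsubmx v)) != 0).
  apply: gen_polyf; last by exists (lsubmx v); rewrite hsubmxK.
  apply: falg_ev => // i; apply: row_mx_polyf => j; first exact: polyfX.
  exact: (falgC (alg _)).
move=> H; apply: gen_imp H _ => u Gu.
apply: (@gen_imp _ (fun t => ev G (row_mx u t) != 0)) => [|t]; last exact: GP.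
apply: gen_polyf; last by exists (rsubmx v).
apply: falg_ev => // i; apply: row_mx_polyf => j; last exact: polyfX.
exact: (falgC (alg _)).
Qed.

End Generic.

Section Charts.
Variable k : numClosedFieldType.
Local Notation V := 'rV[k]_6.
Local Notation N := (nb_monomials 6 3).
Implicit Types (x y z : V) (f : {mpoly k[6]}).

(* Polynomial dependence, in a form that is stable under substitution. *)
Definition jpoly (Psi : 'rV[k]_N -> V -> V -> V -> k) :=
  forall T (C : (T -> k) -> Prop) (a : T -> 'rV[k]_N) (x y z : T -> V), funalg C ->
    (forall i, C (fun t => a t 0 i)) -> (forall i, C (fun t => x t 0 i)) ->
    (forall i, C (fun t => y t 0 i)) -> (forall i, C (fun t => z t 0 i)) ->
    C (fun t => Psi (a t) (x t) (y t) (z t)).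

Definition chart1 (sigma : 'S_6) x := x 0 (sigma 0) = 1.
(** An echelon form of a flag; the free entries of the three vectors are the 5 + 4 + 3 parameters of
    [frame 3 sigma]. *)
Definition chart3 (sigma : 'S_6) x y z :=
  [/\ x 0 (sigma 0) = 1, y 0 (sigma 0) = 0 /\ y 0 (sigma 1) = 1 &
      [/\ z 0 (sigma 0) = 0, z 0 (sigma 1) = 0 & z 0 (sigma 2%:R) = 1]].

Lemma chart1_frame sigma nw x : (4 < nw.+1)%N -> chart1 sigma x ->
  exists w : 'rV[k]_nw.+1, row 0 (frame 1 sigma w) = x /\
    forall p : 'I_nw.+1, (4 < p)%N -> w 0 p = 0.
Proof.
move=> nw4 cx; pose w : 'rV[k]_nw.+1 :=
  \row_p (if (p < 5)%N then x 0 (sigma (inord p.+1)) else 0).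
exists w; split; last by move=> p p5; rewrite mxE ltnNge p5.
apply/rowP => j; rewrite -[j](permKV sigma) mxE frameE mxE; set i := (sigma^-1)%g j.
have [<-|i0] := eqVneq; first exact: esym.
have i_gt0 : (0 < i)%N by rewrite lt0n; apply: contra i0 => /eqP E; apply/eqP/val_inj.
rewrite /= i_gt0 mxE inordK /fpos; last by have := ltn_ord i; lia.
have -> : (i - 1 < 5)%N by have := ltn_ord i; lia.
by congr (x 0 (sigma _)); apply: val_inj; rewrite /= inordK; have := ltn_ord i; lia.
Qed.

Lemma chart3_frame sigma x y z : chart3 sigma x y z ->
  exists w : 'rV[k]_12, let g := frame 3 sigma w in
    [/\ row 0 g = x, row 1 g = y & row 2%:R g = z].
Proof.
move=> [cx [cy0 cy1] [cz0 cz1 cz2]]; pose w : 'rV[k]_12 :=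
  \row_p (if (p < 5)%N then x 0 (sigma (inord p.+1)) else
          if (p < 9)%N then y 0 (sigma (inord (p - 3))) else z 0 (sigma (inord (p - 6)))).
exists w; split; apply/rowP => j; rewrite -[j](permKV sigma) mxE frameE mxE;
  move: ((sigma^-1)%g j) => i; case: eqVneq => [<-//|i0];
  case: i i0 => -[|[|[|[|[|[|//]]]]]] lti i0; rewrite ?mxE /fpos /= ?inordK //=;
  (try by case/negP: i0); (try by congr (_ 0 (sigma _)); apply: val_inj; rewrite /= inordK);
  (try by rewrite -[LHS]cy0; congr (_ 0 (sigma _)); apply: val_inj);
  (try by rewrite -[LHS]cz0; congr (_ 0 (sigma _)); apply: val_inj);
  (try by rewrite -[LHS]cz1; congr (_ 0 (sigma _)); apply: val_inj);
  (try by rewrite -?cy1 -?cz2; congr (_ 0 (sigma _)); apply: val_inj).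
Qed.

End Charts.

(** * Equations forced by degenerate flags, points and cubics *)

Section Relations.
Variable k : numClosedFieldType.
Local Notation V := 'rV[k]_6.
Local Notation N := (nb_monomials 6 3).
Implicit Types (x y z : V) (f : {mpoly k[6]}).

Lemma coefs_frame_eq0 (g : 'M[k]_6) f t : f \is 3.-homog ->
  pol f (row t.1.1 g) (row t.1.2 g) (row t.2 g) = 0 ->
  coefs (sub_lin g f) 0 (mindex t) = 0.
Proof.
move=> f3 H; have := coefs_frame g f3 (mindexE t).
by rewrite H => /eqP; rewrite mulf_eq0 (negPf (m3val_neq0 _ _ _ _)) orbF => /eqP.
Qed.

Lemma form_of_sub_frame (g ginv : 'M[k]_6) f : f \is 3.-homog -> g *m ginv = 1%:M ->
  coefs (sub_lin ginv (form_of (coefs (sub_lin g f)))) = coefs f.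
Proof.
by move=> f3 gg; rewrite form_of_coefs ?sub_homog // sub_mul (mulmx1C gg) sub1.
Qed.

Lemma frame_row_polyf r sigma nw n (u : 'rV[k]_n -> 'rV[k]_nw.+1) i j :
  (forall i, polyf (fun v => u v 0 i)) -> polyf (fun v => row i (frame r sigma (u v)) 0 j).
Proof.
move=> pu; have := falg_polyf (polyf_alg k n) pu (frame_polyf k r sigma nw i j).
by move=> H; apply: polyf_ext H _ => v; rewrite [RHS]mxE.
Qed.

Lemma frame_coefs_polyf r sigma nw i :
  polyf (fun v : 'rV[k]_(nw.+1 + N) =>
    coefs (sub_lin (invmx (frame r sigma (lsubmx v))) (form_of (rsubmx v))) 0 i).
Proof.
apply: falg_coefs_sub => [|a b|j]; first exact: polyf_alg.
  apply: (falg_polyf (polyf_alg k _) _ (frame_inv_polyf k r sigma nw a b)).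
  exact: lsubmx_polyf.
exact: rsubmx_polyf.
Qed.

(** A flag has 12 parameters and meets 8 conditions, which leaves room for four functions [t]: once
    [Psi] is nonzero somewhere in the chart, [frame_relation] puts the flags with [Psi] zero over a
    hypersurface of pairs of a cubic and a value of [t]. *)
Lemma C_relation sigma (t : V -> V -> 'rV[k]_4) Psi :
  jpoly Psi -> (forall i, jpoly (fun _ x y _ => t x y 0 i)) ->
  (exists f x y z, [/\ f \is 3.-homog, flag (pol f) x y z, chart3 sigma x y z &
                       Psi (coefs f) x y z != 0]) ->
  gen (fun u : 'rV[k]_(N + 4) => forall f x y z, f \is 3.-homog ->
    flag (pol f) x y z -> chart3 sigma x y z -> u = row_mx (coefs f) (t x y) ->
    Psi (coefs f) x y z != 0).
Proof.
move=> jP jt [f0 [x0 [y0 [z0 [f03 fl0 ch0 P0]]]]].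
pose ts : seq ('I_6 * 'I_6 * 'I_6) := [:: (0, 0, 0); (0, 0, 1); (0, 1, 1); (1, 1, 1);
  (0, 0, 2%:R); (0, 1, 2%:R); (1, 1, 2%:R); (0, 2%:R, 2%:R)].
pose g (w : 'rV[k]_12) := frame 3 sigma w.
have vanish w f : f \is 3.-homog -> flag (pol f) (row 0 (g w)) (row 1 (g w)) (row 2%:R (g w)) ->
    forall i, i \in map (@mindex) ts -> coefs (sub_lin (g w) f) 0 i = 0.
  move=> f3 [_ [h1 h2 h3 h4] [h5 h6 h7 h8]] _ /mapP [q qts ->].
  apply: coefs_frame_eq0 => //; move: qts; rewrite !inE.
  by do 7 (case/orP => [/eqP->//|]); move=> /eqP->.
pose J w (b : 'rV[k]_N) := Psi (coefs (sub_lin (invmx (g w)) (form_of b))) (row 0 (g w)) (row 1 (g w)) (row 2%:R (g w)).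
have pl n i : polyf (fun v : 'rV[k]_(12 + n) => lsubmx v 0 i) by exact: lsubmx_polyf.
have [|||||||c c0 cP] := @frame_relation k 12 4 g (fun w => invmx (g w)) (map (@mindex) ts) J
   (fun w => t (row 0 (g w)) (row 1 (g w))).
- exact: uniq_mindex.
- by [].
- by move=> w; apply: frameV.
- by move=> i j; apply: frame_inv_polyf.
- move=> i; apply: (jt i _ _ (fun=> 0) _ _ (fun=> 0)) => [|j|j|j|j].
  + exact: polyf_alg.
  + by apply: polyf_ext (falgC (polyf_alg k _) 0) _ => v; rewrite mxE.
  + by apply: (@frame_row_polyf _ _ _ _ id) => l; exact: polyfX.
  + by apply: (@frame_row_polyf _ _ _ _ id) => l; exact: polyfX.
  + by apply: polyf_ext (falgC (polyf_alg k _) 0) _ => v; rewrite mxE.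
- apply: jP => [|i|i|i|i]; first exact: polyf_alg.
  + exact: frame_coefs_polyf.
  + by apply: frame_row_polyf => l; exact: pl.
  + by apply: frame_row_polyf => l; exact: pl.
  + by apply: frame_row_polyf => l; exact: pl.
- have [w /= [r0 r1 r2]] := chart3_frame ch0.
  exists w, (coefs (sub_lin (g w) f0)); split; first by apply: vanish; rewrite // r0 r1 r2.
  by rewrite /J form_of_sub_frame ?frameV // r0 r1 r2.
exists c => // u cu f x y z f3 fl ch uE; apply: contra cu => /eqP P0'.
have [w /= [r0 r1 r2]] := chart3_frame ch.
have := cP w f f3; rewrite uE {1 2}/g -/(g w) r0 r1 => ->; rewrite ?eqxx //.
  by apply: vanish; rewrite // r0 r1 r2.
by rewrite /J form_of_sub_frame ?frameV // r0 r1 r2.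
Qed.

(** The count for points: 5 parameters and 1 condition, again with an excess of 4. *)
Lemma I_relation sigma (t : V -> 'rV[k]_4) Psi :
  jpoly (fun a x _ _ => Psi a x) -> (forall i, jpoly (fun _ x _ _ => t x 0 i)) ->
  (exists f x, [/\ f \is 3.-homog, ev f x = 0, chart1 sigma x & Psi (coefs f) x != 0]) ->
  gen (fun u : 'rV[k]_(N + 4) => forall f x, f \is 3.-homog ->
    ev f x = 0 -> chart1 sigma x -> u = row_mx (coefs f) (t x) -> Psi (coefs f) x != 0).
Proof.
move=> jP jt [f0 [x0 [f03 fx0 ch0 P0]]].
pose ts : seq ('I_6 * 'I_6 * 'I_6) := [:: (0, 0, 0)].
pose g (w : 'rV[k]_5) := frame 1 sigma w.
have vanish w f : f \is 3.-homog -> ev f (row 0 (g w)) = 0 ->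
    forall i, i \in map (@mindex) ts -> coefs (sub_lin (g w) f) 0 i = 0.
  move=> f3 fx i; rewrite inE => /eqP ->.
  by apply: coefs_frame_eq0 => //=; rewrite pol_diag.
pose J w (b : 'rV[k]_N) := Psi (coefs (sub_lin (invmx (g w)) (form_of b))) (row 0 (g w)).
have pl n i : polyf (fun v : 'rV[k]_(5 + n) => lsubmx v 0 i) by exact: lsubmx_polyf.
have zero n (i : 'I_6) : polyf (fun v : 'rV[k]_n => (0 : V) 0 i).
  exact: (falgC (polyf_alg k _)).
have zeroN n (i : 'I_N) : polyf (fun v : 'rV[k]_n => (0 : 'rV[k]_N) 0 i).
  exact: (falgC (polyf_alg k _)).
have [|||||||c c0 cP] := @frame_relation k 5 4 g (fun w => invmx (g w)) (map (@mindex) ts) J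
   (fun w => t (row 0 (g w))).
- exact: uniq_mindex.
- by [].
- by move=> w; apply: frameV.
- by move=> i j; apply: frame_inv_polyf.
- move=> i; apply: (jt i _ _ (fun=> 0) _ (fun=> 0) (fun=> 0)) => [|j|j|j|j] //.
  + exact: polyf_alg.
  + by apply: (@frame_row_polyf _ _ _ _ id) => l; exact: polyfX.
- apply: (jP _ _ _ _ (fun=> 0) (fun=> 0)) => [|i|i|i|i] //; first exact: polyf_alg.
  + exact: frame_coefs_polyf.
  + by apply: frame_row_polyf => l; exact: pl.
- have [w [r0 _]] := @chart1_frame _ _ 4 _ isT ch0.
  exists w, (coefs (sub_lin (g w) f0)); split; first by apply: vanish; rewrite // r0.
  by rewrite /J form_of_sub_frame ?frameV // r0.
exists c => // u cu f x f3 fx ch uE; apply: contra cu => /eqP P0'.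
have [w [r0 _]] := @chart1_frame _ _ 4 _ isT ch.
have := cP w f f3; rewrite uE -/(g w) r0 => ->; rewrite ?eqxx //.
  by apply: vanish; rewrite // r0.
by rewrite /J form_of_sub_frame ?frameV // r0.
Qed.

Definition smooth_cubic f := forall x, x != 0 -> exists v, pol f x x v != 0.

(** A singular point has 5 parameters and imposes 6 conditions. To fit [frame_relation], a sixth
    parameter is added on which the frame does not depend; it is the function [J], and singular
    points are given the value 0 for it. *)
Lemma smooth_gen : gen (fun a : 'rV[k]_N => smooth_cubic (form_of a)).
Proof.
have H (sigma : 'S_6) : gen (fun a : 'rV[k]_N => forall x, chart1 sigma x ->
    exists v, pol (form_of a) x x v != 0).
  pose ts : seq ('I_6 * 'I_6 * 'I_6) := [:: (0, 0, 0); (0, 0, 1); (0, 0, 2%:R);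
    (0, 0, 3%:R); (0, 0, 4%:R); (0, 0, 5%:R)].
  pose g (w : 'rV[k]_6) := frame 1 sigma w.
  have [|||||||c c0 cP] := @frame_relation k 6 0 g (fun w => invmx (g w)) (map (@mindex) ts)
     (fun w _ => w 0 5%:R) (fun=> 0).
  - exact: uniq_mindex.
  - by [].
  - by move=> w; apply: frameV.
  - by move=> i j; apply: frame_inv_polyf.
  - by move=> [].
  - exact: lsubmx_polyf.
  - exists (const_mx 1), 0; split=> [i _|]; rewrite mxE ?oner_neq0 //.
  apply: (@gen_imp _ _ (fun a : 'rV[k]_N => ev c (row_mx a 0) != 0)).
    apply: gen_polyf.
      apply: falg_ev => [|i]; first exact: polyf_alg.
      apply: row_mx_polyf => j; first exact: polyfX.
      exact: (falgC (polyf_alg k _)).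
    have [v cv] := mpoly_nonroot c0; exists (lsubmx v).
    rewrite (_ : 0 = rsubmx v) ?hsubmxK //.
    by apply/rowP => -[].
  move=> a ca x cx; apply: contrapT => none.
  have sing v : pol (form_of a) x x v = 0.
    by apply/eqP; apply: contrapT => /negP Hv; apply: none; exists v.
  have [w [r0 w5]] := @chart1_frame _ sigma 5 x isT cx.
  move/eqP: ca; apply; rewrite -[a in row_mx a]coefs_form_of.
  apply: cP; [exact: form_of_homog | | exact: w5].
  move=> _ /mapP [q qts ->]; apply: coefs_frame_eq0; first exact: form_of_homog.
  by move: qts; rewrite !inE; do 5 (case/orP => [/eqP->|]; first by rewrite /= r0 sing);
     move=> /eqP->; rewrite /= r0 sing.
apply: gen_imp (gen_forall H) _ => a Ha x /rV0Pn [i xi].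
have [|v vP] := Ha (tperm 0 i) ((x 0 i)^-1 *: x).
  by rewrite /chart1 tpermL mxE mulVf.
exists v; apply: contra vP => /eqP xxv.
have TT := pol_symtri (form_of_homog a).
by rewrite (triZ1 TT) (triZ2 TT) xxv !mulr0.
Qed.

End Relations.

(** * Irreducibility of the families of cubics with a flag or a point *)

Section Meet.
Variable k : numClosedFieldType.
Local Notation V := 'rV[k]_6.
Local Notation N := (nb_monomials 6 3).
Implicit Types (x y z : V) (f : {mpoly k[6]}).

Lemma coefsZ c f : coefs (c *: f) = c *: coefs f.
Proof. by apply/rowP => i; rewrite !mxE mcoeffZ. Qed.

Lemma sub_linZ h c f : sub_lin h (c *: f) = c *: sub_lin h f.
Proof. by apply: mpoly_ext => v; rewrite !(ev_sub, evZ). Qed.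

Lemma form_ofZ c (a : 'rV[k]_N) : form_of (c *: a) = c *: form_of a.
Proof. by rewrite /form_of scaler_sumr; apply: eq_bigr => i _; rewrite mxE scalerA. Qed.

Lemma sub_scalar c f : f \is 3.-homog -> sub_lin c%:M f = c ^+ 3 *: f.
Proof.
move=> f3; apply: mpoly_ext => v; rewrite ev_sub evZ mul_mx_scalar -!pol_diag //.
by rewrite (triZ1 (pol_symtri f3)) (triZ2 (pol_symtri f3)) (triZ3 (pol_symtri f3)) !exprS expr0; ring.
Qed.

Definition masked (Bs : seq 'I_N) (a : 'rV[k]_N) (g : 'M[k]_6) :=
  forall i, i \in Bs -> coefs (sub_lin g (form_of a)) 0 i = 0.

Definition gpoly (P : 'rV[k]_N -> 'M[k]_6 -> k) :=
  forall T (C : (T -> k) -> Prop) (a : T -> 'rV[k]_N) (g : T -> 'M[k]_6), funalg C ->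
    (forall i, C (fun t => a t 0 i)) -> (forall i j, C (fun t => g t i j)) ->
    C (fun t => P (a t) (g t)).

(* The forms with prescribed vanishing coefficients in a moving frame make up
   the image of an affine space, so that two nonzero functions do not have
   zero product. *)
Lemma masked_meet Bs P Q : gpoly P -> gpoly Q ->
  (exists a g, [/\ masked Bs a g, g \in unitmx & P a g != 0]) ->
  (exists a g, [/\ masked Bs a g, g \in unitmx & Q a g != 0]) ->
  exists a g, [/\ masked Bs a g, g \in unitmx & P a g * Q a g != 0].
Proof.
pose g_ (v : 'rV[k]_(6 * 6 + N)) : 'M[k]_6 := vec_mx (lsubmx v).
pose b_ (v : 'rV[k]_(6 * 6 + N)) : 'rV[k]_N := \row_i ((i \notin Bs)%:R * rsubmx v 0 i).
(* The adjugate keeps the parametrization polynomial. It differs from the inverse by the determinant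
   d, which acts on cubic forms as d^3; this is the origin of the factor [d ^- 3] below. *)
pose a_ v := coefs (sub_lin (\adj (g_ v)) (form_of (b_ v))).
have alg := polyf_alg k (6 * 6 + N).
have pg i j : polyf (fun v => g_ v i j).
  by apply: polyf_ext (lsubmx_polyf k N (mxvec_index i j)) _ => v; rewrite [RHS]mxE.
have pb i : polyf (fun v => b_ v 0 i).
  by apply: polyf_ext (falgZ alg (i \notin Bs)%:R (rsubmx_polyf k _ i)) _ => v; rewrite [RHS]mxE.
have pa i : polyf (fun v => a_ v 0 i).
  by apply: falg_coefs_sub => // r s; apply: falg_adj.
have masked_ v : masked Bs (a_ v) (g_ v).
  move=> i iB; rewrite /a_ form_of_coefs ?sub_homog ?form_of_homog // sub_mul mul_mx_adj.
  by rewrite sub_scalar ?form_of_homog // coefsZ mxE coefs_form_of mxE iB mul0r mulr0.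
have onto a g : masked Bs a g -> g \in unitmx -> exists v, a_ v = a /\ g_ v = g.
  move=> ma; rewrite unitmxE unitfE => g0; set d := \det g in g0.
  exists (row_mx (mxvec g) ((d ^- 3) *: coefs (sub_lin g (form_of a)))).
  have gE : g_ (row_mx (mxvec g) ((d ^- 3) *: coefs (sub_lin g (form_of a)))) = g.
    by rewrite /g_ row_mxKl mxvecK.
  split=> //; rewrite /a_ gE /b_ row_mxKr.
  have -> : \row_i ((i \notin Bs)%:R * (d ^- 3 *: coefs (sub_lin g (form_of a))) 0 i) =
            d ^- 3 *: coefs (sub_lin g (form_of a)).
    apply/rowP => i; rewrite !mxE; have [iB|] := boolP (i \in Bs); last by rewrite mul1r.
    by have := ma i iB; rewrite mxE => ->; rewrite !mulr0.
  rewrite form_ofZ sub_linZ coefsZ form_of_coefs ?sub_homog ?form_of_homog //.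
  rewrite sub_mul mul_adj_mx sub_scalar ?form_of_homog // coefsZ scalerA coefs_form_of.
  by rewrite mulVf ?scale1r // expf_eq0.
have genP R : gpoly R -> (exists a g, [/\ masked Bs a g, g \in unitmx & R a g != 0]) ->
    gen (fun v => R (a_ v) (g_ v) != 0).
  move=> pR [a [g [ma ug Ra]]]; apply: gen_polyf; first exact: pR.
  by have [v [va vg]] := onto a g ma ug; exists v; rewrite va vg.
move=> pP pQ eP eQ.
have pdet : gpoly (fun _ g => \det g) by move=> T C a g algC _ Hg; apply: falg_det.
have edet : exists a g, [/\ masked Bs a g, g \in unitmx & \det g != 0].
  by have [a [g [ma ug _]]] := eP; exists a, g; split=> //; rewrite -unitfE -unitmxE.
have [v [[Pv Qv] dv]] := gen_ex (gen_and (gen_and (genP P pP eP) (genP Q pQ eQ)) (genP _ pdet edet)).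
by exists (a_ v), (g_ v); split; rewrite ?mulf_neq0 // unitmxE unitfE.
Qed.

Lemma masked_pol (ts : seq ('I_6 * 'I_6 * 'I_6)) a g :
  masked (map mindex ts) a g <->
  forall t, t \in ts -> pol (form_of a) (row t.1.1 g) (row t.1.2 g) (row t.2 g) = 0.
Proof.
split=> H => [t tin | _ /mapP [t tin ->]].
  rewrite -(coefs_frame g (form_of_homog a) (mindexE t)) H ?mul0r //.
  exact: map_f.
by apply: coefs_frame_eq0; rewrite ?form_of_homog // H.
Qed.

Lemma complete_rows x y z : ind3 x y z ->
  exists g : 'M[k]_6, [/\ g \in unitmx, row 0 g = x, row 1 g = y & row 2%:R g = z].
Proof.
move=> I; set A := mx3 x y z.
have rA : \rank A = 3%N by apply/eqP; exact: ind3_row_free.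
pose L : 'M[k]_3 := col_ebase A.
pose g : 'M[k]_(3 + 3) := block_mx L 0 0 1%:M *m (row_ebase A : 'M_(3 + 3)).
have gA : usubmx g = A.
  rewrite -[RHS]mulmx_ebase rA /g -mul_usub_mx.
  have -> : usubmx (block_mx L 0 0 1%:M) = L *m (pid_mx 3 : 'M_(3, 3 + 3)).
    by rewrite /block_mx col_mxKu pid_mx_row mul_mx_row mulmx1 mulmx0.
  by [].
have rowU (i : 'I_3) (i' : 'I_6) (h : 'M[k]_(3 + 3)) : i = i' :> nat ->
    row (i' : 'I_(3 + 3)) h = row i (usubmx h).
  by move=> ii; apply/rowP => j; rewrite !mxE; congr (h _ _); apply: val_inj.
exists g; split.
- have bu : (block_mx L 0 0 1%:M : 'M[k]_(3 + 3)) \in unitmx.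
    by rewrite unitmxE det_ublock det1 mulr1 -unitmxE; exact: col_ebase_unit.
  by rewrite unitmx_mul; apply/andP; split; [exact: bu | exact: row_ebase_unit].
- by rewrite (rowU 0) // gA; apply/rowP => j; rewrite !mxE.
- by rewrite (rowU 1) // gA; apply/rowP => j; rewrite !mxE.
- by rewrite (rowU 2%:R) // gA; apply/rowP => j; rewrite !mxE.
Qed.

Lemma gpoly_jpoly Psi : jpoly Psi ->
  gpoly (fun a g => Psi a (row 0 g) (row 1 g) (row 2%:R g)).
Proof.
move=> jP T C a g algC Ha Hg; apply: jP => // i.
- by apply: falg_ext (Hg 0 i) _ => // t; rewrite mxE.
- by apply: falg_ext (Hg 1 i) _ => // t; rewrite mxE.
- by apply: falg_ext (Hg 2%:R i) _ => // t; rewrite mxE.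
Qed.

Lemma ind3_rows (g : 'M[k]_6) : g \in unitmx -> ind3 (row 0 g) (row 1 g) (row 2%:R g).
Proof.
move=> ug r s t H.
pose e : V := \row_i nth 0 [:: r; s; t] i.
have : e *m g = 0.
  rewrite mulmx_sum_row !big_ord_recl big_ord0 /= !mxE /= -[RHS]H !scale0r !addr0 addrA.
  by congr (_ *: row _ g + _ *: row _ g + _ *: row _ g); apply: val_inj.
move/(congr1 (mulmx^~ (invmx g))); rewrite mulmxK // mul0mx => e0.
by split; [have := congr1 (fun w : V => w 0 0) e0 | have := congr1 (fun w : V => w 0 1) e0
  | have := congr1 (fun w : V => w 0 2%:R) e0]; rewrite !mxE.
Qed.

(** Lets open conditions be exhibited on different examples: the cubics with a flag form an
    irreducible family, so two such conditions hold together somewhere. *)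
Lemma flag_meet Psi Psi' : jpoly Psi -> jpoly Psi' ->
  (exists a x y z, flag (pol (form_of a)) x y z /\ Psi a x y z != 0) ->
  (exists a x y z, flag (pol (form_of a)) x y z /\ Psi' a x y z != 0) ->
  exists a x y z, flag (pol (form_of a)) x y z /\ Psi a x y z * Psi' a x y z != 0.
Proof.
move=> jP jP'.
pose ts : seq ('I_6 * 'I_6 * 'I_6) := [:: (0, 0, 0); (0, 0, 1); (0, 1, 1); (1, 1, 1);
  (0, 0, 2%:R); (0, 1, 2%:R); (1, 1, 2%:R); (0, 2%:R, 2%:R)].
have conv R : (exists a x y z, flag (pol (form_of a)) x y z /\ R a x y z != 0) ->
    exists a g, [/\ masked (map mindex ts) a g, g \in unitmx &
      R a (row 0 g) (row 1 g) (row 2%:R g) != 0].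
  move=> [a [x [y [z [[I [h1 h2 h3 h4] [h5 h6 h7 h8]] Rn]]]]].
  have [g [ug gx gy gz]] := complete_rows I.
  exists a, g; split=> //; last by rewrite gx gy gz.
  apply/masked_pol => q; rewrite !inE.
  do 7 (case/orP => [/eqP->|]; first by rewrite /= ?gx ?gy ?gz).
  by move=> /eqP->; rewrite /= ?gx ?gy ?gz.
move=> /conv eP /conv eP'.
have [a [g [/masked_pol ma ug PP]]] := masked_meet (gpoly_jpoly jP) (gpoly_jpoly jP') eP eP'.
exists a, (row 0 g), (row 1 g), (row 2%:R g); split=> //.
split; first exact: ind3_rows.
  by split; [apply: (ma (0, 0, 0)) | apply: (ma (0, 0, 1)) | apply: (ma (0, 1, 1)) | apply: (ma (1, 1, 1))].
by split; [apply: (ma (0, 0, 2%:R)) | apply: (ma (0, 1, 2%:R)) | apply: (ma (1, 1, 2%:R)) | apply: (ma (0, 2%:R, 2%:R))].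
Qed.

Lemma point_meet Psi Psi' :
  jpoly (fun a x _ _ => Psi a x) -> jpoly (fun a x _ _ => Psi' a x) ->
  (exists a x, [/\ x != 0, ev (form_of a) x = 0 & Psi a x != 0]) ->
  (exists a x, [/\ x != 0, ev (form_of a) x = 0 & Psi' a x != 0]) ->
  exists a x, [/\ x != 0, ev (form_of a) x = 0 & Psi a x * Psi' a x != 0].
Proof.
move=> jP jP'; pose ts : seq ('I_6 * 'I_6 * 'I_6) := [:: (0, 0, 0)].
have conv (R : 'rV[k]_N -> V -> k) :
    (exists a x, [/\ x != 0, ev (form_of a) x = 0 & R a x != 0]) ->
    exists a g, [/\ masked (map mindex ts) a g, g \in unitmx & R a (row 0 g) != 0].
  move=> [a [x [/rV0Pn [i xi] fx Rx]]].
  have [|w [wx _]] := @chart1_frame _ (tperm 0 i) 4 ((x 0 i)^-1 *: x) isT.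
    by rewrite /chart1 tpermL mxE mulVf.
  have gx : row 0 (x 0 i *: frame 1 (tperm 0 i) w) = x.
    by rewrite linearZ /= wx scalerA divff // scale1r.
  exists a, (x 0 i *: frame 1 (tperm 0 i) w); split; rewrite ?gx //.
    by apply/masked_pol => q; rewrite inE => /eqP ->; rewrite gx pol_diag ?form_of_homog.
  by rewrite unitmxZ ?frame_unit // unitfE.
move=> /conv eP /conv eP'.
have [a [g [/masked_pol ma ug PP]]] := masked_meet (gpoly_jpoly jP) (gpoly_jpoly jP') eP eP'.
exists a, (row 0 g); split=> //; first exact: (ind3_neq0 (ind3_rows ug)).
by rewrite -pol_diag ?form_of_homog //; apply: (ma (0, 0, 0)).
Qed.

End Meet.

(** * Resultants of the flags over a point *)

Section Staircase.
Variable k : numClosedFieldType.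
Local Notation V := 'rV[k]_6.
Local Notation N := (nb_monomials 6 3).
Local Notation e_ := (unitv k).

(* Normalized coordinates [(0, 1, t_0, ..., t_3)] of the second vector of a flag. *)
Definition Y (i : 'I_6) : {mpoly k[4]} :=
  if val i is j.+2 then 'X_(inord j) else (val i)%:R%:MP.
Definition yv (t : 'rV[k]_4) : V := \row_i ev (Y i) t.

Section Rel.
Variables (a : 'rV[k]_N) (x : V).
Local Notation T := (pol (form_of a)).

Definition hess : 'M[k]_6 := \matrix_(i, j) T x (e_ i) (e_ j).
Definition tyy (i : 'I_6) : {mpoly k[4]} :=
  \sum_j \sum_l T (e_ i) (e_ j) (e_ l) *: (Y j * Y l).
(* In [P^3 = {v | T x x v = 0} / x] the equations 1, 2 and 3 have these degrees
   plus one, so that they meet in 2 * 3 * 4 points. *)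
Definition yrel (e : 'I_4) : {mpoly k[4]} :=
  match val e with
  | 0 => \sum_j T x x (e_ j) *: Y j
  | 1 => \sum_i \sum_j T x (e_ i) (e_ j) *: (Y i * Y j)
  | 2 => \sum_i Y i * tyy i
  | _ => \sum_i \sum_j (\adj hess) i j *: (tyy i * tyy j)
  end.

Let TT := pol_symtri (form_of_homog a).

Lemma tri_coord3 u v w : T u v w = \sum_j w 0 j * T u v (e_ j).
Proof.
by rewrite (covecE TT) mxE; apply: eq_bigr => j _; rewrite !mxE.
Qed.

Lemma tri_coord23 u v w : T u v w = \sum_i \sum_j v 0 i * w 0 j * T u (e_ i) (e_ j).
Proof.
rewrite (triC23 TT) tri_coord3; apply: eq_bigr => i _.
rewrite (triC23 TT) tri_coord3 mulr_sumr; apply: eq_bigr => j _; ring.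
Qed.

Lemma ev_tyy i t : ev (tyy i) t = T (e_ i) (yv t) (yv t).
Proof.
rewrite tri_coord23 ev_sum; apply: eq_bigr => j _; rewrite ev_sum.
by apply: eq_bigr => l _; rewrite !(evZ, evM) !mxE mulrC.
Qed.

Lemma ev_rel t : [/\ ev (yrel 0) t = T x x (yv t), ev (yrel 1) t = T x (yv t) (yv t),
  ev (yrel 2%:R) t = T (yv t) (yv t) (yv t) &
  ev (yrel 3%:R) t =
    \sum_i \sum_j (\adj hess) i j * (T (e_ i) (yv t) (yv t) * T (e_ j) (yv t) (yv t))].
Proof.
split; rewrite /yrel /= ev_sum.
- by rewrite tri_coord3; apply: eq_bigr => i _; rewrite evZ mxE mulrC.
- rewrite tri_coord23; apply: eq_bigr => i _; rewrite ev_sum.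
  by apply: eq_bigr => j _; rewrite evZ evM !mxE mulrC.
- rewrite tri_coord3; apply: eq_bigr => i _.
  by rewrite evM ev_tyy mxE (triC13 TT).
- apply: eq_bigr => i _; rewrite ev_sum; apply: eq_bigr => j _.
  by rewrite evZ evM !ev_tyy.
Qed.

(* The span of [x], [y], [z] is a Lagrangian subspace for the polar quadric
   [T x], so that [T y y], vanishing on it, is polar to one of its vectors. *)
Lemma rel_flag t z : \det hess != 0 -> flag T x (yv t) z -> forall e, ev (yrel e) t = 0.
Proof.
move=> dH fl; have [E0 E1 E2 E3] := ev_rel t.
have [I [h1 h2 h3 h4] [h5 h6 h7 h8]] := fl.
set y := yv t in E0 E1 E2 E3 fl I h2 h3 h4 h6 h7.
case=> -[|[|[|[|//]]]] lt; first by rewrite -h2 -E0; congr (ev (yrel _) t); apply: val_inj.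
- by rewrite -h3 -E1; congr (ev (yrel _) t); apply: val_inj.
- by rewrite -h4 -E2; congr (ev (yrel _) t); apply: val_inj.
rewrite (_ : Ordinal lt = 3%:R); last exact: val_inj.
rewrite E3; pose c := covec T y y; pose H := hess.
have uH : H \in unitmx by rewrite unitmxE unitfE.
have cvH w : covec T x w = w *m H.
  apply/rowP => j; rewrite !mxE (triC23 TT) tri_coord3.
  by apply: eq_bigr => i _; rewrite !mxE (triC23 TT).
have [D cD] : exists D : 'rV_3, c = D *m mx3 (x *m H) (y *m H) (z *m H).
  apply: (ker3_span (ind3_row_free I)).
  - apply: ind3_row_free => r s u Hr; apply: I.
    have : (r *: x + s *: y + u *: z) *m H = 0 by rewrite !mulmxDl -!scalemxAl.
    by move/(congr1 (mulmx^~ (invmx H))); rewrite mulmxK // mul0mx.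
  - apply/matrixP => i j.
    have -> : (mx3 (x *m H) (y *m H) (z *m H) *m (mx3 x y z)^T) i j =
        T x (nth 0 [:: x; y; z] i) (nth 0 [:: x; y; z] j).
      rewrite (covecE TT) cvH !mxE; apply: eq_bigr => l _; rewrite !mxE mulrC.
      by case: i => -[|[|[|//]]] ?; rewrite /= ?mxE.
    rewrite mxE; case: i => -[|[|[|//]]] ?; case: j => -[|[|[|//]]] ? //=;
      by rewrite // (triC23 TT).
  - apply/rowP => j; rewrite mul_mx3_tr [RHS]mxE.
    have -> (v : V) : (c *m v^T) 0 0 = T y y v.
      by rewrite (covecE TT) !mxE; apply: eq_bigr => l _; rewrite !mxE mulrC.
    by case: j => -[|[|[|//]]] ? //=; rewrite (triC13 TT).
have : (c *m \adj H *m c^T) 0 0 = 0.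
  have -> : c *m \adj H = \det H *: (D *m mx3 x y z).
    rewrite {1}cD (_ : mx3 _ _ _ = mx3 x y z *m H).
      by rewrite (mulmxA D) -(mulmxA (D *m mx3 x y z)) mul_mx_adj mul_mx_scalar.
    by apply/row_matrixP => i; rewrite row_mul !rowK; case: i => -[|[|[|//]]].
  rewrite -scalemxAl mxE mul_mx3 -(covecE TT) !(triD3 TT) !(triZ3 TT).
  by rewrite h4 (triC13 TT) h3 h7 !mulr0 !addr0 mulr0.
rewrite mxE => E; rewrite -[RHS]E exchange_big /=; apply: eq_bigr => j _.
rewrite !mxE mulr_suml; apply: eq_bigr => i _; rewrite !mxE.
by rewrite [T (e_ i) _ _](triC13 TT) [T (e_ j) _ _](triC13 TT); ring.
Qed.

End Rel.

Lemma falg_rel T (C : (T -> k) -> Prop) (a : T -> 'rV[k]_N) (x : T -> V) e : funalg C ->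
  (forall i, C (fun t => a t 0 i)) -> (forall i, C (fun t => x t 0 i)) ->
  falg_mcoef C (fun t => yrel (a t) (x t) e).
Proof.
move=> alg Ha Hx.
have Hu i j : C (fun=> e_ i 0 j) by exact: falgC.
have Hty i : falg_mcoef C (fun t => tyy (a t) i).
  apply: falg_mcoef_sum => // j; apply: falg_mcoef_sum => // l.
  by apply: falg_mcoefZ => //; [apply: falg_pol | apply: falg_mcoef_const].
rewrite /yrel; case: e => -[|[|[|n]]] /= _.
- apply: falg_mcoef_sum => // j.
  by apply: falg_mcoefZ => //; [apply: falg_pol | apply: falg_mcoef_const].
- apply: falg_mcoef_sum => // j; apply: falg_mcoef_sum => // l.
  by apply: falg_mcoefZ => //; [apply: falg_pol | apply: falg_mcoef_const].
- by apply: falg_mcoef_sum => // j; apply: falg_mcoefM => //; apply: falg_mcoef_const.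
apply: falg_mcoef_sum => // j; apply: falg_mcoef_sum => // l.
apply: falg_mcoefZ => //; last exact: falg_mcoefM.
apply: falg_adj => // r s; apply: falg_ext (_ : C (fun t => pol (form_of (a t)) (x t) (e_ r) (e_ s))) _ => //.
  exact: falg_pol.
by move=> t; rewrite mxE.
Qed.

Lemma falg_det_hess T (C : (T -> k) -> Prop) (a : T -> 'rV[k]_N) (x : T -> V) : funalg C ->
  (forall i, C (fun t => a t 0 i)) -> (forall i, C (fun t => x t 0 i)) ->
  C (fun t => \det (hess (a t) (x t))).
Proof.
move=> alg Ha Hx; apply: falg_det => // r s.
apply: falg_ext (_ : C (fun t => pol (form_of (a t)) (x t) (e_ r) (e_ s))) _ => //.
  by apply: falg_pol => // i; apply: falgC.
by move=> t; rewrite mxE.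
Qed.

Lemma msize_sum_le n (I : Type) (r : seq I) (F : I -> {mpoly k[n]}) d :
  (forall i, (msize (F i) <= d)%N) -> (msize (\sum_(i <- r) F i) <= d)%N.
Proof.
move=> H; elim/big_ind: _ => [||i _]; rewrite ?msize0 //.
by move=> p q Hp Hq; apply: leq_trans (msizeD_le _ _) _; rewrite geq_max Hp Hq.
Qed.

Lemma msizeY i : (msize (Y i) <= 2)%N.
Proof. by rewrite /Y; case: (val i) => [|[|j]]; rewrite ?msizeX ?mdeg1 // msizeC; case: (_ != 0). Qed.

Lemma msize_rel a x e : (msize (yrel a x e) <= (val e).+2)%N.
Proof.
have ZZ (c : k) (p : {mpoly k[4]}) d : (msize p <= d)%N -> (msize (c *: p) <= d)%N.
  by move=> H; apply: leq_trans (msizeZ_le _ _) H.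
have ty i : (msize (tyy a i) <= 3)%N.
  apply: msize_sum_le => j; apply: msize_sum_le => l; apply: ZZ.
  exact: (msize_mul_le (msizeY _) (msizeY _)).
rewrite /yrel; case: e => -[|[|[|[|//]]]] /= _; apply: msize_sum_le => i.
- by apply: ZZ; apply: msizeY.
- by apply: msize_sum_le => j; apply: ZZ; apply: (msize_mul_le (msizeY _) (msizeY _)).
- exact: (msize_mul_le (msizeY _) (ty _)).
- by apply: msize_sum_le => j; apply: ZZ; apply: (msize_mul_le (ty _) (ty _)).
Qed.

End Staircase.

(** * An explicit cubic with a monomial staircase *)

Section Example.
Variable k : numClosedFieldType.
Local Notation V := 'rV[k]_6.
Local Notation N := (nb_monomials 6 3).
Local Notation e_ := (unitv k).
Implicit Types (x y z : V).

Definition v3 : 'I_6 := 3%:R.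
Definition v4 : 'I_6 := 4%:R.
Definition v5 : 'I_6 := 5%:R.

(* Over the point [e_0] of this cubic the equations of the flags have leading
   terms [Y5], [Y2^2], [Y3^3] and [Y4^4] for the weights 2, 1, 1 of [Y2, Y3, Y4]. *)
Definition f0 : {mpoly k[6]} :=
  3%:R *: ('X_0 * 'X_0 * 'X_v5) + 3%:R *: ('X_0 * 'X_1 * 'X_1) + 3%:R *: ('X_0 * 'X_2%:R * 'X_2%:R)
  + 6%:R *: ('X_0 * 'X_v3 * 'X_v4) + 'X_v3 * 'X_v3 * 'X_v3 + 3%:R *: ('X_1 * 'X_v4 * 'X_v4).
Definition a0 : 'rV[k]_N := coefs f0.

Lemma f0_homog : f0 \is 3.-homog.
Proof.
have H i j l : ('X_i * 'X_j * 'X_l : {mpoly k[6]}) \is 3.-homog.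
  by rewrite -!mpolyXD dhomogX; apply/eqP/(m3_deg i j l).
by rewrite /f0 !rpredD ?rpredZ.
Qed.

Definition T0 x y z : k :=
  let c i j l := x 0 i * y 0 j * z 0 l in
  c 0 0 v5 + c 0 v5 0 + c v5 0 0 + c 0 1 1 + c 1 0 1 + c 1 1 0
  + c 0 2%:R 2%:R + c 2%:R 0 2%:R + c 2%:R 2%:R 0
  + c 0 v3 v4 + c 0 v4 v3 + c v3 0 v4 + c v4 0 v3 + c v3 v4 0 + c v4 v3 0
  + c v3 v3 v3 + c 1 v4 v4 + c v4 1 v4 + c v4 v4 1.

Lemma pol_f0 x y z : pol (form_of a0) x y z = T0 x y z.
Proof.
rewrite form_of_coefs ?f0_homog // !polD !polZ !polM3 /T0.
by field.
Qed.

Local Notation x0 := (e_ 0).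
Local Notation H0 := (hess a0 x0).

Lemma e_E i j : e_ i 0 j = (i == j)%:R.
Proof. by rewrite mxE eqxx eq_sym. Qed.

(** The polar quadric of [f0] at [e_0] is 2 x_0 x_5 + x_1^2 + x_2^2 + 2 x_3 x_4, whose matrix is the
    permutation matrix of this involution. *)
Definition dual (i : 'I_6) : 'I_6 :=
  match val i with 0 => v5 | 3 => v4 | 4 => v3 | 5 => 0 | _ => i end.

Lemma hess0E i j : H0 i j = (j == dual i)%:R.
Proof.
rewrite mxE pol_f0 /T0 !e_E; case: i => -[|[|[|[|[|[|//]]]]]] ?;
  case: j => -[|[|[|[|[|[|//]]]]]] ? /=; rewrite ?(mulr0, mul0r, mulr1, addr0, add0r) //.
Qed.

Lemma dualK : involutive dual.
Proof. by move=> i; apply: val_inj; case: i => -[|[|[|[|[|[|//]]]]]]. Qed.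

Lemma hess0_sq : H0 *m H0 = 1%:M.
Proof.
apply/matrixP => i j; rewrite !mxE (bigD1 (dual i)) //= !hess0E eqxx dualK mul1r big1 ?addr0.
  by rewrite eq_sym.
by move=> l li; rewrite hess0E (negPf li) mul0r.
Qed.

Lemma det_hess0 : \det H0 != 0.
Proof. by rewrite -unitfE -unitmxE; case/mulmx1_unit: hess0_sq. Qed.

Lemma adj_hess0 i j : (\adj H0) i j = \det H0 * (j == dual i)%:R.
Proof.
have -> : \adj H0 = \det H0 *: H0.
  by rewrite -[LHS]mulmx1 -hess0_sq mulmxA mul_adj_mx mul_scalar_mx.
by rewrite mxE hess0E.
Qed.

Lemma rel0 (t : 'rV[k]_4) : let t0 := t 0 0 in let t1 := t 0 1 in let t2 := t 0 2%:R in
  [/\ ev (yrel a0 x0 0) t = t 0 3%:R, ev (yrel a0 x0 1) t = t0 ^+ 2 + 2%:R * t1 * t2 + 1,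
      ev (yrel a0 x0 2%:R) t = t1 ^+ 3 + 3%:R * t2 ^+ 2 &
      ev (yrel a0 x0 3%:R) t = \det H0 * (t2 ^+ 4 + 4%:R * t1 ^+ 2 * t2)].
Proof.
move=> t0 t1 t2; have [-> -> -> ->] := ev_rel a0 x0 t.
have [y0 y1] : yv t 0 0 = 0 /\ yv t 0 1 = 1 by rewrite !mxE /Y /= !evC.
have y_ (j : nat) (i : 'I_6) : val i = j.+2 -> yv t 0 i = t 0 (inord j).
  by move=> ij; rewrite mxE /Y ij evX.
have i4 (j : nat) (l : 'I_4) : val l = j -> inord j = l.
  by move=> <-; rewrite inord_val.
have y2 : yv t 0 2%:R = t0 by rewrite (y_ 0%N) // (i4 _ 0).
have y3 : yv t 0 v3 = t1 by rewrite (y_ 1%N) // (i4 _ 1).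
have y4 : yv t 0 v4 = t2 by rewrite (y_ 2%N) // (i4 _ 2%:R).
have y5 : yv t 0 v5 = t 0 3%:R by rewrite (y_ 3%N) // (i4 _ 3%:R).
have tE i : pol (form_of a0) (e_ i) (yv t) (yv t) = T0 (e_ i) (yv t) (yv t) by rewrite pol_f0.
split; rewrite ?pol_f0.
- by rewrite /T0 !e_E y0 y1 y2 y3 y4 y5 /=; ring.
- by rewrite /T0 !e_E y0 y1 y2 y3 y4 y5 /=; ring.
- by rewrite /T0 y0 y1 y2 y3 y4 y5; ring.
transitivity (\sum_i \det H0 * (T0 (e_ i) (yv t) (yv t) * T0 (e_ (dual i)) (yv t) (yv t))).
  apply: eq_bigr => i _; rewrite (bigD1 (dual i)) //= big1 ?addr0.
    by rewrite adj_hess0 eqxx mulr1 !pol_f0.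
  by move=> j ji; rewrite adj_hess0 (negPf ji) mulr0 mul0r.
rewrite !big_ord_recl big_ord0 /= /T0 !e_E y0 y1 y2 y3 y4 y5 /=; ring.
Qed.

End Example.

(** * Reduction to 24 monomials *)

Section Span.
Variable k : numClosedFieldType.
Local Notation V := 'rV[k]_6.
Local Notation N := (nb_monomials 6 3).
Local Notation J := ('X_{1..4 < 8}).
Local Notation I := (('I_4 * J) + 'I_24)%type.
Local Notation x0 := (unitv k 0).
Local Notation a0 := (a0 k).

(* The 24 monomials under the staircase with corners [Y2^2], [Y3^3], [Y4^4]. *)
Definition bexp (i : 'I_24) : 'X_{1..4} :=
  [multinom nth 0%N [:: i %% 2; (i %/ 2) %% 3; i %/ 6] j | j < 4].

Lemma bexpP (m : 'X_{1..4}) : (m 0%R < 2)%N -> (m 1%R < 3)%N -> (m 2%:R < 4)%N -> m 3%:R = 0%N ->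
  exists i, bexp i = m.
Proof.
move=> m0 m1 m2 m3; have lt : (m 0%R + 2 * m 1%R + 6 * m 2%:R < 24)%N by lia.
exists (Ordinal lt); apply/mnmP => j; rewrite mnmE /=.
case: j => -[|[|[|[|//]]]] ? /=.
- by rewrite (_ : Ordinal _ = 0); [lia|exact: val_inj].
- by rewrite (_ : Ordinal _ = 1); [lia|exact: val_inj].
- by rewrite (_ : Ordinal _ = 2%:R); [lia|exact: val_inj].
- by rewrite (_ : Ordinal _ = 3%:R); [lia|exact: val_inj].
Qed.

(** Degrees stay below 8: staircase monomials have degree at most 1 + 2 + 3 and will be multiplied
    by one variable. Since [yrel e] has degree at most e + 1, multiples with [mdeg m + e < 7] fit,
    and the others are set to 0 to keep one finite index type. *)
Definition mult (a : 'rV[k]_N) (x : V) (i : I) : {mpoly k[4]} :=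
  match i with
  | inl (e, m) => if (mdeg m + e < 7)%N then 'X_[m] * yrel a x e else 0
  | inr i => 'X_[bexp i]
  end.

Lemma bexp_deg i : (mdeg (bexp i) < 7)%N.
Proof.
rewrite mdegE !big_ord_recl big_ord0 !mnmE /=; case: i => i /= lti.
by move: (ltn_pmod i (isT : 0 < 2)%N) (ltn_pmod (i %/ 2) (isT : 0 < 3)%N); lia.
Qed.

Lemma msize_mult a x i : (msize (mult a x i) <= 8)%N.
Proof.
case: i => [[e m]|i] /=; last by rewrite msizeX; have := bexp_deg i; lia.
case: ifP => [lt|]; last by rewrite msize0.
have mX : (msize ('X_[m] : {mpoly k[4]}) <= (mdeg m).+1)%N by rewrite msizeX.
by apply: leq_trans (msize_mul_le mX (msize_rel a x e)) _; rewrite addnS ltnS.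
Qed.

(** A Macaulay matrix: its rows are the coefficients of the multiples of the flag equations and of
    the staircase monomials. *)
Definition mult_mx a x : 'M[k]_(#|{: I}|, #|{: J}|) :=
  \matrix_(i, j) (mult a x (enum_val i : I))@_(val (enum_val j : J)).

Lemma ev_mult a x i t :
  ev (mult a x (enum_val i : I)) t = \sum_j mult_mx a x i j * ev 'X_[enum_val j : J] t.
Proof.
rewrite [in LHS](mpolywE (msize_mult a x (enum_val i))) ev_sum.
rewrite (reindex (@enum_val _ {: J})) /=; last exact: (onW_bij _ (enum_val_bij _)).
by apply: eq_bigr => j _; rewrite evZ mxE.
Qed.

Definition spanned (p : {mpoly k[4]}) := exists u : I -> k, p = \sum_i u i *: mult a0 x0 i.

Lemma spannedD p q : spanned p -> spanned q -> spanned (p + q).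
Proof.
move=> [u ->] [v ->]; exists (fun i => u i + v i).
by rewrite -big_split; apply: eq_bigr => i _; rewrite scalerDl.
Qed.

Lemma spannedZ c p : spanned p -> spanned (c *: p).
Proof.
move=> [u ->]; exists (fun i => c * u i).
by rewrite scaler_sumr; apply: eq_bigr => i _; rewrite scalerA.
Qed.

Lemma spanned_mult i : spanned (mult a0 x0 i).
Proof.
exists (fun j => (i == j)%:R); rewrite (bigD1 i) //= eqxx scale1r big1 ?addr0 // => j ji.
by rewrite eq_sym (negPf ji) scale0r.
Qed.

Lemma spanned_rel (m : 'X_{1..4}) (e : 'I_4) : (mdeg m + e < 7)%N ->
  spanned ('X_[m] * yrel a0 x0 e).
Proof.
move=> lt; have m8 : (mdeg m < 8)%N by lia.
by have := spanned_mult (inl (e, BMultinom m8)); rewrite /= lt.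
Qed.

(** Division by the four equations. Each replacement of a leading term lowers the weight [w] and
    does not raise the degree, so the multiples used stay within the allowed range; the weight is
    needed because Y2^2 is traded for Y3 Y4, of the same degree. *)
Lemma spanned_monomial (m : 'X_{1..4}) : (mdeg m < 8)%N -> spanned 'X_[m].
Proof.
have dh := det_hess0 k.
pose w (m : 'X_{1..4}) := (2 * m 0%R + m 1%R + m 2%:R)%N.
have Ex : forall t : 'rV[k]_4, [/\ ev (yrel a0 x0 0) t = t 0 3%:R,
     ev (yrel a0 x0 1) t = t 0 0 ^+ 2 + 2%:R * t 0 1 * t 0 2%:R + 1,
      ev (yrel a0 x0 2%:R) t = t 0 1 ^+ 3 + 3%:R * t 0 2%:R ^+ 2 &
      ev (yrel a0 x0 3%:R) t = \det (hess a0 x0) * (t 0 2%:R ^+ 4 + 4%:R * t 0 1 ^+ 2 * t 0 2%:R)].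
  by move=> t; apply: rel0.
have mE (p : 'X_{1..4}) : mdeg p = (p 0%R + p 1%R + p 2%:R + p 3%:R)%N.
  rewrite mdegE !big_ord_recl big_ord0 addn0 !addnA.
  by congr (p _ + p _ + p _ + p _)%N; apply: val_inj.
have sub (l : 'I_4) d (p : 'X_{1..4}) : (d <= p l)%N -> exists q, p = (q + U_(l) *+ d)%MM.
  move=> lp; exists (p - U_(l) *+ d)%MM; rewrite submK //; apply/mnm_lepP => j.
  by rewrite mulmnE mnm1E; case: eqP => [<-|_]; rewrite ?mul1n ?mul0n.
have UE (q : 'X_{1..4}) l d j : (q + U_(l) *+ d)%MM j = (q j + (l == j) * d)%N.
  by rewrite mnmDE mulmnE mnm1E.
have [n] := ubnP (w m); elim: n m => // n IH m wm m8.
have [m3|m3] := posnP (m 3%:R); last first.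
  have [q mq] := sub 3%:R 1%N m m3.
  rewrite (_ : 'X_[m] = 'X_[q] * yrel a0 x0 0).
    by apply: spanned_rel; move: m8; rewrite !mE mq !(mnmDE, mulmnE, mnm1E) /=; lia.
  apply: mpoly_ext => t; have [E _ _ _] := Ex t.
  by rewrite mq mpolyXD evM [RHS]evM E -mpolyXn ev_exp evX expr1.
have [m0|m0] := ltnP 1 (m 0%R).
  have [q mq] := sub 0 2%N m m0.
  rewrite (_ : 'X_[m] = 'X_[q] * yrel a0 x0 1 +
     (- 2%:R *: 'X_[q + U_(1) + U_(2%:R)] + -1 *: 'X_[q])).
    apply: spannedD; last apply: spannedD; last 2 first.
    - apply: spannedZ; apply: IH; first by move: wm; rewrite /w mq !(mnmDE, mulmnE, mnm1E) /=; lia.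
      by move: m8; rewrite !mE mq !(mnmDE, mulmnE, mnm1E) /=; lia.
    - apply: spannedZ; apply: IH; first by move: wm; rewrite /w mq !(mnmDE, mulmnE, mnm1E) /=; lia.
      by move: m8; rewrite !mE mq !(mnmDE, mulmnE, mnm1E) /=; lia.
    by apply: spanned_rel; move: m8; rewrite !mE mq !(mnmDE, mulmnE, mnm1E) /=; lia.
  apply: mpoly_ext => t; have [_ E _ _] := Ex t.
  by rewrite mq !mpolyXD !(evD, evM, evZ) E !evX; ring.
have [m1|m1] := ltnP 2 (m 1%R).
  have [q mq] := sub 1 3%N m m1.
  rewrite (_ : 'X_[m] = 'X_[q] * yrel a0 x0 2%:R + - 3%:R *: 'X_[q + U_(2%:R) *+ 2]).
    apply: spannedD; last first.
      apply: spannedZ; apply: IH; first by move: wm; rewrite /w mq !(mnmDE, mulmnE, mnm1E) /=; lia.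
      by move: m8; rewrite !mE mq !(mnmDE, mulmnE, mnm1E) /=; lia.
    by apply: spanned_rel; move: m8; rewrite !mE mq !(mnmDE, mulmnE, mnm1E) /=; lia.
  apply: mpoly_ext => t; have [_ _ E _] := Ex t.
  by rewrite mq !mpolyXD !(evD, evM, evZ) E !evX; ring.
have [m2|m2] := ltnP 3 (m 2%:R).
  have [q mq] := sub 2%:R 4%N m m2.
  rewrite (_ : 'X_[m] = (\det (hess a0 x0))^-1 *: ('X_[q] * yrel a0 x0 3%:R) +
      - 4%:R *: 'X_[q + U_(1) *+ 2 + U_(2%:R)]).
    apply: spannedD; apply: spannedZ; last first.
      apply: IH; first by move: wm; rewrite /w mq !(mnmDE, mulmnE, mnm1E) /=; lia.
      by move: m8; rewrite !mE mq !(mnmDE, mulmnE, mnm1E) /=; lia.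
    by apply: spanned_rel; move: m8; rewrite !mE mq !(mnmDE, mulmnE, mnm1E) /=; lia.
  apply: mpoly_ext => t; have [_ _ _ E] := Ex t.
  by rewrite mq !mpolyXD !(evD, evM, evZ) E !evX; field.
have [i <-] := @bexpP m m0 m1 m2 m3; exact: (spanned_mult (inr i)).
Qed.

Lemma mult_mx_full : row_full (mult_mx a0 x0).
Proof.
rewrite -sub1mx; apply/row_subP => j; rewrite row1.
have [u uE] := spanned_monomial (bmdeg (enum_val j : J)).
apply/submxP; exists (\row_i u (enum_val i)); apply/rowP => l; rewrite [RHS]mxE.
have := congr1 (mcoeff (enum_val l : J)) uE.
rewrite mcoeffX raddf_sum /= (reindex (@enum_val _ {: I})) /=; last exact: (onW_bij _ (enum_val_bij _)).
move=> E; rewrite mxE eqxx /=.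
rewrite (_ : (l == j) = (val (enum_val j : J) == val (enum_val l : J))).
  by rewrite E; apply: eq_bigr => i _; rewrite !mxE mcoeffZ.
by rewrite (inj_eq val_inj) (inj_eq enum_val_inj) eq_sym.
Qed.

(** [D] is a maximal minor of the Macaulay matrix that is nonzero at the example. By Cramer's rule
    [D] times any monomial is a combination of the rows of the minor, and the rows coming from the
    equations vanish at their common zeros. *)
Lemma staircase : exists (D : 'rV[k]_N -> V -> k) (c : J -> 'I_24 -> 'rV[k]_N -> V -> k),
  [/\ jpoly (fun a x _ _ => D a x), forall m i, jpoly (fun a x _ _ => c m i a x),
      D a0 x0 != 0 &
      forall a x t, (forall e, ev (yrel a x e) t = 0) ->
      forall m, D a x * ev 'X_[m : J] t = \sum_i c m i a x * ev 'X_[bexp i] t].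
Proof.
pose f := fullrankfun mult_mx_full.
pose S a x : 'M[k]_#|{: J}| := rowsub f (mult_mx a x).
pose c (m : J) (i : 'I_24) a x :=
  \sum_l (\adj (S a x)) (enum_rank m) l * ((enum_val (f l) : I) == inr i)%:R.
have pS T (C : (T -> k) -> Prop) (a : T -> 'rV[k]_N) (x : T -> V) : funalg C ->
    (forall i, C (fun t => a t 0 i)) -> (forall i, C (fun t => x t 0 i)) ->
    forall i j, C (fun t => S (a t) (x t) i j).
  move=> alg Ha Hx i j.
  apply: falg_ext (_ : C (fun t => (mult (a t) (x t) (enum_val (f i) : I))@_(val (enum_val j : J)))) _ => //; last first.
    by move=> t; rewrite !mxE.
  case: (enum_val (f i) : I) => [[e m]|l] /=; last exact: falgC.
  case: (mdeg m + e < 7)%N; last exact: falgC.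
  apply: falg_mcoefM => //; first exact: falg_mcoef_const.
  exact: falg_rel.
exists (fun a x => \det (S a x)), c; split.
- by move=> T C a x y z alg Ha Hx _ _; apply: falg_det => //; apply: pS.
- move=> m i T C a x y z alg Ha Hx _ _; apply: falg_sum => // l.
  apply: (falgM alg); last exact: falgC.
  by apply: falg_adj => //; apply: pS.
- rewrite -unitfE -unitmxE; exact: fullrowsub_unit.
move=> a x t zero m; pose X : 'cV[k]_#|{: J}| := \col_j ev 'X_[enum_val j : J] t.
have : \adj (S a x) *m (S a x *m X) = \det (S a x) *: X by rewrite mulmxA mul_adj_mx mul_scalar_mx.
move/matrixP => /(_ (enum_rank m) 0); rewrite !mxE enum_rankK => <-.
rewrite /c; under [RHS]eq_bigr => i _ do rewrite mulr_suml.
rewrite exchange_big /=; apply: eq_bigr => l _.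
have -> : (S a x *m X) l 0 = ev (mult a x (enum_val (f l) : I)) t.
  by rewrite ev_mult mxE; apply: eq_bigr => j _; rewrite !mxE.
case: (enum_val (f l) : I) => [[e p]|i] /=.
  rewrite big1 => [|i _]; last by rewrite mulr0 mul0r.
  by case: ifP => _; rewrite ?ev0 ?mulr0 // evM zero !mulr0.
rewrite (bigD1 i) //= eqxx mulr1 big1 ?addr0 // => j ji.
by rewrite (inj_eq inr_inj) eq_sym (negPf ji) mulr0 mul0r.
Qed.

End Span.

(** * Generic conditions *)

Section Localize.
Variable k : numClosedFieldType.
Local Notation V := 'rV[k]_6.
Local Notation N := (nb_monomials 6 3).

(** Functions that lie in [C] up to a power of [s], compared only where [s] is nonzero. They form a
    function algebra again, so the closure lemmas apply to fractions. *)
Definition localization T (C : (T -> k) -> Prop) (s phi : T -> k) :=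
  exists d, exists2 psi, C psi & forall t, s t != 0 -> psi t = s t ^+ d * phi t.

Lemma localization_alg T (C : (T -> k) -> Prop) (s : T -> k) : funalg C -> C s ->
  funalg (localization C s).
Proof.
move=> alg Cs; split.
- by move=> c; exists 0%N, (fun=> c) => [|t _]; [exact: falgC | rewrite expr0 mul1r].
- move=> p q [d [p' Cp pE]] [e [q' Cq qE]].
  exists (d + e)%N, (fun t => s t ^+ e * p' t + s t ^+ d * q' t) => [|t st].
    by apply: (falgD alg); apply: (falgM alg) => //; apply: falgX.
  by rewrite pE // qE // exprD; ring.
- move=> p q [d [p' Cp pE]] [e [q' Cq qE]].
  exists (d + e)%N, (fun t => p' t * q' t) => [|t st]; first exact: (falgM alg).
  by rewrite pE // qE // exprD; ring.
Qed.

Lemma localize (P : {mpoly k[N + 6]}) : exists2 L : 'rV[k]_N -> V -> k,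
  jpoly (fun a x _ _ => L a x) &
  forall a x, L a x != 0 <-> x 0 0 != 0 /\ ev P (row_mx a ((x 0 0)^-1 *: x)) != 0.
Proof.
have alg := polyf_alg k (N + 6).
pose x_ (v : 'rV[k]_(N + 6)) : V := rsubmx v.
have Cs : polyf (fun v => x_ v 0 0) by exact: rsubmx_polyf.
have [|i|d [psi Cpsi psiE]] := falg_ev (C := localization (@polyf k (N + 6)) (fun v => x_ v 0 0)) (g := fun v => row_mx (lsubmx v) ((x_ v 0 0)^-1 *: x_ v)) P.
- exact: localization_alg.
- apply: falg_row_mx; last exact: localization_alg.
    move=> j; exists 0%N, (fun v => lsubmx v 0 j) => [|v _]; first exact: lsubmx_polyf.
    by rewrite mul1r.
  move=> j; exists 1%N, (fun v => x_ v 0 j) => [|v v0]; first exact: rsubmx_polyf.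
  by rewrite expr1 [(_ *: x_ v) 0 j]mxE mulrA divff // mul1r.
exists (fun (a : 'rV[k]_N) (x : V) => x 0 0 * psi (row_mx a x)) => [T C a x y z algC Ha Hx _ _|a x].
  by apply: (falgM algC) => //; apply: (falg_polyf algC) => //; apply: falg_row_mx.
have [->|x0] := eqVneq (x 0 0) 0; first by rewrite mul0r eqxx; split=> // -[].
rewrite mulf_eq0 (negPf x0) /= psiE /x_ row_mxKr ?row_mxKl //.
by rewrite mulf_eq0 expf_eq0 (negPf x0) andbF; split=> [|[]].
Qed.

End Localize.

Section GoodPolynomial.
Variable k : numClosedFieldType.
Local Notation V := 'rV[k]_6.
Local Notation N := (nb_monomials 6 3).
Implicit Types (x y z u v w : V) (a : 'rV[k]_N).

Definition det3 u v w (i j l : 'I_6) : k :=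
  u 0 i * (v 0 j * w 0 l - v 0 l * w 0 j) - u 0 j * (v 0 i * w 0 l - v 0 l * w 0 i)
  + u 0 l * (v 0 i * w 0 j - v 0 j * w 0 i).

Lemma det3_ind3 u v w i j l : det3 u v w i j l != 0 -> ind3 u v w.
Proof.
move=> d0 r s t H.
have E m : r * u 0 m + s * v 0 m + t * w 0 m = 0.
  by have := congr1 (fun p : V => p 0 m) H; rewrite !mxE.
have Er : r * det3 u v w i j l = 0.
  transitivity ((v 0 j * w 0 l - v 0 l * w 0 j) * (r * u 0 i + s * v 0 i + t * w 0 i)
    - (v 0 i * w 0 l - v 0 l * w 0 i) * (r * u 0 j + s * v 0 j + t * w 0 j)
    + (v 0 i * w 0 j - v 0 j * w 0 i) * (r * u 0 l + s * v 0 l + t * w 0 l)).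
    by rewrite /det3; ring.
  by rewrite !E; ring.
have Es : s * det3 u v w i j l = 0.
  transitivity (- (u 0 j * w 0 l - u 0 l * w 0 j) * (r * u 0 i + s * v 0 i + t * w 0 i)
    + (u 0 i * w 0 l - u 0 l * w 0 i) * (r * u 0 j + s * v 0 j + t * w 0 j)
    - (u 0 i * w 0 j - u 0 j * w 0 i) * (r * u 0 l + s * v 0 l + t * w 0 l)).
    by rewrite /det3; ring.
  by rewrite !E; ring.
have Et : t * det3 u v w i j l = 0.
  transitivity ((u 0 j * v 0 l - u 0 l * v 0 j) * (r * u 0 i + s * v 0 i + t * w 0 i)
    - (u 0 i * v 0 l - u 0 l * v 0 i) * (r * u 0 j + s * v 0 j + t * w 0 j)
    + (u 0 i * v 0 j - u 0 j * v 0 i) * (r * u 0 l + s * v 0 l + t * w 0 l)).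
    by rewrite /det3; ring.
  by rewrite !E; ring.
by split; apply/eqP; [move: Er | move: Es | move: Et] => /eqP; rewrite mulf_eq0 (negPf d0) orbF.
Qed.

Definition p2 x y (i j : 'I_6) : k := x 0 i * y 0 j - x 0 j * y 0 i.

(** A single polynomial whose nonvanishing implies [good]. The minor is taken in columns 3, 4, 5,
    the ones that survive at the flag [e_0, e_1, e_2] of the example; the factor [p2] moreover lets
    coordinates 0 and 1 normalize the line. *)
Definition Jgood a x y z : k :=
  let T := pol (form_of a) in
  T y z z * det3 (covec T x x) (covec T x y) (covec T y y) (v3) (v4) (v5) * p2 x y 0 1.

Lemma Jgood_good a x y z : flag (pol (form_of a)) x y z -> Jgood a x y z != 0 ->
  good (pol (form_of a)) x y z /\ p2 x y 0 1 != 0.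
Proof.
move=> fl; rewrite /Jgood mulf_eq0 negb_or => /andP [Td p].
have := Td; rewrite mulf_eq0 negb_or => /andP [h d].
by split=> //; split=> //; apply: det3_ind3 d.
Qed.

Lemma falg_det3 T (C : (T -> k) -> Prop) (u v w : T -> V) i j l : funalg C ->
  (forall i, C (fun t => u t 0 i)) -> (forall i, C (fun t => v t 0 i)) ->
  (forall i, C (fun t => w t 0 i)) -> C (fun t => det3 (u t) (v t) (w t) i j l).
Proof.
move=> alg Hu Hv Hw; have M := falgM alg; have B := falgB alg; have D := falgD alg.
by apply: (D); [apply: (B)|]; apply: (M) => //; apply: (B); apply: (M).
Qed.

Lemma falg_p2 T (C : (T -> k) -> Prop) (u v : T -> V) i j : funalg C ->
  (forall i, C (fun t => u t 0 i)) -> (forall i, C (fun t => v t 0 i)) ->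
  C (fun t => p2 (u t) (v t) i j).
Proof. by move=> alg Hu Hv; apply: (falgB alg); apply: (falgM alg). Qed.

Lemma Jgood_jpoly : jpoly Jgood.
Proof.
move=> T C a x y z alg Ha Hx Hy Hz.
have cov (u v : T -> V) i : (forall i, C (fun t => u t 0 i)) -> (forall i, C (fun t => v t 0 i)) ->
    C (fun t => covec (pol (form_of (a t))) (u t) (v t) 0 i).
  move=> Hu Hv; apply: falg_ext (_ : C (fun t => pol (form_of (a t)) (u t) (v t) (unitv k i))) _ => //.
    by apply: falg_pol => // j; apply: falgC.
  by move=> t; rewrite mxE.
have M := falgM alg.
by apply: (M); [apply: (M) |]; [apply: falg_pol | apply: falg_det3 => // i; apply: cov | apply: falg_p2].
Qed.

Definition flag_invariant (Psi : 'rV[k]_N -> V -> V -> V -> k) :=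
  forall a x y z (al be ga de ep et : k), flag (pol (form_of a)) x y z ->
    al != 0 -> be != 0 -> ga != 0 -> Psi a x y z != 0 ->
    Psi a (al *: x) (be *: y + de *: x) (ga *: z + ep *: y + et *: x) != 0.

Lemma Jgood_invariant : flag_invariant Jgood.
Proof.
move=> a x y z al be ga de ep et fl al0 be0 ga0.
pose T := pol (form_of a); have TT : symtri T := pol_symtri (form_of_homog a).
have flT : flag T x y z := fl.
have [_ [h1 h2 h3 h4] [h5 h6 h7 h8]] := flT.
rewrite /Jgood -/T.
have -> : T (be *: y + de *: x) (ga *: z + ep *: y + et *: x) (ga *: z + ep *: y + et *: x) =
    be * ga ^+ 2 * T y z z.
  have c12 := triC12 TT; have c23 := triC23 TT; have c13 := triC13 TT.
  have e1 : T y z y = 0 by rewrite c23.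
  have e2 : T y x z = 0 by rewrite c12.
  have e3 : T y z x = 0 by rewrite c13 c23.
  have e4 : T y y x = 0 by rewrite c13.
  have e5 : T y x y = 0 by rewrite c12.
  have e6 : T y x x = 0 by rewrite c13.
  have e7 : T x z y = 0 by rewrite c23.
  have e8 : T x z x = 0 by rewrite c23.
  have e9 : T x y x = 0 by rewrite c23.
  rewrite !(triE TT) e1 e2 e3 e4 e5 e6 e7 e8 e9.
  by rewrite ?h1 ?h2 ?h3 ?h4 ?h5 ?h6 ?h7 ?h8; ring.
have -> : det3 (covec T (al *: x) (al *: x)) (covec T (al *: x) (be *: y + de *: x))
    (covec T (be *: y + de *: x) (be *: y + de *: x)) v3 v4 v5 =
    al ^+ 3 * be ^+ 3 * det3 (covec T x x) (covec T x y) (covec T y y) v3 v4 v5.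
  rewrite /det3 !mxE !(triE TT) ![T y x _](triC12 TT).
  ring.
have -> : p2 (al *: x) (be *: y + de *: x) 0 1 = al * be * p2 x y 0 1 by rewrite /p2 !mxE; ring.
move: (T y z z) (det3 _ _ _ _ _ _) (p2 x y 0 1) => A B D.
move=> nz; rewrite (_ : _ * _ = (be ^+ 5 * ga ^+ 2 * al ^+ 4) * (A * B * D)); last by ring.
by apply: mulf_neq0 nz; do 2 (apply: mulf_neq0; last exact: expf_neq0); apply: expf_neq0.
Qed.

Lemma Jgood_exists : exists a x y z, flag (pol (form_of a)) x y z /\ Jgood a x y z != 0.
Proof.
(* For the flag [e_0, e_1, e_2] the first term gives T y z z = 1, and the other three make T x x, T
   x y and T y y the coordinates 3, 4 and 5. *)
pose f1 : {mpoly k[6]} := 3%:R *: ('X_1 * 'X_2%:R * 'X_2%:R) + 3%:R *: ('X_0 * 'X_0 * 'X_v3)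
  + 6%:R *: ('X_0 * 'X_1 * 'X_v4) + 3%:R *: ('X_1 * 'X_1 * 'X_v5).
have f13 : f1 \is 3.-homog.
  have H i j l : ('X_i * 'X_j * 'X_l : {mpoly k[6]}) \is 3.-homog.
    by rewrite -!mpolyXD dhomogX; apply/eqP/(m3_deg i j l).
  by rewrite /f1 !rpredD ?rpredZ.
pose T1 x y z : k := let c i j l := x 0 i * y 0 j * z 0 l in
  c 1 2%:R 2%:R + c 2%:R 1 2%:R + c 2%:R 2%:R 1 + c 0 0 v3 + c 0 v3 0 + c v3 0 0
  + c 0 1 v4 + c 0 v4 1 + c 1 0 v4 + c v4 0 1 + c 1 v4 0 + c v4 1 0
  + c 1 1 v5 + c 1 v5 1 + c v5 1 1.
have TE x y z : pol (form_of (coefs f1)) x y z = T1 x y z.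
  by rewrite form_of_coefs // !polD !polZ !polM3 /T1; field.
have ind : ind3 (unitv k 0) (unitv k 1) (unitv k 2%:R).
  by apply: (@det3_ind3 _ _ _ 0 1 2%:R); rewrite /det3 !e_E /= !(mulr0, mul0r, mulr1, subr0, addr0) oner_neq0.
exists (coefs f1), (unitv k 0), (unitv k 1), (unitv k 2%:R); split.
  split=> //; split; rewrite TE /T1 !e_E /= ?(mulr0, mul0r, mulr1, addr0) //.
rewrite /Jgood /det3 /p2 !mxE /= !TE /T1 -!/(unitv k _) !e_E /=.
by rewrite !(mulr0, mul0r, mulr1, addr0, add0r, subr0) oner_neq0.
Qed.

Lemma normal_form x y z i0 i1 : x 0 i0 != 0 -> p2 x y i0 i1 != 0 ->
  exists al be de ep et : k, [/\ al != 0, be != 0,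
    [/\ (al *: x) 0 i0 = 1, (be *: y + de *: x) 0 i0 = 0 & (be *: y + de *: x) 0 i1 = 1],
    (z + ep *: y + et *: x) 0 i0 = 0 /\ (z + ep *: y + et *: x) 0 i1 = 0 &
    forall i, (z + ep *: y + et *: x) 0 i = det3 x y z i0 i1 i / p2 x y i0 i1].
Proof.
move=> xi p; pose q := p2 x y i0 i1.
exists (x 0 i0)^-1, (x 0 i0 / q), (- y 0 i0 / q), (- p2 x z i0 i1 / q), (p2 y z i0 i1 / q).
have qE : q = x 0 i0 * y 0 i1 - x 0 i1 * y 0 i0 by [].
have q0 : x 0 i0 * y 0 i1 - x 0 i1 * y 0 i0 != 0 by rewrite -qE.
split; rewrite ?invr_eq0 ?mulf_neq0 ?invr_eq0 //.
- by split; rewrite !mxE ?mulVf // qE; field.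
- by split; rewrite !mxE /p2 qE; field.
- by move=> i; rewrite !mxE /det3 /p2 qE; field.
Qed.

Lemma perm3 (i0 i1 i2 : 'I_6) : i0 != i1 -> i0 != i2 -> i1 != i2 ->
  exists s : 'S_6, [/\ s 0 = i0, s 1 = i1 & s 2%:R = i2].
Proof.
move=> h01 h02 h12; pose s1 := tperm 0 i0.
have s10 : s1 0 = i0 by rewrite tpermL.
pose s2 := (s1 * tperm (s1 1%R) i1)%g.
have s20 : s2 0 = i0.
  by rewrite permM s10 tpermD // 1?eq_sym // -s10 (inj_eq perm_inj).
have s21 : s2 1 = i1 by rewrite permM tpermL.
exists (s2 * tperm (s2 2%:R) i2)%g; split; rewrite permM ?tpermL //.
  by rewrite s20 tpermD // 1?eq_sym // -s20 (inj_eq perm_inj).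
by rewrite s21 tpermD // 1?eq_sym // -s21 (inj_eq perm_inj).
Qed.

Lemma chart_exists x y z i0 i1 : ind3 x y z -> x 0 i0 != 0 -> p2 x y i0 i1 != 0 ->
  exists (sigma : 'S_6) (al be ga de ep et : k), [/\ sigma 0 = i0 /\ sigma 1 = i1,
    al != 0, be != 0, ga != 0 &
    chart3 sigma (al *: x) (be *: y + de *: x) (ga *: z + ep *: y + et *: x)].
Proof.
move=> I xi p; have [al [be [de [ep [et [al0 be0 [h1 h2 h3] [h4 h5] _]]]]]] := normal_form z xi p.
set Z := z + _ + _ in h4 h5.
have /rV0Pn [i2 Zi] : Z != 0.
  apply/eqP => Z0; have [] := I et ep 1; last by move=> _ _ /eqP; rewrite oner_eq0.
  by rewrite -[RHS]Z0 /Z scale1r addrC [et *: x + _]addrC addrA.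
have h01 : i0 != i1 by apply: contraNneq p => ->; rewrite /p2 subrr.
have h02 : i0 != i2 by apply: contraNneq Zi => <-; rewrite h4.
have h12 : i1 != i2 by apply: contraNneq Zi => <-; rewrite h5.
have [s [s0 s1 s2]] := perm3 h01 h02 h12.
exists s, al, be, (Z 0 i2)^-1, de, (ep / Z 0 i2), (et / Z 0 i2); split=> //.
  by rewrite invr_eq0.
have -> : (Z 0 i2)^-1 *: z + (ep / Z 0 i2) *: y + (et / Z 0 i2) *: x = (Z 0 i2)^-1 *: Z.
  by rewrite /Z !scalerDr !scalerA ![_ / _]mulrC.
split; rewrite ?s0 ?s1 ?s2 //.
by split; rewrite mxE ?h4 ?h5 ?mulr0 // mulVf.
Qed.

(** [C_relation] wants a witness in the given chart: [flag_meet] combines an arbitrary witness with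
    the nonvanishing of the three leading minors collected in [Q]. *)
Lemma chart_normal Psi sigma : jpoly Psi -> flag_invariant Psi ->
  (exists a x y z, flag (pol (form_of a)) x y z /\ Psi a x y z != 0) ->
  exists f x y z, [/\ f \is 3.-homog, flag (pol f) x y z, chart3 sigma x y z &
                       Psi (coefs f) x y z != 0].
Proof.
move=> jP inv eP.
pose Q (a : 'rV[k]_N) x y z := x 0 (sigma 0) * p2 x y (sigma 0) (sigma 1)
  * det3 x y z (sigma 0) (sigma 1) (sigma 2%:R).
have [||a [x [y [z [fl]]]]] := flag_meet jP (_ : jpoly Q) eP.
- move=> T C a x y z alg Ha Hx Hy Hz.
  by apply: (falgM alg); [apply: (falgM alg); [exact: Hx | exact: falg_p2] | exact: falg_det3].
- have s01 : (sigma 0 == sigma 1) = false by rewrite (inj_eq perm_inj).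
  have s02 : (sigma 0 == sigma 2%:R) = false by rewrite (inj_eq perm_inj).
  have s12 : (sigma 1 == sigma 2%:R) = false by rewrite (inj_eq perm_inj).
  have d1 : det3 (unitv k (sigma 0)) (unitv k (sigma 1)) (unitv k (sigma 2%:R))
      (sigma 0) (sigma 1) (sigma 2%:R) = 1.
    rewrite /det3 !e_E !eqxx ![sigma 1 == sigma 0]eq_sym ![sigma 2%:R == _]eq_sym s01 s02 s12.
    by rewrite !(mulr0, mul0r, mulr1, subr0, addr0).
  (* For the zero cubic every independent triple is a flag, which gives a witness for [Q]. *)
  exists 0, (unitv k (sigma 0)), (unitv k (sigma 1)), (unitv k (sigma 2%:R)); split.
    have z0 u v w : pol (form_of (0 : 'rV[k]_N)) u v w = 0.
      rewrite (_ : form_of _ = 0) ?pol0 // /form_of big1 // => i _.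
      by rewrite mxE scale0r.
    split; rewrite ?z0 //; apply: (@det3_ind3 _ _ _ (sigma 0) (sigma 1) (sigma 2%:R)).
    by rewrite d1 oner_neq0.
  rewrite /Q d1 /p2 !e_E !eqxx [sigma 1 == sigma 0]eq_sym s01.
  by rewrite !(mulr0, mul0r, mulr1, subr0) oner_neq0.
rewrite !mulf_eq0 !negb_or => /and3P [Pn /andP [x0 p0] d0].
have [al [be [de [ep [et [al0 be0 [h1 h2 h3] [h4 h5] h6]]]]]] := normal_form z x0 p0.
set Z := z + _ + _ in h4 h5 h6.
have Zn : Z 0 (sigma 2%:R) != 0 by rewrite h6 mulf_neq0 // invr_eq0.
pose ga := (Z 0 (sigma 2%:R))^-1; have ga0 : ga != 0 by rewrite invr_eq0.
have E : ga *: z + (ga * ep) *: y + (ga * et) *: x = ga *: Z.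
  by rewrite /Z !scalerDr !scalerA.
exists (form_of a), (al *: x), (be *: y + de *: x), (ga *: z + (ga * ep) *: y + (ga * et) *: x).
have a3 := form_of_homog a.
split=> //; first exact: (flag_change (pol_symtri a3)).
  rewrite E; split=> //; split; rewrite mxE ?h4 ?h5 ?mulr0 //.
  by rewrite /ga mulVf.
by rewrite coefs_form_of; apply: inv.
Qed.

End GoodPolynomial.

(** * The points of a cubic with a good fibre *)

Section FibrePolynomial.
Variable k : numClosedFieldType.
Local Notation V := 'rV[k]_6.
Local Notation N := (nb_monomials 6 3).
Local Notation J := ('X_{1..4 < 8}).
Implicit Types (x y z : V) (a : 'rV[k]_N).

Definition mid x : 'rV[k]_4 := \row_i x 0 (inord i.+1).

Lemma mid_jpoly i : jpoly (fun (_ : 'rV[k]_N) x _ _ => mid x 0 i).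
Proof.
move=> T C a x y z alg _ Hx _ _.
by apply: falg_ext (Hx (inord i.+1)) _ => // t; rewrite mxE.
Qed.

Lemma scale_normal (al : k) x : al != 0 -> x 0 0 != 0 ->
  ((al *: x) 0 0)^-1 *: (al *: x) = (x 0 0)^-1 *: x.
Proof.
by move=> al0 x0; rewrite mxE scalerA invfM mulrAC mulVf // mul1r.
Qed.

Lemma p2_exists x y i0 : ind2 x y -> x 0 i0 != 0 -> exists i1, p2 x y i0 i1 != 0.
Proof.
move=> I xi; apply: contrapT => none.
have [] := I (- y 0 i0) (x 0 i0); last by move=> _ /eqP; rewrite (negPf xi).
apply/rowP => j; rewrite !mxE; have [<-|ji] := eqVneq (p2 x y i0 j) 0; last by case: none; exists j.
by rewrite /p2; ring.
Qed.

(** The first factor makes all flags over [x] good: [C_relation] is applied with the functions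
    [mid x], so that it yields a condition on the point alone. The second keeps the polar quadric
    nondegenerate and the staircase valid. Each factor is exhibited on its own example, and
    [point_meet] joins them. *)
Lemma fibre_polynomial : exists (G : 'rV[k]_N -> V -> k) (D : 'rV[k]_N -> V -> k)
    (c : J -> 'I_24 -> 'rV[k]_N -> V -> k),
  [/\ jpoly (fun a x _ _ => G a x), jpoly (fun a x _ _ => D a x),
      forall m i, jpoly (fun a x _ _ => c m i a x),
      [/\ forall a x (al : k), al != 0 -> G a x != 0 -> G a (al *: x) != 0,
      forall a x, G a x != 0 -> x 0 0 != 0 &
      exists a x, [/\ x != 0, ev (form_of a) x = 0 & G a x != 0]] &
      forall a x, G a x != 0 -> x 0 0 = 1 ->
      [/\ D a x != 0, \det (hess a x) != 0,
          forall y z, flag (pol (form_of a)) x y z -> Jgood a x y z != 0 &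
          forall t, (forall e, ev (yrel a x e) t = 0) ->
          forall m, D a x * ev 'X_[m : J] t = \sum_i c m i a x * ev 'X_[bexp i] t]].
Proof.
have [D [c [jD jc Dx0 Dc]]] := staircase k.
have [g g0 gP] := gen_forall (fun sigma => C_relation (t := fun x _ => mid x) (@Jgood_jpoly k)
  mid_jpoly
  (chart_normal sigma (@Jgood_jpoly k) (@Jgood_invariant k) (@Jgood_exists k))).
pose x_ (v : 'rV[k]_(N + 6)) : V := rsubmx v; pose a_ (v : 'rV[k]_(N + 6)) : 'rV[k]_N := lsubmx v.
have alg := polyf_alg k (N + 6).
have px i : polyf (fun v => x_ v 0 i) by exact: rsubmx_polyf.
have pa i : polyf (fun v => a_ v 0 i) by exact: lsubmx_polyf.
have [P1 P1E] : polyf (fun v : 'rV[k]_(N + 6) => ev g (row_mx (a_ v) (mid (x_ v)))).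
  apply: falg_ev => // i; apply: falg_row_mx => // j.
  by apply: polyf_ext (px (inord j.+1)) _ => q; rewrite [RHS]mxE.
have [P2 P2E] : polyf (fun v : 'rV[k]_(N + 6) => D (a_ v) (x_ v) * \det (hess (a_ v) (x_ v))).
  apply: (falgM alg); last exact: falg_det_hess.
  by apply: (jD _ _ _ _ (fun=> 0) (fun=> 0)) => // i; apply: falgC.
have [L1 jL1 L1P] := localize P1; have [L2 jL2 L2P] := localize P2.
have Prow (a : 'rV[k]_N) x : (ev P1 (row_mx a x) = ev g (row_mx a (mid x))) *
    (ev P2 (row_mx a x) = D a x * \det (hess a x)).
  by rewrite -P1E -P2E /a_ /x_ row_mxKl row_mxKr.
have GP a x : L1 a x * L2 a x != 0 <-> [/\ x 0 0 != 0,
     ev P1 (row_mx a ((x 0 0)^-1 *: x)) != 0 & ev P2 (row_mx a ((x 0 0)^-1 *: x)) != 0].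
  rewrite mulf_eq0 negb_or; split=> [/andP [/L1P [x0 h1] /L2P [_ h2]] //|[x0 h1 h2]].
  by apply/andP; split; [apply/L1P | apply/L2P].
exists (fun a x => L1 a x * L2 a x), D, c; split=> //.
- move=> T C a x y z alg' Ha Hx Hy Hz; apply: (falgM alg').
    exact: (jL1 _ _ _ _ _ _ alg' Ha Hx Hy Hz).
  exact: (jL2 _ _ _ _ _ _ alg' Ha Hx Hy Hz).
- split.
  + move=> a x al al0 /GP [x0 h1 h2]; apply/GP; rewrite scale_normal //.
    by split=> //; rewrite mxE mulf_neq0.
  + by move=> a x /GP [].
  apply: point_meet => //.
    have e5 : gen (fun u : 'rV[k]_(N + 4) =>
        pol (form_of (lsubmx u)) (unitv k v5) (unitv k v5) (unitv k v5) != 0).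
      apply: gen_polyf.
        apply: falg_pol => [|i|i|i|i]; first exact: polyf_alg.
        - exact: lsubmx_polyf.
        - exact: (falgC (polyf_alg _ _)).
        - exact: (falgC (polyf_alg _ _)).
        - exact: (falgC (polyf_alg _ _)).
      exists (row_mx (coefs 'X_[m3 v5 v5 v5]) 0); rewrite row_mxKl form_of_coefs.
        by rewrite pol_m3 eqxx mul1r m3val_neq0.
      by rewrite dhomogX; apply/eqP/(m3_deg v5 v5 v5).
    have [u [gu T5]] : exists u, ev g u != 0 /\ pol (form_of (lsubmx u)) (unitv k v5) (unitv k v5) (unitv k v5) != 0.
      by apply: gen_ex; apply: gen_and e5; exists g.
    pose a := lsubmx u; pose t := rsubmx u; pose f := form_of a.
    have TT : symtri (pol f) := pol_symtri (form_of_homog a).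
    pose w : V := \row_i nth 0 [:: 1; t 0 0; t 0 1; t 0 2%:R; t 0 3%:R; 0] i.
    set T := pol f in TT; rewrite -/a -/f -/T in T5.
    (* With the cubic and the coordinates [mid] prescribed, the last coordinate of a point solves a
       cubic equation with leading coefficient that of X_5^3, nonzero by [T5]. *)
    have [s sE] := @solve_monicpoly k 3 (fun i => - nth 0 [:: T w w w;
       3%:R * T w w (unitv k v5); 3%:R * T w (unitv k v5) (unitv k v5)] i /
       T (unitv k v5) (unitv k v5) (unitv k v5)) isT.
    have x5 : (w + s *: unitv k v5) 0 0 = 1 by rewrite !mxE /= mulr0 addr0.
    exists a, (w + s *: unitv k v5); split.
    + by apply/rV0Pn; exists 0; rewrite x5 oner_neq0.
    + rewrite -pol_diag ?form_of_homog // -/f -/T !(triE TT).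
      rewrite [T (unitv k v5) w w](triC13 TT) [T w (unitv k v5) w](triC23 TT).
      rewrite [T (unitv k v5) w _](triC12 TT) [T (unitv k v5) (unitv k v5) w](triC13 TT).
      move: sE; rewrite !big_ord_recl big_ord0 /= => sE.
      transitivity (s ^+ 3 * T (unitv k v5) (unitv k v5) (unitv k v5) +
        3%:R * s ^+ 2 * T w (unitv k v5) (unitv k v5) + 3%:R * s * T w w (unitv k v5) + T w w w).
        by ring.
      by rewrite sE; field.
    apply/L1P; rewrite x5 invr1 scale1r (Prow _ _).1 oner_neq0; split=> //.
    rewrite (_ : mid _ = t) ?hsubmxK //.
    apply/rowP => i; rewrite !mxE; case: i => -[|[|[|[|//]]]] lt /=; rewrite inordK //=;
      rewrite -val_eqE /= inordK //= mulr0 addr0; congr (u 0 (rshift _ _)); exact: val_inj.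
  exists (a0 k), (unitv k 0); split.
  + by apply/rV0Pn; exists 0; rewrite e_E oner_neq0.
  + by rewrite -pol_diag ?form_of_homog // pol_f0 /T0 !e_E /= !(mulr0, mul0r, addr0).
  apply/L2P; rewrite e_E eqxx invr1 scale1r oner_neq0 (Prow _ _).2; split=> //.
  by rewrite mulf_neq0 ?det_hess0.
move=> a x /GP []; rewrite !(Prow _ _) => _ + + x1; rewrite x1 invr1 scale1r => gx.
rewrite mulf_eq0 negb_or => /andP [Dx Hx]; split=> //; last by move=> t; apply: Dc.
(* Any flag over [x] is normalized in a chart with [sigma 0 = 0], which leaves [x] unchanged; the
   inverse triangular change brings the nonvanishing back. *)
move=> y z fl; have x0 : x 0 0 != 0 by rewrite x1 oner_neq0.
have [i1 p] := p2_exists (ind3_12 (flag_ind fl)) x0.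
have [s [al [be [ga [de [ep [et [[s0 s1] al0 be0 ga0 ch]]]]]]]] := chart_exists (flag_ind fl) x0 p.
have al1 : al = 1 by have [] := ch; rewrite /chart1 s0 mxE x1 mulr1.
have fl' := flag_change (pol_symtri (form_of_homog a)) de ep et al0 be0 ga0 fl.
have := gP _ gx s (form_of a) _ _ _ (form_of_homog a) fl' ch.
rewrite coefs_form_of al1 scale1r => /(_ erefl) Jn.
rewrite al1 scale1r in fl'.
have := @Jgood_invariant k a _ _ _ 1 be^-1 ga^-1 (- de / be) (- ep / (be * ga))
  (ep * de / (be * ga) - et / ga) fl' (oner_neq0 _).
rewrite !invr_eq0 => /(_ be0 ga0 Jn); rewrite scale1r.
rewrite (_ : be^-1 *: _ + _ = y); last by apply/rowP => j; rewrite !mxE; field.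
rewrite (_ : ga^-1 *: _ + _ + _ = z) //.
by apply/rowP => j; rewrite !mxE; field; rewrite ga0 be0.
Qed.

End FibrePolynomial.

(** * Density in the cubic and in its Fano scheme *)

Section Density.
Variable k : numClosedFieldType.
Local Notation V := 'rV[k]_6.
Local Notation N := (nb_monomials 6 3).

Lemma hom_ev n d (h : {mpoly k[n]}) c v : h \is d.-homog -> ev h (c *: v) = c ^+ d * ev h v.
Proof.
move=> /dhomogP hd; rewrite !evE mulr_sumr; apply: eq_big_seq => m mh.
under eq_bigr => i _ do rewrite mxE exprMn.
by rewrite big_split /= prodrXr -mdegE (hd m mh); ring.
Qed.

Lemma rank_directions n r (M : 'M[k]_(n, r)) : (forall d : 'rV_r, exists e : 'rV_n, e *m M = d) -> \rank M = r.
Proof.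
move=> H; apply/eqP; rewrite -[_ == _]/(row_full M) -sub1mx; apply/row_subP => i.
by have [e <-] := H (row i 1%:M); apply: submxMl.
Qed.

(* A vector on the conic [c0 c2 = c1^2] is a multiple of [(al^2, al be, be^2)]. *)
Lemma conic_point (A B C : V) (L0 L1 L2 L3 : k) :
  L0 *: A + (2%:R * L1) *: B + L2 *: C = 0 -> L1 *: A + (2%:R * L2) *: B + L3 *: C = 0 ->
  ~ [/\ L0 = 0, L1 = 0, L2 = 0 & L3 = 0] ->
  exists al be : k, ~ (al = 0 /\ be = 0) /\
    al ^+ 2 *: A + (2%:R * (al * be)) *: B + be ^+ 2 *: C = 0.
Proof.
(* [q] vanishes when the coefficients of the combination of the two relations with weights s and t
   lie on the conic; a binary quadratic form has a nontrivial zero. *)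
move=> R0 R1 nz; pose q s t := (s * L0 + t * L1) * (s * L2 + t * L3) - (s * L1 + t * L2) ^+ 2.
have [s [t [st qst]]] : exists s t, ~ (s = 0 /\ t = 0) /\ q s t = 0.
  pose a2 := L0 * L2 - L1 ^+ 2; pose a1 := L0 * L3 - L1 * L2; pose a0 := L1 * L3 - L2 ^+ 2.
  have qE s t : q s t = a2 * s ^+ 2 + a1 * s * t + a0 * t ^+ 2 by rewrite /q /a2 /a1 /a0; ring.
  have [a20|a20] := eqVneq a2 0.
    exists 1, 0; split=> [[/eqP]|]; first by rewrite oner_eq0.
    by rewrite qE a20; ring.
  have [s sE] := @solve_monicpoly k 2 (fun i => - nth 0 [:: a0; a1] i / a2) isT.
  exists s, 1; split=> [[_ /eqP]|]; first by rewrite oner_eq0.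
  move: sE; rewrite qE !big_ord_recl big_ord0 /= => ->.
  by rewrite /bump /= expr1 expr0; field.
pose c0 := s * L0 + t * L1; pose c1 := s * L1 + t * L2; pose c2 := s * L2 + t * L3.
have cq : c0 * c2 = c1 ^+ 2 by apply/eqP; rewrite -subr_eq0 -/(q s t) qst.
have cR : c0 *: A + (2%:R * c1) *: B + c2 *: C = 0.
  transitivity (s *: (L0 *: A + (2%:R * L1) *: B + L2 *: C) +
                t *: (L1 *: A + (2%:R * L2) *: B + L3 *: C)).
    by apply/rowP => j; rewrite /c0 /c1 /c2 !mxE; ring.
  by rewrite R0 R1 !scaler0 addr0.
have [c00|c00] := eqVneq c0 0; last first.
  exists c0, c1; split=> [[/eqP]|]; first by rewrite (negPf c00).
  transitivity (c0 *: (c0 *: A + (2%:R * c1) *: B + c2 *: C)); last by rewrite cR scaler0.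
  by apply/rowP => j; rewrite -cq !mxE; ring.
have c10 : c1 = 0 by apply/eqP; rewrite -sqrf_eq0 -cq c00 mul0r.
have [c20|c20] := eqVneq c2 0; last first.
  exists 0, c2; split=> [[_ /eqP]|]; first by rewrite (negPf c20).
  transitivity (c2 *: (c0 *: A + (2%:R * c1) *: B + c2 *: C)); last by rewrite cR scaler0.
  by apply/rowP => j; rewrite c00 c10 !mxE; ring.
(* All coefficients of the chosen combination vanish, so the [L] are in geometric progression and
   one of the two given relations already lies on the conic. *)
have [s0|s0] := eqVneq s 0.
  have t0 : t != 0 by apply/eqP => t0; apply: st.
  have z L : s * 0 + t * L = 0 -> L = 0.
    by rewrite mulr0 add0r => /eqP; rewrite mulf_eq0 (negPf t0) => /eqP.
  have l1 : L1 = 0 by apply: z; move: c00; rewrite /c0 s0 mul0r add0r => ->; rewrite mulr0 add0r.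
  have l2 : L2 = 0 by apply: z; move: c10; rewrite /c1 s0 mul0r add0r => ->; rewrite mulr0 add0r.
  have l3 : L3 = 0 by apply: z; move: c20; rewrite /c2 s0 mul0r add0r => ->; rewrite mulr0 add0r.
  have l0 : L0 != 0 by apply/eqP => l0; apply: nz.
  exists 1, 0; split=> [[/eqP]|]; first by rewrite oner_eq0.
  transitivity (L0^-1 *: (L0 *: A + (2%:R * L1) *: B + L2 *: C)); last by rewrite R0 scaler0.
  by apply/rowP => j; rewrite l1 l2 !mxE; field.
pose m := - t / s; have z L L' : s * L + t * L' = 0 -> L = m * L'.
  move=> E; apply/eqP; rewrite -subr_eq0; apply/eqP.
  by transitivity ((s * L + t * L') / s); [rewrite /m; field | rewrite E mul0r].
have l0 := z _ _ c00; have l1 := z _ _ c10; have l2 := z _ _ c20.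
have l3 : L3 != 0 by apply/eqP => l3; apply: nz; rewrite l0 l1 l2 l3 !mulr0.
exists m, 1; split=> [[_ /eqP]|]; first by rewrite oner_eq0.
transitivity (L3^-1 *: (L1 *: A + (2%:R * L2) *: B + L3 *: C)); last by rewrite R1 scaler0.
by apply/rowP => j; rewrite l1 l2 !mxE; field.
Qed.

Section Cubic.
Variable f : {mpoly k[6]}.
Hypotheses (f3 : f \is 3.-homog) (smooth : smooth_cubic f).
Local Notation T := (pol f).
Let TT := pol_symtri f3.

(* The Fano scheme of a smooth cubic is smooth of the expected dimension. *)
Lemma tangent_onto (u v : V) : ind2 u v -> forall d : 'rV[k]_4, exists du dv : V,
  [/\ 3%:R * T u u du = d 0 0, 2%:R * T u v du + T u u dv = d 0 1,
      T v v du + 2%:R * T u v dv = d 0 2%:R & 3%:R * T v v dv = d 0 3%:R].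
Proof.
move=> I d; pose c := covec T.
pose rows : seq 'rV[k]_(6 + 6) := [:: row_mx (3%:R *: c u u) 0; row_mx (2%:R *: c u v) (c u u);
  row_mx (c v v) (2%:R *: c u v); row_mx 0 (3%:R *: c v v)].
pose B : 'M[k]_(4, 6 + 6) := \matrix_(i < 4) nth 0 rows i.
(* The left side is the covector T x x at x = al u + be v, which by smoothness is nonzero unless x
   is. *)
have cz (al be : k) : al ^+ 2 *: c u u + (2%:R * (al * be)) *: c u v + be ^+ 2 *: c v v = 0 ->
    al = 0 /\ be = 0.
  move=> E; have x0 : al *: u + be *: v = 0.
    apply/eqP; apply: contraPT E => /smooth [w /eqP xw] E; apply: xw.
    have : (w *m (al ^+ 2 *: c u u + (2%:R * (al * be)) *: c u v + be ^+ 2 *: c v v)^T) 0 0 = 0.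
      by rewrite E linear0 mulmx0 mxE.
    rewrite !(triE TT) [T v u w](triC12 TT) !linearD !linearZ /= ?mulmxDr -?scalemxAr.
    rewrite !(covecE TT) -/(c u u) -/(c u v) -/(c v v).
    move: (w *m (c u u)^T) (w *m (c u v)^T) (w *m (c v v)^T) => X Y Z; rewrite !mxE => <-.
    ring.
  exact: I.
have Bfree : row_free B.
  apply: inj_row_free => l; rewrite mulmx_sum_row !big_ord_recl big_ord0 addr0 !rowK /= => E.
  pose l0 := l 0 0; pose l1 := l 0 1; pose l2 := l 0 2%:R; pose l3 := l 0 3%:R.
  have [El Er] : l0 *: (3%:R *: c u u) + l1 *: (2%:R *: c u v) + l2 *: c v v = 0 /\
      l1 *: c u u + l2 *: (2%:R *: c u v) + l3 *: (3%:R *: c v v) = 0.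
    have L1 : lift ord0 ord0 = 1 :> 'I_4 by apply: val_inj.
    have L2 : lift ord0 (lift ord0 ord0) = 2%:R :> 'I_4 by apply: val_inj.
    have L3 : lift ord0 (lift ord0 (lift ord0 ord0)) = 3%:R :> 'I_4 by apply: val_inj.
    move: E; rewrite L3 L2 L1 !scale_row_mx !add_row_mx -[RHS]row_mx0 => /eq_row_mx [El Er].
    by split; [rewrite -[RHS]El | rewrite -[RHS]Er]; rewrite !scaler0 ?add0r ?addr0 addrA.
  (* A relation [l] between the four rows amounts to two relations with the overlapping coefficients
     (3 l0, l1, l2, 3 l3), as in [conic_point]. *)
  have [|nz] := pselect [/\ 3%:R * l0 = 0, l1 = 0, l2 = 0 & 3%:R * l3 = 0].
    move=> [/eqP h0 h1 h2 /eqP h3]; move: h0 h3; rewrite !mulf_eq0 !pnatr_eq0 /= => /eqP h0 /eqP h3.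
    apply/rowP => j; rewrite mxE; case: j => -[|[|[|[|//]]]] lt.
    - by rewrite -h0; congr (l 0 _); apply: val_inj.
    - by rewrite -h1; congr (l 0 _); apply: val_inj.
    - by rewrite -h2; congr (l 0 _); apply: val_inj.
    - by rewrite -h3; congr (l 0 _); apply: val_inj.
  have [||al [be [ab E']]] := @conic_point (c u u) (c u v) (c v v) _ _ _ _ _ _ nz.
  - by rewrite -[RHS]El !scalerA; congr (_ *: _ + _ *: _ + _); ring.
  - by rewrite -[RHS]Er !scalerA; congr (_ + _ *: _ + _ *: _); ring.
  by case: ab; apply: cz.
have : row_full B^T by rewrite /row_full mxrank_tr.
move=> /(submx_full d) /submxP [e eB]; exists (lsubmx e), (rsubmx e).
have eE i (p q : V) : row i B = row_mx p q ->
    d 0 i = (lsubmx e *m p^T) 0 0 + (rsubmx e *m q^T) 0 0.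
  move=> rB; transitivity ((e *m (row i B)^T) 0 0).
    by rewrite eB !mxE; apply: eq_bigr => j _; rewrite !mxE.
  by rewrite rB -[in LHS](hsubmxK e) tr_row_mx mul_row_col mxE.
have zz (p : V) : (p *m (0 : V)^T) 0 0 = 0 by rewrite linear0 mulmx0 mxE.
have sc (al : k) (p q : V) : (p *m (al *: q)^T) 0 0 = al * (p *m q^T) 0 0.
  by rewrite linearZ /= -scalemxAr mxE.
split; rewrite !(covecE TT) -/(c u u) -/(c u v) -/(c v v).
- by rewrite (eE 0 (3%:R *: c u u) 0) ?rowK // zz sc addr0.
- by rewrite (eE 1 (2%:R *: c u v) (c u u)) ?rowK // sc.
- by rewrite (eE 2%:R (c v v) (2%:R *: c u v)) ?rowK // sc.
- by rewrite (eE 3%:R 0 (3%:R *: c v v)) ?rowK // zz sc add0r.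
Qed.

Lemma point_directions (v : V) i : ev f v = 0 -> v 0 i = 1 ->
  forall d : 'rV[k]_2, exists e : V, 3%:R * T v v e = d 0 0 /\ e 0 i = d 0 1.
Proof.
move=> fv vi d; have v0 : v != 0 by apply/rV0Pn; exists i; rewrite vi oner_neq0.
have [w vw] := smooth v0.
pose al := d 0 0 / (3%:R * T v v w); exists (al *: w + (d 0 1 - al * w 0 i) *: v); split.
  rewrite !(triE TT) pol_diag // fv mulr0 addr0 /al; field.
  by rewrite ?vw ?pnatr_eq0.
by rewrite !mxE vi; ring.
Qed.

(** The slice f = 0, x_i = 1 is smooth of codimension 2 in dimension 6, so four of the coordinates
    are local parameters and [smooth_dense] applies. *)
Lemma dense_points (P : V -> Prop) :
  (forall sigma (tau : {ffun 'I_4 -> 'I_6}), gen (fun t : 'rV[k]_4 => forall x, ev f x = 0 ->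
     chart1 sigma x -> t = \row_l x 0 (tau l) -> P x)) ->
  forall d h x0, h \is d.-homog -> x0 != 0 -> ev f x0 = 0 -> ev h x0 != 0 ->
  exists x, [/\ x != 0, ev f x = 0, ev h x != 0 & P x].
Proof.
move=> HP d h x0 hd /rV0Pn [i xi] fx hx; pose v := (x0 0 i)^-1 *: x0.
have vi : v 0 i = 1 by rewrite mxE mulVf.
have fv : ev f v = 0 by rewrite (hom_ev _ _ f3) fx mulr0.
have hv : ev h v != 0 by rewrite (hom_ev _ _ hd) mulf_neq0 // expf_neq0 // invr_eq0.
clearbody v; pose g (j : 'I_2) : {mpoly k[2 + 4]} := if val j == 0%N then f else 'X_i - 1%:MP.
have g0 w : (forall j, ev (g j) w = 0) <-> ev f w = 0 /\ w 0 i = 1.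
  split=> [H|[h0 h1] j].
    by have := H 1; have := H 0; rewrite /g /= evB evX evC => -> /eqP; rewrite subr_eq0 => /eqP.
  by rewrite /g; case: ifP => _ //; rewrite evB evX evC h1 subrr.
have rk : \rank (jacobian g v) = 2%N.
  apply: rank_directions => e; have [w [w0 w1]] := point_directions fv vi e.
  exists w; apply: (@jacobian_direction _ 2 _ _ _ _ _
    (fun j => if val j == 0%N then (3%:R * T v w w)%:P + T w w w *: 'X else 0)) => j t.
  rewrite /g; case: j => -[|[|//]] lt /=.
    rewrite -!(pol_diag _ f3) !(triE TT) [T w v v](triC13 TT) [T v w v](triC23 TT).
    rewrite [T w w v](triC13 TT) [T w v w](triC12 TT) pol_diag // hornerD hornerC hornerZ hornerX.
    by rewrite (_ : Ordinal lt = 0) -?w0; [ring | exact: val_inj].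
  rewrite !evB !evX !evC !mxE (_ : Ordinal lt = 1) -?w1; last exact: val_inj.
  by rewrite horner0; ring.
have HP' (tau : 'I_4 -> 'I_6) : exists c : {mpoly k[4]}, c != 0 /\
    forall t, ev c t != 0 -> forall x, ev f x = 0 -> x 0 i = 1 -> t = \row_l x 0 (tau l) -> P x.
  have [c c0 cP] := HP (tperm 0 i) (finfun tau); exists c; split=> // t ct x fx' xi' tx.
  apply: (cP t ct) => //; first by rewrite /chart1 tpermL.
  by rewrite tx; apply/rowP => l; rewrite !mxE ffunE.
have [c cP] := choice HP'.
have [tau [w [/g0 [fw wi] hw cw]]] := @smooth_dense k 2 4 g v h c
  ((g0 v).2 (conj fv vi)) rk hv (fun tau => (cP tau).1).
exists w; split=> //; first by apply/rV0Pn; exists i; rewrite wi oner_neq0.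
by apply: (cP tau).2 cw _ fw wi _.
Qed.

End Cubic.

End Density.

(** * Density in the Fano scheme *)

Section Lines.
Variable k : numClosedFieldType.
Local Notation V := 'rV[k]_6.
Local Notation N := (nb_monomials 6 3).
Implicit Types (x y z : V) (a : 'rV[k]_N).

Definition pl (u v : V) : 'rV[k]_(6 * 6) := mxvec (u^T *m v - v^T *m u).

Lemma plE u v i j : pl u v 0 (mxvec_index i j) = p2 u v i j.
Proof. by rewrite mxvecE !mxE !big_ord1 !mxE /p2; ring. Qed.

Lemma pl_change (al be ga de : k) u v :
  pl (al *: u + be *: v) (ga *: u + de *: v) = (al * de - be * ga) *: pl u v.
Proof.
apply/rowP => q; case/mxvec_indexP: q => i j.
by rewrite plE [RHS]mxE plE /p2 !mxE; ring.
Qed.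

(** In the chart, [u] and [y] are the basis of the line with an identity block at the first two
    pivots: they do not depend on which point of the line [x] is, and so give coordinates on the
    Fano scheme. The boolean orders the two vectors. *)
Definition line_coords (sigma : 'S_6) (b : bool) (tau : {ffun 'I_4 -> 'I_(6 + 6)}) x y : 'rV[k]_4 :=
  let u := x - x 0 (sigma 1) *: y in
  \row_l (if b then row_mx y u else row_mx u y) 0 (tau l).

Lemma line_coords_jpoly sigma b tau i :
  jpoly (fun (_ : 'rV[k]_N) x y _ => line_coords sigma b tau x y 0 i).
Proof.
move=> T C a x y z alg _ Hx Hy _.
have Hu j : C (fun t => (x t - x t 0 (sigma 1%R) *: y t) 0 j).
  apply: falg_ext (falgB alg (Hx j) (falgM alg (Hx (sigma 1)) (Hy j))) _ => // t.
  by rewrite !mxE.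
case: b.
  by apply: falg_ext (falg_row_mx Hy Hu alg (tau i)) _ => // t; rewrite [RHS]mxE.
by apply: falg_ext (falg_row_mx Hu Hy alg (tau i)) _ => // t; rewrite [RHS]mxE.
Qed.

Section Fibre.
Variables (a : 'rV[k]_N).
Local Notation T := (pol (form_of a)).

Lemma fibre_points x : ev (form_of a) x = 0 -> x 0 0 = 1 -> \det (hess a x) != 0 ->
  (forall y z, flag T x y z -> Jgood a x y z != 0) ->
  exists Y Z : 'I_24 -> V, [/\ forall i, flag T x (Y i) (Z i), forall i, Y i 0 0 = 0,
    forall i, Y i 0 1 = 1 & injective Y].
Proof.
move=> fx x1 dh all_J; have a3 := form_of_homog a; have TT := pol_symtri a3.
have x0 : x 0 0 != 0 by rewrite x1 oner_neq0.
have xX : T x x x = 0 by rewrite pol_diag.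
have all_good y z : flag T x y z -> good T x y z.
  by move=> fl; have [] := Jgood_good fl (all_J _ _ fl).
have nondeg w : (forall v, T x w v = 0) -> w = 0.
  move=> H; have : w *m hess a x = 0.
    apply/rowP => j; rewrite !mxE -[RHS](H (unitv k j)) (triC23 TT) [RHS]tri_coord3.
    by apply: eq_bigr => i _; rewrite mxE (triC23 TT).
  move/(congr1 (mulmx^~ (invmx (hess a x)))); rewrite mulmxK ?mul0mx //.
  by rewrite unitmxE unitfE.
have [Y [Z [fl Y0 Yne]]] := fibre24 TT xX x0 all_good nondeg.
have Y1 i : Y i 0 1 != 0.
  have [_] := Jgood_good (fl i) (all_J _ _ (fl i)).
  by rewrite /p2 x1 Y0 mulr0 subr0 mul1r.
exists (fun i => (Y i 0 1)^-1 *: Y i), Z; split.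
- move=> i; have := flag_change TT 0 0 0 (oner_neq0 k) (_ : (Y i 0 1)^-1 != 0) (oner_neq0 k) (fl i).
  by rewrite !scale0r !scale1r !addr0; apply; rewrite invr_eq0.
- by move=> i; rewrite mxE Y0 mulr0.
- by move=> i; rewrite mxE mulVf.
move=> i j E; apply/eqP; apply: contraT => ij.
have /eqP[] := Yne i j ij (Y j 0 1 / Y i 0 1).
by rewrite -scalerA E scalerA divff // scale1r.
Qed.

End Fibre.

Lemma chart_generic_lines (G : 'rV[k]_N -> V -> k) (sigma : 'S_6) b tau :
  jpoly (fun a x _ _ => G a x) ->
  (forall a x (al : k), al != 0 -> G a x != 0 -> G a (al *: x) != 0) ->
  (exists a x y z, flag (pol (form_of a)) x y z /\ G a x != 0) ->
  gen (fun u : 'rV[k]_(N + 4) => forall a x y z, flag (pol (form_of a)) x y z ->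
    chart3 sigma x y z -> u = row_mx a (line_coords sigma b tau x y) ->
    Jgood a x y z * G a x != 0).
Proof.
move=> jG Gs Ge; pose Psi (a : 'rV[k]_N) x y z := Jgood a x y z * G a x.
have jPsi : jpoly Psi.
  move=> T C a x y z alg Ha Hx Hy Hz; apply: (falgM alg); first exact: Jgood_jpoly.
  exact: (jG _ _ _ _ _ _ alg Ha Hx Hy Hz).
have inv : flag_invariant Psi.
  move=> a x y z al be ga de ep et fl al0 be0 ga0.
  rewrite /Psi mulf_eq0 negb_or => /andP [Jn Gn]; apply: mulf_neq0; last exact: Gs.
  exact: Jgood_invariant.
have ePsi := flag_meet (@Jgood_jpoly k) jG (Jgood_exists k) Ge.
apply: gen_imp (C_relation (t := line_coords sigma b tau) jPsi (line_coords_jpoly _ _ _)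
  (chart_normal sigma jPsi inv ePsi)) _ => u H a x y z fl ch uE.
have := H (form_of a) x y z (form_of_homog a) fl ch; rewrite coefs_form_of.
by apply.
Qed.

Section Dense.
Variables (f : {mpoly k[6]}) (P : V -> V -> V -> Prop).
Hypotheses (f3 : f \is 3.-homog) (smooth : smooth_cubic f).
Local Notation T := (pol f).
Let TT := pol_symtri f3.
Hypothesis HP : forall sigma b tau, gen (fun t : 'rV[k]_4 => forall x y z, flag T x y z ->
  chart3 sigma x y z -> t = line_coords sigma b tau x y -> P x y z).

Local Notation U w := (lsubmx (w : 'rV[k]_(6 + 6))).
Local Notation W w := (rsubmx (w : 'rV[k]_(6 + 6))).

Definition line_frame (sigma : 'S_6) (b : bool) x y : 'rV[k]_(6 + 6) :=
  let u := x - x 0 (sigma 1) *: y in if b then row_mx y u else row_mx u y.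

(** Normalized bases of lines on the cubic are cut out in dimension 12 by four normalizations and
    four equations, independent to first order by [tangent_onto]; four coordinates remain as local
    parameters. *)
Lemma dense_chart (u0 v0 : V) (i j : 'I_6) (h : {mpoly k[8 + 4]}) : ind2 u0 v0 ->
  u0 0 i = 1 -> u0 0 j = 0 -> v0 0 i = 0 -> v0 0 j = 1 ->
  [/\ T u0 u0 u0 = 0, T u0 u0 v0 = 0, T u0 v0 v0 = 0 & T v0 v0 v0 = 0] ->
  ev h (row_mx u0 v0 : 'rV_(6 + 6)) != 0 ->
  exists u v : V, [/\ [/\ u 0 i = 1, u 0 j = 0, v 0 i = 0 & v 0 j = 1],
    [/\ T u u u = 0, T u u v = 0, T u v v = 0 & T v v v = 0],
    ev h (row_mx u v : 'rV_(6 + 6)) != 0 &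
    forall sigma b x y z, flag T x y z -> chart3 sigma x y z ->
      row_mx u v = line_frame sigma b x y -> P x y z].
Proof.
move=> I ui uj vi vj [Tuuu Tuuv Tuvv Tvvv] hn.
pose phi (e : 'I_8) (w : 'rV[k]_(6 + 6)) : k :=
  nth 0 [:: T (U w) (U w) (U w); T (U w) (U w) (W w); T (U w) (W w) (W w); T (W w) (W w) (W w);
     U w 0 i - 1; U w 0 j; W w 0 i; W w 0 j - 1] e.
have alg := polyf_alg k (6 + 6).
have pU l : polyf (fun w : 'rV[k]_(6 + 6) => U w 0 l) by exact: lsubmx_polyf.
have pW l : polyf (fun w : 'rV[k]_(6 + 6) => W w 0 l) by exact: rsubmx_polyf.
have pT (A B C : 'rV[k]_(6 + 6) -> V) : (forall l, polyf (fun w => A w 0 l)) ->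
    (forall l, polyf (fun w => B w 0 l)) -> (forall l, polyf (fun w => C w 0 l)) ->
    polyf (fun w => T (A w) (B w) (C w)).
  move=> pA pB pC; apply: polyf_ext (falg_pol (a := fun=> coefs f) alg _ pA pB pC) _ => [l|w].
    exact: falgC.
  by rewrite form_of_coefs.
have /choice [g gE] : forall e, exists g : {mpoly k[8 + 4]}, forall w, phi e w = ev g w.
  rewrite /phi; case=> -[|[|[|[|[|[|[|[|//]]]]]]]] lt /=; rewrite -/(polyf _).
  - exact: pT.
  - exact: pT.
  - exact: pT.
  - exact: pT.
  - by apply: (falgB alg); [exact: pU | exact: falgC].
  - exact: pU.
  - exact: pW.
  - by apply: (falgB alg); [exact: pW | exact: falgC].
have g0 w : (forall e, ev (g e) w = 0) <->
    [/\ U w 0 i = 1, U w 0 j = 0, W w 0 i = 0 & W w 0 j = 1] /\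
    [/\ T (U w) (U w) (U w) = 0, T (U w) (U w) (W w) = 0, T (U w) (W w) (W w) = 0 &
        T (W w) (W w) (W w) = 0].
  split=> [H|[[h1 h2 h3 h4] [h5 h6 h7 h8]] e].
    have H' e : phi e w = 0 by rewrite gE.
    have := H' (inord 0); have := H' (inord 1); have := H' (inord 2); have := H' (inord 3).
    have := H' (inord 4); have := H' (inord 5); have := H' (inord 6); have := H' (inord 7).
    rewrite /phi !inordK //= => /eqP; rewrite subr_eq0 => /eqP-> -> -> /eqP.
    by rewrite subr_eq0 => /eqP-> -> -> -> ->.
  rewrite -gE /phi; case: e => -[|[|[|[|[|[|[|[|//]]]]]]]] lt //=; first by rewrite h1 subrr.
  by rewrite h4 subrr.
pose w0 : 'rV[k]_(6 + 6) := row_mx u0 v0.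
have gw0 : forall e, ev (g e) w0 = 0.
  by apply/g0; rewrite /w0 row_mxKl row_mxKr.
have rk : \rank (jacobian g w0) = 8%N.
  apply: rank_directions => d; pose d_ (l : nat) := d 0 (inord l).
  have [du [dv [D0 D1 D2 D3]]] := tangent_onto f3 smooth I (\row_(l < 4) d_ l).
  (* Adding vectors of the line does not affect the four polar equations, as the line lies on the
     cubic, and adjusts the pivot coordinates. *)
  pose eu := du + (d_ 4%N - du 0 i) *: u0 + (d_ 5%N - du 0 j) *: v0.
  pose ew := dv + (d_ 6%N - dv 0 i) *: u0 + (d_ 7%N - dv 0 j) *: v0.
  have sy := (triC12 TT v0 u0 u0, triC23 TT u0 v0 u0, triC12 TT v0 u0 v0, triC13 TT v0 v0 u0,
     Tuuu, Tuuv, Tuvv, Tvvv).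
  have E0 : 3%:R * T u0 u0 eu = d_ 0%N by rewrite /eu !(triE TT) !sy !mulr0 !addr0 D0 mxE.
  have E1 : 2%:R * T u0 v0 eu + T u0 u0 ew = d_ 1%N.
    by rewrite /eu /ew !(triE TT) !sy !mulr0 !addr0 D1 mxE.
  have E2 : T v0 v0 eu + 2%:R * T u0 v0 ew = d_ 2%N.
    by rewrite /eu /ew !(triE TT) !sy !mulr0 !addr0 D2 mxE.
  have E3 : 3%:R * T v0 v0 ew = d_ 3%N by rewrite /ew !(triE TT) !sy !mulr0 !addr0 D3 mxE.
  have E4 : eu 0 i = d_ 4%N by rewrite !mxE ui vi; ring.
  have E5 : eu 0 j = d_ 5%N by rewrite !mxE uj vj; ring.
  have E6 : ew 0 i = d_ 6%N by rewrite !mxE ui vi; ring.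
  have E7 : ew 0 j = d_ 7%N by rewrite !mxE uj vj; ring.
  clearbody eu ew; exists (row_mx eu ew : 'rV_(6 + 6)).
  pose q (e : 'I_8) : {poly k} := nth 0 [:: (3%:R * T u0 eu eu)%:P + T eu eu eu *: 'X;
    (T eu eu v0 + 2%:R * T u0 eu ew)%:P + T eu eu ew *: 'X;
    (T u0 ew ew + 2%:R * T eu v0 ew)%:P + T eu ew ew *: 'X;
    (3%:R * T v0 ew ew)%:P + T ew ew ew *: 'X] e.
  apply: (@jacobian_direction _ 8 _ _ _ _ _ q) => e t; rewrite -!gE /phi.
  have UE : U (w0 + t *: (row_mx eu ew : 'rV_(6 + 6))) = u0 + t *: eu.
    by rewrite /w0 scale_row_mx add_row_mx row_mxKl.
  have WE : W (w0 + t *: (row_mx eu ew : 'rV_(6 + 6))) = v0 + t *: ew.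
    by rewrite /w0 scale_row_mx add_row_mx row_mxKr.
  rewrite UE WE /w0 row_mxKl row_mxKr.
  have d_E : d 0 e = d_ e by rewrite /d_ inord_val.
  rewrite d_E /q; case: e {d_E} => -[|[|[|[|[|[|[|[|//]]]]]]]] lt /=;
    rewrite ?(hornerD, hornerC, hornerZ, hornerX, horner0).
  - rewrite -E0 !(triE TT) [T eu u0 u0](triC13 TT) [T u0 eu u0](triC23 TT).
    rewrite [T eu u0 eu](triC12 TT) [T eu eu u0](triC13 TT); ring.
  - rewrite -E1 !(triE TT) [T eu u0 v0](triC12 TT) [T u0 eu v0](triC23 TT).
    rewrite [T eu u0 ew](triC12 TT); ring.
  - rewrite -E2 !(triE TT) [T eu v0 v0](triC13 TT) [T u0 ew v0](triC23 TT).
    rewrite [T eu ew v0](triC23 TT); ring.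
  - rewrite -E3 !(triE TT) [T ew v0 v0](triC13 TT) [T v0 ew v0](triC23 TT).
    rewrite [T ew v0 ew](triC12 TT) [T ew ew v0](triC13 TT); ring.
  - by rewrite !mxE ui -E4; ring.
  - by rewrite !mxE uj -E5; ring.
  - by rewrite !mxE vi -E6; ring.
  - by rewrite !mxE vj -E7; ring.
have HP' (tau : 'I_4 -> 'I_(6 + 6)) : exists c : {mpoly k[4]}, c != 0 /\
    forall t, ev c t != 0 -> forall sigma b x y z, flag T x y z -> chart3 sigma x y z ->
    t = line_coords sigma b (finfun tau) x y -> P x y z.
  have [c c0 cP] := gen_forall (fun sigma => gen_forall (fun b => HP sigma b (finfun tau))).
  by exists c; split=> // t ct sigma b; apply: cP ct sigma b.
have [c cP] := choice HP'.
have [tau [w [/g0 [w1 w2] hw cw]]] := @smooth_dense k 8 4 g w0 h c gw0 rk hn (fun tau => (cP tau).1).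
exists (U w), (W w); split=> //; first by rewrite hsubmxK.
move=> sigma b x y z fl ch wE; apply: ((cP tau).2 _ cw sigma b x y z fl ch).
have -> : w = line_frame sigma b x y by rewrite -wE hsubmxK.
apply/rowP => l; rewrite !mxE ffunE /line_frame.
by case: (b).
Qed.

Lemma dense_lines d (h : {mpoly k[6 * 6]}) u0 v0 : h \is d.-homog -> ind2 u0 v0 ->
  [/\ T u0 u0 u0 = 0, T u0 u0 v0 = 0, T u0 v0 v0 = 0 & T v0 v0 v0 = 0] ->
  ev h (pl u0 v0) != 0 ->
  exists x y z, [/\ flag T x y z, P x y z & ev h (pl x y) != 0].
Proof.
move=> hd I [Tuuu Tuuv Tuvv Tvvv] hn.
have [i [j p0]] : exists i j, p2 u0 v0 i j != 0.
  have /rV0Pn [i ui] : u0 != 0.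
    apply/eqP => u00; have [] := I 1 0; last by move/eqP; rewrite oner_eq0.
    by rewrite u00 scaler0 scale0r addr0.
  by have [j] := p2_exists I ui; exists i, j.
pose p := p2 u0 v0 i j; pose u1 := (v0 0 j / p) *: u0 + (- u0 0 j / p) *: v0.
pose v1 := (- v0 0 i / p) *: u0 + (u0 0 i / p) *: v0.
have pE : p = u0 0 i * v0 0 j - u0 0 j * v0 0 i by [].
have pn : u0 0 i * v0 0 j - u0 0 j * v0 0 i != 0 by rewrite -pE.
have u1i : u1 0 i = 1 by rewrite !mxE pE; field.
have u1j : u1 0 j = 0 by rewrite !mxE pE; field.
have v1i : v1 0 i = 0 by rewrite !mxE pE; field.
have v1j : v1 0 j = 1 by rewrite !mxE pE; field.
have h1 : ev h (pl u1 v1) != 0.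
  rewrite pl_change (hom_ev _ _ hd) mulf_neq0 // expf_neq0 //.
  rewrite (_ : _ - _ = p^-1) ?invr_eq0 // pE; field.
  by [].
have T1 : [/\ T u1 u1 u1 = 0, T u1 u1 v1 = 0, T u1 v1 v1 = 0 & T v1 v1 v1 = 0].
  have sy := (triC12 TT v0 u0 u0, triC23 TT u0 v0 u0, triC12 TT v0 u0 v0, triC13 TT v0 v0 u0,
     Tuuu, Tuuv, Tuvv, Tvvv).
  by rewrite /u1 /v1; split; rewrite !(triE TT) !sy !mulr0 !addr0.
clearbody u1 v1.
have I1 : ind2 u1 v1.
  move=> r s E; have := congr1 (fun w : V => w 0 i) E; have := congr1 (fun w : V => w 0 j) E.
  by rewrite !mxE u1i u1j v1i v1j !mulr0 !mulr1 add0r addr0.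
have alg := polyf_alg k (6 + 6).
have [H HE] : polyf (fun w : 'rV[k]_(6 + 6) => ev h (pl (U w) (W w))).
  apply: falg_ev => // q; case/mxvec_indexP: q => r s.
  apply: polyf_ext (falg_p2 r s alg (@lsubmx_polyf k 6 6) (@rsubmx_polyf k 6 6)) _ => w.
  by rewrite plE.
have [|u [v [[ui uj vi vj] Tuv Hn HPuv]]] := @dense_chart u1 v1 i j H I1 u1i u1j v1i v1j T1.
  by rewrite -HE row_mxKl row_mxKr.
rewrite -HE row_mxKl row_mxKr in Hn.
have Iuv : ind2 u v.
  move=> r s E; have := congr1 (fun w : V => w 0 i) E; have := congr1 (fun w : V => w 0 j) E.
  by rewrite !mxE ui uj vi vj !mulr0 !mulr1 add0r addr0.
have [Tu Tv Tw Tz] := Tuv.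
have [al [be [ga [de [z [det0 fl]]]]]] := exists_flag TT Iuv Tu Tv Tw Tz.
set x := al *: u + be *: v in fl; set y := ga *: u + de *: v in fl.
have xi : x 0 i = al by rewrite !mxE ui vi mulr1 mulr0 addr0.
have xj : x 0 j = be by rewrite !mxE uj vj mulr1 mulr0 add0r.
have yi : y 0 i = ga by rewrite !mxE ui vi mulr1 mulr0 addr0.
have yj : y 0 j = de by rewrite !mxE uj vj mulr1 mulr0 add0r.
have span (X : V) (r s : k) : X = r *: x + s *: y -> X = X 0 i *: u + X 0 j *: v.
  move=> ->; rewrite /x /y; apply/rowP => l; rewrite !mxE ui uj vi vj; ring.
(* The special point [x] of the line may vanish at pivot [i]; it is then normalized at [j], and [u]
   and [v] exchange roles, which is what the boolean of [line_coords] records. *)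
have [al0|al0] := eqVneq al 0; last first.
  have xi0 : x 0 i != 0 by rewrite xi.
  have pij : p2 x y i j != 0 by rewrite /p2 xi xj yi yj.
  have [s [a1 [b1 [c1 [d1 [e1 [g1 [[s0 s1] a10 b10 c10 ch]]]]]]]] := chart_exists (flag_ind fl) xi0 pij.
  have fl' := flag_change TT d1 e1 g1 a10 b10 c10 fl.
  exists (a1 *: x), (b1 *: y + d1 *: x), (c1 *: z + e1 *: y + g1 *: x); split=> //.
    apply: (HPuv s false _ _ _ fl' ch); rewrite /line_frame s1.
    have [X1 [Y0 Y1] _] := ch; rewrite s0 s1 in X1 Y0 Y1.
    have YE : b1 *: y + d1 *: x = v.
      by rewrite [LHS](@span _ d1 b1 (addrC _ _)) Y0 Y1 scale0r scale1r add0r.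
    rewrite YE; congr row_mx; apply/esym; rewrite [X in X - _](@span _ a1 0) ?scale0r ?addr0 //.
    by rewrite X1 scale1r addrK.
  have plE' : pl (a1 *: x) (b1 *: y + d1 *: x) = (a1 * b1 * (al * de - be * ga)) *: pl u v.
    rewrite -[a1 *: x]addr0 -(scale0r y) [_ + d1 *: x]addrC.
    by rewrite pl_change mul0r subr0 pl_change scalerA.
  by rewrite plE' (hom_ev _ _ hd) mulf_neq0 // expf_neq0 // !mulf_neq0.
have be0 : be != 0 by apply: contraNneq det0 => ->; rewrite al0 !mul0r subr0.
have xj0 : x 0 j != 0 by rewrite xj.
have pji : p2 x y j i != 0 by rewrite /p2 xi xj yi yj -opprB oppr_eq0.
have [s [a1 [b1 [c1 [d1 [e1 [g1 [[s0 s1] a10 b10 c10 ch]]]]]]]] := chart_exists (flag_ind fl) xj0 pji.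
have fl' := flag_change TT d1 e1 g1 a10 b10 c10 fl.
exists (a1 *: x), (b1 *: y + d1 *: x), (c1 *: z + e1 *: y + g1 *: x); split=> //.
  apply: (HPuv s true _ _ _ fl' ch); rewrite /line_frame s1.
  have [X1 [Y0 Y1] _] := ch; rewrite s0 s1 in X1 Y0 Y1.
  have YE : b1 *: y + d1 *: x = u.
    by rewrite [LHS](@span _ d1 b1 (addrC _ _)) Y0 Y1 scale0r scale1r addr0.
  rewrite YE; congr row_mx; apply/esym; rewrite [X in X - _](@span _ a1 0) ?scale0r ?addr0 //.
  by rewrite X1 scale1r addrAC subrr add0r.
have plE' : pl (a1 *: x) (b1 *: y + d1 *: x) = (a1 * b1 * (al * de - be * ga)) *: pl u v.
  rewrite -[a1 *: x]addr0 -(scale0r y) [_ + d1 *: x]addrC.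
  by rewrite pl_change mul0r subr0 pl_change scalerA.
by rewrite plE' (hom_ev _ _ hd) mulf_neq0 // expf_neq0 // !mulf_neq0.
Qed.

End Dense.

End Lines.

(** * Generic properties and forms *)

Section Generically.
Local Open Scope classical_set_scope.
Local Open Scope ring_scope.
Variable k : numClosedFieldType.

(** Scaling by 2 suffices, since the powers of 2 separate the degrees of the monomials. *)
Lemma homog_of_scaling n d (P : {mpoly k[n]}) :
  (forall c v, c != 0 -> ev P (c *: v) = c ^+ d * ev P v) -> P \is d.-homog.
Proof.
move=> H; apply/dhomogP => m mP.
pose P' : {mpoly k[n]} := \sum_(m <- msupp P) (P@_m * 2%:R ^+ mdeg m) *: 'X_[m].
have P'E : P' = 2%:R ^+ d *: P.
  apply: mpoly_ext => v; rewrite evZ -H ?pnatr_eq0 // ev_sum evE.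
  apply: eq_big_seq => m' _; rewrite evZ evXm.
  under [in RHS]eq_bigr => i _ do rewrite mxE exprMn.
  by rewrite [in RHS]big_split /= prodrXr -mdegE; ring.
have := congr1 (mcoeff m) P'E; rewrite mcoeffZ /P' raddf_sum /=.
rewrite (bigD1_seq m) ?msupp_uniq //= mcoeffZ mcoeffX eqxx mulr1 big1 => [|m' m'm]; last first.
  by rewrite mcoeffZ mcoeffX (negPf m'm) mulr0.
rewrite addr0 mulrC => /(mulIf _) E.
have Pm : P@_m != 0 by rewrite mcoeff_msupp in mP.
have /eqP := E Pm; rewrite -!natrX eqr_nat => /eqP.
by move/(@expnI 2 isT).
Qed.

(** The strict bound leaves a factor [s], so both sides vanish where [s] does and the identity holds
    everywhere. *)
Lemma form_of_local n e (s : {mpoly k[n]}) (phi : 'rV[k]_n -> k) : s \is e.-homog ->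
  localization (@polyf k n) (ev s) phi -> (forall c v, c != 0 -> phi (c *: v) = phi v) ->
  exists m0, forall m, (m0 < m)%N -> exists2 P : {mpoly k[n]}, P \is (e * m).-homog &
    forall v, ev P v = ev s v ^+ m * phi v.
Proof.
move=> se [m0 [psi [Q QE] psiE]] inv; exists m0 => m m0m.
have PE v : ev (s ^+ (m - m0) * Q) v = ev s v ^+ m * phi v.
  rewrite evM ev_exp -QE; have [s0|s0] := eqVneq (ev s v) 0; last first.
    by rewrite psiE // mulrA -exprD subnK // ltnW.
  by rewrite s0 !expr0n subn_eq0 leqNgt m0m (gtn_eqF (leq_ltn_trans (leq0n _) m0m)) !mul0r.
exists (s ^+ (m - m0) * Q) => //; apply: homog_of_scaling => c v c0.
by rewrite !PE inv // (hom_ev _ _ se) exprMn exprM mulrA.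
Qed.

Lemma local_ev n (s : {mpoly k[n]}) r (g : 'rV[k]_n -> 'rV[k]_r) phi :
  (forall i, localization (@polyf k n) (ev s) (fun v => g v 0 i)) -> polyf phi ->
  localization (@polyf k n) (ev s) (fun v => phi (g v)).
Proof.
move=> H; apply: falg_polyf => //.
by apply: localization_alg; [exact: polyf_alg | exact: polyf_ev].
Qed.

Lemma local_frac n (s P : {mpoly k[n]}) phi : (forall v, ev s v != 0 -> phi v = ev P v / ev s v) ->
  localization (@polyf k n) (ev s) phi.
Proof.
move=> H; exists 1%N, (ev P) => [|v sv]; first exact: polyf_ev.
by rewrite H // expr1 mulrC divfK.
Qed.

Variables (n : nat) (V : set 'rV[k]_n).
Hypothesis V0 : forall v, V v -> v != 0.

Lemma gen_vanish (Q : 'rV[k]_n -> Prop) d (H : {mpoly k[n]}) : generically V Q ->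
  H \is d.-homog -> (forall v, V v -> Q v -> ev H v = 0) -> forall v, V v -> ev H v = 0.
Proof.
move=> [Z [_ dZ ZQ]] Hd HQ v Vv.
have Vv' : [set v | v != 0 /\ forall p, [set H] p -> ev p v = 0] v.
  apply: dZ Vv; first by exists [set H] => // p ->; exists d.
  by move=> w [Vw nZw]; split; [exact: V0 | move=> p ->; apply: HQ => //; apply: ZQ].
by case: Vv' => _; apply.
Qed.

Lemma generically_closed (S : set {mpoly k[n]}) (Q : 'rV[k]_n -> Prop) :
  (forall s, S s -> exists d, s \is d.-homog) ->
  (forall d H, H \is d.-homog -> (forall s v, S s -> V v -> ev s v != 0 -> ev H v = 0) ->
     forall v, V v -> ev H v = 0) ->
  (forall s v, S s -> V v -> ev s v != 0 -> Q v) -> generically V Q.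
Proof.
move=> Sh dS SQ; pose Z : set 'rV[k]_n := [set v | v != 0 /\ forall s, S s -> ev s v = 0].
have out v : V v -> ~ Z v -> exists2 s, S s & ev s v != 0.
  move=> Vv nZ; apply: contrapT => none; apply: nZ; split; first exact: V0.
  by move=> s Ss; apply/eqP; apply: contrapT => /negP sv; apply: none; exists s.
exists Z; split; first by exists S.
- move=> Z' [S' S'h ->] AZ' v Vv; split; first exact: V0.
  move=> H S'H; have [d Hd] := S'h H S'H; apply: (dS d) => // s w Ss Vw sw.
  have [_] : [set v | v != 0 /\ forall p, S' p -> ev p v = 0] w.
    apply: AZ'; split=> // -[_ /(_ s Ss) sw0].
    by move: sw; rewrite sw0 eqxx.
  exact.
- by move=> v [Vv /(out v Vv) [s Ss sv]]; apply: SQ sv.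
Qed.

Lemma generically_form d (B : {mpoly k[n]}) (Q : 'rV[k]_n -> Prop) : B \is d.-homog ->
  (forall d H, H \is d.-homog -> (forall v, V v -> ev B v != 0 -> ev H v = 0) ->
     forall v, V v -> ev H v = 0) ->
  (forall v, V v -> ev B v != 0 -> Q v) -> generically V Q.
Proof.
move=> Bd dB BQ; apply: (generically_closed (S := [set B])).
- by move=> s ->; exists d.
- by move=> d' H Hd' HB; apply: (dB d') => // v; apply: HB.
- by move=> s v ->; apply: BQ.
Qed.

Lemma generically_imp (P Q : 'rV[k]_n -> Prop) : generically V P ->
  (forall v, V v -> P v -> Q v) -> generically V Q.
Proof. by move=> [Z [cZ dZ ZP]] PQ; exists Z; split=> // v VZ; apply: PQ (ZP _ VZ); case: VZ. Qed.

(** If a form H vanishes wherever some s s' is nonzero, then each H s vanishes off [Z'], hence on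
    [V]; so H vanishes off [Z], hence on [V]. Each density is used once. *)
Lemma generically_and (P Q : 'rV[k]_n -> Prop) : generically V P -> generically V Q ->
  generically V (fun v => P v /\ Q v).
Proof.
move=> gP gQ; have [Z [cZ dZ ZP]] := gP; have [S Sh ZE] := cZ.
have [Z' [cZ' dZ' ZQ]] := gQ; have [S' Sh' ZE'] := cZ'.
have nZ s v : S s -> ev s v != 0 -> ~ Z v by move=> Ss sv; rewrite ZE => -[_ /(_ s Ss) /eqP]; apply/negP.
have nZ' s v : S' s -> ev s v != 0 -> ~ Z' v by move=> Ss sv; rewrite ZE' => -[_ /(_ s Ss) /eqP]; apply/negP.
have out v : V v -> ~ Z v -> exists2 s, S s & ev s v != 0.
  move=> Vv nZv; apply: contrapT => none; apply: nZv; rewrite ZE; split; first exact: V0.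
  by move=> s Ss; apply/eqP; apply: contrapT => /negP sv; apply: none; exists s.
have out' v : V v -> ~ Z' v -> exists2 s, S' s & ev s v != 0.
  move=> Vv nZv; apply: contrapT => none; apply: nZv; rewrite ZE'; split; first exact: V0.
  by move=> s Ss; apply/eqP; apply: contrapT => /negP sv; apply: none; exists s.
have vZ d H : H \is d.-homog -> (forall v, V v -> ~ Z v -> ev H v = 0) -> forall v, V v -> ev H v = 0.
  by move=> Hd HZ; apply: (gen_vanish (Q := fun v => ~ Z v)) Hd _ => //; exists Z; split=> // v [].
have vZ' d H : H \is d.-homog -> (forall v, V v -> ~ Z' v -> ev H v = 0) -> forall v, V v -> ev H v = 0.
  by move=> Hd HZ; apply: (gen_vanish (Q := fun v => ~ Z' v)) Hd _ => //; exists Z'; split=> // v [].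
apply: (generically_closed (S := [set r | exists s s', [/\ S s, S' s' & r = s * s']])).
- move=> _ [s [s' [Ss Ss' ->]]]; have [d sd] := Sh s Ss; have [d' sd'] := Sh' s' Ss'.
  by exists (d + d')%N; apply: dhomogM.
- move=> d H Hd HS; apply: (vZ d) => // v Vv /(out v Vv) [s Ss sv].
  have [d' sd'] := Sh s Ss.
  suff : ev (H * s) v = 0 by rewrite evM => /eqP; rewrite mulf_eq0 (negPf sv) orbF => /eqP.
  apply: (vZ' (d + d')%N) Vv; first exact: dhomogM.
  move=> w Vw /(out' w Vw) [s' Ss' sw']; rewrite evM.
  have [->|sw] := eqVneq (ev s w) 0; first by rewrite mulr0.
  rewrite (HS (s * s') w) ?mul0r //; first by exists s, s'.
  by rewrite evM mulf_neq0.
- move=> _ v [s [s' [Ss Ss' ->]]] Vv; rewrite evM mulf_eq0 negb_or => /andP [sv sv'].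
  by split; [apply: ZP; split=> //; apply: nZ sv | apply: ZQ; split=> //; apply: nZ' sv'].
Qed.

Lemma generically_forall (I : finType) (P : I -> 'rV[k]_n -> Prop) :
  (forall i, generically V (P i)) -> generically V (fun v => forall i, P i v).
Proof.
move=> H; suff : generically V (fun v => forall i, i \in enum I -> P i v).
  by move/generically_imp; apply=> v _ Pv i; apply: Pv; rewrite mem_enum.
elim: (enum I) => [|j s IH].
  apply: (generically_form (B := 1) (dhomog1 _ _)) => // d Hf _ H1 v Vv.
  by apply: H1 => //; rewrite ev1 oner_neq0.
apply: generically_imp (generically_and (H j) IH) _ => v _ [Pj Ps] i.
by rewrite inE => /orP [/eqP ->|]; [exact: Pj | exact: Ps].
Qed.

Lemma rf_val_scale (h : ratfun V) c v : c != 0 -> rf_val h (c *: v) = rf_val h v.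
Proof.
move=> c0; rewrite /rf_val (hom_ev _ _ (rf_num_homog h)) (hom_ev _ _ (rf_den_homog h)).
by rewrite invfM mulrACA divff ?mul1r // expf_neq0.
Qed.

End Generically.

(** [G] need not be homogeneous and is replaced by its top form: where that is nonzero, c -> G (c v)
    is a nonzero polynomial, so some nonzero multiple of [v] avoids the zeros of [G], and invariance
    under scaling concludes. *)
Lemma generically_projective (k : numClosedFieldType) n (P : 'rV[k]_n.+1 -> Prop) : gen P ->
  (forall c a, c != 0 -> P (c *: a) -> P a) -> generically (@proj_space k n.+1) P.
Proof.
move=> [G G0 GP] Pscale; have T0 := top_form_neq0 G0.
have Td : top_form G \is ((msize G).-1).-homog.
  apply/dhomogP => m; rewrite mcoeff_msupp /top_form raddf_sum /= => H.
  apply/eqP; apply: contraNT H => md; apply/eqP; apply: big1 => m' _.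
  rewrite mcoeffZ mcoeffX; have [->|_] := (eqVneq m' m); last by rewrite mulr0.
  by move: md => /negPf /= ->; rewrite mulr0 mul0r.
apply: (generically_form _ Td) => [//|d H Hd HB v _|v _ Tv].
  suff -> : H = 0 by rewrite ev0.
  apply/eqP; apply: contrapT => /negP Hn.
  have X0 : ('X_0 : {mpoly k[n.+1]}) != 0.
    apply/negP => /eqP /(congr1 (fun p => ev p (const_mx 1))).
    by rewrite evX ev0 mxE => /eqP; rewrite oner_eq0.
  have [w] := mpoly_nonroot (mulf_neq0 (mulf_neq0 Hn T0) X0).
  rewrite !evM !mulf_eq0 !negb_or evX => /andP [/andP [Hw Tw] w0]; move/eqP: Hw; apply.
  by apply: HB => //; apply/rV0Pn; exists 0.
pose q : {poly k} := \sum_(m <- msupp G) (G@_m * \prod_i v 0 i ^+ m i) *: 'X^(mdeg m).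
have qE c : q.[c] = ev G (c *: v).
  rewrite /q horner_sum evE; apply: eq_bigr => m _; rewrite hornerZ hornerXn.
  under [in RHS]eq_bigr => i _ do rewrite mxE exprMn.
  by rewrite [in RHS]big_split /= prodrXr -mdegE; ring.
have q0 : q != 0.
  apply: contraNneq Tv => q0; have := congr1 (fun p : {poly k} => p`_((msize G).-1)) q0.
  rewrite coef0 /q coef_sum => E; apply/eqP; rewrite -[RHS]E ev_sum; apply: eq_bigr => m _.
  by rewrite coefZ coefXn evZ evXm eq_sym; ring.
have X0 : ('X : {poly k}) != 0 by rewrite polyX_eq0.
have [c] := poly_nonroot (mulf_neq0 X0 q0).
rewrite hornerM hornerX mulf_eq0 negb_or qE => /andP [c0 Gc].
exact: Pscale c0 (GP _ Gc).
Qed.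

(** * What the degree computation asks of a cubic *)

Section Nice.
Variable k : numClosedFieldType.
Local Notation V := 'rV[k]_6.
Local Notation N := (nb_monomials 6 3).
Local Notation J := ('X_{1..4 < 8}).
Implicit Types (x y z : V) (a : 'rV[k]_N) (f : {mpoly k[6]}).

Definition on_line (f : {mpoly k[6]}) (u v : V) :=
  [/\ pol f u u u = 0, pol f u u v = 0, pol f u v v = 0 & pol f v v v = 0].

(** The interface between genericity and the degree. [Gf] cuts out the points of the cubic to be
    avoided; [D] and [c] are the denominator and the coefficients of the reduction to 24
    monomials. *)
Record nice_data f (gd : nat) (Gf : {mpoly k[6]}) (D : V -> k) (c : J -> 'I_24 -> V -> k) : Prop :=
  NiceData {
    nice_homog : Gf \is gd.-homog;
    nice_polyf : polyf D /\ forall m i, polyf (c m i);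
    nice_coord : forall x, ev Gf x != 0 -> x 0 0 != 0;
    nice_points : forall d (H : {mpoly k[6]}), H \is d.-homog ->
      (forall x, x != 0 -> ev f x = 0 -> ev Gf x != 0 -> ev H x = 0) ->
      forall x, x != 0 -> ev f x = 0 -> ev H x = 0;
    nice_lines : forall d (H : {mpoly k[6 * 6]}) u v, H \is d.-homog -> ind2 u v ->
      on_line f u v -> ev H (pl u v) != 0 ->
      exists x y z, [/\ flag (pol f) x y z, ev Gf x != 0 & ev H (pl x y) != 0];
    nice_good : forall x y z, x 0 0 = 1 -> ev Gf x != 0 -> flag (pol f) x y z ->
      good (pol f) x y z /\ p2 x y 0 1 != 0;
    nice_fibre : forall x, x 0 0 = 1 -> ev Gf x != 0 -> ev f x = 0 ->
      exists (Y : 'I_24 -> 'rV[k]_4) Z, injective Y /\ forall i, flag (pol f) x (yv (Y i)) (Z i);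
    nice_stair : forall x, x 0 0 = 1 -> ev Gf x != 0 -> D x != 0 /\
      forall t z, flag (pol f) x (yv t) z ->
      forall m : J, D x * ev 'X_[m] t = \sum_i c m i x * ev 'X_[bexp i] t }.

Definition nice f := exists gd Gf D c, @nice_data f gd Gf D c.

Definition tv (y : V) : 'rV[k]_4 := \row_j y 0 (inord j.+2).

Lemma tvK y : y 0 0 = 0 -> y 0 1 = 1 -> yv (tv y) = y.
Proof.
move=> y0 y1; apply/rowP => i; rewrite mxE /Y; case: i => -[|[|j]] lt /=.
- by rewrite evC mulr0n -[LHS]y0; congr (y 0 _); apply: val_inj.
- by rewrite evC mulr1n -[LHS]y1; congr (y 0 _); apply: val_inj.
by rewrite evX mxE inordK //; congr (y 0 _); apply: val_inj; rewrite /= inordK.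
Qed.

Lemma yvK (t : 'rV[k]_4) : tv (yv t) = t.
Proof.
apply/rowP => i; rewrite !mxE /Y /= inordK ?ltnS //; last by have := ltn_ord i; lia.
by rewrite evX inord_val.
Qed.

Lemma yv01 (t : 'rV[k]_4) : yv t 0 0 = 0 /\ yv t 0 1 = 1.
Proof. by rewrite !mxE /Y /= !evC. Qed.

Lemma local_normal n (i j : 'I_n) :
  localization (@polyf k n) (ev 'X_i) (fun v => ((v 0 i)^-1 *: v) 0 j).
Proof. by apply: (@local_frac _ _ _ 'X_j) => v _; rewrite mxE !evX mulrC. Qed.

Lemma scale_normal_form n (i : 'I_n) (c : k) (v : 'rV[k]_n) : c != 0 ->
  ((c *: v) 0 i)^-1 *: (c *: v) = (v 0 i)^-1 *: v.
Proof. by move=> c0; rewrite mxE scalerA invfM mulrAC mulVf // mul1r. Qed.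

Lemma homogenize (phi : V -> k) : polyf phi -> exists m0, forall m, (m0 < m)%N ->
  exists2 P : {mpoly k[6]}, P \is m.-homog &
    forall x, ev P x = x 0 0 ^+ m * phi ((x 0 0)^-1 *: x).
Proof.
move=> pphi; have loc := local_ev (local_normal 0) pphi.
have [|c v c0|m0 H] := form_of_local (_ : 'X_0 \is 1.-homog) loc.
- by rewrite dhomogX; apply/eqP; rewrite /= mdeg1.
- by rewrite scale_normal_form.
exists m0 => m /H [P Pm PE]; exists P; first by rewrite mul1n in Pm.
by move=> x; rewrite PE evX.
Qed.

Lemma gen_nice : gen (fun a : 'rV[k]_N => nice (form_of a)).
Proof.
have [G [D [c [jG jD jc [Gscale Gcoord Gex] Gfib]]]] := fibre_polynomial k.
have Gflag : exists a x y z, flag (pol (form_of a)) x y z /\ G a x != 0.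
  have [a [x [x0 fx Gx]]] := Gex; have xc := Gcoord _ _ Gx.
  pose x' := (x 0 0)^-1 *: x; have x1 : x' 0 0 = 1 by rewrite mxE mulVf.
  have Gx' : G a x' != 0 by apply: Gscale => //; rewrite invr_eq0.
  have fx' : ev (form_of a) x' = 0 by rewrite (hom_ev _ _ (form_of_homog a)) fx mulr0.
  have [_ dh all_J _] := Gfib a x' Gx' x1.
  have [Y [Z [fl _ _ _]]] := fibre_points fx' x1 dh all_J.
  by exists a, x', (Y 0), (Z 0).
have g1 : gen (fun a : 'rV[k]_N => forall sigma b tau, gen (fun t : 'rV[k]_4 =>
    forall x y z, flag (pol (form_of a)) x y z -> chart3 sigma x y z ->
    t = line_coords sigma b tau x y -> Jgood a x y z * G a x != 0)).
  apply: gen_forall => sigma; apply: gen_forall => b; apply: gen_forall => tau.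
  apply: gen_imp (gen_section (chart_generic_lines sigma b tau jG Gscale Gflag)) _ => a H.
  by apply: gen_imp H _ => t H x y z fl ch tE; apply: H fl ch _; rewrite tE.
have g2 : gen (fun a : 'rV[k]_N => forall sigma (tau : {ffun 'I_4 -> 'I_6}), gen (fun t : 'rV[k]_4 =>
    forall x, ev (form_of a) x = 0 -> chart1 sigma x -> t = \row_l x 0 (tau l) -> G a x != 0)).
  apply: gen_forall => sigma; apply: gen_forall => tau.
  have jt i : jpoly (fun (_ : 'rV[k]_N) x (_ _ : V) => (\row_l x 0 (tau l)) 0 i).
    by move=> T C a x y z alg _ Hx _ _; apply: falg_ext (Hx (tau i)) _ => // t; rewrite mxE.
  apply: gen_imp (gen_section (I_relation (sigma := sigma) (t := fun x => \row_l x 0 (tau l)) jG jt _)) _.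
    have jx : jpoly (fun (_ : 'rV[k]_N) x (_ _ : V) => x 0 (sigma 0)).
      by move=> T C a x y z alg _ Hx _ _; apply: Hx.
    have [|a [x [x0 fx]]] := point_meet jG jx Gex.
      exists 0, (unitv k (sigma 0)); rewrite e_E eqxx oner_neq0; split=> //.
        by apply/rV0Pn; exists (sigma 0); rewrite e_E eqxx oner_neq0.
      rewrite (_ : form_of _ = 0) ?ev0 // /form_of big1 // => i _.
      by rewrite mxE scale0r.
    rewrite mulf_eq0 negb_or => /andP [Gx xs].
    exists (form_of a), ((x 0 (sigma 0))^-1 *: x); split; first exact: form_of_homog.
    - by rewrite (hom_ev _ _ (form_of_homog a)) fx mulr0.
    - by rewrite /chart1 mxE mulVf.
    - by rewrite coefs_form_of; apply: Gscale; rewrite ?invr_eq0.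
  move=> a H; apply: gen_imp H _ => t H x fx ch tx.
  by have := H (form_of a) x (form_of_homog a) fx ch; rewrite coefs_form_of tx; apply.
apply: gen_imp (gen_and (gen_and g1 g2) (smooth_gen k)) _ => a [[h1 h2] smooth].
have a3 := form_of_homog a.
have pa T (C : (T -> k) -> Prop) : funalg C -> forall i, C (fun=> a 0 i) by move=> alg i; apply: falgC.
have pj (F : 'rV[k]_N -> V -> k) : jpoly (fun a x _ _ => F a x) -> polyf (F a).
  move=> jF; apply: (jF _ _ (fun=> a) id (fun=> 0) (fun=> 0) (polyf_alg k 6)) => i.
  - exact: (falgC (polyf_alg k 6)).
  - exact: polyfX.
  - exact: (falgC (polyf_alg k 6)).
  - exact: (falgC (polyf_alg k 6)).
have [m0 /(_ _ (ltnSn m0)) [Gf Gfd GfE]] := homogenize (pj _ jG).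
have GfP x : ev Gf x != 0 <-> G a x != 0.
  rewrite GfE mulf_eq0 expf_eq0 negb_or /=; split=> [/andP [x0 Gx]|Gx].
    by have := Gscale _ _ _ x0 Gx; rewrite scalerA divff // scale1r.
  by have x0 := Gcoord _ _ Gx; rewrite x0 Gscale // invr_eq0.
exists m0.+1, Gf, (D a), (fun m i => c m i a); split=> //.
- by split=> [|m i]; apply: pj.
- by move=> x /GfP /Gcoord.
- move=> d H Hd HG x x0 fx; apply/eqP; apply: contrapT => /negP Hx.
  have [y [y0 fy Hy /GfP Gy]] := dense_points a3 smooth h2 Hd x0 fx Hx.
  by move: Hy; rewrite HG ?eqxx.
- move=> d H u v Hd I uv Hn.
  have [x [y [z [fl JG Hxy]]]] := dense_lines a3 smooth h1 Hd I uv Hn.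
  exists x, y, z; split=> //; apply/GfP.
  by move: JG; rewrite mulf_eq0 negb_or => /andP [].
- move=> x y z x1 /GfP Gx fl; have [_ _ all_J _] := Gfib a x Gx x1.
  exact: Jgood_good (all_J _ _ fl).
- move=> x x1 /GfP Gx fx; have [_ dh all_J _] := Gfib a x Gx x1.
  have [Y [Z [fl Y0 Y1 Yinj]]] := fibre_points fx x1 dh all_J.
  exists (fun i => tv (Y i)), Z; split=> [i j E|i]; last by rewrite tvK.
  by apply: Yinj; rewrite -(tvK (Y0 i) (Y1 i)) E tvK.
- move=> x x1 /GfP Gx; have [Dx dh _ st] := Gfib a x Gx x1; split=> // t z fl m.
  exact: st (rel_flag dh fl) m.
Qed.

Lemma polZ' (al : k) f : pol (al *: f) = fun x y z => al * pol f x y z.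
Proof. by apply/funext => x; apply/funext => y; apply/funext => z; rewrite polZ. Qed.

Lemma nice_scale (al : k) f : al != 0 -> nice (al *: f) -> nice f.
Proof.
move=> al0 [gd [Gf [D [c [Gh Gp Gc Hp Hl Hg Hf Hs]]]]].
have cut (t : k) : al * t = 0 <-> t = 0.
  by split=> [/eqP|->]; rewrite ?mulr0 // mulf_eq0 (negPf al0) => /eqP.
have flP x y z : flag (pol (al *: f)) x y z <-> flag (pol f) x y z.
  by rewrite polZ'; split=> -[I [a1 a2 a3 a4] [a5 a6 a7 a8]];
    split=> //; split; apply/cut.
have fP x : ev (al *: f) x = 0 <-> ev f x = 0 by rewrite evZ; apply: cut.
exists gd, Gf, D, c; split=> //.
- move=> d H Hd HG x x0 fx; apply: (Hp d H Hd) => [w w0 /fP|//|]; first exact: HG.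
  exact/fP.
- move=> d H u v Hd I [a1 a2 a3 a4] Hn.
  have [|x [y [z [/flP fl Gx Hxy]]]] := Hl d H u v Hd I _ Hn.
    by rewrite /on_line polZ'; split; apply/cut.
  by exists x, y, z.
- move=> x y z x1 Gx /flP fl; have [[h1 h2] h3] := Hg x y z x1 Gx fl.
  split=> //; move: h1 h2; rewrite polZ' mulf_eq0 negb_or => /andP [_ h1] h2; split=> //.
  have cE u v : covec (fun x y z => al * pol f x y z) u v = al *: covec (pol f) u v.
    by apply/rowP => j; rewrite !mxE.
  move=> r s t E; apply: h2; rewrite !cE -[RHS](scaler0 _ al) -E !scalerDr !scalerA.
  by rewrite ![al * _]mulrC.
- move=> x x1 Gx /fP fx; have [Y [Z [Yi fl]]] := Hf x x1 Gx fx.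
  by exists Y, Z; split=> // i; apply/flP.
- move=> x x1 Gx; have [Dx st] := Hs x x1 Gx; split=> // t z /flP fl.
  exact: st fl.
Qed.

End Nice.

(** * The map to the residual point *)

Section Psi.
Variable k : numClosedFieldType.
Local Notation V := 'rV[k]_6.
Implicit Types (x y z : V).
Variable f : {mpoly k[6]}.
Hypothesis f3 : f \is 3.-homog.
Local Notation T := (pol f).
Let TT := pol_symtri f3.

(** Letting row 0 run through the coordinate vectors makes [zc] the generalized cross product of
    rows 1 to 5, the linear conditions imposed on it. *)
Definition zm (r u v : V) : 'M[k]_6 := \matrix_(i < 6)
  nth 0 [:: r; covec T u u; covec T u v; covec T v v; unitv k 0; unitv k 1] i.

(* The point of the plane tangent along [<u, v>] whose coordinates 0 and 1 vanish. *)
Definition zc (u v : V) : V := \row_j \det (zm (unitv k j) u v).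

Lemma zc_dot (r u v : V) : (zc u v *m r^T) 0 0 = \det (zm r u v).
Proof.
have cof s i : cofactor (zm s u v) 0 i = cofactor (zm r u v) 0 i.
  congr (_ * \det _); apply/matrixP => a b; rewrite !mxE.
  by case: a => -[|[|[|[|[|//]]]]] lt.
rewrite (expand_det_row _ 0) mxE; apply: eq_bigr => j _; rewrite !mxE /= mulrC.
congr (_ * _); rewrite (expand_det_row _ 0) (bigD1 j) //= big1 => [|i ij].
  by rewrite addr0 !mxE /= !eqxx mul1r cof.
by rewrite !mxE /= (negPf ij) mul0r.
Qed.

Lemma zc_zero (u v : V) (i : 'I_6) : i != 0 ->
  (zc u v *m (nth 0 [:: 0; covec T u u; covec T u v; covec T v v; unitv k 0; unitv k 1] i)^T) 0 0 = 0.
Proof.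
move=> i0; rewrite zc_dot; apply: (@determinant_alternate _ _ _ 0 i); first by rewrite eq_sym.
by move=> j; rewrite !mxE; case: i i0 => -[|[|[|[|[|[|//]]]]]] lt.
Qed.

Lemma coord_dot x j : (x *m (unitv k j)^T) 0 0 = x 0 j.
Proof.
rewrite mxE (bigD1 j) //= big1 => [|i ij]; first by rewrite addr0 !mxE !eqxx mulr1.
by rewrite !mxE (negPf ij) andbF mulr0.
Qed.

Definition zcond (u v w : V) :=
  [/\ T u u w = 0, T u v w = 0 & T v v w = 0] /\ w 0 0 = 0 /\ w 0 1 = 0.

Lemma zcP u v : zcond u v (zc u v).
Proof.
have Z i := @zc_zero u v i.
split; [split; rewrite (covecE TT); [exact: (Z 1)|exact: (Z 2%:R)|exact: (Z 3%:R)]|].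
by rewrite -!coord_dot; split; [exact: (Z 4%:R) | exact: (Z 5%:R)].
Qed.

Lemma zcond_mul u v w j : zcond u v w -> w 0 j = 0 -> w *m (zm (unitv k j) u v)^T = 0.
Proof.
move=> [[h1 h2 h3] [h4 h5]] wj; apply/rowP => i.
have -> : (w *m (zm (unitv k j) u v)^T) 0 i = (w *m (row i (zm (unitv k j) u v))^T) 0 0.
  by rewrite !mxE; apply: eq_bigr => l _; rewrite !mxE.
rewrite rowK [RHS]mxE; case: i => -[|[|[|[|[|[|//]]]]]] lt /=; rewrite ?coord_dot -?(covecE TT) //.
Qed.

Lemma zc_unique u v w : zcond u v w -> zc u v != 0 -> exists c : k, w = c *: zc u v.
Proof.
move=> cw /rV0Pn [j zj]; exists (w 0 j / zc u v 0 j).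
have [[a1 a2 a3] [a4 a5]] := cw; have [[b1 b2 b3] [b4 b5]] := zcP u v.
set c := w 0 j / zc u v 0 j; apply/eqP; rewrite -subr_eq0; apply/eqP.
have cd : zcond u v (w - c *: zc u v).
  rewrite /zcond !(triE TT) a1 a2 a3 b1 b2 b3; split; first by rewrite !mulr0 subr0.
  by split; rewrite !mxE ?a4 ?a5 -?/(zc u v 0 _);
    [have := b4 | have := b5]; rewrite mxE => ->; rewrite mulr0 subr0.
have um : (zm (unitv k j) u v)^T \in unitmx.
  by rewrite unitmx_tr unitmxE unitfE; move: zj; rewrite mxE.
have wj : (w - c *: zc u v) 0 j = 0.
  have -> : (w - c *: zc u v) 0 j = w 0 j - c * zc u v 0 j.
    by move: (zc u v) => z; rewrite !mxE.
  by rewrite /c divfK // subrr.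
have := zcond_mul cd wj; move/(congr1 (mulmx^~ (invmx (zm (unitv k j) u v)^T))).
by rewrite mulmxK // mul0mx.
Qed.

Lemma zc_neq0 u v z : z != 0 -> (forall w, zcond u v w -> exists c : k, w = c *: z) -> zc u v != 0.
Proof.
move=> /rV0Pn [j zj] H; apply/rV0Pn; exists j; rewrite mxE -det_tr.
apply/det0P => -[w w0 wM]; move/eqP: w0; apply.
have wi i : (w *m (row i (zm (unitv k j) u v))^T) 0 0 = 0.
  transitivity ((w *m (zm (unitv k j) u v)^T) 0 i); last by rewrite wM mxE.
  by rewrite !mxE; apply: eq_bigr => l _; rewrite !mxE.
have [|c wc] := H w.
  split; first by split; rewrite (covecE TT); [have := wi 1 | have := wi 2%:R | have := wi 3%:R]; rewrite rowK.
  by rewrite -!coord_dot; split; [have := wi 4%:R | have := wi 5%:R]; rewrite rowK.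
have := wi 0; rewrite rowK /= coord_dot wc mxE => /eqP.
by rewrite mulf_eq0 (negPf zj) orbF => /eqP ->; rewrite scale0r.
Qed.

(** Rows 0 and 1 of the alternating matrix of a line are vectors of the line whose coordinate 0,
    respectively 1, vanishes. They form a basis linear in [p] when the Pluecker coordinate 01 is
    nonzero. *)
Definition Up (p : 'rV[k]_(6 * 6)) : V := row 0 (vec_mx p).
Definition Wp (p : 'rV[k]_(6 * 6)) : V := row 1 (vec_mx p).
Definition psi_uv (u v : V) : V :=
  T v (zc u v) (zc u v) *: u - T u (zc u v) (zc u v) *: v.
Definition psi p : V := psi_uv (Up p) (Wp p).

Lemma UpE c x y : Up (c *: pl x y) = c *: (x 0 0 *: y - y 0 0 *: x).
Proof.
by apply/rowP => j; rewrite !mxE plE /p2; ring.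
Qed.

Lemma WpE c x y : Wp (c *: pl x y) = c *: (x 0 1 *: y - y 0 1 *: x).
Proof.
by apply/rowP => j; rewrite !mxE plE /p2; ring.
Qed.

Lemma psi_flag c x y z : c != 0 -> x 0 0 = 1 -> y 0 0 = 0 -> y 0 1 = 1 ->
  flag T x y z -> good T x y z -> exists2 mu, mu != 0 & psi (c *: pl x y) = mu *: x.
Proof.
move=> c0 x0 y0 y1 fl gd; rewrite /psi UpE WpE x0 y0 y1 scale0r subr0 !scale1r.
pose u := c *: y; pose v := c *: (x 0 1 *: y - x).
have xE : x = (x 0 1 / c) *: u + (- c^-1) *: v by apply/rowP => j; rewrite !mxE; field.
have yE : y = c^-1 *: u + 0 *: v by apply/rowP => j; rewrite !mxE; field.
have u0 : u 0 0 = 0 by rewrite mxE y0 mulr0.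
have u1 : u 0 1 = c by rewrite mxE y1 mulr1.
have v0 : v 0 0 = - c by rewrite !mxE x0 y0; ring.
have v1 : v 0 1 = 0 by rewrite !mxE y1; ring.
rewrite -/u -/v; clearbody u v.
have [[z1 z2 z3] [z4 z5]] := zcP u v.
have zn : zc u v != 0.
  (* Coordinates 0 and 1 are independent on the line, so [z] can be moved within the tangent plane
     to the point where both vanish; up to a scalar it is the only one, which makes [zc] nonzero. *)
  pose z' := z + (z 0 0 * x 0 1 - z 0 1) *: y + (- z 0 0) *: x.
  have fl' := flag_change TT (0 : k) (z 0 0 * x 0 1 - z 0 1) (- z 0 0) (oner_neq0 _) (oner_neq0 _) (oner_neq0 _) fl.
  rewrite !scale1r scale0r addr0 -/z' in fl'.
  have z'0 : z' 0 0 = 0 by rewrite !mxE x0 y0; ring.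
  have z'1 : z' 0 1 = 0 by rewrite !mxE y1; ring.
  clearbody z'; apply: (@zc_neq0 _ _ z').
    apply/eqP => Z; have I := flag_ind fl'; have [] := I 0 0 1; last by move=> _ _ /eqP; rewrite oner_eq0.
    by rewrite Z !scale0r scaler0 !addr0.
  move=> w [[w1 w2 w3] [w4 w5]].
  have T1 : T y y w = 0 by rewrite yE !(triE TT) [T v u w](triC12 TT) w1 w2 w3; ring.
  have T2 : T x y w = 0 by rewrite yE xE !(triE TT) [T v u w](triC12 TT) w1 w2 w3; ring.
  have T3 : T x x w = 0 by rewrite xE !(triE TT) [T v u w](triC12 TT) w1 w2 w3; ring.
  have [r [s [t wE]]] := flag_ker TT fl' gd.2 T3 T2 T1.
  have r0 : r = 0 by rewrite -w4 wE !mxE x0 y0 z'0; ring.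
  have s0 : s = 0 by rewrite -w5 wE !mxE r0 y1 z'1; ring.
  by exists t; rewrite wE r0 s0 !scale0r !add0r.
rewrite /psi_uv.
apply: (residual_direction TT fl gd xE yE) => //.
  by rewrite mulr0 sub0r mulNr opprK mulf_neq0 ?invr_eq0.
move=> r s; apply: contra zn => /eqP zE.
have s0 : s = 0.
  by have /eqP := z4; rewrite zE !mxE u0 v0 mulr0 add0r mulrN oppr_eq0 mulf_eq0 (negPf c0) orbF => /eqP.
have r0 : r = 0.
  by have /eqP := z5; rewrite zE !mxE u1 v1 mulr0 addr0 mulf_eq0 (negPf c0) orbF => /eqP.
by rewrite zE r0 s0 !scale0r addr0.
Qed.

(** 14 = 1 + 1 + 2 * 6: apart from [zc], the formula is linear in [u] and in [v]; [zc] enters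
    quadratically and has degree 6, from three rows of degree 2. *)
Lemma psi_scale c p : psi (c *: p) = c ^+ 14 *: psi p.
Proof.
rewrite /psi; have -> : Up (c *: p) = c *: Up p by rewrite /Up !linearZ.
have -> : Wp (c *: p) = c *: Wp p by rewrite /Wp !linearZ.
move: (Up p) (Wp p) => u v.
have zE : zc (c *: u) (c *: v) = c ^+ 6 *: zc u v.
  apply/rowP => j; rewrite !mxE.
  pose dg : 'rV[k]_6 := \row_i nth 0 [:: 1; c ^+ 2; c ^+ 2; c ^+ 2; 1; 1] i.
  have -> : zm (unitv k j) (c *: u) (c *: v) = diag_mx dg *m zm (unitv k j) u v.
    apply/matrixP => i b; rewrite mul_diag_mx [LHS]mxE [RHS]mxE [dg 0 i]mxE [zm _ _ _ i b]mxE.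
    by case: i => -[|[|[|[|[|[|//]]]]]] lt; rewrite /= ?mul1r // !mxE !(triE TT) mulrA expr2.
  rewrite det_mulmx det_diag !big_ord_recl big_ord0 !mxE /=; ring.
rewrite /psi_uv zE; move: (zc u v) => z; rewrite !(triE TT).
by apply/rowP => j; rewrite !mxE; ring.
Qed.

Lemma psi_polyf j : polyf (fun p => psi p 0 j).
Proof.
have alg := polyf_alg k (6 * 6).
have pU i : polyf (fun p => Up p 0 i).
  by apply: polyf_ext (@polyfX k _ (mxvec_index 0 i)) _ => p; rewrite !mxE.
have pW i : polyf (fun p => Wp p 0 i).
  by apply: polyf_ext (@polyfX k _ (mxvec_index 1 i)) _ => p; rewrite !mxE.
have pT (A B C : 'rV[k]_(6 * 6) -> V) : (forall l, polyf (fun w => A w 0 l)) ->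
    (forall l, polyf (fun w => B w 0 l)) -> (forall l, polyf (fun w => C w 0 l)) ->
    polyf (fun w => T (A w) (B w) (C w)).
  move=> pA pB pC; apply: polyf_ext (falg_pol (a := fun=> coefs f) alg _ pA pB pC) _ => [l|w].
    exact: falgC.
  by rewrite form_of_coefs.
have pc (x : V) l : polyf (fun _ : 'rV[k]_(6 * 6) => x 0 l) by exact: falgC.
have pz l : polyf (fun p => zc (Up p) (Wp p) 0 l).
  apply: polyf_ext (falg_det alg (A := fun p => zm (unitv k l) (Up p) (Wp p)) _) _ => [a b|p]; last by rewrite [RHS]mxE.
  have H (g : 'rV[k]_(6 * 6) -> V) : (forall j, polyf (fun p => g p 0 j)) -> polyf (fun p => g p 0 b) by [].
  case: a => -[|[|[|[|[|[|//]]]]]] lt.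
  - by apply: polyf_ext (pc (unitv k l) b) _ => p; rewrite [RHS]mxE.
  - by apply: polyf_ext (pT _ _ _ pU pU (pc (unitv k b))) _ => p; rewrite [RHS]mxE /= mxE.
  - by apply: polyf_ext (pT _ _ _ pU pW (pc (unitv k b))) _ => p; rewrite [RHS]mxE /= mxE.
  - by apply: polyf_ext (pT _ _ _ pW pW (pc (unitv k b))) _ => p; rewrite [RHS]mxE /= mxE.
  - by apply: polyf_ext (pc (unitv k 0) b) _ => p; rewrite [RHS]mxE.
  - by apply: polyf_ext (pc (unitv k 1) b) _ => p; rewrite [RHS]mxE.
have M := falgM alg.
apply: polyf_ext (falgB alg (M _ _ (pT _ _ _ pW pz pz) (pU j)) (M _ _ (pT _ _ _ pU pz pz) (pW j))) _ => p.
rewrite /psi; move: (Up p) (Wp p) => u v; rewrite /psi_uv.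
by move: (T _ _ _) (T _ _ _) => A B; rewrite !mxE.
Qed.

Lemma psi_forms : exists Ps : 'I_6 -> {mpoly k[6 * 6]},
  (forall i, Ps i \is 14.-homog) /\ forall p, \row_i ev (Ps i) p = psi p.
Proof.
have /choice [Ps PsE] : forall i, exists P : {mpoly k[6 * 6]}, forall p, psi p 0 i = ev P p.
  by move=> i; apply: psi_polyf.
exists Ps; split=> [i|p]; last by apply/rowP => i; rewrite mxE PsE.
by apply: homog_of_scaling => c v _; rewrite -!PsE psi_scale mxE.
Qed.

End Psi.

(** * Flags as coordinates on the Fano scheme *)

Section Endgame.
Variable k : numClosedFieldType.
Local Notation V := 'rV[k]_6.
Local Notation J := ('X_{1..4 < 8}).
Variables (f : {mpoly k[6]}) (gd : nat) (Gf : {mpoly k[6]}) (D : V -> k)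
  (c : J -> 'I_24 -> V -> k).
Hypotheses (f3 : f \is 3.-homog) (nd : nice_data f gd Gf D c).
Local Notation T := (pol f).
Let TT := pol_symtri f3.
Local Notation X := (hypersurface f).
Local Notation F := (fano f).
Local Notation psi := (psi f).
Local Notation mono i t := (ev 'X_[bexp i] t).
Implicit Types (x y z : V) (t : 'rV[k]_4) (p : 'rV[k]_(6 * 6)).

Definition Fl x t := [/\ x 0 0 = 1, ev Gf x != 0 & exists z, flag T x (yv t) z].
Definition pt x t := pl x (yv t).

Lemma Fl_hyp x t : Fl x t -> X x.
Proof.
move=> [x0 Gx [z fl]]; split; first by apply/rV0Pn; exists 0; rewrite x0 oner_neq0.
by rewrite -pol_diag //; have [] := flag_line fl.
Qed.

Lemma Fl_line x t (al : k) : al != 0 -> Fl x t -> exists L, [/\ line_in f L,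
  plucker L (al *: pt x t) & forall mu, mu != 0 -> residual_point f L (mu *: x)].
Proof.
move=> al0 [x0 Gx [z fl]]; have [gd' _] := nice_good nd x0 Gx fl.
exists <<[:: x; yv t]>>%VS; split.
- split; first exact: dim_span2 (ind3_12 (flag_ind fl)).
  move=> w /mem_span2 [r [s ->]]; have := flag_section r s 0 f3 fl.
  by rewrite scale0r addr0 => ->; rewrite expr0n mul0r.
- exists (al *: x), (yv t); split; last first.
    have := pl_change al 0 0 1 x (yv t); rewrite !scale0r addr0 add0r scale1r mulr1 mul0r subr0 => <-.
    by [].
  apply/andP; split; last first.
    apply/ind2_free => r s E; have [] := ind3_12 (flag_ind fl) (r := r * al) (s := s).
      by rewrite -scalerA.
    by move=> /eqP; rewrite mulf_eq0 (negPf al0) orbF => /eqP -> ->.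
  apply/eqP/vspaceP => w; apply/mem_span2/mem_span2 => -[r [s ->]].
    by exists (r * al), s; rewrite -scalerA.
  by exists (r / al), s; rewrite scalerA divfK.
move=> mu mu0; have fl' := flag_change TT 0 0 0 mu0 (oner_neq0 _) (oner_neq0 _) fl.
have gd2 := good_change TT 0 0 0 mu0 (oner_neq0 _) (oner_neq0 _) fl gd'.
rewrite !scale0r !scale1r !addr0 in fl' gd2.
have := good_residual f3 (conj fl' gd2).
rewrite (_ : <<[:: mu *: x; yv t]>>%VS = <<[:: x; yv t]>>%VS) //.
apply/vspaceP => w; apply/mem_span2/mem_span2 => -[r [s ->]].
  by exists (r * mu), s; rewrite -scalerA.
by exists (r / mu), s; rewrite scalerA divfK.
Qed.

Lemma Fl_fano x t (al : k) : al != 0 -> Fl x t -> F (al *: pt x t).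
Proof. by move=> al0 fl; have [L [h1 h2 _]] := Fl_line al0 fl; exists L. Qed.

Lemma Fl_psi x t (al : k) : al != 0 -> Fl x t ->
  exists2 mu, mu != 0 & psi (al *: pt x t) = mu *: x.
Proof.
move=> al0 [x0 Gx [z fl]]; have [gd' _] := nice_good nd x0 Gx fl.
have [y0 y1] := yv01 t; exact: (psi_flag f3 al0 x0 y0 y1 fl gd').
Qed.

Lemma fano_basis p : F p -> exists u v, [/\ ind2 u v, on_line f u v & p = pl u v].
Proof.
move=> [L [dL fL] [u [v [bas ->]]]]; exists u, v; split=> //.
  by apply/ind2_free; apply: basis_free bas.
have mem (r s : k) : r *: u + s *: v \in L.
  by apply: rpredD; apply: rpredZ; apply: (basis_mem bas); rewrite !inE eqxx ?orbT.
have E (r s : k) : r ^+ 3 * T u u u + 3%:R * r ^+ 2 * s * T u u v + 3%:R * r * s ^+ 2 * T u v v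
    + s ^+ 3 * T v v v = 0.
  rewrite -[RHS](fL _ (mem r s)) -pol_diag // !(triE TT).
  rewrite [T v u u](triC13 TT) [T u v u](triC23 TT) [T v u v](triC12 TT) [T v v u](triC13 TT).
  by ring.
have E1 : T u u u = 0 by rewrite -[RHS](E 1 0); ring.
have E4 : T v v v = 0 by rewrite -[RHS](E 0 1); ring.
have n6 : (6%:R : k) != 0 by rewrite pnatr_eq0.
have h1 := E 1 1; have h2 := E 1 (-1); rewrite E1 E4 in h1 h2.
split=> //; apply: (mulfI n6); rewrite mulr0.
  by have := congr2 (fun r s => r - s) h1 h2; rewrite subr0 => <-; ring.
by have := congr2 (fun r s => r + s) h1 h2; rewrite addr0 => <-; ring.
Qed.

Lemma pl_neq0 (u v : V) : ind2 u v -> pl u v != 0.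
Proof.
move=> I; have /rV0Pn [i ui] : u != 0.
  apply/eqP => u0; have [] := I 1 0; last by move/eqP; rewrite oner_eq0.
  by rewrite u0 scaler0 scale0r addr0.
have [j uv] := p2_exists I ui.
by apply/rV0Pn; exists (mxvec_index i j); rewrite plE.
Qed.

Lemma fano_neq0 p : F p -> p != 0.
Proof. by move=> /fano_basis [u [v [I _ ->]]]; apply: pl_neq0. Qed.

Lemma flag_Fl x y z : ev Gf x != 0 -> flag T x y z -> p2 x y 0 1 != 0 ->
  exists x' t (al : k), [/\ al != 0, Fl x' t & pl x y = al *: pt x' t].
Proof.
move=> Gx fl p01; have x0 := nice_coord nd Gx.
have [al [be [de [ep [et [al0 be0 [h1 h2 h3] _ _]]]]]] := normal_form z x0 p01.
exists (al *: x), (tv (be *: y + de *: x)), (al * be)^-1; split.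
- by rewrite invr_eq0 mulf_neq0.
- split=> //; first by rewrite (hom_ev _ _ (nice_homog nd)) mulf_neq0 // expf_neq0.
  exists (1 *: z + 0 *: y + 0 *: x); rewrite tvK //.
  by apply: (flag_change TT) fl; rewrite ?oner_neq0.
rewrite /pt tvK // -[al *: x]addr0 -(scale0r y) [_ + de *: x]addrC pl_change mul0r subr0.
by rewrite scalerA mulVf ?scale1r // mulf_neq0.
Qed.

(** Even before the flag is known to be good, [psi p] is a multiple of its point [x]; the hypothesis
    on [Gf] thus passes to [x], and the flag can be normalized. *)
Lemma fano_flag p : F p -> p 0 (mxvec_index 0 1) != 0 -> ev Gf (psi p) != 0 ->
  exists x t (al : k), [/\ al != 0, Fl x t & p = al *: pt x t].
Proof.
move=> Fp p01 Gp; have [u0 [v0 [I [l1 l2 l3 l4] pE]]] := fano_basis Fp.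
have [a [b [a' [b' [z [det0 fl]]]]]] := exists_flag TT I l1 l2 l3 l4.
set x := a *: u0 + b *: v0 in fl; set y := a' *: u0 + b' *: v0 in fl.
pose e := (a * b' - b * a')^-1; have e0 : e != 0 by rewrite invr_eq0.
have pE' : p = e *: pl x y by rewrite pE pl_change scalerA mulVf // scale1r.
have q0 : p2 x y 0 1 != 0 by apply: contraNneq p01 => q0; rewrite pE' mxE plE q0 mulr0.
clearbody x y e; clear u0 v0 I l1 l2 l3 l4 pE det0 a b a' b'.
pose q := p2 x y 0 1; pose u := Up p; pose v := Wp p.
have uE : u = e *: (x 0 0 *: y - y 0 0 *: x) by rewrite /u pE' UpE.
have vE : v = e *: (x 0 1 *: y - y 0 1 *: x) by rewrite /v pE' WpE.
have qE : q = x 0 0 * y 0 1 - x 0 1 * y 0 0 by [].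
have qn : x 0 0 * y 0 1 - x 0 1 * y 0 0 != 0 by rewrite -qE.
pose a := x 0 1 / (e * q); pose b := - x 0 0 / (e * q).
have xE : x = a *: u + b *: v.
  by rewrite uE vE; apply/rowP => j; rewrite !mxE /a /b qE; field; rewrite qn e0.
pose Z := zc f u v.
have psiE : psi p = T v Z Z *: u - T u Z Z *: v by [].
have Zn : Z != 0.
  apply: contraNneq (nice_coord nd Gp) => Z0.
  by rewrite psiE Z0 (tri03 TT) !(tri02 TT) !scale0r subr0 mxE.
pose z' := z + ((y 0 0 * z 0 1 - y 0 1 * z 0 0) / q) *: x + ((x 0 1 * z 0 0 - x 0 0 * z 0 1) / q) *: y.
have z'E : z' = 1 *: z + ((x 0 1 * z 0 0 - x 0 0 * z 0 1) / q) *: y + ((y 0 0 * z 0 1 - y 0 1 * z 0 0) / q) *: x.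
  by rewrite scale1r /z' addrAC.
have fl' := flag_change TT (0 : k) ((x 0 1 * z 0 0 - x 0 0 * z 0 1) / q)
  ((y 0 0 * z 0 1 - y 0 1 * z 0 0) / q) (oner_neq0 _) (oner_neq0 _) (oner_neq0 _) fl.
rewrite -z'E !scale1r scale0r addr0 in fl'.
have z'0 : z' 0 0 = 0 by rewrite !mxE qE; field.
have z'1 : z' 0 1 = 0 by rewrite !mxE qE; field.
clearbody z'; have [I' _ [g1 g2 g3 g4]] := fl'.
have [al zE] : exists al : k, z' = al *: Z.
  apply: (zc_unique f3) => //; split=> //.
  have sy : T y x z' = 0 by rewrite (triC12 TT).
  by rewrite uE vE !(triE TT) g1 g2 g3 sy; split; ring.
have al0 : al != 0.
  apply/eqP => A; have [] := I' 0 0 1; last by move=> _ _ /eqP; rewrite oner_eq0.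
  by rewrite zE A !scale0r scaler0 !addr0.
have xZZ : T x Z Z = 0.
  apply: (mulfI (mulf_neq0 al0 al0)); rewrite mulr0 -[RHS]g4 zE !(triE TT); ring.
have [lam psix] : exists lam : k, psi p = lam *: x.
  have R : a * T u Z Z + b * T v Z Z = 0 by rewrite -[RHS]xZZ xE !(triE TT).
  have [a0|a0] := eqVneq a 0.
    have b0 : b != 0.
      apply/eqP => b0; have [] := I' 1 0 0; last by move/eqP; rewrite oner_eq0.
      by rewrite xE a0 b0 !scale0r !addr0 scaler0.
    have v0 : T v Z Z = 0.
      by apply: (mulfI b0); rewrite mulr0 -[RHS]R a0 mul0r add0r.
    exists (- T u Z Z / b); rewrite psiE v0 [in RHS]xE a0 !scale0r !add0r scalerA -scaleNr.
    by rewrite divfK.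
  exists (T v Z Z / a); rewrite psiE [in RHS]xE scalerDr !scalerA divfK // -scaleNr.
  congr (_ + _ *: _); apply: (mulfI a0).
  by transitivity (- (a * T u Z Z)); [ring | rewrite (_ : a * T u Z Z = - (b * T v Z Z)); [field | apply/eqP; rewrite -addr_eq0 R]].
have Gx : ev Gf x != 0.
  by move: Gp; rewrite psix (hom_ev _ _ (nice_homog nd)) mulf_eq0 negb_or => /andP [].
have [x' [t [be [be0 Flx E]]]] := flag_Fl Gx fl q0.
by exists x', t, (e * be); rewrite mulf_neq0 // -scalerA -E.
Qed.

(** A form that is nonzero at some line of the cubic is, by [nice_lines], nonzero at a line with a
    flag over a good point, and [flag_Fl] brings that line to the shape [pt x t]. *)
Lemma F_zero d (H : {mpoly k[6 * 6]}) : H \is d.-homog ->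
  (forall x t, Fl x t -> ev H (pt x t) = 0) -> forall p, F p -> ev H p = 0.
Proof.
move=> Hd HF p /fano_basis [u [v [I luv ->]]]; apply/eqP; apply: contrapT => /negP Hn.
have [x [y [z [fl Gx Hxy]]]] := nice_lines nd Hd I luv Hn.
have x0 := nice_coord nd Gx; pose x1 := (x 0 0)^-1 *: x.
have fl1 := flag_change TT 0 0 0 (_ : (x 0 0)^-1 != 0) (oner_neq0 _) (oner_neq0 _) fl.
rewrite !scale0r !scale1r !addr0 invr_eq0 in fl1.
have x10 : x1 0 0 = 1 by rewrite mxE mulVf.
have Gx1 : ev Gf x1 != 0.
  by rewrite (hom_ev _ _ (nice_homog nd)) mulf_neq0 // expf_neq0 // invr_eq0.
have [_ q1] := nice_good nd x10 Gx1 (fl1 x0).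
have q : p2 x y 0 1 != 0.
  apply: contraNneq q1 => q; rewrite (_ : p2 _ _ _ _ = (x 0 0)^-1 * p2 x y 0 1).
    by rewrite q mulr0.
  by rewrite /p2 /x1 !mxE; ring.
have [x' [t [be [be0 Flx E]]]] := flag_Fl Gx fl q.
by move: Hxy; rewrite E (hom_ev _ _ Hd) (HF _ _ Flx) mulr0 eqxx.
Qed.

End Endgame.

Section Interpolation.
Variable k : numClosedFieldType.

Lemma separating_poly n m (Y : 'I_m -> 'rV[k]_n) j : injective Y ->
  exists q : {mpoly k[n]}, forall i, (ev q (Y i) == 0) = (i != j).
Proof.
move=> Yinj; have /fin_all_exists [l lP] : forall i, exists l : {mpoly k[n]},
    i != j -> ev l (Y i) = 0 /\ ev l (Y j) != 0.
  move=> i; have [->|ij] := eqVneq i j; first by exists 0.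
  have /rV0Pn [s sP] : Y j - Y i != 0.
    by rewrite subr_eq0 (inj_eq Yinj) eq_sym.
  exists ('X_s - (Y i 0 s)%:MP) => _; rewrite !evB !evX !evC subrr; split=> //.
  by move: sP; rewrite !mxE.
exists (\prod_(i | i != j) l i) => i; rewrite ev_prod.
have [->|ij] := eqVneq i j.
  by apply/negbTE/prodf_neq0 => s sj; case: (lP s sj).
by rewrite (bigD1 i) //= (lP i ij).1 mul0r eqxx.
Qed.

End Interpolation.

(** * Expansion of functions in the 24 monomials *)

Section Endgame.
Variable k : numClosedFieldType.
Local Notation V := 'rV[k]_6.
Local Notation J := ('X_{1..4 < 8}).
Variables (f : {mpoly k[6]}) (gd : nat) (Gf : {mpoly k[6]}) (D : V -> k)
  (c : J -> 'I_24 -> V -> k).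
Hypotheses (f3 : f \is 3.-homog) (nd : nice_data f gd Gf D c).
Local Notation T := (pol f).
Let TT := pol_symtri f3.
Local Notation X := (hypersurface f).
Local Notation F := (fano f).
Local Notation psi := (psi f).
Local Notation Fl := (Fl f Gf).
Local Notation mono i t := (ev 'X_[bexp i] t).
Implicit Types (x y z : V) (t : 'rV[k]_4) (p : 'rV[k]_(6 * 6)).

Lemma comp_form (n : {mpoly k[6]}) d : n \is d.-homog ->
  exists2 P : {mpoly k[6 * 6]}, P \is (14 * d).-homog & forall p, ev P p = ev n (psi p).
Proof.
move=> nh; have [P PE] := falg_ev n (polyf_alg k (6 * 6)) (psi_polyf f3).
exists P => [|p]; last by rewrite PE.
by apply: homog_of_scaling => al p _; rewrite -!PE (psi_scale f3) (hom_ev _ _ nh) exprM.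
Qed.

Lemma pt01 x t (al : k) : x 0 0 = 1 -> (al *: pt x t) 0 (mxvec_index 0 1) = al.
Proof.
move=> x0; have [y0 y1] := yv01 t.
by rewrite mxE plE /p2 x0 y0 y1 !mulr1 mulr0 subr0 mulr1.
Qed.

Lemma Fl_scale x t (mu : k) : mu != 0 -> Fl x t -> ev Gf (mu *: x) != 0.
Proof. by move=> mu0 [_ Gx _]; rewrite (hom_ev _ _ (nice_homog nd)) mulf_neq0 // expf_neq0. Qed.

Lemma generic_Fl : generically F (fun p =>
  exists x t (al : k), [/\ al != 0, Fl x t & p = al *: pt x t]).
Proof.
have [P Ph PE] := comp_form (nice_homog nd).
have Xh : ('X_(mxvec_index 0 1) : {mpoly k[6 * 6]}) \is 1.-homog.
  by rewrite dhomogX; apply/eqP; rewrite /= mdeg1.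
apply: (generically_form (@fano_neq0 _ f f3) (dhomogM Xh Ph)) => [d H Hd HB|p Fp].
  apply: (F_zero f3 nd Hd) => x t fl; rewrite -[pt x t]scale1r.
  apply: HB; first by apply: (Fl_fano f3 nd) => //; apply: oner_neq0.
  rewrite evM evX PE pt01; last by case: fl.
  have [mu' mu'0 ->] := Fl_psi f3 nd (oner_neq0 k) fl.
  by rewrite mul1r (Fl_scale mu'0 fl).
rewrite evM evX PE mulf_eq0 negb_or => /andP [h1 h2].
exact: (fano_flag f3 nd).
Qed.

(** The rational inverse of [pt]: it recovers the point and the normalized second vector of the flag
    from the Pluecker coordinates. *)
Definition section_pt p : 'rV[k]_(6 + 4) :=
  row_mx ((psi p 0 0)^-1 *: psi p) (tv ((Up p 0 1)^-1 *: Up p)).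

Lemma section_ptE x t (al : k) : al != 0 -> Fl x t -> section_pt (al *: pt x t) = row_mx x t.
Proof.
move=> al0 fl; have [mu mu0 E] := Fl_psi f3 nd al0 fl; have [x0 _ _] := fl.
have [y0 y1] := yv01 t.
rewrite /section_pt E scale_normal_form // x0 invr1 scale1r UpE x0 y0 scale0r subr0 scale1r.
by rewrite scale_normal_form // y1 invr1 scale1r yvK.
Qed.

(** Carries a vanishing from a dense open set of the Fano scheme to every flag in [Fl]: composed
    with [section_pt] and multiplied by a power of [s], [Psi] becomes a form, which vanishes
    generically and hence on the whole Fano scheme. *)
Lemma fibre_zero (Psi : {mpoly k[6 + 4]}) Q : generically F Q ->
  (forall x t (al : k), al != 0 -> Fl x t -> Q (al *: pt x t) -> ev Psi (row_mx x t) = 0) ->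
  forall x t, Fl x t -> ev Psi (row_mx x t) = 0.
Proof.
move=> gQ HQ; have X0h : ('X_0 : {mpoly k[6]}) \is 1.-homog by rewrite dhomogX; apply/eqP; rewrite /= mdeg1.
have [P0 P0h P0E] := comp_form X0h.
have Xh : ('X_(mxvec_index 0 1) : {mpoly k[6 * 6]}) \is 1.-homog.
  by rewrite dhomogX; apply/eqP; rewrite /= mdeg1.
pose s := 'X_(mxvec_index 0 1) * P0; have sh : s \is (1 + 14 * 1).-homog := dhomogM Xh P0h.
have Up1 p : Up p 0 1 = p 0 (mxvec_index 0 1) by rewrite !mxE.
have sE p : ev s p = Up p 0 1 * psi p 0 0 by rewrite /s evM evX P0E evX Up1.
have loc : localization (@polyf k (6 * 6)) (ev s) (fun p => ev Psi (section_pt p)).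
  have alg : funalg (localization (@polyf k (6 * 6)) (ev s)).
    by apply: localization_alg; [exact: polyf_alg | exact: polyf_ev].
  have sn p : ev s p != 0 -> Up p 0 1 != 0 /\ psi p 0 0 != 0.
    by rewrite sE mulf_eq0 negb_or => /andP.
  apply: falg_ev => //; apply: falg_row_mx => // i.
    have [Pi PiE] := psi_polyf f3 i.
    apply: (@local_frac _ _ _ ('X_(mxvec_index 0 1) * Pi)) => p /sn [h1 h2].
    by rewrite mxE sE evM evX -PiE -Up1; field; rewrite ?h1 ?h2.
  apply: (@local_frac _ _ _ ('X_(mxvec_index 0 (inord i.+2)) * P0)) => p /sn [h1 h2].
  rewrite sE evM evX P0E evX.
  have -> : p 0 (mxvec_index 0 (inord i.+2)) = Up p 0 (inord i.+2) by rewrite !mxE.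
  by move: (Up p) (psi p) h1 h2 => u w h1 h2; rewrite !mxE; field; rewrite h2 h1.
have [al p al0|m0 /(_ _ (ltnSn m0)) [P Ph PE]] := form_of_local sh loc.
  rewrite /section_pt (psi_scale f3) scale_normal_form ?expf_neq0 //.
  have -> : Up (al *: p) = al *: Up p by rewrite /Up !linearZ.
  by rewrite scale_normal_form.
have zero := gen_vanish (@fano_neq0 _ f f3) (generically_and (@fano_neq0 _ f f3) gQ generic_Fl) Ph.
move=> x t fl; have E1 := section_ptE (oner_neq0 k) fl.
have : ev P (1 *: pt x t) = 0.
  apply: zero; last by apply: (Fl_fano f3 nd) => //; apply: oner_neq0.
  move=> p Fp [Qp [x' [t' [al [al0 fl' pE]]]]]; rewrite PE pE section_ptE //.
  by rewrite (HQ x' t' al) ?mulr0 // -pE.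
rewrite PE E1 => /eqP; rewrite mulf_eq0 expf_eq0 /=.
have [mu mu0 E] := Fl_psi f3 nd (oner_neq0 k) fl; have [x0 _ _] := fl.
have -> : (ev s (1 *: pt x t) == 0) = false.
  apply/negbTE; rewrite sE Up1 pt01 // E mxE x0 mulr1 mul1r //.
by move=> /eqP.
Qed.

Definition stair (phi : V -> 'rV[k]_4 -> k) := exists n (eta : 'I_24 -> V -> k),
  (forall i, polyf (eta i)) /\
  forall x t, Fl x t -> D x ^+ n * phi x t = \sum_i eta i x * mono i t.

Let alg6 := polyf_alg k 6.

Lemma polyf_D n : polyf (fun x => D x ^+ n).
Proof. by apply: falgX => //; have [] := nice_polyf nd. Qed.

Lemma stairD phi phi' : stair phi -> stair phi' -> stair (fun x t => phi x t + phi' x t).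
Proof.
move=> [n [eta [pe E]]] [n' [eta' [pe' E']]].
exists (n + n')%N, (fun i x => D x ^+ n' * eta i x + D x ^+ n * eta' i x); split=> [i|x t fl].
  by apply: (falgD alg6); apply: (falgM alg6) => //; apply: polyf_D.
transitivity (D x ^+ n' * (D x ^+ n * phi x t) + D x ^+ n * (D x ^+ n' * phi' x t)).
  by rewrite exprD; ring.
rewrite E // E' // !mulr_sumr -big_split; apply: eq_bigr => i _ /=; ring.
Qed.

Lemma stairZ (a : V -> k) phi : polyf a -> stair phi -> stair (fun x t => a x * phi x t).
Proof.
move=> pa [n [eta [pe E]]]; exists n, (fun i x => a x * eta i x); split=> [i|x t fl].
  exact: (falgM alg6).
by rewrite mulrCA E // mulr_sumr; apply: eq_bigr => i _; rewrite mulrA.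
Qed.

Lemma stair_mono i : stair (fun _ t => mono i t).
Proof.
exists 0%N, (fun j _ => (j == i)%:R); split=> [j|x t _]; first exact: falgC.
rewrite expr0 mul1r (bigD1 i) //= eqxx mul1r big1 ?addr0 // => j ji.
by rewrite (negPf ji) mul0r.
Qed.

(** A staircase monomial times one variable still has degree below 8, where [nice_stair] applies at
    the cost of one factor [D]. *)
Lemma stairX phi (j : 'I_4) : stair phi -> stair (fun x t => t 0 j * phi x t).
Proof.
move=> [n [eta [pe E]]].
have b8 i : (mdeg (bexp i + U_(j)) < 8)%N by rewrite mdegD mdeg1 addn1 ltnS; exact: bexp_deg.
have [_ pc] := nice_polyf nd.
exists n.+1, (fun l x => \sum_i eta i x * c (BMultinom (b8 i)) l x); split=> [l|x t fl].
  by apply: falg_sum => // i; apply: (falgM alg6).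
transitivity (D x * (t 0 j * (D x ^+ n * phi x t))); first by rewrite exprS; ring.
rewrite E // !mulr_sumr; under [RHS]eq_bigr => l _ do rewrite mulr_suml.
rewrite exchange_big /=; apply: eq_bigr => i _.
have [x0 Gx [z flz]] := fl; have [_ st] := nice_stair nd x0 Gx.
transitivity (eta i x * (D x * ev 'X_[BMultinom (b8 i)] t)).
  by rewrite /= mpolyXD evM evX; ring.
by rewrite (st t z flz) mulr_sumr; apply: eq_bigr => l _; rewrite mulrA.
Qed.

Lemma stair_poly (P : {mpoly k[6 + 4]}) : stair (fun x t => ev P (row_mx x t)).
Proof.
have stair_ext phi phi' : stair phi -> (forall x t, phi x t = phi' x t) -> stair phi'.
  move=> [n [eta [pe E]]] H; exists n, eta; split=> // x t fl.
  by rewrite -H E.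
have [i0 i0E] : exists i, bexp i = 0%MM by apply: bexpP; rewrite mnm0E.
(* The claim is strengthened to multiplication by [P], which can be iterated: a product is treated
   one factor after the other. *)
suff H : forall phi, stair phi -> stair (fun x t => ev P (row_mx x t) * phi x t).
  apply: (stair_ext _ _ (H _ (stair_mono i0))) => x t.
  by rewrite i0E mpolyX0 ev1 mulr1.
elim/mpoly_alg_ind: P => [a|i|P Q HP HQ|P Q HP HQ] phi Hphi.
- apply: (stair_ext _ _ (stairZ (falgC alg6 a) Hphi)) => x t; by rewrite evC.
- case: (splitP i) => j Ej.
    rewrite (_ : i = lshift 4 j); last exact: ord_inj.
    apply: (stair_ext _ _ (stairZ (@polyfX k _ j) Hphi)) => x t.
    by rewrite evX row_mxEl.
  rewrite (_ : i = rshift 6 j); last exact: ord_inj.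
  by apply: (stair_ext _ _ (stairX j Hphi)) => x t; rewrite evX row_mxEr.
- by apply: (stair_ext _ _ (stairD (HP _ Hphi) (HQ _ Hphi))) => x t; rewrite evD mulrDl.
- by apply: (stair_ext _ _ (HP _ (HQ _ Hphi))) => x t; rewrite evM mulrA.
Qed.

Lemma D_neq0 x t : Fl x t -> D x != 0.
Proof. by move=> [x0 Gx _]; case: (nice_stair nd x0 Gx). Qed.

(** Polynomials separate the 24 distinct points of the fibre, and each polynomial reduces there to
    the 24 monomials; hence the square matrix of their values has full rank. *)
Lemma fibre_matrix x : x 0 0 = 1 -> ev Gf x != 0 -> ev f x = 0 ->
  exists Y : 'I_24 -> 'rV[k]_4, (forall i, Fl x (Y i)) /\
    (\matrix_(i, j) mono i (Y j)) \in unitmx.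
Proof.
move=> x0 Gx fx; have [Y [Z [Yinj flY]]] := nice_fibre nd x0 Gx fx.
have Fl_ j : Fl x (Y j) by split=> //; exists (Z j).
exists Y; split=> //; rewrite -unitmx_tr; apply: unitmx_inj => u uE.
have uE' i : \sum_j u 0 j * mono i (Y j) = 0.
  transitivity ((u *m (\matrix_(i, j) mono i (Y j))^T) 0 i); last by rewrite uE mxE.
  by rewrite mxE; apply: eq_bigr => j _; rewrite !mxE.
apply/rowP => j0; rewrite mxE; have [q qP] := separating_poly j0 Yinj.
have [Q QE] : polyf (fun v : 'rV[k]_(6 + 4) => ev q (rsubmx v)).
  by apply: falg_ev; [exact: polyf_alg | exact: rsubmx_polyf].
have [n [eta [_ E]]] := stair_poly Q.
have : \sum_j u 0 j * (D x ^+ n * ev q (Y j)) = 0.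
  transitivity (\sum_i eta i x * \sum_j u 0 j * mono i (Y j)); last first.
    by rewrite big1 // => i _; rewrite uE' mulr0.
  under [RHS]eq_bigr => i _ do rewrite mulr_sumr.
  rewrite exchange_big /=; apply: eq_bigr => j _.
  have := E x (Y j) (Fl_ j); rewrite -QE row_mxKr => ->.
  by rewrite mulr_sumr; apply: eq_bigr => i _; ring.
rewrite (bigD1 j0) //= big1 => [|j jj].
  move/eqP; rewrite addr0 !mulf_eq0 expf_eq0 (negPf (D_neq0 (Fl_ j0))) andbF /= qP eqxx orbF.
  by move/eqP.
have /eqP q0 : ev q (Y j) == 0 by rewrite qP.
by rewrite q0 !mulr0.
Qed.

Lemma fibre_coefs x (eta : 'I_24 -> k) : x 0 0 = 1 -> ev Gf x != 0 -> ev f x = 0 ->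
  (forall t, Fl x t -> \sum_i eta i * mono i t = 0) -> forall i, eta i = 0.
Proof.
move=> x0 Gx fx H; have [Y [flY uE]] := fibre_matrix x0 Gx fx.
have : \row_i eta i *m (\matrix_(i, j) mono i (Y j)) = 0.
  by apply/rowP => j; rewrite !mxE -[RHS](H _ (flY j)); apply: eq_bigr => i _; rewrite !mxE.
move/(congr1 (mulmx^~ (invmx (\matrix_(i, j) mono i (Y j))))); rewrite mulmxK // mul0mx => e0 i.
by have := congr1 (fun w : 'rV[k]_24 => w 0 i) e0; rewrite !mxE.
Qed.

End Endgame.

(** * The degree *)

Section Degree.
Variable k : numClosedFieldType.
Local Notation V := 'rV[k]_6.
Local Notation J := ('X_{1..4 < 8}).
Variables (f : {mpoly k[6]}) (gd : nat) (Gf : {mpoly k[6]}) (D : V -> k)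
  (c : J -> 'I_24 -> V -> k).
Hypotheses (f3 : f \is 3.-homog) (nd : nice_data f gd Gf D c).
Local Notation X := (hypersurface f).
Local Notation F := (fano f).
Local Notation psi := (psi f).
Local Notation Fl := (Fl f Gf).
Local Notation mono i t := (ev 'X_[bexp i] t).
Implicit Types (x y z : V) (t : 'rV[k]_4) (p : 'rV[k]_(6 * 6)).

Lemma hyp_neq0 x : X x -> x != 0. Proof. by case. Qed.

Definition nrm x : V := (x 0 0)^-1 *: x.

Lemma nrmP x : X x -> ev Gf x != 0 -> [/\ X (nrm x), nrm x 0 0 = 1, ev Gf (nrm x) != 0 & x 0 0 != 0].
Proof.
move=> [x0 fx] Gx; have xc := nice_coord nd Gx.
have n1 : nrm x 0 0 = 1 by rewrite mxE mulVf.
split=> //; last by rewrite (hom_ev _ _ (nice_homog nd)) mulf_neq0 // expf_neq0 // invr_eq0.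
by split; [apply/rV0Pn; exists 0; rewrite n1 oner_neq0 | rewrite (hom_ev _ _ f3) fx mulr0].
Qed.

Lemma nrm1 x : x 0 0 = 1 -> nrm x = x.
Proof. by move=> x0; rewrite /nrm x0 invr1 scale1r. Qed.

Lemma generic_G : generically X (fun x => ev Gf x != 0).
Proof.
apply: (generically_form hyp_neq0 (nice_homog nd)) => // d H Hd HG x [x0 fx].
by apply: (nice_points nd Hd) => // y y0 fy Gy; apply: HG.
Qed.

Lemma pt_poly (H : {mpoly k[6 * 6]}) : exists P : {mpoly k[6 + 4]},
  forall x t, ev P (row_mx x t) = ev H (pt x t).
Proof.
have [P PE] : polyf (fun v : 'rV[k]_(6 + 4) => ev H (pt (lsubmx v) (rsubmx v))).
  apply: falg_ev => [|q]; first exact: polyf_alg.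
  case/mxvec_indexP: q => i j.
  have py l : polyf (fun v : 'rV[k]_(6 + 4) => yv (rsubmx v) 0 l).
    apply: polyf_ext (falg_ev (Y k l) (polyf_alg k (6 + 4)) (@rsubmx_polyf k 6 4)) _ => v.
    by rewrite [RHS]mxE.
  apply: polyf_ext (falg_p2 i j (polyf_alg k (6 + 4)) (@lsubmx_polyf k 6 4) py) _ => v.
  by rewrite plE.
by exists P => x t; rewrite -PE row_mxKl row_mxKr.
Qed.

(** Expand in the 24 monomials a form that vanishes on the preimage. Over a good point of the open
    set it vanishes on the whole fibre, so its coefficients, functions of the point, vanish there;
    by density they vanish over all good points, and the form is zero at every flag. *)
Lemma pullback_generic Q : generically X Q -> generically F (fun p => Q (psi p)).
Proof.
move=> gQ; have [Z [cZ dZ ZQ]] := gQ; have [S Sh ZE] := cZ.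
have gZ : generically X (fun v => ~ Z v) by exists Z; split=> // v [].
have [PG PGh PGE] := comp_form f3 (nice_homog nd).
have Xh : ('X_(mxvec_index 0 1) : {mpoly k[6 * 6]}) \is 1.-homog.
  by rewrite dhomogX; apply/eqP; rewrite /= mdeg1.
apply: (generically_closed (@fano_neq0 _ f f3) (S := fun B => exists s, S s /\
  (exists d, B \is d.-homog) /\ forall p, ev B p = p 0 (mxvec_index 0 1) * ev Gf (psi p) * ev s (psi p))).
- by move=> B [s [_ [Bh _]]].
- move=> d H Hd HB; apply: (F_zero f3 nd Hd).
  have [P PE] := pt_poly H.
  have [n [eta [peta E]]] := stair_poly nd P.
  have eta0 i x t : Fl x t -> eta i x = 0.
    move=> fl; have [m0 /(_ _ (ltnSn m0)) [R Rh RE]] := homogenize (peta i).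
    have RG := gen_vanish hyp_neq0 gZ (dhomogM Rh (nice_homog nd)).
    have [x0 Gx _] := fl.
    have : ev (R * Gf) x = 0.
      apply: RG (Fl_hyp f3 fl) => v Xv nZv; rewrite evM RE.
      have [->|Gv] := eqVneq (ev Gf v) 0; first by rewrite mulr0.
      have [Xn n1 Gn v0] := nrmP Xv Gv.
      have [s Ss sv] : exists2 s, S s & ev s v != 0.
        apply: contrapT => none; apply: nZv; rewrite ZE; split; first exact: hyp_neq0.
        by move=> s Ss; apply/eqP; apply: contrapT => /negP sv; apply: none; exists s.
      rewrite -/(nrm v); suff -> : eta i (nrm v) = 0 by rewrite mulr0 mul0r.
      apply: (fibre_coefs nd (x := nrm v) (eta := fun i => eta i (nrm v))) => //; first by case: Xn.
      move=> t' fl'; have := E _ _ fl'; rewrite PE => <-.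
      have [ds sh] := Sh s Ss; have [Ps Psh PsE] := comp_form f3 sh.
      rewrite -[pt _ _]scale1r (HB ('X_(mxvec_index 0 1) * PG * Ps)) ?mulr0 //.
      - exists s; split=> //; split; last by move=> p; rewrite !evM evX PGE PsE.
        by eexists; exact: (dhomogM (dhomogM Xh PGh) Psh).
      - by apply: (Fl_fano f3 nd) => //; apply: oner_neq0.
      rewrite !evM evX PGE PsE pt01 // mul1r.
      have [mu mu0 ->] := Fl_psi f3 nd (oner_neq0 k) fl'.
      rewrite mulf_neq0 //; first by apply: (Fl_scale nd mu0 fl').
      rewrite !(hom_ev _ _ sh).
      by rewrite !mulf_neq0 ?expf_neq0 ?invr_eq0.
    rewrite evM RE -/(nrm x) (nrm1 x0) x0 expr1n mul1r => /eqP.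
    by rewrite mulf_eq0 (negPf Gx) orbF => /eqP.
  move=> x t fl; have := E _ _ fl; rewrite PE big1 => [|i _].
    by move/eqP; rewrite mulf_eq0 expf_eq0 (negPf (D_neq0 nd fl)) andbF => /eqP.
  by rewrite (eta0 i x t fl) mul0r.
- move=> B p [s [Ss [_ BE]]] Fp; rewrite BE !mulf_eq0 !negb_or => /andP [/andP [p01 Gp] sp].
  have [x [t [al [al0 fl pE]]]] := fano_flag f3 nd Fp p01 Gp.
  apply: ZQ; split.
    rewrite pE; have [mu mu0 ->] := Fl_psi f3 nd al0 fl.
    have [x0 fx] := Fl_hyp f3 fl; split; last by rewrite (hom_ev _ _ f3) fx mulr0.
    by rewrite scaler_eq0 negb_or mu0.
  by rewrite ZE => -[_ /(_ s Ss)]; apply/eqP.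
Qed.

Lemma psi_codomain : generically F (fun p => X (psi p)).
Proof.
apply: generically_imp (generic_Fl f3 nd) _ => p _ [x [t [al [al0 fl ->]]]].
have [mu mu0 ->] := Fl_psi f3 nd al0 fl.
have [x0 fx] := Fl_hyp f3 fl; split; last by rewrite (hom_ev _ _ f3) fx mulr0.
by rewrite scaler_eq0 negb_or mu0.
Qed.

Variable phi : ratmap F X.
Hypothesis phiE : forall p, rm_val phi p = psi p.

Lemma phi_residual : generically F (fun p =>
  exists2 L, line_in f L /\ plucker L p & residual_point f L (rm_val phi p)).
Proof.
apply: generically_imp (generic_Fl f3 nd) _ => p _ [x [t [al [al0 fl ->]]]].
have [L [h1 h2 h3]] := Fl_line f3 nd al0 fl; exists L => //.
by rewrite phiE; have [mu mu0 ->] := Fl_psi f3 nd al0 fl; apply: h3.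
Qed.

Lemma phi_dominant : dominant phi.
Proof.
move=> Z' [S' S'h ->] AZ x Xx; split; first exact: hyp_neq0.
move=> H S'H; have [d Hd] := S'h H S'H; case: (Xx) => x0 fx.
apply: (nice_points nd Hd) x0 fx => y y0 fy Gy.
have [Xn n1 Gn yc] := nrmP (conj y0 fy) Gy.
have [Y [flY _]] := fibre_matrix nd n1 Gn (proj2 Xn).
have [mu mu0 E] := Fl_psi f3 nd (oner_neq0 k) (flY 0).
have [_ /(_ H S'H)] : [set v : V | v != 0 /\ forall q, S' q -> ev q v = 0]%classic (mu *: nrm y).
  apply: AZ; split.
    split; first by rewrite scaler_eq0 negb_or mu0; case: Xn.
    by rewrite (hom_ev _ _ f3) (proj2 Xn) mulr0.
  exists (1 *: pt (nrm y) (Y 0)); last by rewrite phiE.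
  exact: (Fl_fano f3 nd (oner_neq0 k) (flY 0)).
rewrite !(hom_ev _ _ Hd) => /eqP.
by rewrite !mulf_eq0 !expf_eq0 invr_eq0 (negPf mu0) (negPf yc) !andbF => /eqP.
Qed.

Lemma pullback_exists (r : ratfun X) : exists b : ratfun F,
  (forall p, rf_val b p = rf_val r (psi p)) /\ pullback phi r b.
Proof.
have [Nm Nh NE] := comp_form f3 (rf_num_homog r).
have [Dm Dh DE] := comp_form f3 (rf_den_homog r).
have gD := pullback_generic (rf_den_neq0 r).
have gD' : generically F (fun p => ev Dm p != 0).
  by apply: generically_imp gD _ => p _; rewrite DE.
exists (RatFun Nh Dh gD'); split=> [p|]; first by rewrite /rf_val /= NE DE.
by apply: generically_imp gD _ => p _ Dp; rewrite phiE; split=> //; rewrite /rf_val /= NE DE.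
Qed.

(** With x_0 = 1, y_0 = 0 and y_1 = 1, the coordinate t_j is the ratio of the Pluecker coordinates
    (0, j + 2) and (0, 1). *)
Lemma flag_function i : exists e : ratfun F, forall x t (al : k), al != 0 -> Fl x t ->
  rf_val e (al *: pt x t) = mono i t.
Proof.
pose d := mdeg (bexp i).
pose Nm : {mpoly k[6 * 6]} := \prod_(j < 4) 'X_(mxvec_index 0 (inord j.+2)) ^+ bexp i j.
pose Dm : {mpoly k[6 * 6]} := 'X_(mxvec_index 0 1) ^+ d.
have NE p : ev Nm p = \prod_(j < 4) p 0 (mxvec_index 0 (inord j.+2)) ^+ bexp i j.
  by rewrite ev_prod; apply: eq_bigr => j _; rewrite ev_exp evX.
have Nh : Nm \is d.-homog.
  apply: homog_of_scaling => al p _; rewrite !NE.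
  under eq_bigr => j _ do rewrite mxE exprMn.
  by rewrite big_split /= prodrXr -mdegE.
have Dh : Dm \is d.-homog.
  by apply: homog_of_scaling => al p _; rewrite /Dm !ev_exp !evX mxE exprMn.
have gD : generically F (fun p => ev Dm p != 0).
  apply: generically_imp (generic_Fl f3 nd) _ => p _ [x [t [al [al0 fl ->]]]].
  by rewrite ev_exp evX pt01 ?expf_neq0 //; case: fl.
exists (RatFun Nh Dh gD) => x t al al0 fl; rewrite rf_val_scale // /rf_val /=.
have [x0 _ _] := fl; have [y0 y1] := yv01 t.
rewrite NE /Dm ev_exp evX -[pt x t]scale1r pt01 // expr1n divr1 evXm scale1r.
apply: eq_bigr => j _; rewrite plE /p2 x0 y0 mul1r mulr0 subr0.
by rewrite -[in RHS](yvK t) [in RHS]mxE.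
Qed.

(** Clearing the denominators of the [r i] gives a relation between the monomials with coefficients
    in the point; [fibre_zero] extends it to all flags and [fibre_coefs] kills the coefficients on
    each fibre. *)
Lemma independence (e : 'I_24 -> ratfun F) :
  (forall i x t (al : k), al != 0 -> Fl x t -> rf_val (e i) (al *: pt x t) = mono i t) ->
  forall (r : 'I_24 -> ratfun X) (b : 'I_24 -> ratfun F),
  (forall i, pullback phi (r i) (b i)) ->
  generically F (fun v => \sum_i rf_val (b i) v * rf_val (e i) v = 0) ->
  forall i, generically X (fun w => rf_val (r i) w = 0).
Proof.
move=> eE r b pb sum0.
pose w i x := ev (rf_num (r i)) x * \prod_(j | j != i) ev (rf_den (r j)) x.
have pl6 (P : {mpoly k[6]}) : polyf (fun v : 'rV[k]_(6 + 4) => ev P (lsubmx v)).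
  by apply: falg_ev; [exact: polyf_alg | exact: lsubmx_polyf].
have pr4 (P : {mpoly k[4]}) : polyf (fun v : 'rV[k]_(6 + 4) => ev P (rsubmx v)).
  by apply: falg_ev; [exact: polyf_alg | exact: rsubmx_polyf].
have [P PE] : polyf (fun v : 'rV[k]_(6 + 4) => \sum_i w i (lsubmx v) * mono i (rsubmx v)).
  have alg := polyf_alg k (6 + 4).
  apply: falg_sum => // i; apply: (falgM alg); last exact: pr4.
  by apply: (falgM alg) => //; apply: falg_prod.
have zero := fibre_zero f3 nd (Psi := P) (generically_and (@fano_neq0 _ f f3)
  (generically_forall (@fano_neq0 _ f f3) pb) sum0).
have w0 x t : Fl x t -> \sum_i w i x * mono i t = 0.
  move=> fl; have := zero _ x t fl; rewrite -PE row_mxKl row_mxKr; apply.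
  move=> x' t' al al0 fl' [Hpb Hsum]; rewrite -PE row_mxKl row_mxKr.
  have [mu mu0 psiE] := Fl_psi f3 nd al0 fl'.
  have den i : ev (rf_den (r i)) x' != 0.
    have [+ _] := Hpb i; rewrite phiE psiE (hom_ev _ _ (rf_den_homog (r i))).
    by rewrite mulf_eq0 negb_or => /andP [].
  transitivity ((\prod_j ev (rf_den (r j)) x') * \sum_i rf_val (b i) (al *: pt x' t') * rf_val (e i) (al *: pt x' t')).
    rewrite mulr_sumr; apply: eq_bigr => i _; rewrite eE //.
    have [_ ->] := Hpb i; rewrite phiE psiE rf_val_scale // /rf_val (bigD1 i) //= /w.
    by have := den i; move: (\prod_(j | _) _) => Pr di; field.
  by rewrite Hsum mulr0.
move=> i; have gden := generically_forall hyp_neq0 (fun j => rf_den_neq0 (r j)).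
apply: generically_imp (generically_and hyp_neq0 gden generic_G) _ => v Xv [den Gv].
have [Xn n1 Gn vc] := nrmP Xv Gv.
rewrite -(rf_val_scale (r i) v (_ : (v 0 0)^-1 != 0)) ?invr_eq0 // -/(nrm v).
have := fibre_coefs nd n1 Gn (proj2 Xn) (eta := fun i => w i (nrm v)) (fun t fl => w0 _ t fl) i.
move/eqP; rewrite /w mulf_eq0 => /orP [/eqP n0|]; first by rewrite /rf_val n0 mul0r.
move=> /prodf_eq0 [j _]; rewrite (hom_ev _ _ (rf_den_homog (r j))) mulf_eq0 (negPf (den j)) orbF.
by rewrite expf_eq0 invr_eq0 (negPf vc) andbF.
Qed.

End Degree.

Section CharPoly.
Variables (k : numClosedFieldType) (T : Type) (C : (T -> k) -> Prop).
Hypothesis alg : funalg C.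

Lemma falg_char_poly n (A : T -> 'M[k]_n) :
  (forall i j, C (fun t => A t i j)) -> falg_coef C (fun t => char_poly (A t)).
Proof.
move=> HA; rewrite /char_poly /determinant.
have fsum (I : Type) (r : seq I) (F : I -> T -> {poly k}) : (forall i, falg_coef C (F i)) ->
    falg_coef C (fun t => \sum_(i <- r) F i t).
  move=> H j; elim: r => [|i r IH].
    by apply: falg_ext (falgC alg 0) _ => // t; rewrite big_nil coef0.
  by apply: falg_ext (falgD alg (H i j) IH) _ => // t; rewrite big_cons coefD.
have fprod (I : Type) (r : seq I) (F : I -> T -> {poly k}) : (forall i, falg_coef C (F i)) ->
    falg_coef C (fun t => \prod_(i <- r) F i t).
  move=> H; elim: r => [|i r IH] j.
    by apply: falg_ext (falgC alg (1 : {poly k})`_j) _ => // t; rewrite big_nil.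
  by apply: falg_ext (falg_coefM alg (H i) IH j) _ => // t; rewrite big_cons.
apply: (fsum) => s; apply: falg_coefM => //; first exact: falg_coef_const.
apply: (fprod) => i j.
apply: falg_ext (falgB alg (falgC alg ('X *+ (i == s i) : {poly k})`_j)
  (falg_coefC alg (HA i (s i)) j)) _ => // t.
by rewrite !mxE coefB.
Qed.

End CharPoly.

Lemma char_poly_tr (R : comNzRingType) n (A : 'M[R]_n) : char_poly A^T = char_poly A.
Proof.
rewrite /char_poly -[RHS]det_tr; congr (\det _); apply/matrixP => i j.
by rewrite !mxE eq_sym.
Qed.

(** * Inverting denominators *)

Section Spanning.
Variable k : numClosedFieldType.
Local Notation V := 'rV[k]_6.
Local Notation J := ('X_{1..4 < 8}).
Variables (f : {mpoly k[6]}) (gd : nat) (Gf : {mpoly k[6]}) (D : V -> k)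
  (c : J -> 'I_24 -> V -> k).
Hypotheses (f3 : f \is 3.-homog) (nd : nice_data f gd Gf D c).
Local Notation X := (hypersurface f).
Local Notation F := (fano f).
Local Notation psi := (psi f).
Local Notation Fl := (Fl f Gf).
Local Notation mono i t := (ev 'X_[bexp i] t).
Implicit Types (x y z : V) (t : 'rV[k]_4) (p : 'rV[k]_(6 * 6)).

Definition taum t : 'cV[k]_24 := \col_i mono i t.

Lemma tau_neq0 t : taum t != 0.
Proof.
have [i iE] : exists i, bexp i = 0%MM by apply: bexpP; rewrite mnm0E.
apply/eqP => /matrixP /(_ i 0); rewrite !mxE iE mpolyX0 ev1 => /eqP.
by rewrite oner_eq0.
Qed.

Lemma polyf_lsub (a : V -> k) : polyf a -> polyf (fun v : 'rV[k]_(6 + 4) => a (lsubmx v)).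
Proof. by move=> pa; apply: (falg_polyf (polyf_alg k _) (@lsubmx_polyf k 6 4) pa). Qed.

(** Multiplication by [P] on the 24 monomials: at each flag the vector of their values is an
    eigenvector, whose eigenvalue is the value of [P] times a power of [D] common to all rows. *)
Lemma multiplication_matrix (P : {mpoly k[6 + 4]}) : exists K (M : V -> 'M[k]_24),
  (forall i j, polyf (fun x => M x i j)) /\
  forall x t, Fl x t -> M x *m taum t = (D x ^+ K * ev P (row_mx x t)) *: taum t.
Proof.
have H i : exists n (eta : 'I_24 -> V -> k), (forall j, polyf (eta j)) /\
    forall x t, Fl x t -> D x ^+ n * (ev P (row_mx x t) * mono i t) = \sum_j eta j x * mono j t.
  have [Q QE] : polyf (fun v : 'rV[k]_(6 + 4) => ev P v * mono i (rsubmx v)).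
    apply: (falgM (polyf_alg k _)); first exact: polyf_ev.
    by apply: falg_ev; [exact: polyf_alg | exact: rsubmx_polyf].
  have [n [eta [pe E]]] := stair_poly nd Q; exists n, eta; split=> // x t fl.
  by rewrite -E // -QE row_mxKr.
have [n nP] := choice H; have [eta etaP] := choice nP.
pose K := (\sum_i n i)%N; exists K, (fun x => \matrix_(i, j) (D x ^+ (K - n i) * eta i j x)).
split=> [i j|x t fl].
  have [pe _] := etaP i.
  apply: polyf_ext (falgM (polyf_alg k 6) (polyf_D nd (K - n i)) (pe j)) _ => x.
  by rewrite mxE.
apply/matrixP => i l; rewrite !mxE; have [_ E] := etaP i.
have nK : (n i <= K)%N by rewrite /K (bigD1 i) //= leq_addr.
transitivity (D x ^+ (K - n i) * (D x ^+ n i * (ev P (row_mx x t) * mono i t))).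
  by rewrite E // mulr_sumr; apply: eq_bigr => j _; rewrite !mxE mulrA.
by rewrite mulrA -exprD subnK // mulrA.
Qed.

Section Invertible.
Variables (P : {mpoly k[6 + 4]}) (K : nat) (M : V -> 'M[k]_24) (Q : 'rV[k]_(6 * 6) -> Prop).
Hypotheses (pM : forall i j, polyf (fun x => M x i j))
  (ME : forall x t, Fl x t -> M x *m taum t = (D x ^+ K * ev P (row_mx x t)) *: taum t)
  (gQ : generically F Q)
  (QP : forall x t (al : k), al != 0 -> Fl x t -> Q (al *: pt x t) -> ev P (row_mx x t) != 0).

Let delta x t := D x ^+ K * ev P (row_mx x t).

Lemma delta_root x t : Fl x t -> (char_poly (M x)).[delta x t] = 0.
Proof.
move=> fl; apply/eqP; rewrite -[_ == 0]/(root _ _) -char_poly_tr -eigenvalue_root_char.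
apply/eigenvalueP; exists (taum t)^T.
  by rewrite -trmx_mul ME // linearZ.
by rewrite -(inj_eq trmx_inj) trmxK trmx0 tau_neq0.
Qed.

(** The values of the monomials at the 24 points diagonalize [M x] with eigenvalues [delta], so a
    zero determinant is a zero eigenvalue at one of the points. *)
Lemma det_zero_fibre x : X x -> x 0 0 = 1 -> ev Gf x != 0 -> \det (M x) = 0 ->
  exists t, Fl x t /\ delta x t = 0.
Proof.
move=> [_ fx] x0 Gx dM; have [Y [flY uE]] := fibre_matrix nd x0 Gx fx.
set E := \matrix_(i, j) _ in uE.
have EM : M x *m E = E *m diag_mx (\row_j delta x (Y j)).
  apply/matrixP => i j; rewrite mul_mx_diag !mxE.
  have := congr1 (fun A : 'cV[k]_24 => A i 0) (ME (flY j)); rewrite !mxE.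
  rewrite -/(delta x (Y j)) mulrC => <-; apply: eq_bigr => l _; by rewrite !mxE.
have := congr1 determinant EM; rewrite !det_mulmx dM mul0r det_diag => /esym/eqP.
rewrite mulf_eq0; have -> : (\det E == 0) = false.
  by apply/negbTE; rewrite -unitfE -unitmxE.
move=> /prodf_eq0 [j _]; rewrite mxE => /eqP dj.
by exists (Y j).
Qed.

(* Were the determinant zero on an open set, the lowest coefficient of the
   characteristic polynomial not vanishing there would give a polynomial in the
   eigenvalue killing it generically, hence also where the eigenvalue is zero. *)
Lemma det_generic : generically X (fun x => \det (M (nrm x)) != 0).
Proof.
have pdet : polyf (fun x => \det (M x)) by apply: falg_det; [exact: polyf_alg | exact: pM].
have [m0 /(_ _ (ltnSn m0)) [R Rh RE]] := homogenize pdet.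
apply: (generically_form (@hyp_neq0 _ f) (dhomogM Rh (nice_homog nd))); last first.
  by move=> v _; rewrite evM RE -/(nrm v) !mulf_eq0 !negb_or => /andP [/andP []].
move=> d H Hd HB x [x0 fx]; apply: (nice_points nd Hd) x0 fx => v v0 fv Gv.
apply/eqP; apply: contrapT => /negP Hv.
pose O1 y := [/\ X y, y 0 0 = 1, ev Gf y != 0 & ev H y != 0].
have O1v : O1 (nrm v).
  have [Xn n1 Gn vc] := nrmP f3 nd (conj v0 fv) Gv; split=> //.
  by rewrite (hom_ev _ _ Hd) mulf_neq0 // expf_neq0 // invr_eq0.
have O1det y : O1 y -> \det (M y) = 0.
  move=> [Xy y1 Gy Hy]; apply/eqP; apply: contraNT Hy => dy; apply/eqP.
  by apply: HB => //; rewrite evM mulf_neq0 // RE y1 expr1n mul1r invr1 scale1r.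
(* The characteristic polynomial is monic of degree 24, so some coefficient is nonzero somewhere on
   [O1]; [s] is the least such index. *)
have exs : exists s, `[< exists2 y, O1 y & (char_poly (M y))`_s != 0 >].
  exists 24%N; apply/asboolP; exists (nrm v) => //.
  have /monicP := char_poly_monic (M (nrm v)); rewrite /lead_coef size_char_poly /= => ->.
  exact: oner_neq0.
have [s /asboolP [yy O1y ys] smin] := ex_minnP exs.
have low z i : O1 z -> (i < s)%N -> (char_poly (M z))`_i = 0.
  move=> Oz is_; apply/eqP; apply: contraTT is_ => ni; rewrite -leqNgt.
  by apply: smin; apply/asboolP; exists z.
pose chi z t := \sum_(i < 25) (char_poly (M z))`_(i + s) * delta z t ^+ i.
have [B BE] : polyf (fun w : 'rV[k]_(6 + 4) => ev H (lsubmx w) * ev Gf (lsubmx w) *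
    \sum_(i < 25) (char_poly (M (lsubmx w)))`_(i + s) * (D (lsubmx w) ^+ K * ev P w) ^+ i).
  have alg := polyf_alg k (6 + 4).
  apply: (falgM alg).
    by apply: (falgM alg); apply: polyf_lsub; apply: polyf_ev.
  apply: falg_sum => // i; apply: (falgM alg).
    by apply: (@polyf_lsub (fun x => (char_poly (M x))`_(i + s))); apply: falg_char_poly => //; exact: polyf_alg.
  apply: falgX => //; apply: (falgM alg); last exact: polyf_ev.
  exact: (polyf_lsub (polyf_D nd K)).
have zero z t : Fl z t -> ev B (row_mx z t) = 0.
  apply: (fibre_zero f3 nd gQ) => {}z {}t al al0 fl Qz; rewrite -BE row_mxKl.
  have [->|Hz] := eqVneq (ev H z) 0; first by rewrite !mul0r.
  have [z0 Gz _] := fl; have Oz : O1 z by split=> //; exact: (Fl_hyp f3 fl).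
  suff -> : \sum_(i < 25) (char_poly (M z))`_(i + s) * (D z ^+ K * ev P (row_mx z t)) ^+ i = 0.
    by rewrite mulr0.
  (* Where the given rational function is defined its denominator makes the eigenvalue nonzero, and
     the power [s] of the eigenvalue can be divided out of the characteristic equation. *)
  have dn : delta z t != 0 by rewrite mulf_neq0 ?expf_neq0 ?(D_neq0 nd fl) ?(QP al0 fl Qz).
  apply: (mulIf (expf_neq0 s dn)); rewrite mul0r -[RHS](delta_root fl).
  have size_le : (size (char_poly (M z)) <= s + 25)%N by rewrite size_char_poly leq_addl.
  rewrite (horner_coef_wide _ size_le) big_split_ord /= [X in _ = X + _]big1 ?add0r => [|i _]; last first.
    by rewrite (low z i Oz (ltn_ord i)) mul0r.
  rewrite mulr_suml; apply: eq_bigr => i _.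
  by rewrite -/(delta z t) -mulrA -exprD addnC.
have [Xy y1 Gy Hy] := O1y.
(* At a flag over [yy] with eigenvalue zero, the divided equation reduces to its constant term, the
   coefficient chosen nonzero at [yy]. *)
have [t [fl dt]] := det_zero_fibre Xy y1 Gy (O1det yy O1y).
have := zero yy t fl; rewrite -BE row_mxKl => /eqP.
rewrite !mulf_eq0 (negPf Hy) (negPf Gy) /= big_ord_recl /= big1 => [|i _]; last first.
  by rewrite -/(delta yy t) dt expr0n mulr0.
by rewrite addr0 expr0 mulr1 add0n (negPf ys).
Qed.

End Invertible.

Variable phi : ratmap F X.
Hypothesis phiE : forall p, rm_val phi p = psi p.

(** Reduce the numerator of [h] to a row eta times the vector tau of monomials. The denominator is
    an eigenvalue of [M x] on tau up to a power of [D], so dividing by it is applying the inverse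
    matrix: the coefficients eta adj(M) / det M, up to powers of [D], are functions of the point
    alone. *)
Lemma spanning (e : 'I_24 -> ratfun F) :
  (forall i x t (al : k), al != 0 -> Fl x t -> rf_val (e i) (al *: pt x t) = mono i t) ->
  forall h : ratfun F, exists (r : 'I_24 -> ratfun X) (b : 'I_24 -> ratfun F),
    (forall i, pullback phi (r i) (b i)) /\
    generically F (fun v => rf_val h v = \sum_i rf_val (b i) v * rf_val (e i) v).
Proof.
move=> eE h; have [PN PNE] := pt_poly (rf_num h); have [PD PDE] := pt_poly (rf_den h).
have [K [M [pM ME]]] := multiplication_matrix PD.
have [n [eta [peta E]]] := stair_poly nd PN.
have QP x t (al : k) : al != 0 -> Fl x t -> ev (rf_den h) (al *: pt x t) != 0 -> ev PD (row_mx x t) != 0.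
  by move=> al0 fl; rewrite PDE (hom_ev _ _ (rf_den_homog h)) mulf_eq0 negb_or => /andP [].
have gdet := det_generic pM ME (rf_den_neq0 h) QP.
pose num i x := D x ^+ K * ((\row_j eta j x) *m \adj (M x)) 0 i.
pose den x := D x ^+ n * \det (M x).
have alg := polyf_alg k 6.
have pnum i : polyf (num i).
  apply: (falgM alg); first exact: (polyf_D nd).
  apply: falg_mulmx => // a b; last exact: falg_adj.
  by apply: polyf_ext (peta b) _ => x; rewrite mxE.
have pden : polyf den by apply: (falgM alg); [exact: (polyf_D nd) | apply: falg_det].
have [m0 m0P] := homogenize pden; have [m_ mP] := choice (fun i => homogenize (pnum i)).
(* A degree above all the bounds of [homogenize], so that the numerators and the common denominator
   become forms of the same degree. *)
pose m := (m0 + \sum_i m_ i).+1.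
have [Rd Rdh RdE] := m0P m (leq_addr _ _ : (m0 < m)%N).
have mi i : (m_ i < m)%N by rewrite /m ltnS (bigD1 i) //= addnCA leq_addr.
have /choice [Rn RnP] : forall i, exists R : {mpoly k[6]}, R \is m.-homog /\
    forall x, ev R x = x 0 0 ^+ m * num i ((x 0 0)^-1 *: x).
  by move=> i; have [R Rh RE] := mP i m (mi i); exists R.
have gden : generically X (fun x => ev Rd x != 0).
  apply: generically_imp (generically_and (@hyp_neq0 _ f) gdet (generic_G nd)) _ => v Xv [dv Gv].
  have [Xn n1 Gn vc] := nrmP f3 nd Xv Gv.
  have [Dn _] := nice_stair nd n1 Gn.
  by rewrite RdE -/(nrm v) !mulf_neq0 ?expf_neq0.
pose r i := RatFun (proj1 (RnP i)) Rdh gden.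
have [b bP] := choice (fun i => pullback_exists f3 nd phiE (r i)).
exists r, b; split=> [i|]; first by case: (bP i).
have gpull := pullback_generic f3 nd gden.
apply: generically_imp (generically_and (@fano_neq0 _ f f3) (generic_Fl f3 nd)
  (generically_and (@fano_neq0 _ f f3) (rf_den_neq0 h) gpull)) _ => p _.
move=> [[x [t [al [al0 fl ->]]]] [Dp Rp]].
have [x0 Gx _] := fl; have [mu mu0 psiE] := Fl_psi f3 nd al0 fl.
rewrite psiE (hom_ev _ _ Rdh) mulf_eq0 negb_or RdE x0 expr1n mul1r invr1 scale1r in Rp.
have /andP [_ dx] := Rp; have Pn := QP x t al al0 fl Dp.
have Dn := D_neq0 nd fl.
have rE i : rf_val (b i) (al *: pt x t) = num i x / den x.
  have [-> _] := bP i; rewrite psiE rf_val_scale // /rf_val /= (proj2 (RnP i)) RdE.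
  by rewrite x0 expr1n !mul1r invr1 scale1r.
under eq_bigr => i _ do rewrite rE eE //.
rewrite rf_val_scale // /rf_val -PNE -PDE.
have dM : \det (M x) != 0 by move: dx; rewrite /den mulf_eq0 negb_or => /andP [].
pose dl := D x ^+ K * ev PD (row_mx x t).
have adjE : dl *: (\adj (M x) *m taum t) = \det (M x) *: taum t.
  by rewrite scalemxAr -ME // mulmxA mul_adj_mx mul_scalar_mx.
have key : dl * \sum_i num i x * mono i t = D x ^+ K * (\det (M x) * (D x ^+ n * ev PN (row_mx x t))).
  rewrite E //; transitivity (D x ^+ K * ((\row_j eta j x) *m (dl *: (\adj (M x) *m taum t))) 0 0).
    rewrite -scalemxAr mulmxA [in RHS]mxE mulrCA; congr (_ * _).
    rewrite [in RHS]mxE mulr_sumr; apply: eq_bigr => i _.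
    by rewrite /num [taum t i 0]mxE mulrA.
  rewrite adjE -scalemxAr [in LHS]mxE; congr (_ * (_ * _)).
  by rewrite mxE; apply: eq_bigr => i _; rewrite !mxE.
have -> : \sum_i num i x / den x * mono i t = (\sum_i num i x * mono i t) / den x.
  by rewrite mulr_suml; apply: eq_bigr => i _; rewrite mulrAC.
apply: (mulfI (_ : dl * den x != 0)); first by rewrite mulf_neq0 // /dl mulf_neq0 // expf_neq0.
transitivity (dl * \sum_i num i x * mono i t); last by field.
by rewrite key /dl /den; field.
Qed.

Theorem degree24 : ratmap_degree phi 24.
Proof.
split=> [r|]; first by have [b [_ H]] := pullback_exists f3 nd phiE r; exists b.
have [e eP] := choice (fun i => flag_function f3 nd i).
exists e; split; first exact: spanning.
exact: (independence f3 nd phiE eP).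
Qed.

End Spanning.

Lemma nice_degree (k : numClosedFieldType) (f : {mpoly k[6]}) : f \is 3.-homog -> nice f ->
  exists psi : ratmap (fano f) (hypersurface f),
    [/\ generically (fano f) (fun p =>
          exists2 L, line_in f L /\ plucker L p & residual_point f L (rm_val psi p)),
        dominant psi & ratmap_degree psi 24].
Proof.
move=> f3 [gd [Gf [D [c nd]]]]; have [Ps [Psh PsE]] := psi_forms f3.
have cod : generically (fano f) (fun v => hypersurface f (\row_i ev (Ps i) v)).
  by apply: generically_imp (psi_codomain f3 nd) _ => p _; rewrite PsE.
pose phi := RatMap Psh cod; have phiE p : rm_val phi p = psi f p by exact: PsE.
exists phi; split.
- exact: (phi_residual f3 nd phiE).
- exact: (phi_dominant f3 nd phiE).
- exact: (degree24 f3 nd phiE).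
Qed.

Lemma generic_degree (k : numClosedFieldType) :
  generically (@proj_space k (nb_monomials 6 3)) (fun a => nice (form_of a)).
Proof.
have proj n (P : 'rV[k]_n -> Prop) : (0 < n)%N -> gen P ->
    (forall c a, c != 0 -> P (c *: a) -> P a) -> generically (@proj_space k n) P.
  by case: n P => // n P _; exact: generically_projective.
apply: proj (gen_nice k) _.
  by have [i _] := cmon_surj (m3_deg 0 0 0); apply: leq_ltn_trans (ltn_ord i).
by move=> c a c0; rewrite form_ofZ; apply: nice_scale.
Qed.

From mathcomp Require Import reals complex.

Theorem lemma5p6 (R : realType) :
  generically (@proj_space R[i] (nb_monomials 6 3))
    (fun a : 'rV[R[i]]_(nb_monomials 6 3) =>
       let f : {mpoly R[i][6]} := form_of a in
       exists psi : ratmap (fano f) (hypersurface f),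
         [/\ generically (fano f) (fun p =>
               exists2 L, line_in f L /\ plucker L p &
                          residual_point f L (rm_val psi p)),
             dominant psi
           & ratmap_degree psi 24]).
Proof.
apply: (generically_imp (generic_degree R[i])) => a _ /nice_degree; apply.
exact: form_of_homog.
Qed.
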